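(* For any $d\geq 3$ there exist $\alpha_1>0$, $c=c(d)>0$ and $C=C(d)<\infty$ such that for all $0\leq\alpha\leq\alpha_1$ and all integers $n\geq 1$, $$\mathbb P\left[\text{the infinite connected component of }\mathcal V^\alpha\text{ intersects }\mathrm B(0,n)\right] \geq 1 - Ce^{-n^c}$$ and $$\mathbb P\left[\begin{array}{c}\text{any two connected subsets of }\mathcal V^\alpha\cap \mathrm B(0,n)\text{ with}\\ \text{diameter}\geq \frac{n}{10}\text{ are connected in }\mathcal V^\alpha\cap \mathrm B(0,2n)\end{array}\right] \geq 1 - Ce^{-n^c}.$$
   Context: $\mathrm B(x,r)$ is the closed $\ell_\infty$-ball in $\mathbb Z^d$ of radius $r$ centered at $x$. Connectedness is with respect to the nearest neighbor graph structure of $\mathbb Z^d$; two sets are connected in $Z\subseteq\mathbb Z^d$ if there is a nearest neighbor path in $Z$ from one to the other. Diameter is measured in the $\ell_\infty$-norm. Random walk loop soup: a based loop is a nearest neighbor path $\dot\ell=(x_1,\dots,x_n)$ on $\mathbb Z^d$ such that $x_n$ is a neighbor of $x_1$. Two based loops of length $n$ are equivalent if they differ by a circular permutation of their vertices; equivalence classes are called loops. Let $\dot\mu(\dot\ell)=\frac1n\left(\frac1{2d}\right)^n$ for a based loop of length $n$, and let $\mu$ be the push-forward of $\dot\mu$ to the space of loops. For $\alpha>0$, $\mathscr L^\alpha$ is the Poisson point process of loops with intensity measure $\alpha\mu$ (for $\alpha=0$ it is empty). The vacant set $\mathcal V^\alpha$ is the set of vertices of $\mathbb Z^d$ that do not belong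 to any loop in $\mathscr L^\alpha$. The probability measure of the underlying space is $\mathbb P$. *)

(* Defs.v *)
From HB Require Import structures.
From mathcomp Require Import all_boot all_order all_algebra.
From mathcomp Require Import generic_quotient.
From mathcomp Require Import all_classical all_reals all_analysis.
From mathcomp Require Import measurable_realfun.

Set Implicit Arguments.
Unset Strict Implicit.
Unset Printing Implicit Defensive.

Import Order.TTheory GRing.Theory Num.Theory.

Local Open Scope classical_set_scope.
Local Open Scope ring_scope.
Local Open Scope quotient_scope.

Section Lattice.
Variable d : nat.
Implicit Types (x y : 'rV[int]_d) (A B Z V : set 'rV[int]_d).

Definition nearest_neighbor : rel 'rV[int]_d :=
  fun x y => (\sum_(i < d) `|x ord0 i - y ord0 i| == 1)%N.

Definition linf_dist x y : nat := (\max_(i < d) `|x ord0 i - y ord0 i|)%N.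

Definition lball x (r : nat) : set 'rV[int]_d :=
  [set y | (linf_dist x y <= r)%N].

Definition path_in Z x y : Prop :=
  exists p : seq 'rV[int]_d,
    [/\ path nearest_neighbor x p, last x p = y
      & forall z, z \in x :: p -> Z z].

Definition connected_in Z A B : Prop :=
  exists x y, [/\ A x, B y & path_in Z x y].

Definition nn_connected A : Prop :=
  forall x y, A x -> A y -> path_in A x y.

Definition nn_component V A : Prop :=
  exists2 x, V x & A = [set y | path_in V x y].

Definition infinite_component V A : Prop :=
  nn_component V A /\ infinite_set A.

Definition linf_diam (R : realType) A : \bar R :=
  ereal_sup [set ((linf_dist x y)%:R)%:E | x in A & y in A].

(* The definite article is read as unique existence. *)
Definition the_infinite_component_meets V B : Prop :=
  exists A, [/\ infinite_component V A,
    forall A', infinite_component V A' -> A' = A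
    & A `&` B !=set0].

Definition large_sets_connected (R : realType) V (n : nat) : Prop :=
  forall A B,
    A `<=` V `&` lball 0 n -> B `<=` V `&` lball 0 n ->
    nn_connected A -> nn_connected B ->
    ((n%:R / 10)%:E <= linf_diam R A)%E ->
    ((n%:R / 10)%:E <= linf_diam R B)%E ->
    connected_in (V `&` lball 0 (2 * n)) A B.

End Lattice.

Section LoopSpace.
Variable d : nat.

(* [cycle] also asks that the last vertex be a neighbor of the first one. *)
Definition based_loop :=
  {l : seq 'rV[int]_d | (l != [::]) && cycle (@nearest_neighbor d) l}.

HB.instance Definition _ := Countable.on based_loop.

Definition rotation_equiv : rel based_loop :=
  fun l1 l2 => `[< exists k : nat, val l2 = rot k (val l1) >].

Lemma rotation_equiv_refl : reflexive rotation_equiv.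
Proof. by move=> l; apply/asboolP; exists 0%N; rewrite rot0. Qed.

Lemma rotation_equiv_sym : symmetric rotation_equiv.
Proof.
suff H l1 l2 : rotation_equiv l1 l2 -> rotation_equiv l2 l1.
  by move=> l1 l2; apply/idP/idP; exact: H.
move=> /asboolP[k l2E]; apply/asboolP.
by exists (size (rot k (val l1)) - k)%N; rewrite l2E -/(rotr k _) rotK.
Qed.

Lemma rotation_equiv_trans : transitive rotation_equiv.
Proof.
move=> l2 l1 l3 /asboolP[k l2E] /asboolP[m l3E]; apply/asboolP.
rewrite l3E l2E.
have [k1 [k1le ->]] : exists j, (j <= size (val l1))%N /\
    rot k (val l1) = rot j (val l1).
  have [kl|/ltnW lk] := leqP k (size (val l1)); first by exists k.
  by exists (size (val l1)); rewrite leqnn rot_size rot_oversize.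
have [mle|/ltnW lm] := leqP m (size (val l1)).
  by eexists; rewrite (rot_add_mod k1le mle).
by exists k1; rewrite [LHS]rot_oversize ?size_rot.
Qed.

Canonical rotation_equiv_rel :=
  EquivRel rotation_equiv rotation_equiv_refl rotation_equiv_sym
    rotation_equiv_trans.

Definition loop := {eq_quot rotation_equiv}%qT.

HB.instance Definition _ := EqQuotient.on loop.
HB.instance Definition _ := Choice.on loop.
HB.instance Definition _ := [Countable of loop by <:%/].

Definition loop_vertices (l : loop) : set 'rV[int]_d :=
  [set x | exists2 b : based_loop, \pi_loop b = l & x \in val b].

Definition based_loop_weight (R : realType) (b : based_loop) : R :=
  (size (val b))%:R^-1 * (2 * d%:R)^-1 ^+ size (val b).

Definition based_loop_measure (R : realType) (B : set based_loop) : \bar R :=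
  \esum_(b in B) (based_loop_weight R b)%:E.

Definition loop_measure (R : realType) (A : set loop) : \bar R :=
  based_loop_measure R (\pi_loop @^-1` A).

End LoopSpace.

Section PoissonPointProcess.
Context {R : realType} {disp : measure_display} {Omega : measurableType disp}.
Variable P : probability Omega R.
Local Open Scope ereal_scope.

Definition mutually_independent (n : nat) (X : 'I_n -> Omega -> \bar R) : Prop :=
  forall B : 'I_n -> set (\bar R), (forall i, measurable (B i)) ->
    P (\bigcap_i (X i @^-1` B i)) = \prod_(i < n) P (X i @^-1` B i).

(* The library's [poisson_pmf] equals 1 at every integer when the rate is 0;
   here rate 0 gives the Dirac mass at 0. *)
Definition poisson_distributed (X : Omega -> \bar R) (m : \bar R) : Prop :=
  (forall lambda : R, m = lambda%:E -> forall k : nat,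
     P [set w | X w = (k%:R)%:E]
     = (lambda ^+ k / k`!%:R * expR (- lambda))%:E) /\
  (m = +oo -> P [set w | X w = +oo] = 1).

Variable T : countType.

(* On the discrete countable space [T], a point measure is given by the
   multiplicities of the points, and every set is measurable. *)
Definition point_count (N : Omega -> T -> nat) (A : set T) (w : Omega) : \bar R :=
  \esum_(t in A) ((N w t)%:R)%:E.

Definition poisson_point_process
    (nu : set T -> \bar R) (N : Omega -> T -> nat) : Prop :=
  [/\ forall t, measurable_fun setT (fun w => N w t),
      forall A : set T, poisson_distributed (point_count N A) (nu A)
    & forall (n : nat) (A : 'I_n -> set T), trivIset setT A ->
        mutually_independent (fun i => point_count N (A i))].

End PoissonPointProcess.

Definition loop_soup (R : realType) (d : nat) (disp : measure_display)
    (Omega : measurableType disp) (P : probability Omega R) (alpha : R)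
    (L : Omega -> loop d -> nat) : Prop :=
  poisson_point_process P (fun A => (alpha%:E * loop_measure R A)%E) L.

Definition vacant_set (d : nat) (L : loop d -> nat) : set 'rV[int]_d :=
  [set x | forall l, (0 < L l)%N -> ~ loop_vertices l x].

(* Main.v *)
Require Import Defs.
From mathcomp Require Import generic_quotient measurable_realfun.
From mathcomp Require Import all_boot all_order all_algebra.
From mathcomp Require Import all_classical all_reals all_analysis.
From mathcomp Require Import zify ring lra.
Set Implicit Arguments.
Unset Strict Implicit.
Unset Printing Implicit Defensive.
Import Order.TTheory GRing.Theory Num.Theory.
Local Open Scope classical_set_scope.
Local Open Scope ring_scope.

(** The proof is a renormalisation. Fix [rho h], written r below. For each of the 4^d shifts [tau]
    there are disjoint boxes of radius r centred at r(tau + 4x), one per site x, each surrounded by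
    a shell [gam] of lattice lines of mesh r; shells of adjacent sites meet. A site is [bad] if a
    loop hits the line grid [gamAll] around it, or if for some shift the loops visit its box more
    than K times.

    Good sites percolate strongly. The Plummer-type potential [plum] satisfies avg plum <= plum -
    plum^5 because d >= 3, and supersolutions built from it bound sums over loops ([walk_sum]).
    Together with Mecke's formula this gives product bounds over sparse families of sites for
    hitting grids ([Pr_hits]) and for large occupation ([Pr_visits]). A line grid has potential of
    order log r on itself but only of order one seen from other sites, so taking h large, then K
    large, then alpha small makes all factors small. A Peierls argument over trees whose scales grow
    by a factor 16 ([trees], [peierls]) shows that a star path of bad sites of diameter above 2*16^k
    costs 2^-(2^k), up to a polynomial factor. By discrete topology the boundary of a hole is star
    connected ([inner_bdry_class]); hence without long bad paths the cluster of good sites has small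
    holes and is locally connected ([holes_small], [outer_comp_connected]), and the shells of its
    sites form a vacant network.

    It remains to attach any large vacant connected set to this network. Its vacant cluster is
    explored outside the boxes of one shift; when it touches an unopened box at a face point that no
    loop crosses, loop surgery compares probabilities. Every excursion into the box is rerouted off
    a chute leading from that point to the shell of the box, without changing anything outside; the
    complement of the chute in the box is connected because d >= 3. If the box carries at most K
    visits the cost is bounded ([surgery_bound]). So each such box gives a uniformly positive chance
    of connection, and s failures have probability at most (C/(C+1))^s ([stuck_bound]). A connected
    set of diameter n/10 meets s suitable boxes of a single shift ([frequent_tau]), hence is joined
    to the network ([local_uniqueness]).

    The Poisson computations are made on finite families of loops that are stable under surgery and
    exhaust the loop space; [liminf_bound] passes to the full soup. With s = 2^k and 32^k of order n
    the error at scale n is of order exp(-2 n^(1/10)). Local uniqueness together with a vacant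
    spanning set at all scales 2^j n produces the unique infinite component meeting the ball
    ([infinite_comp]), and the errors are summable in j. *)

(** * Connectivity inside a set along a relation *)

Section Rconn.
Variables (T : eqType) (e : rel T).
Implicit Types (Z A : set T).

(** The relation is a parameter because nearest neighbour and star adjacency are both used; at
    [nearest_neighbor] this unfolds to [path_in]. *)
Definition rconn Z (x y : T) : Prop :=
  exists p : seq T, [/\ path e x p, last x p = y & forall z, z \in x :: p -> Z z].

Lemma rconn_refl Z x : Z x -> rconn Z x x.
Proof. by move=> Zx; exists [::]; split=> // z; rewrite inE => /eqP ->. Qed.

Lemma rconn_l Z x y : rconn Z x y -> Z x.
Proof. by case=> p [_ _]; apply; rewrite mem_head. Qed.

Lemma rconn_r Z x y : rconn Z x y -> Z y.
Proof. by case=> p [_ <-]; apply; apply: mem_last. Qed.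

Lemma rconn_trans Z x y z : rconn Z x y -> rconn Z y z -> rconn Z x z.
Proof.
case=> p [ep lp Zp] [q [eq lq Zq]]; exists (p ++ q); split.
- by rewrite cat_path ep lp.
- by rewrite last_cat lp.
- move=> w; rewrite -cat_cons mem_cat => /orP[/Zp//|wq].
  by apply: Zq; rewrite inE wq orbT.
Qed.

Lemma rconn_step Z x y : Z x -> Z y -> e x y -> rconn Z x y.
Proof.
move=> Zx Zy exy; exists [:: y]; split=> //=; first by rewrite exy.
by move=> z; rewrite !inE => /orP[] /eqP ->.
Qed.

Lemma rconn_rcons Z x y z : rconn Z x y -> e y z -> Z z -> rconn Z x z.
Proof.
move=> c ez Zz; apply: (rconn_trans c); apply: rconn_step => //.
exact: (rconn_r c).
Qed.

Lemma rconn_sym Z x y : symmetric e -> rconn Z x y -> rconn Z y x.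
Proof.
move=> es [p [ep lp Zp]]; exists (rev (belast x p)); split.
- by rewrite -lp rev_path; rewrite (eq_path (e' := e)) // => u v; rewrite es.
- by case: p ep lp Zp => [|a p] //= _ <- _; rewrite rev_cons last_rcons.
- move=> z; rewrite -lp inE mem_rev => /orP[/eqP ->|/mem_belast]; last exact: Zp.
  by apply: Zp; apply: mem_last.
Qed.

Lemma rconn_sub Z Z' x y : Z `<=` Z' -> rconn Z x y -> rconn Z' x y.
Proof. by move=> s [p [ep lp Zp]]; exists p; split=> // z /Zp /s. Qed.

(** Cut the path at its first step out of A. All first-exit arguments below use this form, and
    [rconn_inv] turns it into propagation of an invariant. *)
Lemma rconn_exit Z A x y : rconn Z x y -> A x -> ~ A y ->
  exists u v, [/\ rconn (Z `&` A) x u, e u v, Z v, ~ A v & rconn Z v y].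
Proof.
case=> p; elim: p x => [|a p IH] x [/= ep lp Zp] Ax nAy.
  by case: nAy; rewrite -lp.
case/andP: ep => exa ep.
have Za : forall z, z \in a :: p -> Z z.
  by move=> z zp; apply: Zp; rewrite inE zp orbT.
have Zx : Z x by apply: Zp; rewrite mem_head.
have cay : rconn Z a y by exists p.
case: (pselect (A a)) => Aa.
  have [u [v [cu euv Zv nAv cv]]] := IH a (And3 ep lp Za) Aa nAy.
  exists u, v; split=> //; apply: rconn_trans cu.
  by apply: rconn_step => //; split=> //; apply: Za; rewrite mem_head.
exists x, a; split=> //; last by apply: Za; rewrite mem_head.
exact: rconn_refl.
Qed.

Lemma rconn_inv Z A x y : rconn Z x y -> A x ->
  (forall u v, Z u -> Z v -> e u v -> A u -> A v) -> A y.
Proof.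
move=> c Ax st; case: (pselect (A y)) => // nAy.
have [u [v [cu euv Zv nAv cv]]] := rconn_exit c Ax nAy.
have [Zu Au] := rconn_r cu.
by case: nAv; apply: (st u v).
Qed.

Lemma rconn_self Z x y : rconn Z x y -> rconn [set z | rconn Z x z] x y.
Proof.
move=> c; apply: (rconn_inv (A := [set z | rconn [set z | rconn Z x z] x z]) c).
  by apply: rconn_refl; apply: rconn_refl; exact: (rconn_l c).
move=> u v Zu Zv euv cu; apply: (rconn_rcons cu euv) => /=.
exact: (rconn_rcons (rconn_r cu) euv Zv).
Qed.

End Rconn.

(** * Coordinates, segments and boxes in Z^d *)

Section Lattice.
Variable d : nat.
Local Notation V := 'rV[int]_d.
Implicit Types (x y z : V) (Z : set V).

(* The same two facts with vertices typed as vectors: the generic versions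
   produce vertices of the underlying eqType, which hides coordinates from lia *)
Lemma vconn_exit (e : rel V) Z (A : set V) x y : rconn e Z x y -> A x -> ~ A y ->
  exists u v : V, [/\ rconn e (Z `&` A) x u, e u v, Z v, ~ A v & rconn e Z v y].
Proof. exact: rconn_exit. Qed.

Lemma vconn_inv (e : rel V) Z (A : set V) x y : rconn e Z x y -> A x ->
  (forall u v : V, Z u -> Z v -> e u v -> A u -> A v) -> A y.
Proof. exact: rconn_inv. Qed.

Lemma path_inE Z x y : path_in Z x y = rconn (@nearest_neighbor d) Z x y.
Proof. by []. Qed.

Lemma nnP x y : nearest_neighbor x y <->
  exists i, `|x ord0 i - y ord0 i|%N = 1%N /\
    forall j, j != i -> x ord0 j = y ord0 j.
Proof.
rewrite /nearest_neighbor; split.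
  move=> /eqP h.
  have [i hi] : exists i, `|x ord0 i - y ord0 i|%N != 0%N.
    apply: contrapT => /forallNP h0.
    move: h; rewrite big1 // => i _; apply/eqP; case: eqP => // /eqP ne.
    by case: (h0 i).
  move: h; rewrite (bigD1 i) //= => h.
  move: h hi; set a := `|_|%N; set s := bigop.body _ _ _ => h hi.
  have [a1 h1] : a = 1%N /\ s = 0%N by move: h hi; clearbody a s; lia.
  exists i; split; first by [].
  move=> j ji; move/eqP: h1; rewrite sum_nat_eq0 => /forallP /(_ j) /implyP /(_ ji) /eqP.
  by lia.
case=> i [hi hj]; rewrite (bigD1 i) //= hi big1 ?addn0 // => j ji.
by rewrite hj // subrr.
Qed.

Lemma nn_sym : symmetric (@nearest_neighbor d).
Proof.
move=> x y; rewrite /nearest_neighbor.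
by congr (_ == _); apply: eq_bigr => i _; rewrite distnC.
Qed.

Lemma linf_distC x y : linf_dist x y = linf_dist y x.
Proof. by apply: eq_bigr => i _; rewrite distnC. Qed.

Lemma linfP x y r : (linf_dist x y <= r)%N <->
  forall i, (`|x ord0 i - y ord0 i| <= r)%N.
Proof.
split; last by move=> h; apply/bigmax_leqP => i _; exact: h.
by move=> /bigmax_leqP h i; exact: h.
Qed.

Lemma linf_coord x y i : (`|x ord0 i - y ord0 i| <= linf_dist x y)%N.
Proof. by have /linfP/(_ i) := leqnn (linf_dist x y). Qed.

Lemma linf_triangle y x z : (linf_dist x z <= linf_dist x y + linf_dist y z)%N.
Proof.
apply/linfP => i.
have := linf_coord x y i; have := linf_coord y z i.
by lia.
Qed.

Lemma linfxx x : linf_dist x x = 0%N.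
Proof. by apply/eqP; rewrite -leqn0; apply/linfP => i; rewrite subrr. Qed.

Lemma linf_gt x y r : (r < linf_dist x y)%N ->
  exists i, (r < `|x ord0 i - y ord0 i|)%N.
Proof.
move=> h; apply: contrapT => /forallNP hn.
move: h; rewrite ltnNge => /negP; apply; apply/linfP => i.
by move: (hn i) => /negP; rewrite -leqNgt.
Qed.

Lemma linf_eq x y : (forall i, x ord0 i = y ord0 i) -> x = y.
Proof. by move=> h; apply/rowP. Qed.

Lemma nn_linf x y : nearest_neighbor x y -> (linf_dist x y <= 1)%N.
Proof.
move/nnP => [i [hi hj]]; apply/linfP => j.
by have [->|ji] := eqVneq j i; [rewrite hi | rewrite hj // subrr].
Qed.

Definition upd x (i : 'I_d) (a : int) : V :=
  \row_j (if j == i then a else x ord0 j).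

Lemma updE x i a j : upd x i a ord0 j = if j == i then a else x ord0 j.
Proof. by rewrite mxE. Qed.

Lemma upd_id x i : upd x i (x ord0 i) = x.
Proof. by apply: linf_eq => j; rewrite updE; case: eqP => // ->. Qed.

Lemma upd_upd x i a b : upd (upd x i a) i b = upd x i b.
Proof. by apply: linf_eq => j; rewrite !updE; case: eqP. Qed.

Lemma nn_upd x i (a b : int) : `|a - b|%N = 1%N -> nearest_neighbor (upd x i a) (upd x i b).
Proof.
move=> h; apply/nnP; exists i; rewrite !updE eqxx; split=> // j /negPf ji.
by rewrite !updE ji.
Qed.

Definition btw (a b c : int) : bool := (a <= b <= c) || (c <= b <= a).

Lemma line_conn Z x i a : (forall c, btw (x ord0 i) c a -> Z (upd x i c)) ->
  path_in Z x (upd x i a).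
Proof.
move: {-2}(`|a - x ord0 i|%N) (erefl `|a - x ord0 i|%N) => n.
elim: n x => [|n IH] x hn hZ.
  have -> : a = x ord0 i by lia.
  rewrite upd_id; apply: rconn_refl; rewrite -(upd_id x i); apply: hZ.
  by rewrite /btw; lia.
set b := if x ord0 i <= a then x ord0 i + 1 else x ord0 i - 1.
have hb : `|x ord0 i - b|%N = 1%N by rewrite /b; case: ifP; lia.
have hb2 : `|a - b|%N = n by move: hn; rewrite /b; case: ifP; lia.
have bt c : btw b c a -> btw (x ord0 i) c a.
  by move: hn; rewrite /b /btw; case: ifP; lia.
have Zx : Z x.
  by rewrite -(upd_id x i); apply: hZ; rewrite /btw; lia.
have Zb : Z (upd x i b) by apply: hZ; apply: bt; rewrite /btw; lia.
apply: (@rconn_trans _ _ _ _ (upd x i b)).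
  apply: rconn_step => //; rewrite -{1}(upd_id x i); exact: nn_upd.
rewrite -(upd_upd x i b a); apply: IH; first by rewrite updE eqxx hb2.
by move=> c; rewrite updE eqxx => /bt; rewrite upd_upd; exact: hZ.
Qed.

Lemma box_conn Z x y :
  (forall z, (forall j, btw (x ord0 j) (z ord0 j) (y ord0 j)) -> Z z) ->
  path_in Z x y.
Proof.
have [n] : exists n, (#|[set i | x ord0 i != y ord0 i]%SET| <= n)%N by eexists.
elim: n x => [|n IH] x hn hZ.
  have <- : x = y.
    apply: linf_eq => i; apply/eqP; move: hn; rewrite leqn0 cards_eq0 => /eqP h.
    by have := finset.in_set0 i; rewrite -h finset.inE => /negbFE.
  by apply: rconn_refl; apply: hZ => j; rewrite /btw; lia.
have [[i hi]|/forallNP hi] := pselect (exists i, x ord0 i != y ord0 i); last first.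
  have <- : x = y.
    by apply: linf_eq => i; apply/eqP; move: (hi i) => /negP; rewrite negbK.
  by apply: rconn_refl; apply: hZ => j; rewrite /btw; lia.
apply: (@rconn_trans _ _ _ _ (upd x i (y ord0 i))).
  apply: line_conn => c hc; apply: hZ => j; rewrite updE.
  by case: eqP => [->//|_]; rewrite /btw; lia.
apply: IH.
  rewrite -ltnS; apply: leq_trans hn; apply: proper_card; apply/properP; split.
    apply/fintype.subsetP => j; rewrite !finset.inE updE.
    by case: (eqVneq j i) => [->|//]; rewrite eqxx.
  by exists i; rewrite !finset.inE ?updE ?eqxx.
move=> z hz; apply: hZ => j; move: (hz j); rewrite updE; case: eqP => [->|_] //.
by rewrite /btw; lia.
Qed.

End Lattice.

(** Boundaries of nearest neighbour clusters are connected only for this weaker adjacency. It is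
    reflexive. *)
Definition star (d : nat) : rel 'rV[int]_d := fun x y => (linf_dist x y <= 1)%N.

Lemma star_sym d : symmetric (@star d).
Proof. by move=> x y; rewrite /star linf_distC. Qed.

Lemma nn_star d (x y : 'rV[int]_d) : nearest_neighbor x y -> star x y.
Proof. exact: nn_linf. Qed.

(** * Closed mod 2 cochains on the lattice are exact *)

Section Primitive.

(** The mod 2 antiderivative of g that vanishes at 0. *)
Definition prim (g : int -> bool) (a : int) : bool :=
  match a with
  | Posz n => \big[addb/false]_(0 <= j < n) g j%:Z
  | Negz n => \big[addb/false]_(0 <= j < n.+1) g (- (j.+1)%:Z)
  end.

Lemma prim0 g : prim g 0 = false.
Proof. by have -> : 0 = Posz 0 by []; rewrite /prim big_geq. Qed.

Lemma primS g a : prim g (a + 1) = prim g a (+) g a.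
Proof.
case: a => n.
  have -> : Posz n + 1 = Posz n.+1 by lia.
  by rewrite /prim big_nat_recr.
have -> : Negz n + 1 = - n%:Z by lia.
rewrite NegzE; case: n => [|n].
  by rewrite oppr0 prim0 /= big_nat1 addbb.
rewrite -NegzE -NegzE /prim [in RHS]big_nat_recr //=.
have -> : Negz n.+1 = - (n.+2)%:Z by lia.
by rewrite -addbA addbb addbF.
Qed.

Lemma int_ind2 (Q : int -> Prop) : Q 0 -> (forall a, Q a <-> Q (a + 1)) ->
  forall a, Q a.
Proof.
move=> Q0 QS; case=> n.
  elim: n => [//|n IH]; have -> : Posz n.+1 = Posz n + 1 by lia.
  exact: (QS n%:Z).1 IH.
elim: n => [|n IH].
  by apply: (QS (Negz 0)).2; have -> : Negz 0 + 1 = 0 by lia.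
by apply: (QS (Negz n.+1)).2; have -> : Negz n.+1 + 1 = Negz n by lia.
Qed.

End Primitive.

Section Exactness.
Variables (d : nat) (w : 'rV[int]_d -> 'rV[int]_d -> bool).
Local Notation V := 'rV[int]_d.
Local Notation up x i := (upd x i (x ord0 i + 1)).
Hypothesis closed : forall (x : V) (i j : 'I_d), i != j ->
  w x (up x i) (+) w (up x j) (upd (up x i) j (x ord0 j + 1)) =
  w x (up x j) (+) w (up x i) (upd (up x i) j (x ord0 j + 1)).

Definition trunc (k : nat) (x : V) : V :=
  \row_j (if (j < k)%N then 0 else x ord0 j).

Definition lineg (x : V) (k : 'I_d) (a : int) : bool :=
  w (upd x k a) (upd x k (a + 1)).

(** The integral of w from 0 to x along axis segments, the last coordinate being moved first. *)
Definition potential (x : V) : bool :=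
  \big[addb/false]_(k < d) prim (lineg (trunc k x) k) (x ord0 k).

Lemma big_telescope (T : nat -> bool) n :
  \big[addb/false]_(k < n) (T k (+) T k.+1) = T 0%N (+) T n.
Proof.
elim: n => [|n IH]; first by rewrite big_ord0 addbb.
by rewrite big_ord_recr /= IH -addbA (addbA (T n)) addbb.
Qed.

Lemma updC (x : V) i j a b : i != j -> upd (upd x i a) j b = upd (upd x j b) i a.
Proof.
move=> ij; apply: linf_eq => k; rewrite !updE.
by case: eqP => [->|//]; rewrite eq_sym (negPf ij).
Qed.

(** Stokes on a strip of plaquettes: the integrals along two parallel lines differ by the two rungs
    closing the strip. *)
Lemma lineg_shift (x : V) (i k : 'I_d) a : i != k ->
  prim (lineg x k) a (+) prim (lineg (up x i) k) a =
  w (upd x k a) (upd (up x i) k a) (+) w (upd x k 0) (upd (up x i) k 0).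
Proof.
move=> ik; move: a; apply: int_ind2; first by rewrite !prim0 !addbb.
move=> a; rewrite !primS /lineg.
have := closed (upd x k a) ik; rewrite !updE eqxx (negPf ik) upd_upd.
rewrite -!(updC _ _ _ ik) !upd_upd => h.
move: h; set Ta := w _ _; set T1 := w (upd x k (a + 1)) _.
set A := w _ _; set B := w _ _; set p := prim _ _; set q := prim _ _.
set T0 := w _ _; move: Ta T1 A B p q T0.
by do 7!case.
Qed.

(** Raising coordinate i changes the segments k < i by a strip, the segment k = i by one edge and
    the segments k > i not at all. The rungs [T] of consecutive strips cancel, leaving the rung at x
    itself. *)
Lemma potential_up x i : potential (up x i) (+) potential x = w x (up x i).
Proof.
pose T (k : nat) := if (k <= i)%N then w (trunc k x) (trunc k (up x i)) else false.
rewrite /potential -big_split /=.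
rewrite (eq_bigr (fun k : 'I_d => T k (+) T k.+1)); last first.
  move=> k _; rewrite /T.
  have [ki|ik|ki] := ltngtP k i.
  - have nik : i != k by apply/eqP => e; move: ki; rewrite e ltnn.
    have e1 : trunc k (up x i) = up (trunc k x) i.
      apply: linf_eq => j; rewrite !(updE, mxE) (ltnNge i k) (ltnW ki) /=.
      by case: eqP => [->|//]; rewrite ltnNge (ltnW ki).
    have e2 y : upd (trunc k y) k 0 = trunc k.+1 y.
      apply: linf_eq => j; rewrite !(updE, mxE) ltnS -val_eqE /=.
      by case: ltngtP.
    have e3 y : upd (trunc k y) k (y ord0 k) = trunc k y.
      apply: linf_eq => j; rewrite !(updE, mxE).
      by case: eqP => [->|//]; rewrite ltnn.
    have e4 : up x i ord0 k = x ord0 k by rewrite updE eq_sym (negPf nik).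
    rewrite e4 addbC e1 lineg_shift // -e1 e3 e2.
    by rewrite -{1}e4 e3 e2.
  - have nik : k != i by apply/eqP => e; move: ik; rewrite e ltnn.
    rewrite updE (negPf nik).
    have -> : trunc k (up x i) = trunc k x; last by rewrite addbb.
    apply: linf_eq => j; rewrite !(updE, mxE).
    by case: (ltnP j k) => // kj; case: eqP => // ji; move: kj; rewrite ji leqNgt ik.
  - move/val_inj: ki => ->; rewrite updE eqxx primS addbF.
    have e1 : trunc i (up x i) = up (trunc i x) i.
      apply: linf_eq => j; rewrite !(updE, mxE) ltnn.
      by case: eqP => [->|//]; rewrite ltnn.
    have -> : lineg (trunc i (up x i)) i = lineg (trunc i x) i.
      by apply/funext => a; rewrite /lineg e1 !upd_upd.
    rewrite addbAC addbb /= /lineg e1 !mxE ltnn.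
    congr (w _ _); apply: linf_eq => j; rewrite !(updE, mxE).
    by case: eqP => [->|//]; rewrite ltnn.
rewrite big_telescope /T /= leqNgt ltn_ord addbF.
by congr (w _ _); apply: linf_eq => j; rewrite mxE.
Qed.

Hypothesis w_sym : forall x y, w x y = w y x.

Lemma potential_nn x y : nearest_neighbor x y -> potential x (+) potential y = w x y.
Proof.
move/nnP => [i [hi hj]].
have [e|e] : y ord0 i = x ord0 i + 1 \/ x ord0 i = y ord0 i + 1 by lia.
  have -> : y = up x i.
    by apply: linf_eq => j; rewrite updE; case: eqP => [->//|/eqP /hj].
  by rewrite addbC potential_up.
have -> : x = up y i.
  by apply: linf_eq => j; rewrite updE; case: eqP => [->//|/eqP /hj].
by rewrite potential_up w_sym.
Qed.

End Exactness.

Lemma nn_irr d (x : 'rV[int]_d) : nearest_neighbor x x = false.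
Proof.
apply/negP => /nnP [i [h _]]; move: h; rewrite subrr.
by [].
Qed.

Lemma lballP d (y : 'rV[int]_d) N : lball 0 N y <->
  forall i, - (N%:Z) <= y ord0 i <= N%:Z.
Proof.
rewrite /lball /= linfP; split=> h i; have := h i; rewrite mxE; lia.
Qed.

(** * Star-connectedness of the boundary between a connected set and a hole *)

Section Boundary.
Variables (d N : nat) (U H : set 'rV[int]_d).
Local Notation V := 'rV[int]_d.
Local Notation Box := (@lball d 0 N).
Hypothesis Unn : forall u u', U u -> U u' -> rconn (@nearest_neighbor d) U u u'.
Hypothesis Hst : forall u u', H u -> H u' -> rconn (@star d) H u u'.
Hypothesis UB : U `<=` Box.
Hypothesis HB : H `<=` Box.
Hypothesis dis : forall x, U x -> H x -> False.
Hypothesis clo : forall h y, H h -> Box y -> star h y -> H y \/ U y.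

Definition inner_bdry : set V :=
  [set h | H h /\ exists2 u, U u & nearest_neighbor u h].

(** The coordinatewise projection onto the box. Pulling back along it extends a cochain of the box
    to Z^d, where [potential] is available. *)
Definition clamp (x : V) : V :=
  \row_j Num.max (- N%:Z) (Num.min (x ord0 j) N%:Z).

Lemma clamp_box x : Box (clamp x).
Proof. by apply/lballP => i; rewrite mxE; lia. Qed.

Lemma clamp_id x : Box x -> clamp x = x.
Proof. by move/lballP => h; apply: linf_eq => i; rewrite mxE; have := h i; lia. Qed.

Lemma clamp_nn x y : nearest_neighbor x y ->
  clamp x = clamp y \/ nearest_neighbor (clamp x) (clamp y).
Proof.
move/nnP => [i [hi hj]].
have [e|e] := eqVneq (clamp x ord0 i) (clamp y ord0 i).
  left; apply: linf_eq => j; have [->//|ji] := eqVneq j i.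
  by rewrite !mxE hj.
right; apply/nnP; exists i; split.
  by move: e; rewrite !mxE; lia.
by move=> j ji; rewrite !mxE hj.
Qed.

Variable h0 : V.
Hypothesis h0D : inner_bdry h0.

Definition bdry_class : set V := [set h | rconn (@star d) inner_bdry h0 h].

(** The cochain that counts, mod 2, edges between U and the star component [bdry_class] of one
    boundary point. The aim is to show that this component is the whole inner boundary. *)
Definition crossing (x y : V) : bool :=
  `[< (U x /\ bdry_class y) \/ (U y /\ bdry_class x) >] && nearest_neighbor x y.

Lemma crossing_sym x y : crossing x y = crossing y x.
Proof.
rewrite /crossing nn_sym; congr (_ && _); apply: asbool_equiv_eq.
by split; case=> [[]|[]]; tauto.
Qed.

Lemma bdry_classH h : bdry_class h -> H h.
Proof. by move/rconn_r => []. Qed.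

(** On a star clique of the box the cochain is zero or the coboundary of the indicator of U. Indeed,
    once the clique meets the class, [clo] puts each of its vertices in H or U, and a vertex of H
    next to U inside the clique joins the class. *)
Lemma crossing_hull (Q : set V) : Q `<=` Box ->
  (forall a b, Q a -> Q b -> star a b) ->
  forall a b, Q a -> Q b -> a = b \/ nearest_neighbor a b ->
  crossing a b = `[< exists2 q, Q q & bdry_class q >] && (`[<U a>] (+) `[<U b>]).
Proof.
move=> QB Qs a b Qa Qb [->|nab]; first by rewrite /crossing nn_irr addbb !andbF.
rewrite /crossing nab andbT.
have [[q Qq cq]|nc] := asboolP (exists2 q, Q q & bdry_class q); last first.
  apply/asboolP => -[[_ cb]|[_ ca]]; apply: nc; first by exists b.
  by exists a.
have HU z : Q z -> H z \/ U z.
  by move=> Qz; apply: (clo (bdry_classH cq) (QB _ Qz)); exact: Qs.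
have ext x y : Q x -> Q y -> nearest_neighbor x y -> U x -> ~ U y -> bdry_class y.
  move=> Qx Qy nxy Ux nUy; have [Hy|//] := HU _ Qy.
  apply: (rconn_rcons cq); first exact: Qs.
  by split=> //; exists x.
apply/asboolP.
case: (asboolP (U a)) => Ua; case: (asboolP (U b)) => Ub /=.
- by case=> [] [_ /bdry_classH h]; [apply: (dis Ub h)|apply: (dis Ua h)].
- by left; split=> //; apply: (ext a b).
- by right; split=> //; apply: (ext b a) => //; rewrite nn_sym.
- by case=> [] [].
Qed.

(** The cochain is closed, hence the differential of some phi. Since phi is constant on U and on H,
    the cochain takes one value on all edges between U and H. That value is 1 at [h0], so every
    inner boundary point belongs to the class of [h0]. *)
Lemma inner_bdry_class h : inner_bdry h -> bdry_class h.
Proof.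
move=> hD; pose w x y := crossing (clamp x) (clamp y).
have wcl (x : V) (i j : 'I_d) : i != j ->
  w x (upd x i (x ord0 i + 1)) (+)
    w (upd x j (x ord0 j + 1)) (upd (upd x i (x ord0 i + 1)) j (x ord0 j + 1)) =
  w x (upd x j (x ord0 j + 1)) (+)
    w (upd x i (x ord0 i + 1)) (upd (upd x i (x ord0 i + 1)) j (x ord0 j + 1)).
  move=> ij.
  pose xij := upd (upd x i (x ord0 i + 1)) j (x ord0 j + 1).
  have hx k : x ord0 k <= xij ord0 k <= x ord0 k + 1.
    rewrite /xij !updE; case: (eqVneq k j) => [->|_]; first by lia.
    by case: (eqVneq k i) => [->|_]; lia.
  (* After clamping, the corners of a plaquette lie in one star clique of the box, where
     [crossing_hull] exhibits a coboundary. *)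
  pose Q := [set clamp p | p in [set p : V | forall k, btw (x ord0 k) (p ord0 k) (xij ord0 k)]].
  have QB : Q `<=` Box by move=> _ [p _ <-]; exact: clamp_box.
  have Qs a b : Q a -> Q b -> star a b.
    move=> [p hp <-] [q hq <-]; apply/linfP => k.
    have := hp k; have := hq k; have := hx k; rewrite /btw !mxE; lia.
  have Qx : Q (clamp x) by exists x => // k; rewrite /btw; lia.
  have Qxi : Q (clamp (upd x i (x ord0 i + 1))).
    exists (upd x i (x ord0 i + 1)) => // k; rewrite /xij /btw !updE.
    by case: (eqVneq k j) => [->|kj]; [rewrite eq_sym (negPf ij); lia|case: ifP => _; lia].
  have Qxj : Q (clamp (upd x j (x ord0 j + 1))).
    exists (upd x j (x ord0 j + 1)) => // k; rewrite /xij /btw !updE.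
    by case: (eqVneq k j) => [->|kj]; [lia|case: ifP => _; lia].
  have Qxij : Q (clamp xij).
    by exists xij => // k; rewrite /btw; lia.
  have n1 (y : V) k : nearest_neighbor y (upd y k (y ord0 k + 1)).
    by rewrite -{1}(upd_id y k); apply: nn_upd; lia.
  have ec := crossing_hull QB Qs.
  have nxi := n1 (upd x i (x ord0 i + 1)) j.
  rewrite updE eq_sym (negPf ij) in nxi.
  have nxj := n1 (upd x j (x ord0 j + 1)) i.
  rewrite updE (negPf ij) -(updC _ _ _ ij) in nxj.
  rewrite /w !ec //; try exact: clamp_nn.
  by case: asbool => //=; case: asbool; case: asbool; case: asbool; case: asbool.
have ws x y : w x y = w y x by rewrite /w crossing_sym.
pose phi := potential w.
have phiE : forall x y, nearest_neighbor x y -> phi x (+) phi y = w x y.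
  exact: (potential_nn wcl ws).
have phiU u u' : U u -> U u' -> phi u = phi u'.
  move=> Uu Uu'; symmetry.
  apply: (vconn_inv (A := [set z | phi z = phi u]) (Unn Uu Uu')) => //.
  move=> a b Ua Ub nab /= <-; have := phiE _ _ nab.
  rewrite /w !clamp_id; try exact: UB.
  have -> : crossing a b = false.
    apply/negP => /andP[/asboolP]; case=> [] [_ /bdry_classH Hz] _.
      exact: (dis Ub).
    exact: (dis Ua).
  by case: (phi a); case: (phi b).
have phiH u u' : H u -> H u' -> phi u = phi u'.
  move=> Hu Hu'; symmetry.
  apply: (vconn_inv (A := [set z | phi z = phi u]) (Hst Hu Hu')) => //.
  move=> a b Ha Hb sab /= <-.
  (* A star step inside H is refined to a nearest neighbour path in the hull of its end points,
     which is a star clique. There phi and [c] times the indicator of U have equal increments, and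
     the indicator vanishes at both ends. *)
  pose Q := [set q : V | forall k, btw (a ord0 k) (q ord0 k) (b ord0 k)].
  have QB : Q `<=` Box.
    move=> q hq; apply/lballP => k; have := hq k.
    have /lballP/(_ k) := HB Ha; have /lballP/(_ k) := HB Hb; rewrite /btw; lia.
  have Qs p q : Q p -> Q q -> star p q.
    move=> hp hq; apply/linfP => k; have := hp k; have := hq k.
    have /linfP/(_ k) := sab; rewrite /btw; lia.
  pose c := `[< exists2 q, Q q & bdry_class q >].
  have pab : rconn (@nearest_neighbor d) Q a b by apply: box_conn.
  have : phi b (+) (c && `[<U b>]) = phi a (+) (c && `[<U a>]).
    apply: (vconn_inv (A := [set z | phi z (+) (c && `[<U z>]) =
      phi a (+) (c && `[<U a>])]) pab) => //.
    move=> p q Qp Qq npq /= <-.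
    have := crossing_hull QB Qs Qp Qq (or_intror npq); rewrite -/c.
    have := phiE _ _ npq; rewrite /w !clamp_id; try exact: QB.
    move=> <-.
    by move: c (phi p) (phi q) `[<U p>] `[<U q>]; do 5!case.
  have -> : `[<U a>] = false by apply/asboolP => Ua; exact: (dis Ua Ha).
  have -> : `[<U b>] = false by apply/asboolP => Ub; exact: (dis Ub Hb).
  by rewrite andbF !addbF.
have [H0 [u0 Uu0 n0]] := h0D.
have [Hh [u Uu nh]] := hD.
have c0 : bdry_class h0 by apply: rconn_refl.
have w0 : w u0 h0.
  rewrite /w !clamp_id; [|exact: HB|exact: UB].
  by rewrite /crossing n0 andbT; apply/asboolP; left.
have : w u h.
  by rewrite -phiE // (phiU _ _ Uu Uu0) (phiH _ _ Hh H0) phiE.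
rewrite /w !clamp_id; [|exact: HB|exact: UB].
case/andP => /asboolP[] [] // Uh _ _.
by case: (dis Uh Hh).
Qed.

End Boundary.

(** * Small holes and local connectedness of the outer cluster *)

Section Holes.
Variable d : nat.
Hypothesis hd : (1 < d)%N.
Local Notation V := 'rV[int]_d.
Local Notation nrm x := (linf_dist (0 : V) x).
Local Notation nn := (@nearest_neighbor d).
Local Notation st := (@star d).

Definition sphere j : set V := [set x | nrm x = j].

Lemma nrm_coord (x : V) j : (0 < j)%N -> nrm x = j ->
  exists i, `|x ord0 i|%N = j.
Proof.
case: j => // j _ e; have [i hi] : exists i, (j < `|(0%R : V) ord0 i - x ord0 i|)%N.
  by apply: linf_gt; rewrite e.
exists i; have := linf_coord 0 x i; rewrite e; move: hi; rewrite mxE; lia.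
Qed.

Lemma nrm_eq (x : V) j i : `|x ord0 i|%N = j ->
  (forall k, (`|x ord0 k| <= j)%N) -> nrm x = j.
Proof.
move=> hi hk; apply/eqP; rewrite eqn_leq; apply/andP; split.
  by apply/linfP => k; rewrite mxE; have := hk k; lia.
by have := linf_coord 0 x i; rewrite mxE -hi; lia.
Qed.

Lemma nrm_le (x : V) k : (`|x ord0 k| <= nrm x)%N.
Proof. by have := linf_coord 0 x k; rewrite mxE; lia. Qed.

Lemma sphere_conn j x y : sphere j x -> sphere j y -> rconn nn (sphere j) x y.
Proof.
case: j => [|j].
  have z x' : sphere 0 x' -> x' = 0.
    move=> e; apply: linf_eq => i; have := nrm_le x' i; rewrite e mxE; lia.
  by move=> /[dup] /z -> h /z ->; apply: rconn_refl.
pose c : V := \row__ j.+1%:Z.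
suff main x' : sphere j.+1 x' -> rconn nn (sphere j.+1) x' c.
  move=> hx hy; apply: (rconn_trans (main _ hx)).
  by apply: rconn_sym (main _ hy); exact: nn_sym.
move=> hx; have [i hi] := nrm_coord (ltn0Sn j) hx.
have hk k : (`|x' ord0 k| <= j.+1)%N by rewrite -hx; exact: nrm_le.
have [k ki] : exists k : 'I_d, k != i.
  have h0 : (0 < d)%N by lia.
  case: (eqVneq (Ordinal h0) i) => [e|e]; last by exists (Ordinal h0).
  by exists (Ordinal hd); rewrite -e.
(* Coordinate i keeps the point on the sphere while the others move to the corner [c]; then
   coordinate k does so while i moves. *)
pose y' : V := upd c i (x' ord0 i).
apply: (@rconn_trans _ _ _ _ y'); apply: box_conn => z hz.
  apply: (nrm_eq (i := i)).
    by have := hz i; rewrite /y' updE eqxx /btw; lia.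
  by move=> l; have := hz l; have := hk l; rewrite /y' /btw updE mxE; case: ifP => _; lia.
apply: (nrm_eq (i := k)).
  by have := hz k; rewrite /y' updE (negPf ki) mxE /btw; lia.
by move=> l; have := hz l; have := hk i; rewrite /y' /btw updE mxE; case: ifP => _; lia.
Qed.

Lemma max_fun (f : V -> int) (H : set V) (N : int) : (exists h, H h) ->
  (forall h, H h -> f h <= N) -> exists2 h, H h & forall h', H h' -> f h' <= f h.
Proof.
move=> [h0 H0] hN.
have [n] : exists n, (`|N - f h0| <= n)%N by eexists.
elim: n h0 H0 => [|n IH] h0 H0 hn.
  by exists h0 => // h' H'; have := hN _ H'; have := hN _ H0; lia.
have [[h1 [H1 lt]]|nex] := pselect (exists h1, H h1 /\ f h0 < f h1).
  by apply: (IH h1 H1); have := hN _ H1; have := hN _ H0; lia.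
exists h0 => // h' H'; rewrite leNgt; apply/negP => lt; apply: nex.
by exists h'.
Qed.

Lemma norm_ivt Z x y j : rconn nn Z x y -> (nrm x <= j <= nrm y)%N ->
  exists2 z : V, nrm z = j & rconn nn Z x z.
Proof.
move=> c /andP[hx hy]; have [->|ne] := eqVneq j (nrm y); first by exists y.
have ny : ~ (nrm y <= j)%N by move/negP: ne; lia.
have [u [v [cu nuv Zv nv cv]]] := vconn_exit (A := [set z | (nrm z <= j)%N]) c hx ny.
exists u; last by apply: (rconn_sub _ cu) => z [].
have [_ /= hu] := rconn_r cu.
have := linf_triangle u 0 v; have := nn_linf nuv; move: nv => /= /negP; lia.
Qed.

Section Outer.
Variables (N m : nat) (B : set V).
Hypothesis NB : forall h h', rconn st (B `&` lball 0 N) h h' -> (linf_dist h h' < m)%N.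

Hypothesis m_gt0 : (0 < m)%N.

(** The sphere of radius N is declared open, so that the outer cluster contains it and is connected
    through it. *)
Definition open_site : set V := [set x | lball 0 N x /\ (~ B x \/ nrm x = N)].
Definition outer_comp : set V :=
  [set x | exists2 y : V, nrm y = N & rconn nn open_site x y].

Lemma outer_comp_conn u u' : outer_comp u -> outer_comp u' -> rconn nn outer_comp u u'.
Proof.
have st1 x y : nrm y = N -> rconn nn open_site x y -> rconn nn outer_comp x y.
  move=> ny c; have cs := rconn_sym (@nn_sym d) c.
  apply: rconn_sym; first exact: nn_sym.
  apply: (rconn_sub _ (rconn_self cs)) => z /= cz; exists y => //.
  exact: (rconn_sym (@nn_sym d)).
have sp x : nrm x = N -> outer_comp x.
  move=> nx; exists x => //; apply: rconn_refl; split; last by right.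
  by rewrite /lball /= nx.
move=> [y ny cy] [y' ny' cy']; apply: (rconn_trans (st1 _ _ ny cy)).
apply: (@rconn_trans _ _ _ _ y'); last first.
  by apply: rconn_sym; [exact: nn_sym|exact: st1].
apply: (rconn_sub _ (sphere_conn ny ny')) => z; exact: sp.
Qed.

Lemma outer_comp_layer x : nrm x = N -> outer_comp x.
Proof.
move=> nx; exists x => //; apply: rconn_refl; split; last by right.
by rewrite /lball /= nx.
Qed.

Lemma outer_comp_box : outer_comp `<=` lball 0 N.
Proof. by move=> x [y _ /rconn_l []]. Qed.

Lemma outer_comp_good x : outer_comp x -> (nrm x < N)%N -> ~ B x.
Proof. by move=> [y _ /rconn_l [_ [//|->]]]; rewrite ltnn. Qed.

Lemma outer_comp_nn x y : outer_comp x -> open_site y -> nearest_neighbor x y -> outer_comp y.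
Proof.
move=> [z nz cz] oy nxy; exists z => //.
apply: (rconn_trans _ cz); apply: rconn_step => //; last by rewrite nn_sym.
exact: (rconn_l cz).
Qed.

(** The inner boundary of a hole consists of B-points, is star connected, and is as wide as the hole
    in every axis direction. *)
Lemma holes_small x y : rconn st (lball 0 N `\` outer_comp) x y -> (linf_dist x y < m)%N.
Proof.
move=> cxy; rewrite ltnNge; apply/negP => hm.
have [i hi] : exists i, (m <= `|x ord0 i - y ord0 i|)%N.
  by case: m m_gt0 hm => // m' _; exact: linf_gt.
pose H : set V := [set z : V | rconn st (lball 0 N `\` outer_comp) x z].
have HB : H `<=` lball 0 N by move=> z /rconn_r [].
have dis z : outer_comp z -> H z -> False by move=> ? /rconn_r [].
have clo h z : H h -> lball 0 N z -> star h z -> H z \/ outer_comp z.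
  move=> Hh Bz shz; have [?|nX] := pselect (outer_comp z); [by right|left].
  exact: (rconn_rcons Hh shz).
have Hst u u' : H u -> H u' -> rconn st H u u'.
  move=> Hu Hu'; apply: (@rconn_trans _ _ _ _ x).
    apply: rconn_sym; first exact: star_sym.
    exact: (rconn_self Hu).
  exact: (rconn_self Hu').
have DB : inner_bdry outer_comp H `<=` B `&` lball 0 N.
  move=> h [Hh [u Xu nu]]; have [Bh nX] := rconn_r Hh; split=> //.
  apply: contrapT => nB; apply: nX; apply: (outer_comp_nn Xu) => //.
  by split=> //; left.
(* A point of the hole that is extremal in direction s along axis i is a boundary point: its next
   neighbour is still in the ball but not in the hole, hence in the outer cluster. *)
have ext (s : int) : s = 1 \/ s = -1 -> exists2 h : V, inner_bdry outer_comp H h &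
    s * x ord0 i <= s * h ord0 i /\ s * y ord0 i <= s * h ord0 i.
  move=> hs; have [h Hh mx] : exists2 h : V, H h & forall h' : V, H h' -> s * h' ord0 i <= s * h ord0 i.
    apply: (@max_fun (fun z => s * z ord0 i) _ N%:Z).
      by exists x; apply: rconn_refl; exact: (rconn_l cxy).
    by move=> z /HB /lballP /(_ i); case: hs => ->; lia.
  exists h; last first.
    by split; apply: mx => //; apply: rconn_refl; exact: (rconn_l cxy).
  split=> //; have [Bh nXh] := rconn_r Hh.
  have hn : (nrm h < N)%N.
    by rewrite ltn_neqAle Bh andbT; apply/eqP => /outer_comp_layer.
  pose h1 := upd h i (h ord0 i + s).
  have nh : nearest_neighbor h h1.
    by rewrite -{1}(upd_id h i); apply: nn_upd; case: hs => ->; lia.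
  have Bh1 : lball 0 N h1.
    apply/lballP => k; rewrite updE; have := nrm_le h k; have := nrm_le h i.
    by case: ifP => _; case: hs => e; rewrite ?e; lia.
  exists h1; last by rewrite nn_sym.
  have [Hh1|//] := clo _ _ Hh Bh1 (nn_star nh).
  by have := mx _ Hh1; rewrite updE eqxx; case: hs => ->; lia.
have [h1 D1 [a1 a2]] := ext 1 (or_introl erefl).
have [h2 D2 [b1 b2]] := ext (-1) (or_intror erefl).
have := inner_bdry_class outer_comp_conn Hst outer_comp_box HB dis clo D1 D2.
rewrite /bdry_class /= => /(rconn_sub DB) /NB lt.
by have := linf_coord h1 h2 i; lia.
Qed.

End Outer.

Section Inner.
Variables (N m n : nat) (B : set V).
Hypothesis NB : forall h h', rconn st (B `&` lball 0 N.+1) h h' -> (linf_dist h h' < m)%N.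
Hypothesis nm : (n + m <= N)%N.

Lemma outer_comp_connected u1 u2 : outer_comp N.+1 B u1 -> outer_comp N.+1 B u2 ->
  (nrm u1 <= n)%N -> (nrm u2 <= n)%N -> rconn nn (lball 0 N `\` B) u1 u2.
Proof.
move=> X1 X2 h1 h2.
have reach x : outer_comp N.+1 B x -> (nrm x <= n)%N ->
    exists2 y : V, nrm y = N & rconn nn (lball 0 N `\` B) x y.
  move=> [y ny cy] hx.
  have hxN : (nrm x <= N)%N by lia.
  have nyN : ~ (nrm y <= N)%N by rewrite ny ltnn.
  have [u [v [cu nuv Zv nv cv]]] :=
    vconn_exit (A := [set z | (nrm z <= N)%N]) cy hxN nyN.
  have s : open_site N.+1 B `&` [set z | (nrm z <= N)%N] `<=` lball 0 N `\` B.
    move=> z [[_ [nB|e]] /= hz]; first by split.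
    by move: hz; rewrite e ltnn.
  have cu' := rconn_sub s cu.
  exists u => //; have [/= hu _] := rconn_r cu'; apply/eqP; rewrite eqn_leq hu /=.
  have := linf_triangle u 0 v; have := nn_linf nuv; move: nv => /= /negP; lia.
have [y1 n1 c1] := reach _ X1 h1.
have [y2 n2 c2] := reach _ X2 h2.
apply: contrapT => nc.
pose X : set V := [set z : V | rconn nn (lball 0 N `\` B) u1 z].
pose H : set V := [set z : V | rconn st (lball 0 N `\` X) u2 z].
have Xc u u' : X u -> X u' -> rconn nn X u u'.
  move=> Hu Hu'; apply: (@rconn_trans _ _ _ _ u1).
    apply: rconn_sym; first exact: nn_sym.
    exact: (rconn_self Hu).
  exact: (rconn_self Hu').
have Hst u u' : H u -> H u' -> rconn st H u u'.
  move=> Hu Hu'; apply: (@rconn_trans _ _ _ _ u2).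
    apply: rconn_sym; first exact: star_sym.
    exact: (rconn_self Hu).
  exact: (rconn_self Hu').
have XB : X `<=` lball 0 N by move=> z /rconn_r [].
have HB : H `<=` lball 0 N by move=> z /rconn_r [].
have dis z : X z -> H z -> False by move=> ? /rconn_r [].
have clo h z : H h -> lball 0 N z -> star h z -> H z \/ X z.
  move=> Hh Bz shz; have [?|nX] := pselect (X z); [by right|left].
  exact: (rconn_rcons Hh shz).
have DB : inner_bdry X H `<=` B `&` lball 0 N.+1.
  move=> h [Hh [u Xu nu]]; have [Bh nX] := rconn_r Hh; split; last first.
    by move: Bh; rewrite /lball /=; lia.
  apply: contrapT => nB; apply: nX; exact: (rconn_rcons Xu).
have comp2 z : rconn nn (lball 0 N `\` B) u2 z -> H z.
  move=> c; have nX z' : rconn nn (lball 0 N `\` B) u2 z' -> ~ X z'.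
    move=> c' Xz; apply: nc; apply: (rconn_trans Xz).
    by apply: rconn_sym => //; exact: nn_sym.
  apply: (vconn_inv (A := H) c).
    apply: rconn_refl; split; first by have [] := rconn_l c2.
    by apply: nX; apply: rconn_refl; exact: (rconn_l c).
  move=> u v [Bu nBu] [Bv nBv] nuv Hu.
  have [//|Xv] := clo _ _ Hu Bv (nn_star nuv).
  exfalso; apply: (dis u) => //; apply: (rconn_rcons Xv); first by rewrite nn_sym.
  by split.
(* Both clusters meet the connected sphere of radius j; along the sphere from one to the other the
   last point before leaving H is a boundary point. *)
have lev j : (n <= j <= N)%N -> exists2 h : V, inner_bdry X H h & nrm h = j.
  move=> hj.
  have [z1 nz1 cz1] : exists2 z : V, nrm z = j & rconn nn (lball 0 N `\` B) u1 z.
    by apply: (norm_ivt c1); rewrite n1; lia.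
  have [z2 nz2 cz2] : exists2 z : V, nrm z = j & rconn nn (lball 0 N `\` B) u2 z.
    by apply: (norm_ivt c2); rewrite n2; lia.
  have nH1 : ~ H z1 by move=> h; exact: (dis z1).
  have [u [v [cu nuv Zv nHv _]]] :=
    vconn_exit (A := H) (sphere_conn nz2 nz1) (comp2 _ cz2) nH1.
  have [/= nu Hu] := rconn_r cu; exists u => //; split=> //.
  exists v; last by rewrite nn_sym.
  have Bv : lball 0 N v by rewrite /lball /= Zv; lia.
  by have [//|] := clo _ _ Hu Bv (nn_star nuv).
have [h3 D3 n3] : exists2 h : V, inner_bdry X H h & nrm h = n by apply: lev; lia.
have [h4 D4 n4] : exists2 h : V, inner_bdry X H h & nrm h = N by apply: lev; lia.
have := inner_bdry_class Xc Hst XB HB dis clo D3 D4.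
rewrite /bdry_class /= => /(rconn_sub DB) /NB lt.
by have := linf_triangle h3 0 h4; lia.
Qed.

End Inner.
End Holes.

(** * A strictly superharmonic potential and weighted sums over walks *)

Section Potential.
Variables (R : realType) (d : nat).
Local Notation V := 'rV[int]_d.
Implicit Types (x y z : V) (u : V -> R).

Definition nbrs x : seq V :=
  [seq upd x i (x ord0 i + 1) | i <- enum 'I_d] ++
  [seq upd x i (x ord0 i - 1) | i <- enum 'I_d].

Lemma nbrsP x y : nearest_neighbor x y -> y \in nbrs x.
Proof.
move/nnP => [i [hi hj]]; rewrite mem_cat.
have e a : y ord0 i = a -> y = upd x i a.
  by move=> ya; apply: linf_eq => j; rewrite updE; case: eqP => [->//|/eqP /hj].
have [e1|e1] : y ord0 i = x ord0 i + 1 \/ y ord0 i = x ord0 i - 1 by lia.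
  apply/orP; left; rewrite (e _ e1); apply: (map_f (fun i => upd x i (x ord0 i + 1))).
  by rewrite mem_enum.
apply/orP; right; rewrite (e _ e1); apply: (map_f (fun i => upd x i (x ord0 i - 1))).
by rewrite mem_enum.
Qed.

Definition avg u x : R := (2 * d%:R)^-1 * \sum_(y <- nbrs x) u y.

Lemma avgE u x : avg u x = (2 * d%:R)^-1 *
  \sum_(i < d) (u (upd x i (x ord0 i + 1)) + u (upd x i (x ord0 i - 1))).
Proof. by rewrite /avg big_cat /= !big_map -!big_enum big_split. Qed.

Lemma invd_ge0 : 0 <= (2 * d%:R : R)^-1.
Proof. by rewrite invr_ge0 mulr_ge0. Qed.

Lemma le_avg u v x : (forall y, u y <= v y) -> avg u x <= avg v x.
Proof. by move=> h; rewrite ler_wpM2l ?invd_ge0 // ler_sum. Qed.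

Lemma avgD u v x : avg (fun y => u y + v y) x = avg u x + avg v x.
Proof. by rewrite /avg big_split mulrDr. Qed.

Lemma avgZ c u x : avg (fun y => c * u y) x = c * avg u x.
Proof. by rewrite /avg -mulr_sumr mulrCA. Qed.

Lemma avg_sum (I : Type) (r : seq I) (P : pred I) (F : I -> V -> R) x :
  avg (fun y => \sum_(i <- r | P i) F i y) x = \sum_(i <- r | P i) avg (F i) x.
Proof. by rewrite /avg exchange_big mulr_sumr. Qed.

Lemma avg_shift u z x : avg (fun y => u (y - z)) x = avg u (x - z).
Proof.
rewrite !avgE; congr (_ * _); apply: eq_bigr => i _.
by congr (u _ + u _); apply: linf_eq => j; rewrite !(updE, mxE); case: eqP => // ->; ring.
Qed.

Section WalkSum.
Variables (St : Type) (nx : St -> V -> St) (wt : St -> V -> V -> R).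
Variables (e w : St -> V -> R).
Hypothesis wt0 : forall s x y, 0 <= wt s x y.
Hypothesis e0 : forall s x, 0 <= e s x.
Hypothesis w0 : forall s x, 0 <= w s x.
Hypothesis super : forall s x,
  e s x + avg (fun y => wt s x y * w (nx s y) y) x <= w s x.

Fixpoint weight (s : St) x (p : seq V) : R :=
  if p is y :: q then (2 * d%:R)^-1 * (wt s x y * weight (nx s y) y q) else e s x.

Lemma weight_ge0 s x p : 0 <= weight s x p.
Proof.
elim: p s x => [|y q IH] s x /=; first exact: e0.
by rewrite mulr_ge0 ?invd_ge0 // mulr_ge0.
Qed.

(** A supermartingale bound: split the walks by their first step and induct on the maximal length.
    The state s is a memory of the walk, so costs may depend on the past. Any w satisfying [super]
    then dominates the total weight of any finite set of walks. *)
Lemma walk_sum s x (X : seq (seq V)) : uniq X ->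
  (forall p, p \in X -> path (@nearest_neighbor d) x p) ->
  \sum_(p <- X) weight s x p <= w s x.
Proof.
have [N] : exists N, forall p, p \in X -> (size p <= N)%N.
  by exists (\max_(p <- X) size p)%N => p pX; exact: leq_bigmax_seq.
elim: N s x X => [|N IH] s x X hN uX pX.
  have X0 p : p \in X -> p = [::] by move/hN; rewrite leqn0 size_eq0 => /eqP.
  apply: le_trans (super s x); rewrite -[leLHS]addr0; apply: lerD; last first.
    by rewrite /avg mulr_ge0 ?invd_ge0 // sumr_ge0 // => y _; rewrite mulr_ge0.
  case: X uX X0 {hN pX} => [|p [|q X]] uX X0; first by rewrite big_nil.
    by rewrite big_seq1 (X0 p) ?mem_head.
  move: uX; rewrite (X0 p) ?mem_head // (X0 q) ?inE ?eqxx ?orbT //.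
apply: le_trans (super s x).
rewrite (bigID (fun p => p == [::])) /=; apply: lerD.
  rewrite -big_filter.
  have : uniq [seq p <- X | p == [::]] by rewrite filter_uniq.
  have : {in [seq p <- X | p == [::]], forall p, p = [::]}.
    by move=> p; rewrite mem_filter => /andP[/eqP].
  case: [seq _ <- _ | _] => [|p [|q Y]] h uY; first by rewrite big_nil.
    by rewrite big_seq1 (h p) ?mem_head.
  by move: uY; rewrite (h p) ?mem_head // (h q) ?inE ?eqxx ?orbT.
pose Xy y := [seq behead p | p <- X & ohead p == Some y].
have XyP y q : q \in Xy y -> y :: q \in X.
  case/mapP => -[|a p]; rewrite mem_filter //= => /andP[/eqP [->] h] -> //.
have uXy y : uniq (Xy y).
  rewrite map_inj_in_uniq ?filter_uniq // => -[|a p] [|b q];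
  rewrite !mem_filter //= => /andP[/eqP[->] _] /andP[/eqP[->] _] -> //.
have -> : avg (fun y => wt s x y * w (nx s y) y) x =
   \sum_(y <- nbrs x) (2 * d%:R)^-1 * (wt s x y * w (nx s y) y).
  by rewrite /avg mulr_sumr.
apply: (@le_trans _ _ (\sum_(y <- nbrs x) \sum_(p <- X | ohead p == Some y) weight s x p)).
  rewrite (exchange_big_dep xpredT) //= big_mkcond big_seq [leRHS]big_seq ler_sum // => p pinX.
  case: p pinX => [|y q] pinX /=; first by rewrite sumr_ge0 // => *; apply: (weight_ge0 _ _ [::]).
  rewrite (big_rem y) /=; last by have /andP[/nbrsP] := pX _ pinX.
  by rewrite eqxx lerDl sumr_ge0 // => *; exact: (weight_ge0 _ _ (y :: q)).
rewrite ler_sum // => y _.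
have -> : \sum_(p <- X | ohead p == Some y) weight s x p =
    \sum_(q <- Xy y) (2 * d%:R)^-1 * (wt s x y * weight (nx s y) y q).
  rewrite big_map big_filter; apply: eq_bigr => -[|a q] //= /eqP[->].
  by [].
rewrite -mulr_sumr -mulr_sumr ler_wpM2l ?invd_ge0 // ler_wpM2l //.
apply: IH => // q /XyP h; first by have := hN _ h.
by have /andP[] := pX _ h.
Qed.

End WalkSum.

(** The Taylor polynomial of (1+T)^(-1/2) with its fourth order coefficient enlarged to 1. The bound
    reduces to q^2 (1+T) >= 1, whose excess is T^4 times a positive factor. *)
Lemma invsqrt_poly (S T : R) : 0 < S -> -(1/2) <= T -> T <= 1/2 ->
  (Num.sqrt (S * (1 + T)))^-1 <=
  (Num.sqrt S)^-1 * (1 - T / 2 + 3/8 * T ^+ 2 - 5/16 * T ^+ 3 + T ^+ 4).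
Proof.
move=> S0 T1 T2.
set q := (1 - T / 2 + 3/8 * T ^+ 2 - 5/16 * T ^+ 3 + T ^+ 4).
rewrite (sqrtrM _ (ltW S0)) invfM; apply: ler_wpM2l; first by rewrite invr_ge0 sqrtr_ge0.
have q0 : 0 < q by rewrite /q; nra.
have hT : 0 < 1 + T by lra.
have w0 : 0 < Num.sqrt (1 + T) by rewrite sqrtr_gt0.
have w2 : Num.sqrt (1 + T) ^+ 2 = 1 + T by rewrite sqr_sqrtr // ltW.
suff h : 1 <= q * Num.sqrt (1 + T).
  by rewrite -[leLHS]mul1r ler_pdivrMr.
have h2 : 1 <= (q * Num.sqrt (1 + T)) ^+ 2.
  rewrite exprMn w2.
  have -> : q ^+ 2 * (1 + T) = 1 + (T ^+ 2) ^+ 2 * (93/64 + 39/32 * T - 99/256 * T ^+ 2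
     + 57/256 * T ^+ 3 + 3/8 * T ^+ 4 + T ^+ 5) by rewrite /q; field.
  rewrite lerDl mulr_ge0 ?sqr_ge0 //.
  have a1 : T ^+ 2 <= 1/4 by nra.
  have a0 : 0 <= T ^+ 2 by rewrite sqr_ge0.
  have a3 : -(1/4) <= T ^+ 3 by rewrite exprS; nra.
  have a4 : 0 <= T ^+ 4 by rewrite -[4%N]/(2 * 2)%N exprM sqr_ge0.
  have a5 : -(1/4) <= T ^+ 5.
    have -> : T ^+ 5 = T ^+ 2 * T ^+ 3 by ring.
    nra.
  lra.
by rewrite -(@ler_pXn2r _ 2) ?nnegrE ?expr1n // mulr_ge0 // ltW.
Qed.

Lemma invsqrt_pair (S y : R) : 100 + y ^+ 2 <= S ->
  (Num.sqrt (S + 2 * y + 1))^-1 + (Num.sqrt (S - 2 * y + 1))^-1 <=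
  (Num.sqrt S)^-1 * (2 - S^-1 + (3 * y ^+ 2 + 3/4) * S^-1 ^+ 2
     + (32 * y ^+ 2 + 49) * S^-1 ^+ 3).
Proof.
move=> hS; have S0 : 0 < S by nra.
pose v := S^-1.
have v0 : 0 < v by rewrite invr_gt0.
have Sv : S * v = 1 by rewrite /v divff // gt_eqF.
have vl : v <= 1/100 by nra.
have yv : y ^+ 2 * v <= 1 by nra.
have e1 : S + 2 * y + 1 = S * (1 + (1 + 2 * y) * v).
  by rewrite mulrDr mulr1 mulrCA Sv; ring.
have e2 : S - 2 * y + 1 = S * (1 + (1 - 2 * y) * v).
  by rewrite mulrDr mulr1 mulrCA Sv; ring.
rewrite e1 e2 -/v.
have b1 : `|y| * v <= 1/5.
  have := normr_ge0 y; have : `|y| ^+ 2 = y ^+ 2 by rewrite real_normK ?num_real.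
  nra.
have [b2 b3] : - (1/5) <= y * v /\ y * v <= 1/5.
  by move: b1; rewrite -{1}(gtr0_norm v0) -normrM ler_norml => /andP[].
apply: le_trans (lerD (invsqrt_poly S0 _ _) (invsqrt_poly S0 _ _)) _; try lra.
rewrite -mulrDr ler_wpM2l ?invr_ge0 ?sqrtr_ge0 //.
have c1 : 0 <= (y ^+ 2 * v ^+ 3) * (1 - y ^+ 2 * v).
  by rewrite mulr_ge0 ?subr_ge0 // mulr_ge0 ?sqr_ge0 // exprn_ge0 // ltW.
have c2 : 0 <= v ^+ 3 * (1 - y ^+ 2 * v).
  by rewrite mulr_ge0 ?subr_ge0 // exprn_ge0 // ltW.
have c3 : 0 <= v ^+ 3 * (1/100 - v).
  by rewrite mulr_ge0 ?subr_ge0 // exprn_ge0 // ltW.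
have c4 : 0 <= y ^+ 2 * v ^+ 3 by rewrite mulr_ge0 ?sqr_ge0 // exprn_ge0 // ltW.
have c5 : 0 <= v ^+ 3 by rewrite exprn_ge0 // ltW.
rewrite -subr_ge0.
have -> : 2 - v + (3 * y ^+ 2 + 3 / 4) * v ^+ 2 + (32 * y ^+ 2 + 49) * v ^+ 3 -
  (1 - (1 + 2 * y) * v / 2 + 3 / 8 * ((1 + 2 * y) * v) ^+ 2 -
   5 / 16 * ((1 + 2 * y) * v) ^+ 3 + ((1 + 2 * y) * v) ^+ 4 +
   (1 - (1 - 2 * y) * v / 2 + 3 / 8 * ((1 - 2 * y) * v) ^+ 2 -
    5 / 16 * ((1 - 2 * y) * v) ^+ 3 + ((1 - 2 * y) * v) ^+ 4)) =
  32 * ((y ^+ 2 * v ^+ 3) * (1 - y ^+ 2 * v)) + 48 * (v ^+ 3 * (1 - y ^+ 2 * v))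
   + 2 * (v ^+ 3 * (1/100 - v)) + (1 - 2/100) * v ^+ 3 + 15/2 * (y ^+ 2 * v ^+ 3)
   + 5/8 * v ^+ 3.
  by field.
lra.
Qed.

(** The inverse square root of this is the Plummer potential, a smoothed 1/|x|. The softening d +
    100 is large enough to absorb the discretisation errors. *)
Definition plum_sq x : R := (d + 100)%:R + \sum_(i < d) (x ord0 i)%:~R ^+ 2.
Definition plum x : R := (Num.sqrt (plum_sq x))^-1.

Lemma intr_sqr (a : int) : a%:~R ^+ 2 = (`|a|%N)%:R ^+ 2 :> R.
Proof. by case: a => n; rewrite ?NegzE ?mulrNz ?sqrrN. Qed.

Lemma plum_sq_ge x i : 100 + (x ord0 i)%:~R ^+ 2 <= plum_sq x.
Proof.
rewrite /plum_sq natrD (bigD1 i) //= addrA; apply: ler_wpDr.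
  by rewrite sumr_ge0 // => j _; rewrite sqr_ge0.
by rewrite lerD2r lerDr.
Qed.

Lemma plum_sq_ge100 x : 100 <= plum_sq x.
Proof.
rewrite /plum_sq natrD -addrA; apply: ler_wpDl => //.
by apply: ler_wpDr => //; rewrite sumr_ge0 // => j _; rewrite sqr_ge0.
Qed.

Lemma plum_sq_gt0 x : 0 < plum_sq x.
Proof. by apply: lt_le_trans (plum_sq_ge100 x); rewrite ltr0n. Qed.

Lemma plum_gt0 x : 0 < plum x.
Proof. by rewrite invr_gt0 sqrtr_gt0 plum_sq_gt0. Qed.

Lemma plum_le_inv x (r : R) : 0 < r -> r ^+ 2 <= plum_sq x -> plum x <= r^-1.
Proof.
move=> r0 h; rewrite /plum lef_pV2 ?posrE ?sqrtr_gt0 ?plum_sq_gt0 //.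
by rewrite -(ger0_norm (ltW r0)) -sqrtr_sqr ler_wsqrtr.
Qed.

Lemma plum_le1 x : plum x <= 1.
Proof.
rewrite -[1]invr1; apply: plum_le_inv => //.
by apply: le_trans (plum_sq_ge100 x); rewrite expr1n ler1n.
Qed.

Lemma plum_up x (r : nat) : (0 < r)%N -> (r <= linf_dist 0 x)%N -> plum x <= r%:R^-1.
Proof.
case: r => // r _ /linf_gt [i]; rewrite mxE => hi; apply: plum_le_inv => //.
apply: le_trans (plum_sq_ge x i); apply: ler_wpDl => //.
rewrite intr_sqr.
by rewrite ler_pXn2r ?nnegrE // ler_nat; lia.
Qed.

Lemma plum_lo x (r : nat) : (linf_dist 0 x <= r)%N -> ((d + 100) * r.+1)%:R^-1 <= plum x.
Proof.
move=> h; rewrite /plum lef_pV2 ?posrE ?sqrtr_gt0 ?plum_sq_gt0 ?ltr0n ?muln_gt0 ?addn_gt0 ?orbT //.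
rewrite -(ger0_norm (_ : 0 <= ((d + 100) * r.+1)%:R)) // -sqrtr_sqr ler_wsqrtr //.
have hx i : (x ord0 i)%:~R ^+ 2 <= (r ^ 2)%:R :> R.
  rewrite intr_sqr.
  rewrite natrX ler_pXn2r ?nnegrE // ler_nat.
  by move/linfP: h => /(_ i); rewrite mxE; lia.
rewrite /plum_sq; apply: (@le_trans _ _ ((d + 100)%:R + \sum_(i < d) (r ^ 2)%:R)).
  by rewrite lerD2l ler_sum.
rewrite sumr_const card_ord -mulrnA -natrD -natrX ler_nat; nia.
Qed.

Hypothesis hd : (3 <= d)%N.

(** In R^3 the Laplacian of the Plummer potential is a negative multiple of its fifth power. On the
    lattice, with v the inverse of [plum_sq], the first order terms sum to (3 - d)v <= 0, and the
    softening leaves -3(d + 100)v^2, which beats the remainder. The strict defect plum^5 pays for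
    visits in the loop estimates. *)
Lemma plum_super x : avg plum x <= plum x - plum x ^+ 5.
Proof.
have S0 := plum_sq_gt0 x; set S := plum_sq x in S0.
pose v := S^-1; have v0 : 0 < v by rewrite invr_gt0.
have Sv : S * v = 1 by rewrite /v divff // gt_eqF.
have d0 : 0 < d%:R :> R by rewrite ltr0n; lia.
have d3 : 3 <= d%:R :> R by rewrite ler_nat.
have upS i a : plum_sq (upd x i a) = S - (x ord0 i)%:~R ^+ 2 + a%:~R ^+ 2.
  rewrite /S /plum_sq (bigD1 i) //= [in RHS](bigD1 i) //= updE eqxx.
  rewrite (eq_bigr (fun j : 'I_d => (x ord0 j)%:~R ^+ 2)); first by ring.
  by move=> j /negPf ji; rewrite updE ji.
rewrite avgE.
have pair (i : 'I_d) : plum (upd x i (x ord0 i + 1)) + plum (upd x i (x ord0 i - 1)) <=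
    plum x * (2 - v + (3 * (x ord0 i)%:~R ^+ 2 + 3/4) * v ^+ 2
     + (32 * (x ord0 i)%:~R ^+ 2 + 49) * v ^+ 3).
  apply: le_trans (invsqrt_pair (plum_sq_ge x i)); rewrite /plum !upS !intrD.
  apply: lerD; rewrite le_eqVlt; apply/orP; left; apply/eqP; congr (Num.sqrt _)^-1.
    by rewrite -/S; ring.
  by rewrite -/S mulrN1z; ring.
pose Q := \sum_(i < d) (x ord0 i)%:~R ^+ 2 : R.
have QS : S = (d + 100)%:R + Q by [].
have Q0 : 0 <= Q by rewrite sumr_ge0 // => i _; rewrite sqr_ge0.
have sumE : \sum_(i < d) (2 - v + (3 * (x ord0 i)%:~R ^+ 2 + 3/4) * v ^+ 2
     + (32 * (x ord0 i)%:~R ^+ 2 + 49) * v ^+ 3) =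
   2 * d%:R - d%:R * v + (3 * Q + 3/4 * d%:R) * v ^+ 2 + (32 * Q + 49 * d%:R) * v ^+ 3.
  rewrite (eq_bigr (fun i : 'I_d => (2 - v + 3/4 * v ^+ 2 + 49 * v ^+ 3) +
     (3 * v ^+ 2 + 32 * v ^+ 3) * (x ord0 i)%:~R ^+ 2)); last by move=> i _; ring.
  by rewrite big_split /= sumr_const card_ord -mulr_sumr -/Q -mulr_natr; ring.
have main : \sum_(i < d) (2 - v + (3 * (x ord0 i)%:~R ^+ 2 + 3/4) * v ^+ 2
     + (32 * (x ord0 i)%:~R ^+ 2 + 49) * v ^+ 3) <= 2 * d%:R * (1 - v ^+ 2).
  rewrite sumE.
  have Qv : Q * v = 1 - (d%:R + 100) * v by move: Sv; rewrite QS natrD; lra.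
  have dv : d%:R * v <= 1.
    by have := mulr_ge0 Q0 (ltW v0); lra.
  have vv : 0 <= v ^+ 2 by rewrite sqr_ge0.
  have e1 : Q * v ^+ 2 = v - (d%:R + 100) * v ^+ 2.
    have -> : Q * v ^+ 2 = (Q * v) * v by ring.
    by rewrite Qv; ring.
  have e2 : Q * v ^+ 3 <= v ^+ 2.
    have -> : Q * v ^+ 3 = v ^+ 2 - (d%:R + 100) * v * v ^+ 2.
      have -> : Q * v ^+ 3 = (Q * v) * v ^+ 2 by ring.
      by rewrite Qv; ring.
    by rewrite gerBl mulr_ge0 // mulr_ge0 ?(ltW v0) // addr_ge0 // ltW.
  have e3 : d%:R * v ^+ 3 <= v ^+ 2.
    have -> : d%:R * v ^+ 3 = d%:R * v * v ^+ 2 by ring.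
    by rewrite -[leRHS]mul1r ler_wpM2r.
  have e4 : 3 * v <= d%:R * v by rewrite ler_wpM2r // ltW.
  have e5 : 0 <= d%:R * v ^+ 2 by rewrite mulr_ge0 // ltW.
  have -> : 2 * d%:R - d%:R * v + (3 * Q + 3/4 * d%:R) * v ^+ 2 +
     (32 * Q + 49 * d%:R) * v ^+ 3 = 2 * d%:R - d%:R * v + 3 * (Q * v ^+ 2)
     + 3/4 * (d%:R * v ^+ 2) + 32 * (Q * v ^+ 3) + 49 * (d%:R * v ^+ 3) by ring.
  rewrite e1; lra.
have g2 : plum x ^+ 2 = v by rewrite /plum exprVn sqr_sqrtr ?ltW.
have -> : plum x - plum x ^+ 5 = (2 * d%:R)^-1 * (plum x * (2 * d%:R * (1 - v ^+ 2))).
  rewrite -g2; have dn : d%:R != 0 :> R by rewrite gt_eqF.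
  by field.
rewrite ler_wpM2l ?invd_ge0 //; apply: le_trans (ler_sum _ (fun i _ => pair i)) _.
by rewrite -mulr_sumr ler_wpM2l // ltW // plum_gt0.
Qed.

End Potential.

(** * Mecke's formula for a finite family of independent Poisson counts *)

Section EsumScale.
Variables (R : realType) (T : choiceType).
Local Open Scope ereal_scope.

Lemma esumZ_le (S : set T) (k : R) (a : T -> R) : (0 <= k)%R -> (forall t, 0 <= a t)%R ->
  (\esum_(t in S) (k * a t)%:E <= k%:E * (\esum_(t in S) (a t)%:E))%E.
Proof.
move=> k0 a0; apply: ge_ereal_sup => _ [X [fX XS] <-].
have -> : \sum_(t \in X) (k * a t)%:E = k%:E * \sum_(t \in X) (a t)%:E.
  by rewrite ge0_mule_fsumr // => t; rewrite lee_fin.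
by rewrite lee_wpmul2l ?lee_fin //; apply: ereal_sup_ubound; exists X.
Qed.

Lemma esumZ_ge (S : set T) (k : R) (a : T -> R) : (0 <= k)%R -> (forall t, 0 <= a t)%R ->
  (k%:E * (\esum_(t in S) (a t)%:E) <= \esum_(t in S) (k * a t)%:E)%E.
Proof.
move=> k0 a0; move: k0; rewrite le_eqVlt => /orP[/eqP <-|k0].
  by rewrite mul0e esum_ge0 // => t _; rewrite mul0r.
have -> : \esum_(t in S) (a t)%:E = \esum_(t in S) (k^-1 * (k * a t))%:E.
  by apply: eq_esum => t _; rewrite mulrA mulVf ?mul1r // gt_eqF.
have h := @esumZ_le S k^-1 (fun t => k * a t)%R.
apply: (@le_trans _ _ (k%:E * (k^-1%:E * \esum_(t in S) (k * a t)%:E))).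
  rewrite lee_wpmul2l ?lee_fin ?(ltW k0) //; apply: h => [|t].
    by rewrite invr_ge0 ltW.
  by rewrite mulr_ge0 // ltW.
by rewrite muleA -EFinM divff ?gt_eqF // mul1e.
Qed.

End EsumScale.

Section PoissonFamily.
Context {R : realType} {disp : measure_display} {Omega : measurableType disp}.
Variable P : probability Omega R.
Variables (T : countType) (N : Omega -> T -> nat) (lam : T -> R) (fam : seq T).
Hypothesis mN : forall t k, measurable [set w | N w t = k].
Hypothesis lam0 : forall t, 0 <= lam t.
Hypothesis uf : uniq fam.
Local Notation n := (size fam).
Local Notation ti := (tnth (in_tuple fam)).
Local Notation cT := {ffun 'I_n -> nat}.

Definition pois (l : R) (k : nat) : R := l ^+ k / k`!%:R * expR (- l).

Hypothesis law : forall c : cT,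
  P [set w | forall i, N w (ti i) = c i] = (\prod_(i < n) pois (lam (ti i)) (c i))%:E.

(** Events are always evaluated on the restriction to the finite family, which takes countably many
    values; probabilities become sums over count vectors. *)
Definition restr (nu : T -> nat) : T -> nat := fun t => if t \in fam then nu t else 0%N.
Definition addl (nu : T -> nat) t : T -> nat := fun s => (nu s + (s == t))%N.
Definition subl (nu : T -> nat) t : T -> nat := fun s => (nu s - (s == t))%N.

Definition cf (c : cT) : T -> nat := fun t => (\sum_(i < n | ti i == t) c i)%N.
Definition cX w : cT := [ffun i => N w (ti i)].
Definition cadd (c : cT) (i : 'I_n) : cT := [ffun j => (c j + (j == i))%N].
Definition csub (c : cT) (i : 'I_n) : cT := [ffun j => (c j - (j == i))%N].
Definition pc (c : cT) : R := \prod_(i < n) pois (lam (ti i)) (c i).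

Lemma ti_inj : injective ti.
Proof. by apply/tuple_uniqP. Qed.

Lemma ti_mem i : ti i \in fam. Proof. exact: mem_tnth. Qed.

Lemma tiP t : t \in fam -> exists i, ti i = t.
Proof.
move=> tf; have h : (index t fam < n)%N by rewrite index_mem.
by exists (Ordinal h); rewrite (tnth_nth t) /= nth_index.
Qed.

Lemma cf_ti c i : cf c (ti i) = c i.
Proof. by rewrite /cf (big_pred1 i) // => j; rewrite (inj_eq ti_inj). Qed.

Lemma cf_out c t : t \notin fam -> cf c t = 0%N.
Proof.
move=> tf; rewrite /cf big1 // => i /eqP e.
by move: tf; rewrite -e ti_mem.
Qed.

Lemma restrE w : restr (N w) = cf (cX w).
Proof.
apply/funext => t; rewrite /restr; case: ifP => tf; last by rewrite cf_out ?tf.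
by have [i <-] := tiP tf; rewrite cf_ti ffunE.
Qed.

Lemma cf_add c i : addl (cf c) (ti i) = cf (cadd c i).
Proof.
apply/funext => t; rewrite /addl; have [tf|tf] := boolP (t \in fam); last first.
  by rewrite !cf_out // (_ : t == ti i = false) //; apply: contraNF tf => /eqP ->; exact: ti_mem.
by have [j <-] := tiP tf; rewrite !cf_ti ffunE (inj_eq ti_inj).
Qed.

Lemma cf_sub c i : subl (cf c) (ti i) = cf (csub c i).
Proof.
apply/funext => t; rewrite /subl; have [tf|tf] := boolP (t \in fam); last first.
  by rewrite !cf_out // (_ : t == ti i = false) //; apply: contraNF tf => /eqP ->; exact: ti_mem.
by have [j <-] := tiP tf; rewrite !cf_ti ffunE (inj_eq ti_inj).
Qed.

Lemma cadd_inj (i : 'I_n) : injective (cadd ^~ i).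
Proof.
move=> c c' /ffunP h; apply/ffunP => j; have := h j; rewrite !ffunE.
exact: addIn.
Qed.

Lemma csubK (c : cT) i : (0 < c i)%N -> cadd (csub c i) i = c.
Proof.
move=> ci; apply/ffunP => j; rewrite !ffunE.
by case: (eqVneq j i) => [->|_]; rewrite ?subnK // subn0 addn0.
Qed.

Lemma pois_ge0 l k : 0 <= l -> 0 <= pois l k.
Proof. by move=> l0; rewrite /pois mulr_ge0 ?expR_ge0 // divr_ge0 // exprn_ge0. Qed.

Lemma pc_ge0 c : 0 <= pc c.
Proof. by apply: prodr_ge0 => i _; apply: pois_ge0. Qed.

(** The Poisson identity behind Mecke's formula: adding one point of type i trades its intensity for
    its new multiplicity. *)
Lemma pc_cadd c i : lam (ti i) * pc c = (c i).+1%:R * pc (cadd c i).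
Proof.
rewrite /pc (bigD1 i) //= [in RHS](bigD1 i) //= !mulrA; congr (_ * _); last first.
  by apply: eq_bigr => j /negPf ji; rewrite ffunE ji addn0.
rewrite ffunE eqxx addn1 /pois exprS factS natrM.
have h1 : (c i).+1%:R != 0 :> R by rewrite pnatr_eq0.
have h2 : (c i)`!%:R != 0 :> R by rewrite pnatr_eq0 -lt0n fact_gt0.
by move: h1; rewrite -natr1 addrC => h1; field; rewrite h2 h1.
Qed.

Lemma meas_cX (S : set cT) : measurable [set w | S (cX w)].
Proof.
have -> : [set w | S (cX w)] = \bigcup_(c in S) \bigcap_(i in [set: 'I_n]) [set w | N w (ti i) = c i].
  apply/seteqP; split=> w /=.
    by move=> Sw; exists (cX w) => //; move=> i _ /=; rewrite ffunE.
  case=> c Sc h.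
  by have -> : cX w = c by apply/ffunP => i; rewrite ffunE; exact: h.
rewrite bigcup_mkcond; apply: (@countable_bigcupT_measurable) => // c.
case: ifP => _ //; apply: fin_bigcap_measurable => // i _; exact: mN.
Qed.

Lemma P_cX (S : set cT) :
  P [set w | S (cX w)] = (\esum_(c in S) (pc c)%:E)%E.
Proof.
have -> : [set w | S (cX w)] =
    \bigcup_(k in pickle @` S) [set w | pickle (cX w) = k].
  apply/seteqP; split=> w /=; first by move=> Sw; exists (pickle (cX w)) => //; exists (cX w).
  by move=> [_ [c Sc <-]] /= /(pcan_inj pickleK) ->.
rewrite measure_bigcup; last 2 first.
- by move=> k _; exact: (meas_cX [set c | pickle c = k]).
- by move=> i j _ _ [w [/= <- <-]].
rewrite nneseries_esum //.
have -> : [set k | k \in pickle @` S] = pickle @` S by apply/seteqP; split=> k /=; rewrite inE.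
rewrite (@reindex_esum _ _ _ S _ pickle).
  apply: eq_esum => c _; rewrite -law; congr (P _).
  apply/seteqP; split=> w /=.
    by move=> /(pcan_inj pickleK) <- i; rewrite ffunE.
  by move=> h; congr pickle; apply/ffunP => i; rewrite ffunE h.
split; [by move=> c Sc; exists c | | by []].
by move=> c c' _ _ /(pcan_inj pickleK).
Qed.

Definition Pr (E : set (T -> nat)) : R := fine (P [set w | E (restr (N w))]).

Lemma Pr_setE E : [set w | E (restr (N w))] = [set w | [set c | E (cf c)] (cX w)].
Proof. by apply/seteqP; split=> w /=; rewrite restrE. Qed.

Lemma Pr_meas E : measurable [set w | E (restr (N w))].
Proof. by rewrite Pr_setE; exact: meas_cX. Qed.

Lemma PrK E : (Pr E)%:E = P [set w | E (restr (N w))].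
Proof. by rewrite fineK // fin_num_measure //; exact: Pr_meas. Qed.

Lemma PrE E : (Pr E)%:E = (\esum_(c in [set c | E (cf c)]) (pc c)%:E)%E.
Proof. by rewrite PrK Pr_setE P_cX. Qed.

Lemma Pr_ge0 E : 0 <= Pr E.
Proof. by rewrite -lee_fin PrK. Qed.

Lemma Pr_le1 E : Pr E <= 1.
Proof. by rewrite -lee_fin PrK; apply: probability_le1; exact: Pr_meas. Qed.

Lemma Pr_le E E' : (forall w, E (restr (N w)) -> E' (restr (N w))) -> Pr E <= Pr E'.
Proof.
move=> h; rewrite -lee_fin !PrK; apply: le_measure; rewrite ?inE; try exact: Pr_meas.
by move=> w; exact: h.
Qed.

Lemma PrU E E' : Pr (E `|` E') <= Pr E + Pr E'.
Proof.
rewrite -lee_fin EFinD !PrK; apply: measureU2; exact: Pr_meas.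
Qed.

Lemma Pr_disj E E' : (forall nu, E nu -> E' nu -> False) -> Pr (E `|` E') = Pr E + Pr E'.
Proof.
move=> h; apply: EFin_inj; rewrite EFinD !PrK.
rewrite -(measureU P (Pr_meas E) (Pr_meas E')) //.
by apply/seteqP; split=> w //= [/h].
Qed.

Lemma Pr_bigU (I : eqType) (r : seq I) (E : I -> set (T -> nat)) :
  Pr [set nu | exists2 i, i \in r & E i nu] <= \sum_(i <- r) Pr (E i).
Proof.
elim: r => [|a r IH].
  rewrite big_nil (_ : [set _ | _] = set0); last by apply/seteqP; split=> nu //= [i].
  by rewrite /Pr (_ : [set _ | _] = set0) ?measure0 //; apply/seteqP; split.
rewrite big_cons; apply: le_trans (lerD (lexx _) IH).
apply: le_trans (PrU _ _); apply: Pr_le => w [i]; rewrite inE => /orP[/eqP ->|ir] Ei.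
  by left.
by right; exists i.
Qed.

Lemma Pr_sum_disj (I : eqType) (r : seq I) (E : I -> set (T -> nat)) (F : set (T -> nat)) :
  uniq r -> (forall i, i \in r -> E i `<=` F) ->
  (forall i j nu, i \in r -> j \in r -> E i nu -> E j nu -> i = j) ->
  \sum_(i <- r) Pr (E i) <= Pr F.
Proof.
elim: r F => [|a r IH] F; first by rewrite big_nil Pr_ge0.
move=> /= /andP[ar ur] EF dj; rewrite big_cons.
have h : \sum_(i <- r) Pr (E i) <= Pr (F `\` E a).
  apply: IH => // [i ir nu Ei|i j nu ir jr]; last first.
    by apply: dj; rewrite inE ?ir ?jr orbT.
  split; first by apply: (EF i) => //; rewrite inE ir orbT.
  move=> Ea; have ai : a = i by apply: (dj _ _ nu) => //; rewrite ?mem_head // inE ir orbT.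
  by move: ar; rewrite ai ir.
apply: le_trans (lerD (lexx _) h) _; rewrite -Pr_disj; last by move=> nu Ea [].
apply: Pr_le => w [Ea|[]//]; apply: (EF a) => //; exact: mem_head.
Qed.

(* Mecke's formula, as an upper bound: remove a witnessing point. *)
Lemma mecke_le (B : set (T -> nat)) (A : T -> set (T -> nat)) :
  (forall c, B (cf c) -> exists2 t, t \in fam & (0 < cf c t)%N /\ A t (subl (cf c) t)) ->
  Pr B <= \sum_(t <- fam) lam t * Pr (A t).
Proof.
move=> hB; pose Bi t := [set nu | [/\ B nu, (0 < nu t)%N & A t (subl nu t)]].
apply: (@le_trans _ _ (Pr [set nu | exists2 t, t \in fam & Bi t nu])).
  by apply: Pr_le => w; rewrite restrE => /[dup] Bw /hB [t tf [ct At]]; exists t.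
apply: le_trans (Pr_bigU _ _) _.
rewrite !big_seq ler_sum // => t /tiP [i <-].
rewrite -lee_fin EFinM !PrE.
apply: le_trans (esumZ_le _ (lam0 _) pc_ge0).
set S := [set c | Bi _ (cf c)]; set S' := [set c | A _ (cf c)].
have SP c : S c -> (0 < c i)%N /\ S' (csub c i).
  by case=> _; rewrite cf_ti => ci; rewrite cf_sub.
apply: (@le_trans _ _ (\esum_(c in S) (lam (ti i) * pc (csub c i))%:E)%E).
  apply: le_esum => c /SP [ci _]; rewrite lee_fin pc_cadd csubK //.
  rewrite -[leLHS]mul1r ler_wpM2r ?pc_ge0 // ler1n.
  by [].
rewrite -(@reindex_esum _ _ _ S ((csub ^~ i) @` S) (csub ^~ i) (fun c => (lam (ti i) * pc c)%:E)).
  have -> : (csub ^~ i) @` S = S' `&` ((csub ^~ i) @` S).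
    by apply/seteqP; split=> [_ [c Sc <-]|c []//]; split; [have [] := SP _ Sc|exists c].
  rewrite esum_mkcondr; apply: le_esum => c _; case: ifP => _ //.
  by rewrite lee_fin mulr_ge0 // pc_ge0.
split; [by move=> c Sc; exists c | | by []].
move=> c c' /set_mem /SP [ci _] /set_mem /SP [ci' _] e.
by rewrite -(csubK ci) e csubK.
Qed.

(* Mecke's formula, as a lower bound: add a point. *)
Lemma mecke_ge (B : set (T -> nat)) (A : T -> set (T -> nat)) (K : nat) :
  (forall c t, t \in fam -> A t (cf c) -> B (addl (cf c) t)) ->
  (forall c, B (cf c) ->
     (\sum_(t <- fam | `[< (0 < cf c t)%N /\ A t (subl (cf c) t) >]) cf c t <= K)%N) ->
  \sum_(t <- fam) lam t * Pr (A t) <= K%:R * Pr B.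
Proof.
move=> hA hB.
have tuE (F : T -> R) : \sum_(t <- fam) F t = \sum_(i < n) F (ti i).
  by rewrite -(big_tuple _ _ (in_tuple fam) xpredT F).
rewrite tuE -lee_fin -sumEFin EFinM.
set S := [set c | B (cf c)].
have step (i : 'I_n) : ((lam (ti i) * Pr (A (ti i)))%:E <=
    \esum_(c in S) (if `[< (0 < c i)%N /\ A (ti i) (cf (csub c i)) >] then (c i)%:R * pc c else 0)%:E)%E.
  rewrite EFinM PrE; apply: le_trans (esumZ_ge _ (lam0 _) pc_ge0) _.
  set S' := [set c | _].
  have -> : (\esum_(c in S') (lam (ti i) * pc c)%:E =
      \esum_(c in S') ((cadd c i i)%:R * pc (cadd c i))%:E)%E.
    by apply: eq_esum => c _; rewrite pc_cadd ffunE eqxx addn1.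
  rewrite -(@reindex_esum _ _ _ S' ((cadd ^~ i) @` S') (cadd ^~ i) (fun c => ((c i)%:R * pc c)%:E)).
    have -> : (cadd ^~ i) @` S' = S `&` ((cadd ^~ i) @` S').
      apply/seteqP; split=> [_ [c Sc <-]|c []//]; split; last by exists c.
      by rewrite /S /= -cf_add; apply: hA => //; exact: ti_mem.
    rewrite esum_mkcondr; apply: le_esum => c _; case: ifP => [|_].
      rewrite inE => -[c' Sc' <-]; rewrite lee_fin.
      rewrite (_ : `[< _ >]) //; apply/asboolP; split; first by rewrite ffunE eqxx addn1.
      suff -> : csub (cadd c' i) i = c' by [].
      by apply/ffunP => j; rewrite !ffunE addnK.
    by rewrite lee_fin; case: ifP => // _; rewrite mulr_ge0 // pc_ge0.
  split; [by move=> c Sc; exists c | | by []].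
  by move=> c c' _ _ /cadd_inj.
apply: le_trans (lee_sum _ (fun i _ => step i)) _.
rewrite -esum_sum; last first.
  by move=> c i _ _; rewrite lee_fin; case: ifP => // _; rewrite mulr_ge0 // pc_ge0.
rewrite PrE; apply: le_trans (esumZ_le _ (ler0n _ _) pc_ge0).
apply: le_esum => c Sc; rewrite sumEFin lee_fin -big_mkcond /= -mulr_suml.
rewrite ler_wpM2r ?pc_ge0 // -natr_sum ler_nat; apply: leq_trans (hB c Sc).
rewrite [leqRHS](big_tuple _ _ (in_tuple fam) (fun t => `[< (0 < cf c t)%N /\ A t (subl (cf c) t) >]) (cf c)).
rewrite (eq_bigl (fun i => `[< (0 < cf c (ti i))%N /\ A (ti i) (subl (cf c) (ti i)) >])).
  by rewrite leq_eqVlt; apply/orP; left; apply/eqP; apply: eq_bigr => i _; rewrite cf_ti.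
by move=> i; rewrite cf_ti cf_sub.
Qed.

End PoissonFamily.

(** * Loops, their multiplicities and their intensities *)

Section IterRot.
Variables (T : eqType) (a : pred (seq T)) (s : seq T).
Local Notation n := (size s).
Local Notation g i := (iter i (rot 1) s).

Lemma iter_rot i : (i <= n)%N -> g i = rot i s.
Proof.
elim: i => [|i IH] h; first by rewrite rot0.
by rewrite iterS IH 1?ltnW // -rotS.
Qed.

Definition nmarks : nat := count (fun k => a (rot k s)) (iota 0 n).
Definition nrots : nat := size (undup [seq rot k s | k <- iota 0 n]).

Lemma nrots_le : (nrots <= n)%N.
Proof. by rewrite /nrots (leq_trans (size_undup _)) // size_map size_iota. Qed.

(** The rotation by k together with the number of marks before k determines k: equal data at k < k'
    would give a period free of marks, hence no marks at all. The marks therefore bound how often a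
    loop can repeat itself. *)
Lemma nrots_marks : (0 < nmarks)%N -> (n <= nrots * nmarks.+1)%N.
Proof.
move=> mk0.
pose f k := (rot k s, count (fun k => a (rot k s)) (iota 0 k)).
have uf : uniq [seq f k | k <- iota 0 n].
  rewrite map_inj_in_uniq ?iota_uniq // => k k'; rewrite !mem_iota /= add0n.
  wlog : k k' / (k <= k')%N.
    by move=> W hk hk' e; case/orP: (leq_total k k') => h; [|symmetry]; apply: W.
  rewrite leq_eqVlt => /orP[/eqP //|kk'] hk hk' [er ec]; exfalso.
  have nm j : (k <= j < k')%N -> ~~ a (rot j s).
    move=> /andP[kj jk']; apply/negP => aj.
    have : (count (fun k => a (rot k s)) (iota 0 k) <
            count (fun k => a (rot k s)) (iota 0 k'))%N.
      rewrite -(subnKC (ltnW kk')) iotaD count_cat -[X in (X < _)%N]addn0 ltn_add2l -has_count.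
      by apply/hasP; exists j => //; rewrite mem_iota; lia.
    by rewrite ec ltnn.
  have per i : (k <= i)%N -> g (i + (k' - k)) = g i.
    move=> ki; have -> : (i + (k' - k) = (i - k) + k')%N by lia.
    rewrite iterD [g k']iter_rot 1?ltnW // -er -iter_rot 1?ltnW // -iterD.
    by congr (g _); lia.
  move: mk0; rewrite /nmarks -has_count => /hasP [m]; rewrite mem_iota add0n /= => hm am.
  have am' : a (g (m + n)).
    by rewrite iterD iter_rot // rot_size iter_rot // ltnW.
  have : exists i, (k <= i)%N /\ a (g i) by exists (m + n)%N; split=> //; lia.
  case=> i [ki ai].
  (* Shifting a marked index down by the period brings it into the mark-free window. *)
  have [j [kj aj]] : exists j, (k <= j < k')%N /\ a (g j).
    elim/ltn_ind: i ki ai => i IH ki ai.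
    have [ik'|k'i] := ltnP i k'; first by exists i; rewrite ki.
    apply: (IH (i - (k' - k))%N); [lia|lia|].
    by rewrite -per; [rewrite subnK //; lia|lia].
  have := nm _ kj; rewrite -iter_rot ?aj //; lia.
rewrite -(size_iota 0 n) -(size_map f).
rewrite -[X in (_ <= _ * X)%N](size_iota 0) -(size_allpairs pair).
apply: uniq_leq_size => // _ /mapP [k kn ->].
apply/allpairsP; exists (f k); rewrite -surjective_pairing mem_undup.
rewrite (map_f (fun k => rot k s)) //; split=> //.
rewrite mem_iota /= add0n ltnS /nmarks; move: kn; rewrite mem_iota /= add0n => kn.
by rewrite -(subnKC (ltnW kn)) iotaD count_cat leq_addr.
Qed.

End IterRot.

Section Loops.
Local Open Scope quotient_scope.
Variables (R : realType) (d : nat).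
Local Notation V := 'rV[int]_d.
Local Notation nn := (@nearest_neighbor d).
Implicit Types (t : loop d) (s : seq V).

Definition rep t : seq V := val (repr t).
Definition lsize t : nat := size (rep t).
Definition is_loop s := (s != [::]) && cycle nn s.

Lemma rep_ok t : is_loop (rep t). Proof. exact: (valP (repr t)). Qed.

Lemma lsize_gt0 t : (0 < lsize t)%N.
Proof. by have /andP[] := rep_ok t; rewrite /lsize; case: rep. Qed.

Lemma pi_loopP (b1 b2 : based_loop d) :
  \pi_(loop d) b1 = \pi_(loop d) b2 <-> exists k, val b2 = rot k (val b1).
Proof.
split; first by move/eqquotP/asboolP.
by move=> h; apply/eqquotP/asboolP.
Qed.

Lemma loop_eqP t t' : (exists k, rep t' = rot k (rep t)) -> t = t'.
Proof. by move=> h; rewrite -(reprK t) -(reprK t'); apply/pi_loopP. Qed.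

Definition loop_of s (h : is_loop s) : loop d := \pi_(loop d) (exist _ s h : based_loop d).

Lemma rep_loop_of s (h : is_loop s) : exists k, rep (loop_of h) = rot k s.
Proof. by apply/(pi_loopP (exist _ s h)); rewrite reprK. Qed.

Lemma is_loop_rot k s : is_loop s -> is_loop (rot k s).
Proof.
by move=> /andP[s0 cs]; rewrite /is_loop rot_cycle cs andbT -size_eq0 size_rot size_eq0.
Qed.

Lemma loop_ofP s (h : is_loop s) t : loop_of h = t <-> exists k, rep t = rot k s.
Proof.
split; first by move<-; exact: rep_loop_of.
by move=> e; rewrite -(reprK t); apply/pi_loopP.
Qed.

Lemma loop_verticesP t x : loop_vertices t x <-> x \in rep t.
Proof.
split.
  move=> [b bt xb]; have [k e] : exists k, val (repr t) = rot k (val b).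
    by apply/pi_loopP; rewrite reprK.
  by rewrite /rep e mem_rot.
by move=> h; exists (repr t); rewrite ?reprK.
Qed.

(** [nrots] counts the distinct based loops in the class; it is smaller than the length for a
    periodic loop. *)
Definition mu t : R :=
  (nrots (rep t))%:R * ((lsize t)%:R^-1 * (2 * d%:R)^-1 ^+ lsize t).

Lemma loop_measure1 t : loop_measure R [set t] = (mu t)%:E.
Proof.
rewrite /loop_measure /based_loop_measure.
pose bs : seq (based_loop d) :=
  pmap insub (undup [seq rot k (rep t) | k <- iota 0 (lsize t)]).
have bsP (b : based_loop d) : b \in bs <-> \pi_(loop d) b = t.
  rewrite mem_pmap_sub mem_undup; split.
    move=> /mapP [k _ e]; rewrite -(reprK t); symmetry; apply/pi_loopP.
    by exists k.
  rewrite -{1}(reprK t) => /esym /pi_loopP [k e]; rewrite [val b]e.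
  have [kn|nk] := ltnP k (lsize t); first by apply: map_f; rewrite mem_iota add0n.
  rewrite rot_oversize // -[val _](rot0 (rep t)).
  by apply: (map_f (fun k => rot k (rep t))); rewrite mem_iota /= add0n lsize_gt0.
have -> : \pi_(loop d) @^-1` [set t] = [set` bs].
  by apply/seteqP; split=> b /=; rewrite bsP.
have ub : uniq bs by rewrite pmap_sub_uniq // undup_uniq.
have w0 b : 0 <= based_loop_weight R b.
  by rewrite /based_loop_weight mulr_ge0 ?invr_ge0 // exprn_ge0 // invr_ge0 mulr_ge0.
rewrite esum_fset; [|exact: finite_seq|by move=> b _; rewrite lee_fin].
rewrite -fsbig_seq // sumEFin; congr EFin.
have sb b : b \in bs -> size (val b) = lsize t.
  rewrite bsP => /esym; rewrite -{1}(reprK t) => /pi_loopP [k ->].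
  by rewrite size_rot.
rewrite big_seq (eq_bigr (fun=> (lsize t)%:R^-1 * (2 * d%:R)^-1 ^+ lsize t)); last first.
  by move=> b /sb e; rewrite /based_loop_weight e.
have sbs : size bs = nrots (rep t).
  rewrite /nrots size_pmap_sub; apply/eqP; rewrite -all_count; apply/allP => s.
  by rewrite mem_undup => /mapP [k _ ->]; exact: is_loop_rot (rep_ok t).
rewrite -big_seq big_const_seq count_predT iter_addr addr0 /mu sbs. by rewrite [RHS]mulr_natl.
Qed.

Lemma mu_ge0 t : 0 <= mu t.
Proof.
by rewrite mulr_ge0 // mulr_ge0 ?invr_ge0 // exprn_ge0 // invr_ge0 mulr_ge0.
Qed.

Lemma mu_le t : mu t <= (2 * d%:R)^-1 ^+ lsize t.
Proof.
rewrite /mu mulrA -[leRHS]mul1r ler_wpM2r ?exprn_ge0 ?invr_ge0 ?mulr_ge0 //.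
by rewrite ler_pdivrMr ?ltr0n ?lsize_gt0 // mul1r ler_nat nrots_le.
Qed.

(** Periodicity makes the mass smaller than (2d)^-n; a bound on the number of marked rotations
    limits this loss. Surgery uses it with rotations that start at an exit from a box. *)
Lemma mu_ge (a : pred (seq V)) t : (0 < nmarks a (rep t))%N ->
  (2 * d%:R)^-1 ^+ lsize t <= (nmarks a (rep t)).+1%:R * mu t.
Proof.
move=> /nrots_marks h; rewrite /mu !mulrA -[leLHS]mul1r.
rewrite ler_wpM2r ?exprn_ge0 ?invr_ge0 ?mulr_ge0 //.
rewrite ler_pdivlMr ?ltr0n ?lsize_gt0 // mul1r -natrM ler_nat mulnC.
exact: h.
Qed.

End Loops.

Section Soup.
Local Open Scope quotient_scope.
Context {R : realType} {disp : measure_display} {Omega : measurableType disp}.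
Variables (P : probability Omega R) (d : nat) (alpha : R) (L : Omega -> loop d -> nat).
Hypothesis soup : loop_soup P alpha L.

Definition lam (t : loop d) : R := alpha * mu R t.

Lemma soup_meas t k : measurable [set w | L w t = k].
Proof.
have [m _ _] := soup.
have := m t measurableT [set k] I.
by rewrite setTI.
Qed.

Lemma point_count1 t w : point_count (R := R) L [set t] w = ((L w t)%:R)%:E.
Proof. by rewrite /point_count esum_set1 // lee_fin. Qed.

(** Distinct loops are disjoint singletons of the loop space, so the counts are independent Poisson
    variables. *)
Lemma soup_law (fam : seq (loop d)) (uf : uniq fam) (c : {ffun 'I_(size fam) -> nat}) :
  P [set w | forall i, L w (tnth (in_tuple fam) i) = c i] =
  (\prod_(i < size fam) pois (lam (tnth (in_tuple fam) i)) (c i))%:E.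
Proof.
have [_ pd ind] := soup.
set ti := tnth (in_tuple fam).
have ti_in : injective ti by apply/tuple_uniqP.
have tr : trivIset setT (fun i => [set ti i]).
  by move=> i j _ _ [x [/= -> /ti_in]].
have := ind _ _ tr (fun i => [set ((c i)%:R)%:E]) (fun i => emeasurable_set1 _).
have -> : \bigcap_i (point_count (R := R) L [set ti i] @^-1` [set ((c i)%:R)%:E]) =
    [set w | forall i, L w (ti i) = c i].
  apply/seteqP; split=> w /= h i.
    by have := h i I; rewrite /= point_count1 => -[] /eqP; rewrite eqr_nat => /eqP.
  by move=> _; rewrite /= point_count1 h.
move=> ->; rewrite -prodEFin; apply: eq_bigr => i _.
have [p1 _] := pd [set ti i].
rewrite /pois -(p1 (lam (ti i))); last by rewrite loop_measure1 -EFinM.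
by [].
Qed.

End Soup.

(** * Product bounds for hitting sets and for occupation of boxes *)

Lemma sub_in_count (T : eqType) (a1 a2 : pred T) (s : seq T) :
  (forall x, x \in s -> a1 x -> a2 x) -> (count a1 s <= count a2 s)%N.
Proof.
elim: s => //= x s IH h; apply: leq_add; last first.
  by apply: IH => y ys; apply: h; rewrite inE ys orbT.
by case E: (a1 x) => //; rewrite (h x) ?mem_head.
Qed.

Section LoopWalks.
Variables (R : realType) (d : nat).
Local Notation V := 'rV[int]_d.
Local Notation nn := (@nearest_neighbor d).
Implicit Types (t : loop d).

(** The loop rooted at z, as the steps of a closed walk from z. It determines the loop, so sums over
    loops through z become sums over walks. *)
Definition walk_of t (z : V) : seq V := rcons (behead (rot (index z (rep t)) (rep t))) z.

Lemma walk_ofE t z : z \in rep t ->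
  z :: walk_of t z = rcons (rot (index z (rep t)) (rep t)) z.
Proof. by move=> h; rewrite /walk_of (rot_index h). Qed.

Lemma walk_of_path t z : z \in rep t -> path nn z (walk_of t z).
Proof.
move=> h; have /andP[_] := is_loop_rot (index z (rep t)) (rep_ok t).
by rewrite /walk_of (rot_index h).
Qed.

Lemma walk_of_size t z : z \in rep t -> size (walk_of t z) = lsize t.
Proof.
by move=> h; rewrite size_rcons size_behead size_rot prednK // lsize_gt0.
Qed.

Lemma walk_of_last t z : last z (walk_of t z) = z.
Proof. by rewrite /walk_of last_rcons. Qed.

Lemma walk_of_inj t t' z : z \in rep t -> z \in rep t' ->
  walk_of t z = walk_of t' z -> t = t'.
Proof.
move=> h h' /(congr1 (cons z)); rewrite !walk_ofE // => /rcons_inj [e].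
pose hl := is_loop_rot (index z (rep t)) (rep_ok t).
have <- : loop_of hl = t.
  apply/loop_ofP; exists (size (rot (index z (rep t)) (rep t)) - index z (rep t))%N.
  by rewrite -/(rotr _ _) rotK.
apply/loop_ofP; rewrite e.
exists (size (rot (index z (rep t')) (rep t')) - index z (rep t'))%N.
by rewrite -/(rotr _ _) rotK.
Qed.

Lemma walk_of_mem t z y : z \in rep t -> y \in rep t -> y \in walk_of t z.
Proof.
move=> h; rewrite -(mem_rot (index z (rep t))) /walk_of (rot_index h) /= mem_rcons.
by [].
Qed.

Lemma loops_through_sum (St : Type) (nx : St -> V -> St) (wt : St -> V -> V -> R)
  (e w : St -> V -> R) (s : St) (z : V) (F : seq (loop d)) :
  (forall s x y, 0 <= wt s x y) -> (forall s x, 0 <= e s x) ->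
  (forall s x, 0 <= w s x) ->
  (forall s x, e s x + avg (fun y => wt s x y * w (nx s y) y) x <= w s x) ->
  uniq F -> (forall t, t \in F -> z \in rep t) ->
  \sum_(t <- F) weight nx wt e s z (walk_of t z) <= w s z.
Proof.
move=> wt0 e0 w0 super uF zF.
rewrite -(big_map (walk_of ^~ z) xpredT (weight nx wt e s z)).
apply: walk_sum => //; last by move=> p /mapP [t tF ->]; apply: walk_of_path; exact: zF.
rewrite map_inj_in_uniq // => t t' tF tF'; apply: walk_of_inj; exact: zF.
Qed.

End LoopWalks.

Section Estimates.
Context {R : realType} {disp : measure_display} {Omega : measurableType disp}.
Variables (P : probability Omega R) (d : nat) (alpha : R) (L : Omega -> loop d -> nat).
Hypothesis soup : loop_soup P alpha L.
Hypothesis alpha0 : 0 <= alpha.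
Hypothesis hd : (3 <= d)%N.
Variable fam : seq (loop d).
Hypothesis uf : uniq fam.
Local Notation V := 'rV[int]_d.
Local Notation pr := (Pr P L fam).
Local Notation lam := (@lam R d alpha).
Local Notation c0 := (plum R (0 : V) ^+ 5).

Lemma lam_ge0 t : 0 <= lam t.
Proof. by rewrite mulr_ge0 // mu_ge0. Qed.

Lemma lam_le t : lam t <= alpha * (2 * d%:R)^-1 ^+ lsize t.
Proof. by rewrite ler_wpM2l // mu_le. Qed.

Lemma c0_gt0 : 0 < c0. Proof. by rewrite exprn_gt0 // plum_gt0. Qed.

Definition hit (nu : loop d -> nat) (z : V) : Prop :=
  exists2 t, (0 < nu t)%N & z \in rep t.
Definition hits (nu : loop d -> nat) (G : seq V) : Prop :=
  exists2 z, z \in G & hit nu z.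
Definition lhits (G : seq V) (t : loop d) : bool := has (fun z => z \in rep t) G.

Definition supported (nu : loop d -> nat) : Prop :=
  forall t, t \notin fam -> nu t = 0%N.

Lemma restr_supported nu : supported (restr fam nu).
Proof. by move=> t /negPf tf; rewrite /restr tf. Qed.

Lemma pr_ge0 E : 0 <= pr E.
Proof. exact: Pr_ge0 (soup_meas soup) uf _. Qed.

Lemma pr_le1 E : pr E <= 1.
Proof. exact: Pr_le1 (soup_meas soup) uf _. Qed.

Lemma pr_le (E E' : set (loop d -> nat)) :
  (forall nu, supported nu -> E nu -> E' nu) -> pr E <= pr E'.
Proof.
by move=> h; apply: (Pr_le _ (soup_meas soup) uf) => w; apply: h; exact: restr_supported.
Qed.

Lemma prU E E' : pr (E `|` E') <= pr E + pr E'.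
Proof. exact: PrU (soup_meas soup) uf _ _. Qed.

Lemma pr_bigU (I : eqType) (r : seq I) (E : I -> set (loop d -> nat)) :
  pr [set nu | exists2 i, i \in r & E i nu] <= \sum_(i <- r) pr (E i).
Proof. exact: Pr_bigU (soup_meas soup) uf _ _ _. Qed.

Lemma pr_disj (E E' : set (loop d -> nat)) :
  (forall nu, E nu -> E' nu -> False) -> pr (E `|` E') = pr E + pr E'.
Proof. exact: (Pr_disj _ (soup_meas soup) uf). Qed.

Lemma pr_sum_disj (I : eqType) (r : seq I) (E : I -> set (loop d -> nat)) F :
  uniq r -> (forall i, i \in r -> E i `<=` F) ->
  (forall i j nu, i \in r -> j \in r -> E i nu -> E j nu -> i = j) ->
  \sum_(i <- r) pr (E i) <= pr F.
Proof. exact: (Pr_sum_disj _ (soup_meas soup) uf). Qed.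

Lemma pr_mecke_ge (B : set (loop d -> nat)) (A : loop d -> set (loop d -> nat)) (K : nat) :
  (forall nu t, supported nu -> t \in fam -> A t nu -> B (addl nu t)) ->
  (forall nu, supported nu -> B nu ->
     (\sum_(t <- fam | `[< (0 < nu t)%N /\ A t (subl nu t) >]) nu t <= K)%N) ->
  \sum_(t <- fam) lam t * pr (A t) <= K%:R * pr B.
Proof.
move=> h1 h2; apply: (mecke_ge (soup_meas soup) lam_ge0 uf (soup_law soup uf)).
  by move=> c t; apply: h1 => s; exact: cf_out.
by move=> c; apply: h2 => s; exact: cf_out.
Qed.

Lemma pr_mecke (B : set (loop d -> nat)) (A : loop d -> set (loop d -> nat)) :
  (forall nu, supported nu -> B nu ->
     exists2 t, t \in fam & (0 < nu t)%N /\ A t (subl nu t)) ->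
  pr B <= \sum_(t <- fam) lam t * pr (A t).
Proof.
move=> h; apply: (mecke_le (soup_meas soup) lam_ge0 uf (soup_law soup uf)).
by move=> c; apply: h => t; exact: cf_out.
Qed.

Lemma sum_lhits (f : loop d -> R) (G : seq V) : (forall t, 0 <= f t) ->
  \sum_(t <- fam | lhits G t) f t <= \sum_(z <- G) \sum_(t <- fam | z \in rep t) f t.
Proof.
move=> f0; rewrite (exchange_big_dep xpredT) //= big_mkcond ler_sum // => t _.
case: ifP => [/hasP [z zG zt]|_]; last by rewrite sumr_ge0.
by rewrite (big_rem z) //= zt lerDl sumr_ge0.
Qed.

Section Hits.
Variable S : eqType.
Variables (G : S -> seq V) (h : S -> V -> R) (eps : R).
Hypothesis eps0 : 0 < eps.
Hypothesis eps1 : eps <= 1.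
Hypothesis h_ge0 : forall j x, 0 <= h j x.
Hypothesis h_super : forall j x, avg (h j) x <= h j x.
Hypothesis h_ge1 : forall j (x : V), x \in G j -> 1 <= h j x.
Hypothesis alpha_small : forall j, alpha * ((size (G j))%:R * (2 / c0)) <= eps.

(** The potentials of all other sets are small on each set: after reaching a new set, the walk sees
    only eps/2 of the remaining ones. *)
Definition separated (I : seq S) : Prop :=
  [/\ uniq I,
    forall i j (x : V), i \in I -> j \in I -> x \in G i -> x \in G j -> i = j
  & forall i (x : V), i \in I -> x \in G i -> \sum_(j <- I | j != i) h j x <= eps / 2].

Lemma separated_filter (a : pred S) I : separated I -> separated [seq x <- I | a x].
Proof.
move=> [uI dI rI]; split; first by rewrite filter_uniq.
  by move=> i j x; rewrite !mem_filter => /andP[_ iI] /andP[_ jI]; exact: dI.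
move=> i x; rewrite mem_filter => /andP[_ iI] xi; apply: le_trans (rI _ _ iI xi).
rewrite big_filter_cond /= big_mkcond [leRHS]big_mkcond ler_sum // => j _.
by case: (a j) => //=; case: ifP.
Qed.

Section Transitions.
Variables (I : seq S) (z : V).
Hypothesis sepI : separated I.

Definition leaf (y : V) : option S := ohead [seq j <- I | y \in G j].

Lemma leafP y j : leaf y = Some j <-> j \in I /\ y \in G j.
Proof.
have [uI dI _] := sepI; rewrite /leaf; split.
  case E: [seq _ <- _ | _] => [//|a r] [<-].
  have : a \in [seq j <- I | y \in G j] by rewrite E mem_head.
  by rewrite mem_filter => /andP[].
case=> jI yj; have : j \in [seq j <- I | y \in G j] by rewrite mem_filter yj.
case E: [seq _ <- _ | _] => [//|a r] _ /=; congr Some.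
have : a \in [seq j <- I | y \in G j] by rewrite E mem_head.
rewrite mem_filter => /andP[ya aI]; exact: (dI _ _ y).
Qed.

Definition next_leaf (s : S) (y : V) : S := odflt s (leaf y).
(** The state is the set visited last; a factor 1/eps is charged whenever a different set is
    reached. *)
Definition leaf_cost (s : S) (x y : V) : R :=
  if leaf y is Some j then (if j == s then 1 else eps^-1) else 1.
Definition at_z (s : S) (x : V) : R := (x == z)%:R.
Definition leaf_pot (s : S) (x : V) : R :=
  c0^-1 * (plum R (x - z) + 2 / eps * \sum_(j <- I | j != s) h j x).

Fixpoint ntrans (s : S) (p : seq V) : nat :=
  if p is y :: q then
    ((if leaf y is Some j then j != s else false) + ntrans (next_leaf s y) q)%N
  else 0%N.

Lemma leaf_pot_ge0 s x : 0 <= leaf_pot s x.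
Proof.
rewrite mulr_ge0 ?invr_ge0 ?(ltW c0_gt0) // addr_ge0 ?(ltW (plum_gt0 _ _)) //.
by rewrite mulr_ge0 ?divr_ge0 ?(ltW eps0) // sumr_ge0.
Qed.

(** The defect of [plum] at z pays for the terminal weight. Reaching set j costs at most (1/eps)(1 +
    1) afterwards, by separation, and this is covered by the term 2/eps * h j, since h j >= 1
    there. *)
Lemma leaf_pot_super s x :
  at_z s x + avg (fun y => leaf_cost s x y * leaf_pot (next_leaf s y) y) x <= leaf_pot s x.
Proof.
have [uI dI rI] := sepI.
have b y : leaf_cost s x y * leaf_pot (next_leaf s y) y <= leaf_pot s y.
  rewrite /leaf_cost /next_leaf; case E: (leaf y) => [j|] /=; last by rewrite mul1r.
  have [->|js] := eqVneq j s; first by rewrite mul1r.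
  have [jI yj] := (leafP y j).1 E.
  rewrite /leaf_pot mulrCA ler_wpM2l ?invr_ge0 ?(ltW c0_gt0) //.
  apply: (@le_trans _ _ (eps^-1 * (1 + 2 / eps * (eps / 2)))).
    rewrite ler_wpM2l ?invr_ge0 ?(ltW eps0) // lerD ?plum_le1 //.
    by rewrite ler_wpM2l ?divr_ge0 ?(ltW eps0) // rI.
  have -> : eps^-1 * (1 + 2 / eps * (eps / 2)) = 2 / eps * 1.
    by field; rewrite gt_eqF.
  apply: ler_wpDl; first exact: ltW (plum_gt0 _ _).
  rewrite ler_wpM2l ?divr_ge0 ?(ltW eps0) //.
  apply: le_trans (h_ge1 yj) _.
  rewrite (big_rem j) //= js lerDl sumr_ge0 //.
apply: (@le_trans _ _ (at_z s x + avg (leaf_pot s) x)).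
  by rewrite lerD2l le_avg.
rewrite /leaf_pot avgZ avgD avgZ avg_sum avg_shift.
have h1 : avg (plum R (d:=d)) (x - z) <= plum R (x - z) - at_z s x * c0.
  apply: le_trans (plum_super _ hd _) _; rewrite lerD2l lerN2 /at_z.
  case: eqP => [->|_]; first by rewrite subrr mul1r.
  by rewrite mul0r exprn_ge0 // ltW // plum_gt0.
have h2 : \sum_(j <- I | j != s) avg (h j) x <= \sum_(j <- I | j != s) h j x.
  by rewrite ler_sum.
have c00 := c0_gt0.
have e0 : 0 <= 2 / eps by rewrite divr_ge0 // ltW.
have -> : at_z s x = c0^-1 * (at_z s x * c0) by rewrite mulrCA mulVf ?mulr1 // gt_eqF.
rewrite -mulrDr ler_wpM2l ?invr_ge0 ?(ltW c00) //.
have := ler_wpM2l e0 h2; lra.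
Qed.

Lemma weight_leaf s x p : weight next_leaf leaf_cost at_z s x p =
  (2 * d%:R)^-1 ^+ size p * (eps^-1 ^+ ntrans s p * (last x p == z)%:R).
Proof.
elim: p s x => [|y q IH] s x /=; first by rewrite !expr0 !mul1r.
rewrite IH exprS exprD /leaf_cost.
move: ((2 * d%:R)^-1) ((2 * d%:R)^-1 ^+ size q) (eps^-1 ^+ ntrans _ _)
  ((last y q == z)%:R : R) => c k v u.
by case: (leaf y) => [j|]; [case: eqP => _|]; rewrite /= ?expr0 ?expr1; ring.
Qed.

Lemma count_ntrans s p :
  (count (fun j => (j != s) && has (mem (G j)) p) I <= ntrans s p)%N.
Proof.
have [uI dI rI] := sepI.
elim: p s => [|y q IH] s /=.
  by rewrite (eq_count (a2 := pred0)) ?count_pred0 // => j; rewrite andbF.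
rewrite /next_leaf; case E: (leaf y) => [j|] /=; last first.
  rewrite add0n; apply: leq_trans (IH s); rewrite leq_eqVlt; apply/orP; left; apply/eqP.
  apply: eq_in_count => k kI /=; case: (boolP (y \in G k)) => // yk.
  by have := (leafP y k).2 (conj kI yk); rewrite E.
have [jI yj] := (leafP y j).1 E.
have [e|js] := eqVneq j s => /=.
  rewrite e add0n; apply: leq_trans (IH s); rewrite leq_eqVlt; apply/orP; left; apply/eqP.
  apply: eq_in_count => k kI /=; case: (boolP (y \in G k)) => //= yk.
  by rewrite (dI k j y) // e eqxx.
apply: leq_trans (leq_add (_ : count (pred1 j) I <= 1)%N (IH j)); last first.
  by rewrite count_uniq_mem // leq_b1.
rewrite -count_predUI; apply: leq_trans (leq_addr _ _).
apply: sub_in_count => k kI /= /andP[ks /orP[yk|hq]].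
  by rewrite (dI _ _ y kI jI yk yj) eqxx.
by case: eqP => //= _; rewrite hq.
Qed.

End Transitions.

(** Induction on the number of sets: remove by Mecke one loop hitting the first set; the remaining
    loops must hit all the sets it misses. The removed loop is therefore weighted by 1/eps for each
    set it hits, and [leaf_pot] together with the smallness of alpha keeps the weighted sum below
    1. *)
Lemma Pr_hits (I : seq S) : separated I ->
  pr [set nu | forall i, i \in I -> hits nu (G i)] <= eps ^+ size I.
Proof.
have [m] : exists m, (size I <= m)%N by exists (size I).
elim: m I => [|m IH] I hm sI.
  move: hm; rewrite leqn0 size_eq0 => /eqP ->; rewrite expr0; exact: pr_le1.
case: I hm sI => [|i0 I'] hm sI.
  rewrite expr0; exact: pr_le1.
set I := i0 :: I'.
pose J t := [seq i <- I | ~~ lhits (G i) t].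
pose A t : set (loop d -> nat) := if lhits (G i0) t then
   [set nu | forall i, i \in J t -> hits nu (G i)] else set0.
have pr0 : pr set0 = 0.
  by rewrite /Pr (_ : [set _ | _] = set0) ?measure0 //; apply/seteqP; split.
have hitsub nu t i : hits nu (G i) -> ~~ lhits (G i) t -> hits (subl nu t) (G i).
  move=> [z zG [t' nt' zt']] /hasPn /(_ z zG) /= zt; exists z => //; exists t' => //.
  rewrite /subl; case: eqP => [e|_]; last by rewrite subn0.
  by move: zt; rewrite -e zt'.
apply: le_trans (pr_mecke (A := A) _) _.
  move=> nu supp hB; have [z zG [t nt zt]] := hB i0 (mem_head _ _).
  have lt : lhits (G i0) t by apply/hasP; exists z.
  exists t.
    by apply: contraLR nt => /supp ->.
  split=> //; rewrite /A lt => i; rewrite mem_filter => /andP[nl iI].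
  by apply: hitsub => //; exact: hB.
have bnd t : lam t * pr (A t) <= if lhits (G i0) t then
    eps ^+ size I * (lam t * eps^-1 ^+ count (fun i => lhits (G i) t) I) else 0.
  rewrite /A; case: ifP => lt; last by rewrite pr0 mulr0.
  rewrite mulrCA ler_wpM2l ?lam_ge0 //.
  apply: le_trans (IH (J t) _ _) _.
  - rewrite size_filter /I /= lt /= add0n; apply: leq_trans (count_size _ _) _.
    by move: hm.
  - exact: separated_filter.
  - rewrite size_filter -(count_predC (fun i => lhits (G i) t) I) exprD.
    rewrite mulrAC exprVn divff ?mul1r; first by [].
    by rewrite expf_neq0 // gt_eqF.
apply: le_trans (ler_sum _ (fun t _ => bnd t)) _.
rewrite -big_mkcond -mulr_sumr -[leRHS]mulr1 ler_wpM2l ?exprn_ge0 ?(ltW eps0) //.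
have F0 t : 0 <= lam t * eps^-1 ^+ count (fun i => lhits (G i) t) I.
  by rewrite mulr_ge0 ?lam_ge0 // exprn_ge0 // invr_ge0 ltW.
apply: le_trans (sum_lhits _ F0) _.
have thr z : z \in G i0 -> \sum_(t <- fam | z \in rep t)
    lam t * eps^-1 ^+ count (fun i => lhits (G i) t) I <= alpha * eps^-1 * (2 / c0).
  move=> zG.
  pose F := [seq t <- fam | z \in rep t].
  apply: (@le_trans _ _ (alpha * eps^-1 *
     \sum_(t <- F) weight (next_leaf I) (leaf_cost I) (at_z z) i0 z (walk_of t z))).
    rewrite mulr_sumr big_filter ler_sum // => t zt.
    rewrite weight_leaf // walk_of_last eqxx mulr1 walk_of_size //.
    have -> : alpha / eps * ((2 * d%:R)^-1 ^+ lsize t * eps^-1 ^+ ntrans I i0 (walk_of t z)) =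
      (alpha * (2 * d%:R)^-1 ^+ lsize t) * eps^-1 ^+ (1 + ntrans I i0 (walk_of t z)).
      by rewrite exprD expr1 mulrACA.
    apply: ler_pM; rewrite ?lam_ge0 ?exprn_ge0 ?invr_ge0 ?(ltW eps0) ?lam_le //.
    rewrite ler_weXn2l //; first by rewrite invf_ge1.
    (* The starting set accounts for one factor 1/eps, every other set hit by the loop for at least
       one transition. *)
    apply: leq_trans (_ : _ <= 1 + count (fun j => (j != i0) && has (mem (G j)) (walk_of t z)) I)%N _; last first.
      by rewrite add1n ltnS; apply: (count_ntrans sI).
    have [uI _ _] := sI.
    apply: leq_trans (leq_add (_ : count (pred1 i0) I <= 1)%N (leqnn _)); last first.
      by rewrite count_uniq_mem // leq_b1.
    rewrite -count_predUI; apply: leq_trans (leq_addr _ _).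
    apply: sub_in_count => k kI /= /hasP [y yk yt].
    case: eqP => //= _; apply/hasP; exists y => //.
    exact: walk_of_mem.
  rewrite ler_wpM2l ?mulr_ge0 ?invr_ge0 ?(ltW eps0) //.
  apply: (@le_trans _ _ (leaf_pot I z i0 z)).
    apply: loops_through_sum => //.
    - move=> s x y; rewrite /leaf_cost; case: leaf => [j|//].
      by case: ifP => // _; rewrite invr_ge0 ltW.
    - by move=> s x; apply: leaf_pot_ge0.
    - by move=> s x; apply: leaf_pot_super.
    - by rewrite filter_uniq.
    - by move=> t; rewrite mem_filter => /andP[].
  rewrite /leaf_pot subrr mulrC ler_wpM2r ?invr_ge0 ?(ltW c0_gt0) //.
  apply: (@le_trans _ _ (1 + 2 / eps * (eps / 2))); last first.
    by rewrite le_eqVlt; apply/orP; left; apply/eqP; field; rewrite gt_eqF.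
  rewrite lerD ?plum_le1 // ler_wpM2l ?divr_ge0 ?(ltW eps0) //.
  by have [_ _ r] := sI; apply: r => //; exact: mem_head.
rewrite big_seq; apply: le_trans (ler_sum _ thr) _.
rewrite -big_seq big_const_seq count_predT iter_addr addr0 -mulr_natl.
rewrite [leLHS](_ : _ = eps^-1 * (alpha * ((size (G i0))%:R * (2 / c0)))); last by ring.
by rewrite mulrC ler_pdivrMr ?mul1r.
Qed.

End Hits.

Definition visits (b : pred V) (t : loop d) : nat := count b (rep t).
Definition occupation (b : pred V) (nu : loop d -> nat) : nat :=
  (\sum_(t <- fam) nu t * visits b t)%N.

Section Visits.
Variable S : eqType.
Variables (b : S -> pred V) (bl : S -> seq V) (o : S -> V) (I : seq S).
Variables (kappa C eta : R).
Hypothesis blP : forall i z, b i z -> z \in bl i.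
Hypothesis kappaP : forall i x, b i x -> kappa <= plum R (x - o i) ^+ 5.
Hypothesis C_bound : forall x, \sum_(i <- I) plum R (x - o i) <= C.
Hypothesis eta0 : 0 < eta.
Hypothesis etaP : eta * (1 + C) <= kappa.
Hypothesis disj : forall x, (count (fun i => b i x) I <= 1)%N.
Hypothesis alpha_small : forall i, alpha * ((size (bl i))%:R * ((1 + C) / c0)) <= 1.

Definition visit_cost (s : unit) (x y : V) : R := (1 + eta) ^+ count (fun i => b i x) I.
Definition visit_pot (z : V) (s : unit) (x : V) : R :=
  c0^-1 * (plum R (x - z) + \sum_(i <- I) plum R (x - o i)).

Lemma eta1 : 1 <= 1 + eta. Proof. by rewrite lerDl ltW. Qed.

(** Inside a box the sum of potentials loses at least [kappa] in one step; by [etaP] this pays for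
    the factor 1 + eta charged per visit. *)
Lemma visit_pot_super (z : V) (s : unit) x :
  (x == z)%:R + avg (fun y => visit_cost s x y * visit_pot z tt y) x <= visit_pot z s x.
Proof.
have c00 := c0_gt0.
rewrite /visit_cost avgZ; set E := _ ^+ _.
pose D := (x == z)%:R * c0 + \sum_(i <- I) plum R (x - o i) ^+ 5.
have av : avg (visit_pot z tt) x <= visit_pot z s x - c0^-1 * D.
  rewrite /visit_pot avgZ avgD avg_sum avg_shift -mulrBr ler_wpM2l ?invr_ge0 ?(ltW c00) //.
  have h1 : avg (plum R (d:=d)) (x - z) <= plum R (x - z) - (x == z)%:R * c0.
    apply: le_trans (plum_super _ hd _) _; rewrite lerD2l lerN2.
    case: eqP => [->|_]; first by rewrite subrr mul1r.
    by rewrite mul0r exprn_ge0 // ltW // plum_gt0.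
  have h2 : \sum_(i <- I) avg (fun y => plum R (y - o i)) x <=
     \sum_(i <- I) plum R (x - o i) - \sum_(i <- I) plum R (x - o i) ^+ 5.
    rewrite -sumrB ler_sum // => i _; rewrite avg_shift.
    exact: plum_super.
  by rewrite /D; lra.
have u0 : 0 <= avg (visit_pot z tt) x.
  rewrite /avg mulr_ge0 ?invd_ge0 // sumr_ge0 // => y _.
  rewrite mulr_ge0 ?invr_ge0 ?(ltW c00) // addr_ge0 ?(ltW (plum_gt0 _ _)) //.
  by rewrite sumr_ge0 // => i _; rewrite ltW // plum_gt0.
have uC : visit_pot z s x <= c0^-1 * (1 + C).
  rewrite ler_wpM2l ?invr_ge0 ?(ltW c00) // lerD ?plum_le1 //.
have xz : (x == z)%:R = c0^-1 * ((x == z)%:R * c0) :> R.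
  by rewrite mulrCA mulVf ?mulr1 // gt_eqF.
have [nh|] := boolP (has (fun i => b i x) I); last first.
  rewrite has_count -eqn0Ngt => /eqP e; rewrite /E e expr0 mul1r.
  have : 0 <= c0^-1 * \sum_(i <- I) plum R (x - o i) ^+ 5.
    rewrite mulr_ge0 ?invr_ge0 ?(ltW c00) // sumr_ge0 // => i _.
    by rewrite exprn_ge0 // ltW // plum_gt0.
  by rewrite {1}xz; move: av; rewrite /D mulrDr; lra.
have -> : E = 1 + eta.
  rewrite /E (_ : count _ _ = 1%N) ?expr1 //; apply/eqP; rewrite eqn_leq disj.
  by rewrite -has_count.
have kD : kappa <= \sum_(i <- I) plum R (x - o i) ^+ 5.
  have /hasP [i iI bi] := nh; apply: le_trans (kappaP bi) _.
  rewrite (big_rem i) //= lerDl sumr_ge0 // => j _.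
  by rewrite exprn_ge0 // ltW // plum_gt0.
have e1 : eta * avg (visit_pot z tt) x <= c0^-1 * kappa.
  apply: (@le_trans _ _ (eta * (c0^-1 * (1 + C)))); last first.
    by rewrite mulrCA ler_wpM2l ?invr_ge0 ?(ltW c00).
  rewrite ler_wpM2l ?(ltW eta0) //; apply: le_trans av _.
  have D0 : 0 <= D.
    apply: addr_ge0; first by rewrite mulr_ge0 ?ler0n ?(ltW c00).
    by apply: sumr_ge0 => i _; rewrite exprn_ge0 // ltW // plum_gt0.
  by apply: le_trans uC; rewrite gerBl mulr_ge0 ?invr_ge0 ?(ltW c00).
have e2 : c0^-1 * kappa <= c0^-1 * \sum_(i <- I) plum R (x - o i) ^+ 5.
  by rewrite ler_wpM2l ?invr_ge0 ?(ltW c00).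
rewrite {1}xz mulrDl mul1r; move: av; rewrite /D mulrDr.
move: e1 e2; lra.
Qed.

Lemma weight_visits z x p : weight (fun s _ => s) visit_cost (fun _ x => (x == z)%:R) tt x p =
  (2 * d%:R)^-1 ^+ size p *
  ((1 + eta) ^+ (\sum_(y <- belast x p) count (fun i => b i y) I)%N * (last x p == z)%:R).
Proof.
elim: p x => [|y q IH] x /=; first by rewrite big_nil !expr0 !mul1r.
rewrite IH big_cons exprS exprD /visit_cost.
move: ((2 * d%:R)^-1) ((2 * d%:R)^-1 ^+ size q) ((1 + eta) ^+ _) ((1 + eta) ^+ _)
  ((last y q == z)%:R : R) => c k v u w.
by ring.
Qed.

Lemma sum_visits t : (\sum_(i <- I) visits (b i) t =
  \sum_(y <- rep t) count (fun i => b i y) I)%N.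
Proof.
rewrite /visits (eq_bigr (fun i => \sum_(y <- rep t) (b i y : nat))%N); last first.
  by move=> i _; rewrite -sum1_count big_mkcond /=; apply: eq_bigr => y _; case: (b i y).
rewrite exchange_big /=; apply: eq_bigr => y _.
by rewrite -sum1_count [RHS]big_mkcond /=; apply: eq_bigr => i _; case: (b i y).
Qed.

Lemma sum_visit_loops i : \sum_(t <- fam | (0 < visits (b i) t)%N)
    lam t * (1 + eta) ^+ (\sum_(j <- I) visits (b j) t)%N <= 1.
Proof.
have e0 : 0 <= 1 + eta by apply: le_trans eta1.
have F0 t : 0 <= lam t * (1 + eta) ^+ (\sum_(j <- I) visits (b j) t)%N.
  by rewrite mulr_ge0 ?lam_ge0 // exprn_ge0.
apply: (@le_trans _ _ (\sum_(t <- fam | lhits (bl i) t)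
    lam t * (1 + eta) ^+ (\sum_(j <- I) visits (b j) t)%N)).
  rewrite big_mkcond [leRHS]big_mkcond ler_sum // => t _.
  case: ifP => [|_]; last by case: ifP.
  rewrite /visits -has_count => /hasP [z zt biz].
  by rewrite (_ : lhits _ _ = true) //; apply/hasP; exists z => //; exact: blP.
apply: le_trans (sum_lhits _ F0) _.
have thr z : \sum_(t <- fam | z \in rep t)
    lam t * (1 + eta) ^+ (\sum_(j <- I) visits (b j) t)%N <= alpha * ((1 + C) / c0).
  pose F := [seq t <- fam | z \in rep t].
  apply: (@le_trans _ _ (alpha * \sum_(t <- F)
      weight (fun s _ => s) visit_cost (fun _ x => (x == z)%:R) tt z (walk_of t z))).
    rewrite mulr_sumr big_filter ler_sum // => t zt.
    rewrite weight_visits walk_of_last eqxx mulr1 walk_of_size // mulrA.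
    rewrite ler_pM ?lam_ge0 ?exprn_ge0 ?lam_le //.
    rewrite sum_visits le_eqVlt; apply/orP; left; apply/eqP; congr (_ ^+ _).
    apply: perm_big; rewrite /walk_of belast_rcons.
    have -> : z :: behead (rot (index z (rep t)) (rep t)) = rot (index z (rep t)) (rep t).
      by rewrite (rot_index zt).
    by rewrite perm_sym perm_rot.
  rewrite ler_wpM2l //; apply: (@le_trans _ _ (visit_pot z tt z)).
    apply: (loops_through_sum (e := fun _ x => (x == z)%:R) (w := visit_pot z)).
    - by move=> s x y; rewrite /visit_cost exprn_ge0.
    - by move=> s x; exact: ler0n.
    - move=> s x; rewrite mulr_ge0 ?invr_ge0 ?(ltW c0_gt0) // addr_ge0 ?(ltW (plum_gt0 _ _)) //.
      by rewrite sumr_ge0 // => j _; rewrite ltW // plum_gt0.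
    - by case=> x; exact: visit_pot_super.
    - by rewrite filter_uniq.
    - by move=> t; rewrite mem_filter => /andP[].
  rewrite /visit_pot mulrC ler_wpM2r ?invr_ge0 ?(ltW c0_gt0) //.
  by rewrite lerD ?plum_le1.
apply: le_trans (ler_sum _ (fun z _ => thr z)) _.
rewrite big_const_seq count_predT iter_addr addr0 -mulr_natl mulrCA.
exact: alpha_small.
Qed.

(** An exponential Chebyshev bound for all boxes at once. Mecke removes a loop that visits a box
    with positive threshold, all thresholds drop by its visits, and the induction is on their
    sum. *)
Lemma Pr_visits (k : S -> nat) :
  pr [set nu | forall i, i \in I -> (k i <= occupation (b i) nu)%N] <=
  \prod_(i <- I) (1 + eta)^-1 ^+ k i.
Proof.
have e0 : 0 < 1 + eta by apply: lt_le_trans eta1.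
have [m] : exists m, (\sum_(i <- I) k i <= m)%N by eexists.
elim: m k => [|m IH] k hm.
  have k0 i : i \in I -> k i = 0%N.
    move=> iI; apply/eqP; rewrite -leqn0; apply: leq_trans hm.
    by rewrite (big_rem i) //= leq_addr.
  rewrite big_seq (eq_bigr (fun=> 1)); last by move=> i /k0 ->; rewrite expr0.
  by rewrite big1 //; exact: pr_le1.
have [[i0 [iI k0]]|nex] := pselect (exists i, i \in I /\ (0 < k i)%N); last first.
  rewrite big_seq (eq_bigr (fun=> 1)); last first.
    move=> i iI; suff -> : k i = 0%N by rewrite expr0.
    by apply/eqP; rewrite -leqn0 leqNgt; apply/negP => h; apply: nex; exists i.
  by rewrite big1 //; exact: pr_le1.
pose k' t i := (k i - visits (b i) t)%N.
pose A t : set (loop d -> nat) := if (0 < visits (b i0) t)%N then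
  [set nu | forall i, i \in I -> (k' t i <= occupation (b i) nu)%N] else set0.
have pr0 : pr set0 = 0.
  by rewrite /Pr (_ : [set _ | _] = set0) ?measure0 //; apply/seteqP; split.
have occ_sub nu t b' : t \in fam -> (0 < nu t)%N ->
    occupation b' nu = (occupation b' (subl nu t) + visits b' t)%N.
  move=> tf nt; rewrite /occupation !(bigD1_seq t) //= /subl eqxx.
  have -> : (\sum_(s <- fam | s != t) (nu s - (s == t)) * visits b' s =
     \sum_(s <- fam | s != t) nu s * visits b' s)%N.
    by apply: eq_bigr => s /negPf ->; rewrite subn0.
  by nia.
apply: le_trans (pr_mecke (A := A) _) _.
  move=> nu supp hB; have ho := hB _ iI; have [t tf /andP[nt vt]] : exists2 t, t \in fam & (0 < nu t)%N && (0 < visits (b i0) t)%N.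
    apply: contrapT => nex; move: (leq_trans k0 ho).
    rewrite lt0n => /eqP; apply; rewrite /occupation big_seq big1 // => t tf.
    case: (posnP (nu t)) => [->|nt]; first by rewrite mul0n.
    case: (posnP (visits (b i0) t)) => [->|vt]; first by rewrite muln0.
    by case: nex; exists t => //; rewrite nt vt.
  exists t => //; split=> //; rewrite /A vt => i iI'.
  have := hB _ iI'; rewrite (occ_sub nu t _ tf nt) /k'.
  by move=> h; rewrite leq_subLR addnC.
have bnd t : lam t * pr (A t) <= if (0 < visits (b i0) t)%N then
    (\prod_(i <- I) (1 + eta)^-1 ^+ k i) *
    (lam t * (1 + eta) ^+ (\sum_(j <- I) visits (b j) t)%N) else 0.
  rewrite /A; case: ifP => lt; last by rewrite pr0 mulr0.
  rewrite mulrCA ler_wpM2l ?lam_ge0 //.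
  apply: le_trans (IH (k' t) _) _.
    rewrite -ltnS; apply: leq_trans hm.
    rewrite (big_rem i0) // [leqRHS](big_rem i0) //=.
    have h1 : (\sum_(y <- rem i0 I) k' t y <= \sum_(y <- rem i0 I) k y)%N.
      by apply: leq_sum => i _; exact: leq_subr.
    by rewrite -addSn leq_add // /k'; move: k0 lt; lia.
  rewrite -prodrXr -big_split /= ler_prod // => i _.
  rewrite exprn_ge0 ?invr_ge0 ?(ltW e0) //= /k' !exprVn.
  rewrite mulrC ler_pdivlMr ?exprn_gt0 // mulrC ler_pdivrMr ?exprn_gt0 // -exprD.
  by rewrite ler_weXn2l ?eta1 // -leq_subLR.
apply: le_trans (ler_sum _ (fun t _ => bnd t)) _.
rewrite -big_mkcond -mulr_sumr -[leRHS]mulr1 ler_wpM2l ?sum_visit_loops //.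
by apply: prodr_ge0 => i _; rewrite exprn_ge0 // invr_ge0 ltW.
Qed.

End Visits.
End Estimates.

(** * Trees of scales 16^k and their leaves *)

Section BoxSeq.
Variable d : nat.
Local Notation V := 'rV[int]_d.

Definition boxseq (r : nat) : seq V :=
  [seq ((\row_j (((f : {ffun 'I_d -> 'I_(2 * r).+1}) j : nat)%:Z - r%:Z)) : V) | f <- enum {ffun 'I_d -> 'I_(2 * r).+1}].
Definition boxat (x : V) r : seq V := [seq x + w | w <- boxseq r].

Lemma size_boxseq r : size (boxseq r) = ((2 * r).+1 ^ d)%N.
Proof. by rewrite size_map -cardE card_ffun !card_ord. Qed.

Lemma mem_boxseq r (x : V) : (x \in boxseq r) <-> (linf_dist 0 x <= r)%N.
Proof.
split.
  move=> /mapP [f _ ->]; apply/linfP => i; rewrite !mxE.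
  by case: (f i) => q /= hq; lia.
move=> /linfP h; have h' i : - r%:Z <= x ord0 i <= r%:Z.
  by have := h i; rewrite mxE; lia.
apply/mapP; exists [ffun i => inord (absz (x ord0 i + r%:Z))]; first by rewrite mem_enum.
apply: linf_eq => i; rewrite mxE ffunE inordK; have := h' i; lia.
Qed.

Lemma mem_boxat x r (y : V) : (y \in boxat x r) <-> (linf_dist x y <= r)%N.
Proof.
have e : linf_dist 0 (y - x) = linf_dist x y.
  by apply: eq_bigr => i _; rewrite !mxE sub0r opprB.
rewrite -e -mem_boxseq; split.
  by move=> /mapP [w hw ->]; rewrite addrC addKr.
by move=> h; apply/mapP; exists (y - x); rewrite // addrC subrK.
Qed.

Lemma size_boxat x r : size (boxat x r) = ((2 * r).+1 ^ d)%N.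
Proof. by rewrite size_map size_boxseq. Qed.

Lemma uniq_boxseq r : uniq (boxseq r).
Proof.
rewrite map_inj_uniq ?enum_uniq // => f g /rowP h; apply/ffunP => i; apply: val_inj.
have := h i; rewrite !mxE => /addIr /eqP; rewrite eqz_nat => /eqP; exact.
Qed.

End BoxSeq.

Section Trees.
Variable d : nat.
Local Notation V := 'rV[int]_d.

Definition round_to (r : nat) (u : V) : V := \row_j ((u ord0 j %/ r%:Z)%Z * r%:Z).
Definition cand (k : nat) (x : V) : seq V :=
  [seq round_to (16 ^ k) x + (16 ^ k)%:Z *: w | w <- boxseq d 35].

(** Possible leaf lists of binary trees rooted at x. The two children at level k lie on the mesh
    16^k, at distance at least 14*16^k, so both subtrees stay well apart. *)
Fixpoint trees (k : nat) (x : V) : seq (seq V) :=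
  if k is k'.+1 then
    flatten [seq flatten [seq [seq I1 ++ I2 | I1 <- trees k' y, I2 <- trees k' z]
                         | z <- cand k' x & (14 * 16 ^ k' <= linf_dist y z)%N]
            | y <- cand k' x]
  else [seq [:: y] | y <- boxat x 1].

Lemma treesS k x I : I \in trees k.+1 x -> exists y z I1 I2,
  [/\ y \in cand k x, z \in cand k x, (14 * 16 ^ k <= linf_dist y z)%N &
     [/\ I1 \in trees k y, I2 \in trees k z & I = I1 ++ I2]].
Proof.
move=> /= /flatten_mapP [y yc /flatten_mapP [z]].
rewrite mem_filter => /andP[hz zc] /allpairsP [[I1 I2] /= [h1 h2 ->]].
by exists y, z, I1, I2.
Qed.

Lemma treesS_intro k x y z I1 I2 : y \in cand k x -> z \in cand k x ->
  (14 * 16 ^ k <= linf_dist y z)%N -> I1 \in trees k y -> I2 \in trees k z ->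
  I1 ++ I2 \in trees k.+1 x.
Proof.
move=> yc zc hz h1 h2 /=; apply/flatten_mapP; exists y => //.
apply/flatten_mapP; exists z; first by rewrite mem_filter hz.
by apply/allpairsP; exists (I1, I2).
Qed.

Lemma round_to_dist r u : (0 < r)%N -> (linf_dist (round_to r u) u <= r)%N.
Proof.
move=> r0; apply/linfP => i; rewrite mxE.
have := divz_eq (u ord0 i) r%:Z.
have rn : r%:Z != 0 by lia.
have := modz_ge0 (u ord0 i) rn; have : (u ord0 i %% r%:Z)%Z < r%:Z by rewrite ltz_pmod //; lia.
by move: ((_ %/ _)%Z) ((_ %% _)%Z) => q m; nia.
Qed.

Lemma cand_dist k x y : y \in cand k x -> (linf_dist x y <= 36 * 16 ^ k)%N.
Proof.
move=> /mapP [w /mem_boxseq hw ->].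
have p0 : (0 < 16 ^ k)%N by rewrite expn_gt0.
apply: leq_trans (linf_triangle (round_to (16 ^ k) x) _ _) _.
have h1 := round_to_dist x p0; rewrite linf_distC in h1.
suff : (linf_dist (round_to (16 ^ k) x) (round_to (16 ^ k) x + (16 ^ k)%:Z *: w) <= 35 * 16 ^ k)%N.
  by lia.
apply/linfP => i; move/linfP: hw => /(_ i); rewrite !mxE sub0r abszN => hw.
by rewrite opprD addrA subrr sub0r abszN abszM absz_nat mulnC leq_mul.
Qed.

Lemma cand_mem k x u : (linf_dist x u <= 32 * 16 ^ k + 1)%N ->
  round_to (16 ^ k) u \in cand k x.
Proof.
move=> hu; have p0 : (0 < 16 ^ k)%N by rewrite expn_gt0.
apply/mapP; exists (\row_j ((u ord0 j %/ (16 ^ k)%:Z)%Z - (x ord0 j %/ (16 ^ k)%:Z)%Z)); last first.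
  by apply: linf_eq => i; rewrite !mxE; ring.
apply/mem_boxseq; apply/linfP => i; rewrite !mxE.
have := linf_coord x u i.
have := divz_eq (u ord0 i) (16 ^ k)%:Z; have := divz_eq (x ord0 i) (16 ^ k)%:Z.
move: hu p0; move: (16 ^ k)%N => r hu r0.
have rn : r%:Z != 0 by lia.
have := modz_ge0 (u ord0 i) rn; have : (u ord0 i %% r%:Z)%Z < r%:Z by rewrite ltz_pmod //; lia.
have := modz_ge0 (x ord0 i) rn; have : (x ord0 i %% r%:Z)%Z < r%:Z by rewrite ltz_pmod //; lia.
move: ((u ord0 i %/ _)%Z) ((u ord0 i %% _)%Z) ((x ord0 i %/ _)%Z) ((x ord0 i %% _)%Z).
move=> q1 m1 q2 m2 a1 a2 b1 b2 -> -> h.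
have h2 : (absz (q2 * r%:Z + m2 - (q1 * r%:Z + m1))%R <= 32 * r + 1)%N by lia.
have h3 : (absz ((q2 - q1) * r%:Z)%R <= 34 * r)%N by lia.
have h4 : (absz (q2 - q1)%R * r <= 34 * r)%N by move: h3; rewrite abszM absz_nat.
have h5 : (absz (q2 - q1)%R <= 34)%N by rewrite -(leq_pmul2r r0).
lia.
Qed.

(** A path from radius 16^(k+1) to beyond twice that radius has two ends far apart. Rounding them to
    the mesh 16^k gives two children, and the same path, read from either end, crosses the annulus
    of each child one level down. *)
Lemma tree_crossing (B : set V) k x u v : rconn (@star d) B u v ->
  (linf_dist x u <= 16 ^ k)%N -> (2 * 16 ^ k < linf_dist x v)%N ->
  exists2 I, I \in trees k x & forall i, i \in I -> B i.
Proof.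
elim: k x u v => [|k IH] x u v c hu hv.
  exists [:: u]; first by apply: (map_f (fun y => [:: y])); apply/mem_boxat.
  by move=> i; rewrite inE => /eqP ->; exact: (rconn_l c).
have p0 : (0 < 16 ^ k)%N by rewrite expn_gt0.
move: hu hv; rewrite expnS; set r := (16 ^ k)%N => hu hv.
have hu0 : (linf_dist x u <= 2 * (16 * r))%N by apply: (leq_trans hu); rewrite leq_pmull.
have hv0 : ~ (linf_dist x v <= 2 * (16 * r))%N by apply/negP; rewrite -ltnNge.
(* Stopping just outside radius 2*16^(k+1) keeps the far end within range of [cand]. *)
have [u' [v' [cu suv Bv nAv _]]] :=
  vconn_exit (A := [set z | (linf_dist x z <= 2 * (16 * r))%N]) c hu0 hv0.
have [_ /= Au] := rconn_r cu.
have cuv : rconn (@star d) B u v'.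
  apply: (rconn_rcons _ suv Bv); apply: (rconn_sub _ cu); by move=> z [].
have hv' : (linf_dist x v' <= 32 * r + 1)%N.
  have ar2 (b c' e q : nat) : (c' <= 2 * (16 * q) -> e <= 1 -> b <= c' + e -> b <= 32 * q + 1)%N by lia.
  exact: ar2 Au suv (linf_triangle u' x v').
move/negP: nAv; rewrite /= -ltnNge => gv.
have t1 := linf_triangle u x v'.
set y := round_to r u; set z := round_to r v'.
have dy : (linf_dist y u <= r)%N by exact: round_to_dist.
have dz : (linf_dist z v' <= r)%N by exact: round_to_dist.
have ar (a b e f g q : nat) : (a <= 16 * q -> 2 * (16 * q) < b -> b <= a + e ->
   f <= q -> e <= f + g -> 2 * q < g \/ q = 0)%N by lia.
have yv : (2 * r < linf_dist y v')%N.
  case: (ar _ _ _ _ _ r hu gv t1 dy (_ : _ <= _ + linf_dist y v')%N) => // [|r0].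
    by rewrite (linf_distC y u); exact: linf_triangle.
  by move: p0; rewrite -/r r0.
have zu : (2 * r < linf_dist z u)%N.
  case: (ar _ _ _ _ _ r hu gv t1 dz (_ : _ <= _ + linf_dist z u)%N) => // [|r0].
    by rewrite addnC (linf_distC z u); exact: linf_triangle.
  by move: p0; rewrite -/r r0.
have [I1 t1' B1] : exists2 I, I \in trees k y & forall i, i \in I -> B i.
  exact: (IH _ _ _ cuv dy yv).
have [I2 t2' B2] : exists2 I, I \in trees k z & forall i, i \in I -> B i.
  exact: (IH _ _ _ (rconn_sym (@star_sym d) cuv) dz zu).
exists (I1 ++ I2); last by move=> i; rewrite mem_cat => /orP[/B1|/B2].
apply: (treesS_intro _ _ _ t1' t2').
- have ar3 (a q : nat) : (a <= 16 * q -> a <= 32 * q + 1)%N by lia.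
  by apply: cand_mem; exact: ar3.
- by apply: cand_mem.
- have ar4 (a b e f g i j q : nat) : (a <= 16 * q -> 2 * (16 * q) < b -> b <= a + e ->
     f <= q -> g <= q -> e <= i + g -> i <= f + j -> 14 * q <= j)%N by lia.
  apply: (ar4 _ _ _ _ _ _ _ _ hu gv t1 dy dz (linf_triangle z u v')).
  by rewrite (linf_distC y u); exact: linf_triangle.
Qed.

Lemma trees_size k x I : I \in trees k x -> size I = (2 ^ k)%N.
Proof.
elim: k x I => [|k IH] x I; first by move=> /mapP [y _ ->].
move=> /treesS [y [z [I1 [I2 [_ _ _ [/IH h1 /IH h2 ->]]]]]].
by rewrite size_cat h1 h2 expnS; lia.
Qed.

Lemma trees_dist k x I i : I \in trees k x -> i \in I -> (linf_dist x i <= 3 * 16 ^ k)%N.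
Proof.
elim: k x I i => [|k IH] x I i.
  by move=> /mapP [y /mem_boxat h ->]; rewrite inE => /eqP ->; lia.
move=> /treesS [y [z [I1 [I2 [/cand_dist hy /cand_dist hz _ [h1 h2 ->]]]]]].
rewrite mem_cat expnS => /orP[/(IH _ _ _ h1)|/(IH _ _ _ h2)] h.
  by have := linf_triangle y x i; lia.
by have := linf_triangle z x i; lia.
Qed.

Variable R : realType.

(** A leaf sees the 2^k leaves of the opposite subtree at distance at least 8*16^k, a contribution
    of at most 8^-(k+1); these form a geometric series with sum 1/7. *)
Lemma trees_separated k x I : I \in trees k x ->
  [/\ uniq I, forall i j, i \in I -> j \in I -> i != j -> (8 <= linf_dist i j)%N
    & forall i, i \in I -> \sum_(j <- I | j != i) (linf_dist i j)%:R^-1 <=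
        7^-1 * (1 - 8^-1 ^+ k) :> R].
Proof.
elim: k x I => [|k IH] x I.
  move=> /mapP [y _ ->]; split=> // [i j|i]; rewrite !inE.
    by move=> /eqP -> /eqP ->; rewrite eqxx.
  move=> /eqP ->; rewrite big_cons eqxx /= big_nil expr0 subrr mulr0.
  by [].
move=> /treesS [y [z [I1 [I2 [_ _ hyz [t1 t2 ->]]]]]].
have p0 : (0 < 16 ^ k)%N by rewrite expn_gt0.
have [u1 d1 s1] := IH _ _ t1; have [u2 d2 s2] := IH _ _ t2.
have far i j : i \in I1 -> j \in I2 -> (8 * 16 ^ k <= linf_dist i j)%N.
  move=> i1 j2; have h1 := trees_dist t1 i1; have h2 := trees_dist t2 j2.
  have := linf_triangle i y z; have := linf_triangle j i z.
  by rewrite (linf_distC j z); lia.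
have far8 i j : i \in I1 -> j \in I2 -> (8 <= linf_dist i j)%N.
  by move=> i1 j2; apply: leq_trans (far _ _ i1 j2); rewrite leq_pmulr.
have ne i j : i \in I1 -> j \in I2 -> i != j.
  by move=> i1 j2; apply/eqP => e; move: (far8 _ _ i1 j2); rewrite e linfxx.
have part J i : size J = (2 ^ k)%N -> (forall j, j \in J -> (8 * 16 ^ k <= linf_dist i j)%N) ->
    \sum_(j <- J | j != i) (linf_dist i j)%:R^-1 <= 8^-1 ^+ k.+1 :> R.
  move=> sJ hJ.
  apply: (@le_trans _ _ (\sum_(j <- J) ((8 * 16 ^ k)%:R^-1 : R))).
    rewrite big_mkcond /= big_seq [leRHS]big_seq ler_sum // => j jJ.
    case: ifP => _; last by rewrite invr_ge0.
    rewrite lef_pV2 ?posrE ?ltr0n ?ler_nat ?hJ // ?muln_gt0 ?p0 //.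
    by apply: leq_trans (hJ _ jJ); rewrite muln_gt0 p0.
  rewrite big_const_seq count_predT iter_addr addr0 sJ -(mulr_natl _ (2 ^ k)).
  rewrite natrM !natrX exprS exprVn.
  have -> : 16 ^+ k = 2 ^+ k * 8 ^+ k :> R by rewrite -exprMn -natrM.
  have n2 : 2 ^+ k != 0 :> R by rewrite expf_neq0.
  have n8 : 8 ^+ k != 0 :> R by rewrite expf_neq0.
  by rewrite le_eqVlt; apply/orP; left; apply/eqP; field; rewrite n2 n8.
have arith : 7^-1 * (1 - 8^-1 ^+ k) + 8^-1 ^+ k.+1 = 7^-1 * (1 - 8^-1 ^+ k.+1) :> R.
  by rewrite exprS; field.
split.
- rewrite cat_uniq u1 u2 andbT /=; apply/hasPn => j j2; apply/negP => j1.
  by have := ne _ _ j1 j2; rewrite eqxx.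
- move=> i j; rewrite !mem_cat => /orP[hi|hi] /orP[hj|hj] nij.
  + exact: d1.
  + exact: far8.
  + by rewrite linf_distC; exact: far8.
  + exact: d2.
- move=> i; rewrite mem_cat big_cat /= -arith => /orP[hi|hi].
    apply: lerD; first exact: s1.
    by apply: part => [|j hj]; [exact: (trees_size t2)|exact: far].
  rewrite addrC; apply: lerD; first exact: s2.
  by apply: part => [|j hj]; [exact: (trees_size t1)|rewrite linf_distC; exact: far].
Qed.

Definition tree_const : nat := ((71 ^ d) ^ 2 * 3 ^ d)%N.

(** There are 71^d candidates for each child, so (71^d)^2 times the count is at most squared from
    one level to the next. *)
Lemma trees_count k x : (size (trees k x) <= tree_const ^ (2 ^ k))%N.
Proof.
suff h y : ((71 ^ d) ^ 2 * size (trees k y) <= tree_const ^ (2 ^ k))%N.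
  apply: leq_trans (h x); rewrite leq_pmull // !expn_gt0 //.
elim: k y => [|k IH] y.
  by rewrite /= size_map size_boxat expn0 expn1.
have c1 y' : (size (cand k y') = 71 ^ d)%N by rewrite size_map size_boxseq.
have sz : (size (trees k.+1 y) <= (71 ^ d) ^ 2 * (\max_(z <- cand k y) size (trees k z)) ^ 2)%N.
  rewrite /= size_flatten /shape -map_comp sumnE big_map.
  set M := (\max_(z <- _) _)%N.
  apply: (@leq_trans (\sum_(a <- cand k y) 71 ^ d * M ^ 2)%N); last first.
    by rewrite big_const_seq count_predT c1 iter_addn_0; nia.
  rewrite big_seq [leqRHS]big_seq; apply: leq_sum => a ay /=.
  rewrite size_flatten /shape -map_comp sumnE big_map.
  apply: (@leq_trans (\sum_(z <- cand k y) M ^ 2)%N); last first.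
    by rewrite big_const_seq count_predT c1 iter_addn_0; nia.
  rewrite big_filter big_mkcond big_seq [leqRHS]big_seq; apply: leq_sum => z zy /=.
  case: ifP => // _; rewrite size_allpairs -mulnn; apply: leq_mul.
    by rewrite /M; exact: (leq_bigmax_seq (F := fun z => size (trees k z)) a ay).
  by rewrite /M; exact: (leq_bigmax_seq (F := fun z => size (trees k z)) z zy).
have [M0|[z [zc zM]]] : (\max_(z <- cand k y) size (trees k z))%N = 0%N \/
    exists z, z \in cand k y /\ (\max_(z <- cand k y) size (trees k z))%N = size (trees k z).
  elim: (cand k y) => [|a l [e|[z [zl e]]]]; first by left; rewrite big_nil.
    right; exists a; rewrite mem_head big_cons e maxn0 //.
  right; rewrite big_cons e; case: (leqP (size (trees k a)) (size (trees k z))) => h.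
    by exists z; rewrite inE zl orbT.
  by exists a; rewrite mem_head.
  move: sz; rewrite M0 exp0n // muln0 leqn0 => /eqP ->.
  by rewrite muln0.
rewrite zM in sz; apply: leq_trans (leq_mul (leqnn _) sz) _.
have h := IH z.
have -> : (tree_const ^ (2 ^ k.+1) = (tree_const ^ (2 ^ k)) ^ 2)%N by rewrite expnS mulnC expnM.
rewrite (_ : (_ * (_ * _))%N = (((71 ^ d) ^ 2 * size (trees k z)) ^ 2)%N); last first.
  by rewrite expnMn -!mulnn; nia.
by rewrite leq_exp2r.
Qed.

End Trees.

(** * Boxes, shells and grids at the block scale *)

Section Geometry.
Variables (d h : nat).
Hypothesis hd : (3 <= d)%N.
Hypothesis h0 : (0 < h)%N.
Local Notation V := 'rV[int]_d.
Local Notation nn := (@nearest_neighbor d).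
Implicit Types (x z c tau : V).

Let hd1 : (1 < d)%N. Proof. exact: ltnW. Qed.

Definition rho : nat := (2 * h)%N.

Lemma rho_gt0 : (0 < rho)%N. Proof. by rewrite /rho muln_gt0. Qed.

Definition boxctr tau x : V := \row_j (rho%:Z * (tau ord0 j + 4 * x ord0 j)).
(** A closed box without the points having two extremal coordinates, so that each of its points at
    distance [rho] lies in the interior of exactly one face. *)
Definition inbox c : pred V := fun z => (linf_dist c z <= rho)%N &&
  (#|[set j | `|c ord0 j - z ord0 j|%N == rho]%SET| <= 1)%N.
Definition grid z : bool := [exists k, [forall j, (j != k) ==> (rho%:Z %| z ord0 j)%Z]].
(** Lines of mesh [rho] in the shell just outside the box. These shells avoid every box of the same
    shift, so their vacancy is not affected by changes inside the boxes. *)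
Definition gam tau x : seq V :=
  [seq z <- boxat (boxctr tau x) (2 * rho) | grid z && (rho < linf_dist (boxctr tau x) z)%N].
(** The radius 5 covers the shells of all shifts: offset at most 3, shell radius 2. *)
Definition gamAll x : seq V := [seq z <- boxat (boxctr 0 x) (5 * rho) | grid z].

Definition is_tau tau : Prop := forall j, 0 <= tau ord0 j <= 3.
Definition taus : seq V :=
  [seq (\row_j ((f : {ffun 'I_d -> 'I_4}) j : nat)%:Z : V) | f <- enum {ffun 'I_d -> 'I_4}].

Lemma size_taus : size taus = (4 ^ d)%N.
Proof. by rewrite size_map -cardE card_ffun !card_ord. Qed.

Lemma mem_taus tau : (tau \in taus) <-> is_tau tau.
Proof.
split; first by move=> /mapP [f _ ->] j; rewrite mxE; case: (f j) => q /= hq; lia.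
move=> ht; apply/mapP; exists [ffun i => inord (absz (tau ord0 i))]; first by rewrite mem_enum.
by apply: linf_eq => i; rewrite mxE ffunE inordK; have := ht i; lia.
Qed.

Definition site_of z : V := \row_j divz (z ord0 j + h%:Z) (8 * h)%:Z.
Definition tau_of z : V := \row_j modz (divz (z ord0 j + h%:Z) (2 * h)%:Z) 4.

Lemma gridP z : grid z -> exists k, exists w : V, forall j, j != k -> z ord0 j = rho%:Z * w ord0 j.
Proof.
move=> /existsP [k /forallP hk]; exists k.
exists (\row_j divz (z ord0 j) rho%:Z) => j jk; rewrite mxE mulrC divzK //.
exact: (implyP (hk j)).
Qed.

Lemma grid_intro z k : (forall j, j != k -> exists q : int, z ord0 j = rho%:Z * q) -> grid z.
Proof.
move=> hz; apply/existsP; exists k; apply/forallP => j; apply/implyP => jk.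
by have [q ->] := hz j jk; apply: dvdz_mulr.
Qed.

Lemma mem_gam tau x z : (z \in gam tau x) <->
  [/\ grid z, (rho < linf_dist (boxctr tau x) z)%N & (linf_dist (boxctr tau x) z <= 2 * rho)%N].
Proof.
rewrite mem_filter; split; first by move=> /andP[/andP[? ?] /mem_boxat].
by case=> -> -> ?; apply/mem_boxat.
Qed.

Lemma mem_gamAll x z : (z \in gamAll x) <-> grid z /\ (linf_dist (boxctr 0 x) z <= 5 * rho)%N.
Proof.
rewrite mem_filter; split; first by move=> /andP[? /mem_boxat].
by case=> -> ?; apply/mem_boxat.
Qed.

Lemma inbox_dist c z : inbox c z -> (linf_dist c z <= rho)%N.
Proof. by case/andP. Qed.

Lemma boxctr_dist tau x x' : linf_dist (boxctr tau x) (boxctr tau x') = (4 * rho * linf_dist x x')%N.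
Proof.
apply/eqP; rewrite eqn_leq; apply/andP; split.
  apply/linfP => j; rewrite !mxE; have := linf_coord x x' j.
  by move: (x ord0 j) (x' ord0 j) (tau ord0 j) => a b t; nia.
have [->|l0] := posnP (linf_dist x x'); first by rewrite muln0.
have [j hj] := @linf_gt d x x' (linf_dist x x').-1 (ltac:(lia)).
apply: leq_trans (linf_coord _ _ j); rewrite !mxE.
have -> : rho%:Z * (tau ord0 j + 4 * x ord0 j) - rho%:Z * (tau ord0 j + 4 * x' ord0 j) =
  (4 * rho)%:Z * (x ord0 j - x' ord0 j) by rewrite PoszM; ring.
by rewrite abszM absz_nat leq_mul2l; apply/orP; right; lia.
Qed.

Lemma box_disjoint tau x x' z : (linf_dist (boxctr tau x) z <= rho)%N ->
  (linf_dist (boxctr tau x') z <= rho)%N -> x = x'.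
Proof.
move=> hx hx'; have := linf_triangle z (boxctr tau x) (boxctr tau x').
rewrite boxctr_dist (linf_distC z) => h1; have r0 := rho_gt0.
have h2 : (linf_dist x x' = 0)%N by nia.
apply: linf_eq => j; have := linf_coord x x' j; rewrite h2; lia.
Qed.

Lemma gam_box tau x x' z : z \in gam tau x -> inbox (boxctr tau x') z -> False.
Proof.
move=> /mem_gam [_ h1 h2] /inbox_dist h3.
have := linf_triangle z (boxctr tau x) (boxctr tau x').
rewrite boxctr_dist (linf_distC z) => h4; have r0 := rho_gt0.
have h5 : (linf_dist x x' = 0)%N by nia.
have e : x = x' by apply: linf_eq => j; have := linf_coord x x' j; rewrite h5; lia.
by move: h1; rewrite e ltnNge h3.
Qed.

Lemma gam_sub tau x z : is_tau tau -> z \in gam tau x -> z \in gamAll x.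
Proof.
move=> ht /mem_gam [g _ h2]; apply/mem_gamAll; split=> //.
have h3 : (linf_dist (boxctr 0 x) (boxctr tau x) <= 3 * rho)%N.
  apply/linfP => j; rewrite !mxE; have := ht j.
  by move: (x ord0 j) (tau ord0 j) => a t; have := rho_gt0; nia.
by have := linf_triangle (boxctr tau x) (boxctr 0 x) z; lia.
Qed.

(** Rounding to the mesh 2h and splitting the quotient modulo 4 puts every point within half a
    radius of a centre of some shift. *)
Lemma site_tau z : is_tau (tau_of z) /\
  (linf_dist (boxctr (tau_of z) (site_of z)) z <= h)%N.
Proof.
split; first by move=> j; rewrite mxE; have := modz_ge0 (divz (z ord0 j + h%:Z) (2 * h)%:Z) (ltac:(by []) : (4 : int) != 0); have := ltz_pmod (divz (z ord0 j + h%:Z) (2 * h)%:Z) (ltac:(by []) : (0 : int) < 4); lia.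
apply/linfP => j; rewrite !mxE.
set a := z ord0 j + h%:Z.
have e8 : (8 * h)%:Z = (2 * h)%:Z * 4 by lia.
have e1 := divz_eq a (2 * h)%:Z.
have e2 := divz_eq (divz a (2 * h)%:Z) 4.
have e3 : divz a (8 * h)%:Z = divz (divz a (2 * h)%:Z) 4.
  by rewrite e8 -divzMA_ge0 //; lia.
rewrite e3; have hn : (2 * h)%:Z != 0 by lia.
have m1 := modz_ge0 a hn; have m2 : modz a (2 * h)%:Z < (2 * h)%:Z by rewrite ltz_pmod //; lia.
rewrite /rho [_ + _ * divz _ _]addrC [4 * _]mulrC -e2.
have : z ord0 j = a - h%:Z by rewrite /a; lia.
move=> ->; move: e1 m1 m2; move: (divz a _) (modz a _) => q r e1 m1 m2.
rewrite {}e1; have -> : (2 * h)%:Z * q = q * (2 * h)%:Z by rewrite mulrC.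
lia.
Qed.

Lemma site_of_star z z' : nearest_neighbor z z' -> star (site_of z) (site_of z').
Proof.
move/nnP => [i [hi hj]]; apply/linfP => j; rewrite !mxE.
have [->|ji] := eqVneq j i; last by rewrite hj // subrr.
set a := z ord0 i + h%:Z; set b := z' ord0 i + h%:Z.
have hab : `|a - b|%N = 1%N by rewrite /a /b; lia.
have hn : (8 * h)%:Z != 0 by lia.
have := divz_eq a (8 * h)%:Z; have := divz_eq b (8 * h)%:Z.
have := modz_ge0 a hn; have : modz a (8 * h)%:Z < (8 * h)%:Z by rewrite ltz_pmod //; lia.
have := modz_ge0 b hn; have : modz b (8 * h)%:Z < (8 * h)%:Z by rewrite ltz_pmod //; lia.
move: (divz a _) (modz a _) (divz b _) (modz b _) => q r q' r' h1 h2 h3 h4 e1 e2.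
have : (absz ((q - q') * (8 * h)%:Z)%R <= 8 * h)%N.
  have -> : (q - q') * (8 * h)%:Z = (a - b) - (r - r') by rewrite e1 e2; ring.
  by lia.
rewrite abszM absz_nat -{2}[(8 * h)%N]mul1n leq_pmul2r //; lia.
Qed.

Definition pt tau x (u : V) : V := \row_j (boxctr tau x ord0 j + rho%:Z * u ord0 j).

Lemma ptE tau x u j : pt tau x u ord0 j = boxctr tau x ord0 j + rho%:Z * u ord0 j.
Proof. by rewrite mxE. Qed.

Lemma pt_lift tau x (Z A : set V) u u' :
  (forall v v', A v -> A v' -> nearest_neighbor v v' -> path_in Z (pt tau x v) (pt tau x v')) ->
  Z (pt tau x u) -> rconn nn A u u' -> path_in Z (pt tau x u) (pt tau x u').
Proof.
move=> st Zu c.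
apply: (vconn_inv (A := [set v | path_in Z (pt tau x u) (pt tau x v)]) c).
  exact: rconn_refl.
by move=> v v' Av Av' nv cv; apply: (rconn_trans cv); exact: st.
Qed.

Lemma pt_line tau x Z v v' : nearest_neighbor v v' ->
  (forall z, (exists k, (forall j, j != k -> v ord0 j = v' ord0 j /\
      z ord0 j = boxctr tau x ord0 j + rho%:Z * v ord0 j) /\ v ord0 k != v' ord0 k /\
      btw (boxctr tau x ord0 k + rho%:Z * v ord0 k) (z ord0 k)
         (boxctr tau x ord0 k + rho%:Z * v' ord0 k)) -> Z z) ->
  path_in Z (pt tau x v) (pt tau x v').
Proof.
move=> /nnP [i [hi hj]] hZ.
have -> : pt tau x v' = upd (pt tau x v) i (boxctr tau x ord0 i + rho%:Z * v' ord0 i).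
  by apply: linf_eq => j; rewrite updE !mxE; case: eqP => [->//|/eqP /hj ->].
apply: line_conn => a; rewrite ptE => ha; apply: hZ; exists i; split.
  by move=> j ji; rewrite updE (negPf ji) mxE hj.
rewrite updE eqxx; split=> //; apply/eqP => e; move: hi; rewrite e subrr.
by [].
Qed.

(** Each point slides along its grid line to a mesh point at distance 2 [rho]: towards the centre if
    another coordinate is already extremal, outwards otherwise. The mesh points form a copy of the
    sphere of radius 2, which is connected. *)
Lemma gam_conn tau x z z' : z \in gam tau x -> z' \in gam tau x ->
  path_in [set` gam tau x] z z'.
Proof.
have r0 := rho_gt0.
pose c := boxctr tau x.
have cE j : c ord0 j = rho%:Z * (tau ord0 j + 4 * x ord0 j) by rewrite mxE.
pose Z : set V := [set` gam tau x].
have toS (y : V) : y \in gam tau x -> exists2 u : V, @sphere d 2 u & path_in Z y (pt tau x u).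
  move=> /[dup] gy /mem_gam [g h1 h2].
  have [k [w hw]] := gridP g.
  have hyc j : (`|c ord0 j - y ord0 j| <= 2 * rho)%N by apply: leq_trans (linf_coord c y j) h2.
  pose w' : V := \row_j (w ord0 j - (tau ord0 j + 4 * x ord0 j)).
  have yw j : j != k -> y ord0 j = c ord0 j + rho%:Z * w' ord0 j.
    by move=> jk; rewrite hw // cE mxE; ring.
  have w2 j : j != k -> (`|w' ord0 j| <= 2)%N.
    move=> jk; have := hyc j; rewrite yw //.
    rewrite opprD addrA subrr sub0r abszN abszM absz_nat mulnC leq_pmul2r //.
  have mv (s : int) : (`|s| <= 2)%N ->
     (forall a, btw (y ord0 k) a (c ord0 k + rho%:Z * s) -> upd y k a \in gam tau x) ->
     path_in Z y (pt tau x (upd w' k s)).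
    move=> hs ha; have -> : pt tau x (upd w' k s) = upd y k (c ord0 k + rho%:Z * s).
      apply: linf_eq => j; rewrite !(updE, mxE); case: eqP => [->//|/eqP jk].
      by rewrite yw // /c !mxE.
    exact: line_conn.
  have gridu a : grid (upd y k a).
    by apply: (@grid_intro _ k) => j jk; exists (w ord0 j); rewrite updE (negPf jk) hw.
  have [[j [jk j2]]|nj] := pselect (exists j, j != k /\ `|w' ord0 j|%N = 2%N).
    exists (upd w' k 0).
      apply: (nrm_eq hd1 (i := j)); first by rewrite updE (negPf jk).
      by move=> l; rewrite updE; case: (eqVneq l k) => // lk; exact: w2.
    apply: mv => // a; rewrite mulr0 addr0 => ha; apply/mem_gam; split=> //.
      apply: leq_trans (linf_coord _ _ j); rewrite updE (negPf jk) yw //.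
      by rewrite opprD addrA subrr sub0r abszN abszM absz_nat j2; lia.
    apply/linfP => l; rewrite updE; case: (eqVneq l k) => [->|_]; last exact: hyc.
    by have := hyc k; move: ha; rewrite /btw -/c; lia.
  have w1 j : j != k -> (`|w' ord0 j| <= 1)%N.
    move=> jk; have := w2 j jk; have : `|w' ord0 j|%N <> 2%N.
      by move=> e; apply: nj; exists j.
    by lia.
  have hk : (rho < `|c ord0 k - y ord0 k|)%N.
    have [j hj] := linf_gt h1; have [<-//|jk] := eqVneq j k.
    exfalso; move: hj; rewrite yw // opprD addrA subrr sub0r abszN abszM absz_nat.
    by rewrite -{1}[rho]muln1 ltn_pmul2l // ltnNge w1.
  pose s : int := if c ord0 k < y ord0 k then 2 else -2.
  exists (upd w' k s).
    apply: (nrm_eq hd1 (i := k)); first by rewrite updE eqxx /s; case: ifP.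
    move=> l; rewrite updE; case: (eqVneq l k) => [_|lk]; last exact: w2.
    by rewrite /s; case: ifP.
  apply: mv; first by rewrite /s; case: ifP.
  move=> a ha; apply/mem_gam; split=> //.
    apply: leq_trans (linf_coord _ _ k); rewrite updE eqxx -/c.
    by move: ha hk; rewrite /btw /s; case: ifP => ?; lia.
  apply/linfP => l; rewrite updE; case: (eqVneq l k) => [->|_]; last exact: hyc.
  by have := hyc k; move: ha hk; rewrite -/c /btw /s; case: ifP => ?; lia.
have ptg u : @sphere d 2 u -> pt tau x u \in gam tau x.
  move=> hu; have hk k : (`|u ord0 k| <= 2)%N by rewrite -hu; exact: nrm_le hd1 _ _.
  have [i hi] := nrm_coord hd1 (ltac:(by []) : (0 < 2)%N) hu.
  apply/mem_gam; split.
  - apply: (@grid_intro _ i) => j _; exists (tau ord0 j + 4 * x ord0 j + u ord0 j).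
    by rewrite !mxE; ring.
  - apply: leq_trans (linf_coord _ _ i); rewrite ptE.
    by rewrite opprD addrA subrr sub0r abszN abszM absz_nat hi; lia.
  - apply/linfP => j; rewrite ptE opprD addrA subrr sub0r abszN abszM absz_nat mulnC.
    by rewrite leq_pmul2r.
have stp v v' : @sphere d 2 v -> @sphere d 2 v' -> nearest_neighbor v v' ->
    path_in Z (pt tau x v) (pt tau x v').
  move=> hv hv' nv; apply: pt_line => // y [k [hj [hk hb]]].
  have av l : (`|v ord0 l| <= 2)%N by rewrite -hv; exact: nrm_le hd1 _ _.
  have av' l : (`|v' ord0 l| <= 2)%N by rewrite -hv'; exact: nrm_le hd1 _ _.
  have [j [jk j2]] : exists j, j != k /\ `|v ord0 j|%N = 2%N.
    have [i hi] := nrm_coord hd1 (ltac:(by []) : (0 < 2)%N) hv.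
    have [i' hi'] := nrm_coord hd1 (ltac:(by []) : (0 < 2)%N) hv'.
    have [ik|ik] := eqVneq i k; last by exists i.
    have [ik'|ik'] := eqVneq i' k; last by exists i'; split=> //; have [-> _] := hj i' ik'.
    exfalso; move/nnP: nv => [l [hl hl']].
    have lk : l = k.
      by apply/eqP; apply: contraNT hk => lk; rewrite hl' // eq_sym.
    move: hl hi hi'; rewrite ik ik' lk; lia.
  have bnd l : (`|c ord0 l - y ord0 l| <= 2 * rho)%N.
    have [->|lk] := eqVneq l k.
      have := av k; have := av' k; move: hb; rewrite -/c /btw.
      by move: (c ord0 k) (y ord0 k) (v ord0 k) (v' ord0 k) r0 => a b e f r0; nia.
    have [_ ->] := hj l lk; rewrite opprD addrA subrr sub0r abszN abszM absz_nat mulnC.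
    by rewrite leq_pmul2r.
  apply/mem_gam; split; last by apply/linfP.
    apply: (@grid_intro _ k) => l lk; have [_ ->] := hj l lk.
    by exists (tau ord0 l + 4 * x ord0 l + v ord0 l); rewrite mxE; ring.
  apply: leq_trans (linf_coord _ _ j); have [_ ->] := hj j jk.
  by rewrite opprD addrA subrr sub0r abszN abszM absz_nat j2; lia.
move=> /toS [u hu cu] /toS [u' hu' cu'].
apply: (rconn_trans cu); apply: (@rconn_trans _ _ _ _ (pt tau x u')); last first.
  by apply: rconn_sym; [exact: nn_sym|exact: cu'].
apply: (pt_lift stp); first exact: ptg.
by apply: sphere_conn => //; lia.
Qed.

(** The midpoint of the two centres is at distance 2 [rho] from both, hence in both shells. *)
Lemma gam_adj tau x x' : nearest_neighbor x x' ->
  exists2 z, z \in gam tau x & z \in gam tau x'.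
Proof.
have r0 := rho_gt0.
move=> /nnP [i [hi hj]].
pose s : int := x' ord0 i - x ord0 i.
have hs : `|s|%N = 1%N by rewrite /s; lia.
pose z : V := upd (boxctr tau x) i (boxctr tau x ord0 i + rho%:Z * (2 * s)).
have gz : grid z.
  apply: (@grid_intro _ i) => j ji; rewrite updE (negPf ji) mxE.
  by exists (tau ord0 j + 4 * x ord0 j).
have far (y : V) : (forall j, j != i -> y ord0 j = x ord0 j) ->
    (absz (boxctr tau y ord0 i - z ord0 i) = 2 * rho)%N ->
    z \in gam tau y.
  move=> hy hd2; apply/mem_gam; split=> //.
    by apply: leq_trans (linf_coord _ _ i); rewrite hd2; lia.
  apply/linfP => j; have [->|ji] := eqVneq j i; first by rewrite hd2.
  by rewrite updE (negPf ji) !mxE hy // subrr.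
exists z; apply: far => //.
- by rewrite updE eqxx opprD addrA subrr sub0r abszN !abszM absz_nat hs; lia.
- by move=> j ji; rewrite hj.
- rewrite updE eqxx !mxE.
  have -> : x' ord0 i = x ord0 i + s by rewrite /s; lia.
  have -> : rho%:Z * (tau ord0 i + 4 * (x ord0 i + s)) -
    (rho%:Z * (tau ord0 i + 4 * x ord0 i) + rho%:Z * (2 * s)) = rho%:Z * 2 * s by ring.
  by rewrite !abszM absz_nat hs; lia.
Qed.

Lemma gamAll_conn x z z' : z \in gamAll x -> z' \in gamAll x ->
  path_in [set` gamAll x] z z'.
Proof.
have r0 := rho_gt0.
pose c := boxctr 0 x.
have cE j : c ord0 j = rho%:Z * (4 * x ord0 j) by rewrite !mxE add0r.
pose Z : set V := [set` gamAll x].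
have toS (y : V) : y \in gamAll x -> exists2 u : V, lball 0 5 u & path_in Z y (pt 0 x u).
  move=> /[dup] gy /mem_gamAll [g h2].
  have [k [w hw]] := gridP g.
  have hyc j : (`|c ord0 j - y ord0 j| <= 5 * rho)%N by apply: leq_trans (linf_coord c y j) h2.
  pose w' : V := \row_j (if j == k then 0 else w ord0 j - 4 * x ord0 j).
  have yw j : j != k -> y ord0 j = c ord0 j + rho%:Z * w' ord0 j.
    by move=> jk; rewrite hw // cE mxE (negPf jk); ring.
  exists w'.
    apply/lballP => j; have [->|jk] := eqVneq j k; first by rewrite mxE eqxx.
    have := hyc j; rewrite yw // opprD addrA subrr sub0r abszN abszM absz_nat mulnC leq_pmul2r //.
    lia.
  have -> : pt 0 x w' = upd y k (c ord0 k).
    apply: linf_eq => j; rewrite updE [pt _ _ _ _ _]mxE; case: (eqVneq j k) => [->|jk].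
      by rewrite [w' _ _]mxE eqxx mulr0 addr0.
    by rewrite yw.
  apply: line_conn => a ha; apply/mem_gamAll; split.
    by apply: (@grid_intro _ k) => j jk; exists (w ord0 j); rewrite updE (negPf jk) hw.
  apply/linfP => l; rewrite updE; case: (eqVneq l k) => [->|_]; last exact: hyc.
  by have := hyc k; move: ha; rewrite /btw -/c; lia.
have ptg u : lball 0 5 u -> pt 0 x u \in gamAll x.
  move/lballP => hu; apply/mem_gamAll; split.
    apply: (@grid_intro _ (Ordinal (ltac:(lia) : (0 < d)%N))) => j _; exists (4 * x ord0 j + u ord0 j).
    by rewrite !mxE; ring.
  apply/linfP => j; rewrite ptE opprD addrA subrr sub0r abszN abszM absz_nat mulnC.
  by rewrite leq_pmul2r //; have := hu j; lia.
have stp v v' : lball 0 5 v -> lball 0 5 v' -> nearest_neighbor v v' ->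
    path_in Z (pt 0 x v) (pt 0 x v').
  move=> /lballP hv /lballP hv' nv; apply: pt_line => // y [k [hj [hk hb]]].
  apply/mem_gamAll; split.
    apply: (@grid_intro _ k) => l lk; have [_ ->] := hj l lk.
    by exists (4 * x ord0 l + v ord0 l); rewrite !mxE; ring.
  apply/linfP => l; have [->|lk] := eqVneq l k.
    have := hv k; have := hv' k; move: hb; rewrite -/c /btw.
    by move: (c ord0 k) (y ord0 k) (v ord0 k) (v' ord0 k) r0 => a b e f r0; nia.
  have [_ ->] := hj l lk; rewrite opprD addrA subrr sub0r abszN abszM absz_nat mulnC.
  by rewrite leq_pmul2r //; have := hv l; lia.
move=> /toS [u hu cu] /toS [u' hu' cu'].
apply: (rconn_trans cu); apply: (@rconn_trans _ _ _ _ (pt 0 x u')); last first.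
  by apply: rconn_sym; [exact: nn_sym|exact: cu'].
apply: (pt_lift stp); first exact: ptg.
apply: box_conn => y hy; apply/lballP => j.
by move/lballP: hu => /(_ j); move/lballP: hu' => /(_ j); have := hy j; rewrite /btw; lia.
Qed.

(** Moving towards the centre along the free coordinate stays in the grid. This segment produces the
    logarithm in the potential of the grid at its own points. *)
Lemma gamAll_line x z : z \in gamAll x -> exists (k : 'I_d) (s : int), `|s|%N = 1%N /\
  forall t : nat, (t <= rho)%N -> upd z k (z ord0 k + s * t%:Z) \in gamAll x.
Proof.
have r0 := rho_gt0.
move=> /mem_gamAll [g h2]; have [k [w hw]] := gridP g.
pose c := boxctr 0 x.
pose s : int := if c ord0 k < z ord0 k then -1 else 1.
exists k, s; split; first by rewrite /s; case: ifP.
move=> t tr; apply/mem_gamAll; split.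
  by apply: (@grid_intro _ k) => j jk; exists (w ord0 j); rewrite updE (negPf jk) hw.
apply/linfP => l; rewrite updE; case: (eqVneq l k) => [->|_]; last first.
  exact: leq_trans (linf_coord _ _ l) h2.
have := leq_trans (linf_coord _ _ k) h2; rewrite -/c /s; case: ifP => ?; lia.
Qed.

(** Only one coordinate is free, the others take at most 11 values each: the size is linear in
    [rho]. *)
Lemma size_gamAll x : (size (gamAll x) <= d * 11 ^ d * (11 * rho))%N.
Proof.
have r0 := rho_gt0.
pose f (p : ('I_d * {ffun 'I_d -> 'I_11}) * 'I_(11 * rho)) : V :=
  \row_j (if j == p.1.1 then boxctr 0 x ord0 j + (p.2 : nat)%:Z - (5 * rho)%:Z
          else boxctr 0 x ord0 j + rho%:Z * ((p.1.2 j : nat)%:Z - 5)).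
have -> : (d * 11 ^ d * (11 * rho))%N = size [seq f p | p <- enum {: ('I_d * {ffun 'I_d -> 'I_11}) * 'I_(11 * rho)}].
  by rewrite size_map -cardE !card_prod card_ffun !card_ord.
apply: uniq_leq_size.
  rewrite filter_uniq // /boxat map_inj_uniq ?uniq_boxseq //; exact: addrI.
move=> z0; move: (z0 : V) => z {z0} /mem_gamAll [g h2]; have [k [w hw]] := gridP g.
have hz j : (`|boxctr 0 x ord0 j - z ord0 j| <= 5 * rho)%N.
  exact: leq_trans (linf_coord _ _ j) h2.
pose p : ('I_d * {ffun 'I_d -> 'I_11}) * 'I_(11 * rho) :=
  ((k, [ffun j => inord (absz (w ord0 j - 4 * x ord0 j + 5))]),
   insubd (Ordinal (ltac:(lia) : (0 < 11 * rho)%N)) (absz (z ord0 k - boxctr 0 x ord0 k + (5 * rho)%:Z))).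
apply/mapP; exists p; first by rewrite mem_enum.
apply: linf_eq => j; rewrite mxE /=; case: (eqVneq j k) => [->|jk].
  by rewrite val_insubd ifT; have := hz k; lia.
have := hz j; rewrite hw // ffunE !mxE !add0r.
have -> : rho%:Z * (4 * x ord0 j) - rho%:Z * w ord0 j = rho%:Z * (4 * x ord0 j - w ord0 j) by ring.
rewrite abszM absz_nat mulnC leq_pmul2r // => h5.
rewrite inordK; last by lia.
have -> : (absz (w ord0 j - 4 * x ord0 j + 5) : int) = w ord0 j - 4 * x ord0 j + 5 by lia.
by ring.
Qed.

End Geometry.

(** * Loop surgery: rerouting excursions in a box *)

Section Words.
Variable T : eqType.
Implicit Types (A : seq T).

Fixpoint words A n : seq (seq T) :=
  if n is n'.+1 then [::] :: [seq x :: w | x <- A, w <- words A n'] else [:: [::]].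

Lemma size_words A n : (size (words A n) <= (size A).+1 ^ n)%N.
Proof.
elim: n => //= n IH; rewrite size_allpairs expnS mulSn.
by rewrite -add1n leq_add ?expn_gt0 // leq_mul.
Qed.

Lemma mem_words A n w : (size w <= n)%N -> (forall x, x \in w -> x \in A) -> w \in words A n.
Proof.
elim: n w => [|n IH] [|x w] //= hs hw; rewrite inE; apply/orP; right.
apply/allpairsP; exists (x, w); rewrite /= hw ?mem_head; split=> //.
by apply: IH => // y yw; apply: hw; rewrite inE yw orbT.
Qed.

Definition cyc_edges (x0 : T) (s : seq T) : seq (T * T) := pairmap pair (last x0 s) s.

Lemma cyc_edges_rot x0 k s : perm_eq (cyc_edges x0 (rot k s)) (cyc_edges x0 s).
Proof.
rewrite -{2}(cat_take_drop k s) /rot.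
case: (take k s) (drop k s) => [|x p] [|y q]; rewrite ?cats0 //.
by rewrite /cyc_edges !pairmap_cat !last_cat perm_catC.
Qed.

Lemma mem_pairmap_cat (x : T) s1 s2 e : (e \in pairmap pair x (s1 ++ s2)) =
  (e \in pairmap pair x s1) || (e \in pairmap pair (last x s1) s2).
Proof. by rewrite pairmap_cat mem_cat. Qed.

Variable b : pred T.

Lemma block_split (o1 o2 i1 i2 s1 s2 : seq T) :
  all (predC b) o1 -> all (predC b) o2 -> all b i1 -> all b i2 -> i1 != [::] -> i2 != [::] ->
  (forall x p, s1 = x :: p -> ~~ b x) -> (forall x p, s2 = x :: p -> ~~ b x) ->
  o1 ++ i1 ++ s1 = o2 ++ i2 ++ s2 -> [/\ o1 = o2, i1 = i2 & s1 = s2].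
Proof.
move=> ho1 ho2 hi1 hi2 n1 n2 h1 h2 e.
have fo o i s : all (predC b) o -> all b i -> i != [::] -> find b (o ++ i ++ s) = size o.
  move=> ho hi ni; rewrite find_cat ifN; last by rewrite -all_predC.
  by case: i hi ni => //= x i /andP[-> _] _; rewrite addn0.
have fi i s : all b i -> (forall x p, s = x :: p -> ~~ b x) ->
    find (predC b) (i ++ s) = size i.
  move=> hi hs; rewrite find_cat ifN; last by rewrite has_predC hi.
  by case: s hs => [|x p] hs /=; rewrite ?addn0 // (hs x p) // addn0.
have so : size o1 = size o2 by rewrite -(fo o1 i1 s1) // e fo.
move/eqP: e; rewrite eqseq_cat // => /andP[/eqP -> /eqP e].
have si : size i1 = size i2 by rewrite -(fi i1 s1) // e fi.
by move/eqP: e; rewrite eqseq_cat // => /andP[/eqP -> /eqP ->].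
Qed.

Lemma block_exists (s : seq T) x0 : ~~ b (head x0 s) -> b (last x0 s) ->
  exists o i r, [/\ s = o ++ i ++ r, o != [::], all (predC b) o, i != [::] & all b i] /\
    (forall x p, r = x :: p -> ~~ b x).
Proof.
case: s => [|x s] hh hl; first by rewrite /= hl in hh.
have hb : has b (x :: s).
  by apply/hasP; exists (last x s) => //; exact: mem_last.
set n := find b (x :: s); set t := drop n (x :: s).
have n0 : (0 < n)%N by rewrite /n /= (negPf hh).
set m := find (predC b) t.
exists (take n (x :: s)), (take m t), (drop m t); split; first split.
- by rewrite !cat_take_drop.
- by rewrite -size_eq0 size_takel ?find_size // -lt0n.
- apply/allP => y /(nthP x) [i]; rewrite size_takel ?find_size // => hi <-.
  by rewrite nth_take //= before_find.
- have nt : (n < size (x :: s))%N by rewrite -has_find.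
  have bt : b (head x t).
    by rewrite -nth0 nth_drop addn0 nth_find.
  rewrite -size_eq0 size_takel ?find_size // -lt0n /m.
  have : (0 < size t)%N by rewrite size_drop subn_gt0.
  by case: (t) bt => //= y q ->.
- apply/allP => y /(nthP x) [i]; rewrite size_takel ?find_size // => hi <-.
  by rewrite nth_take //; have := before_find x hi => /= /negbFE.
- move=> y p e; have hm : (m < size t)%N.
    have : (0 < size (drop m t))%N by rewrite e.
    by rewrite size_drop subn_gt0.
  have := nth_find x (a := predC b) (s := t); rewrite has_find => /(_ hm) /=.
  by rewrite -/m -[m]addn0 -nth_drop e.
Qed.

End Words.

Section Surgery.
Variable d : nat.
Local Notation V := 'rV[int]_d.
Local Notation nn := (@nearest_neighbor d).
Variables (b pi : pred V) (bl : seq V) (route : V -> V -> seq V) (m : nat).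
Hypothesis blP : forall z, b z -> z \in bl.
Hypothesis pib : forall z, pi z -> b z.
Hypothesis routeP : forall u v, b u -> ~~ pi u -> b v -> ~~ pi v ->
  [/\ exists p, route u v = u :: p /\ path nn u p, last u (route u v) = v,
    all b (route u v), all (predC pi) (route u v) & (size (route u v) <= m)%N].
Implicit Types (s : seq V) (t : loop d).

(** The input is a loop cut so that it starts outside the box and ends inside. Every maximal inside
    block is replaced by the prescribed route between its end points, and the third argument records
    the original blocks. *)
Inductive surg : seq V -> seq V -> seq (seq V) -> Prop :=
| surg0 : surg [::] [::] [::]
| surgS (o i s s' : seq V) (C : seq (seq V)) (x0 : V) : o != [::] -> all (predC b) o -> i != [::] -> all b i ->
   ~~ pi (head x0 i) -> ~~ pi (last x0 i) -> surg s s' C ->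
   surg (o ++ i ++ s) (o ++ route (head x0 i) (last x0 i) ++ s') (i :: C).

Lemma surg_head s s' C : surg s s' C ->
  (forall x p, s' = x :: p -> ~~ b x) /\ (forall x, head x s = head x s').
Proof.
case=> [|o i s1 s1' C1 x0]; first by split.
by case: o => // y o _ /= /andP[hy _] _ _ _ _ _; split=> // x p [<- _].
Qed.

Lemma routeE x0 i : i != [::] -> all b i -> ~~ pi (head x0 i) -> ~~ pi (last x0 i) ->
  [/\ exists p, route (head x0 i) (last x0 i) = head x0 i :: p /\ path nn (head x0 i) p,
    forall x, last x (route (head x0 i) (last x0 i)) = last x i,
    all b (route (head x0 i) (last x0 i)), all (predC pi) (route (head x0 i) (last x0 i))
    & (size (route (head x0 i) (last x0 i)) <= m)%N].
Proof.
case: i => // y i _ hb h1 h2 /=.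
have bl' : b (last y i) by apply: (allP hb); exact: mem_last.
have by' : b y by apply: (allP hb); exact: mem_head.
have [[p [e1 e2]] l ab ap sz] := routeP by' h1 bl' h2.
split; [by exists p| |by []|by []|by []].
by move=> x; move: l; rewrite e1 /=.
Qed.

Lemma surg_last s s' C x : surg s s' C -> last x s = last x s'.
Proof.
move=> h; elim: s s' C / h x => [//|o i s s' C x0 no ho ni hi h1 h2 _ IH] x.
have [_ l _ _ _] := routeE ni hi h1 h2.
by rewrite !last_cat l.
Qed.

(** The blocks of s' are located by b alone, so the record suffices to undo the surgery; this bounds
    the number of preimages. *)
Lemma surg_inj s1 s2 s' C : surg s1 s' C -> surg s2 s' C -> s1 = s2.
Proof.
move=> h; elim: s1 s' C / h s2 => [|o i s s' C x0 no ho ni hi h1 h2 hs IH] s2 h.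
  by inversion h.
have [[p [e1 _]] _ ab _ _] := routeE ni hi h1 h2.
inversion h as [|o2 i2 s3 s3' C' x1 no2 ho2 ni2 hi2 h12 h22 hs2 E1 E2 [E3 E4]]; subst.
have [[p2 [e12 _]] _ ab2 _ _] := routeE ni2 hi2 h12 h22.
have [] := block_split ho2 ho ab2 ab _ _ (surg_head hs2).1 (surg_head hs).1 E2.
- by rewrite e12.
- by rewrite e1.
by move=> -> _ e; rewrite e in hs2; rewrite (IH _ hs2).
Qed.

Definition both_in (e : V * V) : bool := b e.1 && b e.2.

Lemma filter_inside x i : b x -> all b i -> [seq e <- pairmap pair x i | ~~ both_in e] = [::].
Proof. by elim: i x => //= y i IH x hx /andP[hy hi]; rewrite /both_in /= hx hy /= IH. Qed.

Lemma surg_edges s s' C x : surg s s' C ->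
  [seq e <- pairmap pair x s | ~~ both_in e] = [seq e <- pairmap pair x s' | ~~ both_in e].
Proof.
move=> h; elim: s s' C / h x => [//|o i s s' C x0 no ho ni hi h1 h2 _ IH] x.
have [[p [e1 _]] l ab _ _] := routeE ni hi h1 h2.
rewrite !pairmap_cat !filter_cat; congr (_ ++ _).
rewrite l IH; congr (_ ++ _); rewrite e1.
move: ab; rewrite e1; case: i ni hi h1 h2 e1 l => // y i _ /= /andP[hy hi] _ _ _ _ /andP[_ hp].
by case: ifP => _; rewrite !filter_inside.
Qed.

Lemma surg_outside s s' C : surg s s' C ->
  [seq z <- s | ~~ b z] = [seq z <- s' | ~~ b z].
Proof.
move=> h; elim: s s' C / h => [//|o i s s' C x0 no ho ni hi h1 h2 _ IH].
have [[p [e1 _]] l ab _ _] := routeE ni hi h1 h2.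
have n0 q : all b q -> [seq z <- q | ~~ b z] = [::].
  by move=> hq; apply/eqP; rewrite -[_ == _]negbK -has_filter; apply/hasPn => z /(allP hq) ->.
by rewrite !filter_cat (n0 i) // (n0 (route _ _)) // IH.
Qed.

Lemma surg_path s s' C x : surg s s' C -> path nn x s -> path nn x s'.
Proof.
move=> h; elim: s s' C / h x => [//|o i s s' C x0 no ho ni hi h1 h2 _ IH] x.
have [[p [e1 hp]] l ab _ _] := routeE ni hi h1 h2.
rewrite !cat_path l => /and3P[-> hi' /IH ->]; rewrite andbT /= e1 /= hp andbT.
by case: i ni hi' {hi h1 h2 e1 hp l ab} => //= y i _ /andP[].
Qed.

Lemma surg_pi s s' C : surg s s' C -> all (predC pi) s'.
Proof.
move=> h; elim: s s' C / h => [//|o i s s' C x0 no ho ni hi h1 h2 _ IH].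
have [_ _ _ ap _] := routeE ni hi h1 h2.
rewrite !all_cat ap IH !andbT; apply: sub_all ho => z /=.
by apply: contra; exact: pib.
Qed.

Lemma surg_size s s' C : surg s s' C ->
  [/\ (size s' <= size s + m * size C)%N, (size C <= count b s)%N,
    (count b s' <= m * size C)%N,
    forall i, i \in C -> (size i <= count b s)%N
  & forall i z, i \in C -> z \in i -> z \in bl].
Proof.
move=> h; elim: s s' C / h => [//|o i s s' C x0 no ho ni hi h1 h2 _ [IH1 IH2 IH3 IH4 IH5]].
have [_ _ ab _ sz] := routeE ni hi h1 h2.
have ci : count b i = size i by apply/eqP; rewrite -all_count.
have co : count b o = 0%N.
  by apply/eqP; rewrite -leqn0 leqNgt -has_count -all_predC.
have i0 : (0 < size i)%N by rewrite lt0n size_eq0.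
split; rewrite ?size_cat ?count_cat ?co ?ci /=.
- by rewrite mulnS; move: IH1 sz; move: (size (route _ _)) => q; lia.
- by lia.
- rewrite mulnS; apply: leq_add IH3; exact: leq_trans (count_size _ _) sz.
- by rewrite add0n => j; rewrite inE => /orP[/eqP ->|/IH4 q]; [exact: leq_addr|exact: leq_trans q (leq_addl _ _)].
- move=> j z; rewrite inE => /orP[/eqP -> zi|]; last exact: IH5.
  by apply: blP; exact: (allP hi).
Qed.

(** No crossing of the box boundary happens at pi, so each excursion has end points between which a
    route avoiding pi is available. *)
Definition pi_free (e : V * V) : bool :=
  (~~ b e.1 && b e.2 ==> ~~ pi e.2) && (b e.1 && ~~ b e.2 ==> ~~ pi e.1).

Lemma surg_exists x s : (s = [::] \/ ~~ b (head x s) /\ b (last x s)) ->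
  all pi_free (pairmap pair x s) -> (s != [::] -> ~~ pi (last x s)) ->
  exists s' C, surg s s' C.
Proof.
have [n] := ubnP (size s); elim: n s x => // n IH s x hn.
case=> [->|[hh hl]]; first by exists [::], [::]; exact: surg0.
have [ o [i [r [[e no ho ni hi] hr]]]] := block_exists hh hl.
rewrite e !pairmap_cat !all_cat => /and3P[_ ai ar] hlast.
have hi1 : ~~ pi (head x i).
  case: i ni hi ai {e hlast ar} => // y i _ /= /andP[hy _] /andP[+ _].
  rewrite /pi_free /= hy andbT => /andP[/implyP + _]; apply.
  case: o no ho => // z o _ ho /=; apply: (allP ho); exact: mem_last.
have li y : last y i = last x i by case: i ni {hi hi1 hlast e ai ar}.
have bi : b (last x i).
  by case: i ni hi {hi1 hlast e ai ar li} => // y i _ hi /=; apply: (allP hi); exact: mem_last.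
have hi2 : ~~ pi (last x i).
  case: r hr e hlast ar => [|y r] hr e hlast /=.
    by move=> _; rewrite cats0 last_cat li in hlast; apply: hlast; case: (o) no.
  rewrite li => /andP[]; rewrite /pi_free /= bi (hr y r erefl) /= => -> _.
  by [].
have [s' [C hs]] : exists s' C, surg r s' C.
  apply: (IH r (last (last x o) i)).
  - by move: hn; rewrite e !size_cat; case: (o) no => //= ? ? _; lia.
  - case: r hr e {ar hlast} => [|y r] hr e; [by left|right; split; first exact: hr].
    by rewrite e !last_cat in hl.
  - by [].
  - by move=> nr; have := hlast; rewrite !last_cat; apply; case: (o) no.
by exists (o ++ route (head x i) (last x i) ++ s'), (i :: C); apply: surgS.
Qed.

End Surgery.

Section LoopSurgery.
Variables (R : realType) (d : nat).
Local Notation V := 'rV[int]_d.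
Local Notation nn := (@nearest_neighbor d).
Variables (b pi : pred V) (bl : seq V) (route : V -> V -> seq V) (m K : nat).
Hypothesis d0 : (0 < d)%N.
Hypothesis blP : forall z, b z -> z \in bl.
Hypothesis pib : forall z, pi z -> b z.
Hypothesis routeP : forall u v, b u -> ~~ pi u -> b v -> ~~ pi v ->
  [/\ exists p, route u v = u :: p /\ path nn u p, last u (route u v) = v,
    all b (route u v), all (predC pi) (route u v) & (size (route u v) <= m)%N].
Implicit Types (s : seq V) (t : loop d).
Local Notation sg := (surg b pi route).

Definition edges_of t : seq (V * V) := cyc_edges 0 (rep t).
Definition exit_edge (e : V * V) : bool := b e.1 && ~~ b e.2.
Definition exits t : nat := count exit_edge (edges_of t).
Definition marked s : bool := ~~ b (head 0 s) && b (last 0 s).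
Definition entry_free t : bool := all (pi_free b pi) (edges_of t).

Lemma last_rot (x : V) k s : (k < size s)%N -> last x (rot k s) = nth x (last x s :: s) k.
Proof.
move=> ks; rewrite /rot last_cat; case: k ks => [|k] ks; first by rewrite take0 drop0.
by rewrite (last_nth x) size_takel ?(ltnW ks) //= nth_take.
Qed.

Lemma nmarksE s : nmarks marked s = count exit_edge (cyc_edges 0 s).
Proof.
rewrite /nmarks -[in RHS](mkseq_nth (0, 0) (cyc_edges 0 s)) count_map.
rewrite /cyc_edges size_pairmap.
apply: eq_in_count => k; rewrite mem_iota add0n /= => ks.
rewrite /marked /exit_edge last_rot //= (nth_pairmap 0) //=.
by rewrite -nth0 /rot nth_cat size_drop subn_gt0 ks nth_drop addn0 andbC.
Qed.

Lemma exits_visits t : (exits t <= visits b t)%N.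
Proof.
rewrite /exits /visits /edges_of /cyc_edges.
case: (rep t) => // y s; rewrite [X in count b X]lastI -cats1 count_cat addnC.
apply: (@leq_trans (count (b \o fst) (pairmap pair (last 0 (y :: s)) (y :: s)))).
  by apply: sub_count => e /andP[].
rewrite -count_map; have -> x q : [seq e.1 | e <- pairmap pair x q] = belast x q.
  by elim: q x => //= z q IH x; rewrite IH.
by rewrite /= addn0.
Qed.

Lemma exits_gt0 t : has b (rep t) -> ~~ all b (rep t) -> (0 < exits t)%N.
Proof.
move=> /hasP [z zt bz]; apply: contraNltn; rewrite leqn0 => /eqP h0.
have hp := cyc_edges_rot 0 (index z (rep t)) (rep t).
have := permP hp exit_edge; rewrite -[RHS]/(exits t) h0 (rot_index zt).
move=> /eqP; rewrite -leqn0 leqNgt -has_count -all_predC.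
set p := drop _ _ ++ _ => /= /andP[_] hall.
have ap : all b p.
  elim: (p) (z) bz hall => //= y q IH x bx /andP[]; rewrite /exit_edge /= bx /= negbK => hy.
  by move=> /(IH y hy); rewrite hy.
rewrite -(eq_all_r (mem_rot (index z (rep t)) (rep t))) (rot_index zt) -/p /= bz.
exact: ap.
Qed.

(** Surgery on loops, read through suitable rotations of the two representatives. *)
Definition psi_rel t t' : Prop :=
  exists k k' C, sg (rot k (rep t)) (rot k' (rep t')) C.

Lemma rot_back s k : exists j, s = rot j (rot k s).
Proof.
have [kn|nk] := leqP k (size s).
  by exists (size s - k)%N; rewrite -(size_rot k s) -/(rotr k _) rotK.
by exists 0%N; rewrite rot0 rot_oversize // ltnW.
Qed.

Lemma loop_rot_eq t t' k k' : rot k (rep t) = rot k' (rep t') -> t = t'.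
Proof.
move=> e; have h := is_loop_rot k (rep_ok t).
have -> : t = loop_of h by symmetry; apply/loop_ofP; exact: rot_back.
by apply/loop_ofP; rewrite e; exact: rot_back.
Qed.

Lemma rep_neq0 t : rep t != [::].
Proof. by have /andP[] := rep_ok t. Qed.

Lemma surg_marked s s' C : sg s s' C -> s != [::] -> marked s.
Proof.
move=> h s0; apply/andP; split.
  by case: s s' C / h s0 => // -[//|y o] i s s' C x0 _ /= /andP[].
elim: s s' C / h s0 => [//|o i s s' C x0 no ho ni hi h1 h2 _ IH _].
have bi x : b (last x i).
  by case: i ni hi {h1 h2} => // y i _ hi /=; apply: (allP hi); exact: mem_last.
by rewrite !last_cat; case: s IH => [_|y s IH] /=; [exact: bi|exact: IH].
Qed.

Lemma psi_edges t t' : psi_rel t t' ->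
  perm_eq [seq e <- edges_of t | ~~ both_in b e] [seq e <- edges_of t' | ~~ both_in b e].
Proof.
move=> [k [k' [C h]]].
have e1 := perm_filter (fun e => ~~ both_in b e) (cyc_edges_rot 0 k (rep t)).
have e2 := perm_filter (fun e => ~~ both_in b e) (cyc_edges_rot 0 k' (rep t')).
rewrite -(permPl e1) -(permPr e2) /cyc_edges (surg_last routeP 0 h) (surg_edges routeP _ h).
exact: perm_refl.
Qed.

Lemma psi_exits t t' : psi_rel t t' -> exits t = exits t'.
Proof.
move=> /psi_edges /permP /(_ exit_edge); rewrite !count_filter.
by rewrite !(@eq_count _ (predI exit_edge _) exit_edge) // => -[u v] /=;
  rewrite /exit_edge /both_in /=; case: (b u); case: (b v).
Qed.

Lemma psi_mem_edges t t' e : psi_rel t t' -> ~~ both_in b e ->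
  (e \in edges_of t) = (e \in edges_of t').
Proof.
by move=> /psi_edges /perm_mem /(_ e); rewrite !mem_filter => + he; rewrite he.
Qed.

Lemma psi_count (a : pred V) t t' : psi_rel t t' -> (forall z, a z -> ~~ b z) ->
  count a (rep t) = count a (rep t').
Proof.
move=> [k [k' [C h]]] ab.
have := surg_outside routeP h => /(congr1 (count a)); rewrite !count_filter.
rewrite !(@eq_count _ (predI a _) a); last first.
- by move=> z /=; case E: (a z) => //=; rewrite ab.
- by move=> z /=; case E: (a z) => //=; rewrite ab.
have hp j s : count a (rot j s) = count a s by have /permP -> : perm_eq (rot j s) s by rewrite perm_rot.
by rewrite !hp.
Qed.

Lemma psi_pi t t' : psi_rel t t' -> ~~ has pi (rep t').
Proof.
move=> [k [k' [C h]]]; rewrite -all_predC.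
have := surg_pi pib routeP h.
by rewrite (eq_all_r (mem_rot k' (rep t'))).
Qed.

Lemma psi_size t t' : psi_rel t t' -> (lsize t' <= lsize t + m * visits b t)%N /\
  (visits b t' <= m * visits b t)%N.
Proof.
move=> [k [k' [C h]]].
have [h1 h2 h3 _ _] := surg_size blP routeP h; rewrite !size_rot in h1.
have hp j s : count b (rot j s) = count b s by have /permP -> : perm_eq (rot j s) s by rewrite perm_rot.
rewrite !hp in h2 h3; rewrite /lsize /visits; split.
  by apply: leq_trans h1 _; rewrite leq_add2l leq_mul2l h2 orbT.
by apply: leq_trans h3 _; rewrite leq_mul2l h2 orbT.
Qed.

Lemma psi_exists t : (0 < exits t)%N -> entry_free t -> exists t', psi_rel t t'.
Proof.
rewrite /exits -nmarksE /nmarks -has_count => /hasP [k _ /andP[mh ml]] ef.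
set s := rot k (rep t) in mh ml *.
have s0 : s != [::] by rewrite -size_eq0 size_rot size_eq0 rep_neq0.
have ef' : all (pi_free b pi) (cyc_edges 0 s).
  by rewrite (eq_all_r (perm_mem (cyc_edges_rot 0 k (rep t)))).
have pl : ~~ pi (last (last 0 s) s).
  move: ef'; rewrite /cyc_edges; case: (s) s0 mh ml => //= y q _ mh ml /andP[+ _].
  by rewrite /pi_free /= ml mh (negPf mh) /= .
have [s' [C h]] : exists s' C, sg s s' C.
  apply: (surg_exists route (x := last 0 s) _ ef') => //; right.
  by move: mh ml s0; case: (s).
have [sl1 sl2] := surg_head h.
have s'0 : s' != [::].
  case: s' h sl1 sl2 => // h; exfalso.
  by inversion h as [e1|o2 i2 s3 s3' C' x1 no2 ho2 ni2 hi2 h12 h22 hs2 E1 E2 E3];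
    [rewrite -e1 in s0|case: (o2) no2 E2].
have cs' : is_loop s'.
  have /andP[_] := is_loop_rot k (rep_ok t); rewrite -/s => cs.
  rewrite /is_loop s'0 (cycle_path 0) -(surg_last routeP 0 h).
  by apply: (surg_path routeP h); rewrite -(cycle_path 0).
have [k' e] := rep_loop_of cs'.
exists (loop_of cs'), k, (size s' - k')%N, C.
have [kn|nk] := leqP k' (size s').
  by rewrite e -(size_rot k' s') -/(rotr k' _) rotK.
rewrite e (rot_oversize (ltnW nk)) (_ : (size s' - k' = 0)%N) ?rot0 //.
by apply/eqP; rewrite subn_eq0 ltnW.
Qed.

Definition fibre_const : nat :=
  (K * ((size bl).+1 ^ K).+1 ^ K * (K.+1 * (2 * d) ^ (m * K)))%N.

Variables (alpha : R) (fam : seq (loop d)).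
Hypothesis alpha0 : 0 <= alpha.
Hypothesis uf : uniq fam.
Local Notation lm := (@lam R d alpha).

(** A preimage is determined by the marked rotation of t' at which it is read and by the record of
    at most K blocks of length at most K. Lengths grow by at most m*K, so each preimage costs at
    most (2d)^(mK), and [mu_ge] accounts for the periodicity of t'. *)
Lemma psi_fibre t' :
  \sum_(t <- fam | `[< psi_rel t t' /\ (0 < exits t)%N >] && (visits b t <= K)%N) lm t
    <= fibre_const%:R * lm t'.
Proof.
rewrite -big_filter; set F := [seq _ <- _ | _].
have FP t : t \in F -> [/\ psi_rel t t', (0 < exits t)%N & (visits b t <= K)%N].
  by rewrite mem_filter => /andP[/andP[/asboolP[? ?] ?] _].
have uF : uniq F by rewrite filter_uniq.
have lam0 : 0 <= lm t' by rewrite mulr_ge0 // mu_ge0.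
case EF : F => [|t0 F0]; first by rewrite big_nil mulr_ge0.
rewrite -EF; have [p0 e0 v0] : [/\ psi_rel t0 t', (0 < exits t0)%N & (visits b t0 <= K)%N].
  by apply: FP; rewrite EF mem_head.
have ex' : (0 < exits t' <= K)%N.
  by rewrite -(psi_exits p0) e0 (leq_trans (exits_visits _)).
pose marks := [seq rot k (rep t') | k <- iota 0 (lsize t') & marked (rot k (rep t'))].
have smarks : size marks = exits t'.
  by rewrite size_map size_filter /exits -nmarksE.
pose codes := words (words bl K) K.
(* The code of a preimage: the modified cut loop and its record; injective by [surg_inj]. *)
pose f t := if pselect (exists rC : seq V * seq (seq V), exists k k',
     sg (rot k (rep t)) rC.1 rC.2 /\ rC.1 = rot k' (rep t')) is left h
  then sval (cid h) else ([::], [::]).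
have fP t : t \in F -> exists k k', sg (rot k (rep t)) (f t).1 (f t).2 /\
    (f t).1 = rot k' (rep t').
  move=> /FP [[k [k' [C h]]] _ _]; rewrite /f; case: pselect => [h'|[]].
    by case: (cid h').
  by exists (rot k' (rep t'), C), k, k'.
have sF : (size F <= size marks * size codes)%N.
  rewrite -(size_allpairs pair) -(size_map f); apply: uniq_leq_size.
    rewrite map_inj_in_uniq // => t1 t2 /fP [k1 [k1' [h1 _]]] /fP [k2 [k2' [h2 _]]] e.
    rewrite -e in h2; have e12 := surg_inj routeP h1 h2.
    exact: loop_rot_eq e12.
  move=> _ /mapP [t tF ->]; apply/allpairsP; exists (f t); split; last by case: (f t).
    have [k [k' [h e]]] := fP t tF; rewrite e.
    have mk : marked (rot k' (rep t')).
      rewrite -e /marked -(surg_last routeP 0 h).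
      have [_ hd] := surg_head h; rewrite -hd.
      move: (f t) h {e hd} => [r C] /= h.
      have s0 : rot k (rep t) != [::] by rewrite -size_eq0 size_rot size_eq0 rep_neq0.
      exact: (surg_marked h s0).
    have [kn|nk] := ltnP k' (lsize t').
      by apply: (map_f (fun k => rot k (rep t'))); rewrite mem_filter mk mem_iota.
    rewrite rot_oversize // -(rot0 (rep t')) in mk *.
    by apply: (map_f (fun k => rot k (rep t'))); rewrite mem_filter mk mem_iota /= lsize_gt0.
  have [k [k' [h _]]] := fP t tF; have [_ _ vt] := FP t tF.
  have [_ h2 _ h4 h5] := surg_size blP routeP h.
  have hp : count b (rot k (rep t)) = visits b t.
    by have /permP -> : perm_eq (rot k (rep t)) (rep t) by rewrite perm_rot.
  rewrite hp in h2 h4.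
  apply: mem_words; first exact: leq_trans h2 vt.
  move=> i iC; apply: mem_words; first exact: leq_trans (h4 i iC) vt.
  by move=> z zi; exact: h5 zi.
have q0 : 0 < (2 * d%:R : R) by rewrite mulr_gt0 // ltr0n.
have q1 : (2 * d%:R : R)^-1 <= 1.
  by rewrite invf_le1 // -natrM ler1n muln_gt0.
have lamF t : t \in F -> lm t <= ((2 * d) ^ (m * K) * K.+1)%:R * lm t'.
  move=> /FP [pt _ vt]; have [st _] := psi_size pt.
  have mk0 : (0 < nmarks marked (rep t'))%N by rewrite nmarksE; case/andP: ex'.
  have mg := mu_ge R mk0.
  have mkK : (nmarks marked (rep t') <= K)%N by rewrite nmarksE; case/andP: ex'.
  rewrite /lam [leRHS]mulrCA ler_wpM2l //; apply: le_trans (mu_le R t) _.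
  have q2 : 0 <= (2 * d%:R : R)^-1 by rewrite invr_ge0 ltW.
  have h1 : (2 * d%:R : R)^-1 ^+ (lsize t + m * K) <= (2 * d%:R)^-1 ^+ lsize t'.
    apply: ler_wiXn2l => //; apply: leq_trans st _.
    by rewrite leq_add2l leq_mul2l vt orbT.
  have h2 : (2 * d%:R : R)^-1 ^+ lsize t <= ((2 * d) ^ (m * K))%:R * (2 * d%:R)^-1 ^+ lsize t'.
    rewrite natrX natrM [leRHS]mulrC -ler_pdivrMr ?exprn_gt0 //.
    by rewrite -exprVn -exprD.
  apply: le_trans h2 _; rewrite natrM -mulrA ler_wpM2l //.
  apply: le_trans mg _; rewrite ler_wpM2r ?mu_ge0 // ler_nat ltnS //.
rewrite big_seq; apply: (@le_trans _ _ (\sum_(t <- F) ((2 * d) ^ (m * K) * K.+1)%:R * lm t')).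
  by rewrite [leRHS]big_seq; apply: ler_sum => t; exact: lamF.
rewrite big_const_seq count_predT iter_addr addr0 -[_ *+ size F]mulr_natl mulrA -natrM ler_wpM2r // ler_nat.
rewrite /fibre_const [X in (_ * X)%N]mulnC leq_mul2r; apply/orP; right.
apply: leq_trans sF _; rewrite smarks leq_mul //; first by case/andP: ex'.
apply: leq_trans (size_words _ _) _; rewrite leq_exp2r ?ltnS; last by rewrite (leq_trans _ (andP ex').2) //; case/andP: ex'.
exact: size_words.
Qed.

End LoopSurgery.

Section SurgeryBound.
Context {R : realType} {disp : measure_display} {Omega : measurableType disp}.
Variables (P : probability Omega R) (d : nat) (alpha : R) (L : Omega -> loop d -> nat).
Hypothesis soup : loop_soup P alpha L.
Hypothesis alpha0 : 0 <= alpha.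
Hypothesis alpha1 : alpha <= 1.
Hypothesis d0 : (0 < d)%N.
Variable fam : seq (loop d).
Hypothesis uf : uniq fam.
Local Notation V := 'rV[int]_d.
Local Notation nn := (@nearest_neighbor d).
Local Notation pr := (Pr P L fam).
Local Notation lm := (@lam R d alpha).

Definition wsum (a : pred (loop d)) (g : loop d -> nat) (nu : loop d -> nat) : nat :=
  (\sum_(t <- fam | a t) nu t * g t)%N.

Lemma wsum_addl a g nu t : t \in fam -> wsum a g (addl nu t) = (wsum a g nu + a t * g t)%N.
Proof.
move=> tf; rewrite /wsum /addl.
rewrite (eq_bigr (fun s => nu s * g s + (s == t) * g s)%N); last by move=> s _; rewrite mulnDl.
rewrite big_split /=; congr (_ + _)%N; rewrite big_mkcond (bigD1_seq t) //= eqxx.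
rewrite big1 ?addn0; first by case: (a t).
by move=> s /negPf ->; rewrite mul0n if_same.
Qed.

Lemma sublK (nu : loop d -> nat) t : (0 < nu t)%N -> addl (subl nu t) t = nu.
Proof.
move=> h; apply/funext => s; rewrite /addl /subl.
by case: (eqVneq s t) => [->|_]; rewrite ?subnK // subn0 addn0.
Qed.

Lemma wsum_le (a : pred (loop d)) g (nu : loop d -> nat) t : t \in fam -> a t -> (nu t * g t <= wsum a g nu)%N.
Proof. by move=> tf at_; rewrite /wsum (big_rem t) //= at_ leq_addr. Qed.

Variables (b pi : pred V) (bl : seq V) (route : V -> V -> seq V) (m K : nat).
Hypothesis blP : forall z, b z -> z \in bl.
Hypothesis pib : forall z, pi z -> b z.
Hypothesis routeP : forall u v, b u -> ~~ pi u -> b v -> ~~ pi v ->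
  [/\ exists p, route u v = u :: p /\ path nn u p, last u (route u v) = v,
    all b (route u v), all (predC pi) (route u v) & (size (route u v) <= m)%N].
Local Notation prel := (psi_rel b pi route).
Local Notation ex := (exits b).
Local Notation efree := (entry_free b pi).
Local Notation hpi t := (has pi (rep t)).

Variable W : set (loop d -> nat).
Hypothesis W_free : forall (nu : loop d -> nat) t, t \in fam -> (0 < nu t)%N -> W nu -> efree t.
Hypothesis W_surg : forall (nu : loop d -> nat) t t', t \in fam -> t' \in fam -> prel t t' ->
  W (addl nu t) -> W (addl nu t').
Hypothesis W_local : forall (nu : loop d -> nat) t, t \in fam -> all b (rep t) -> W (addl nu t) -> W nu.
Hypothesis fam_surg : forall t t', t \in fam -> prel t t' -> t' \in fam.

(** Here j is the number of loops, with multiplicity, that meet pi; it is to be brought down to 0.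
    The other two conditions keep the box occupation under control along the way. *)
Definition stage j : set (loop d -> nat) := [set nu | [/\ W nu, (wsum xpredT ex nu <= K)%N,
  (wsum (fun t => hpi t) (visits b) nu <= K)%N & wsum (fun t => hpi t) (fun=> 1%N) nu = j]].

Definition stage_const : nat := ((size bl).+1 ^ K + fibre_const bl m K * K)%N.

Definition psi t : loop d :=
  if pselect (exists t', prel t t') is left h then sval (cid h) else t.

(** Remove one loop meeting pi. If it stays in the box it is discarded, and there are few such
    loops. Otherwise its rerouted version is put back: [pr_mecke] removes the old loop, [psi_fibre]
    sums over preimages and [pr_mecke_ge] reabsorbs the new loop. *)
Lemma stage_step j : pr (stage j.+1) <= stage_const%:R * pr (stage j).
Proof.
pose loc t := all b (rep t) && (visits b t <= K)%N.
pose nl t := [&& (0 < ex t)%N, (visits b t <= K)%N & `[< prel t (psi t) /\ psi t \in fam >]].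
pose A t : set (loop d -> nat) := [set nu |
  if loc t then stage j nu else nl t /\ stage j (addl nu (psi t))].
have le1 : pr (stage j.+1) <= \sum_(t <- fam) lm t * pr (A t).
  apply: (pr_mecke soup alpha0 uf) => nu _ [Wn Xn Vn Nn].
  have [t [tf ht nt]] : exists t, [/\ t \in fam, hpi t & (0 < nu t)%N].
    apply: contrapT => hno; move: Nn; rewrite /wsum big_seq_cond big1 // => t /andP[tf ht].
    rewrite muln1; apply/eqP; rewrite -leqn0 leqNgt; apply/negP => nt.
    by apply: hno; exists t.
  exists t => //; split=> //; rewrite /A /=.
  set nu' := subl nu t; have e : nu = addl nu' t by rewrite sublK.
  have vK : (visits b t <= K)%N.
    apply: leq_trans Vn; apply: leq_trans (wsum_le _ _ tf ht).
    by rewrite leq_pmull.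
  have et := W_free tf nt Wn.
  rewrite e !wsum_addl // ht !mul1n in Xn Vn Nn; rewrite e in Wn.
  have b0 : (0 < visits b t)%N.
    by rewrite /visits -has_count; apply: sub_has ht => z; exact: pib.
  case: ifP => [/andP[lt _]|nlt].
    split; [exact: W_local lt Wn|lia|lia|lia].
  have nlt' : ~~ all b (rep t) by apply: contraFN nlt => h; rewrite /loc h vK.
  have ext : (0 < ex t)%N.
    by apply: exits_gt0 => //; apply: sub_has ht => z; exact: pib.
  have [t1 pt1] := psi_exists routeP ext et.
  have pt : prel t (psi t).
    by rewrite /psi; case: pselect => [h|[]]; [case: (cid h)|exists t1].
  have pf := fam_surg tf pt.
  split; first by rewrite /nl ext vK /=; apply/asboolP.
  have hp := psi_pi pib routeP pt.
  rewrite /stage /= !wsum_addl // (negPf hp) -(psi_exits routeP pt) !mul0n !addn0.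
  split; [exact: W_surg Wn|lia|lia|lia].
apply: le_trans le1 _.
have sp0 : 0 <= pr (stage j) by exact: (pr_ge0 soup uf _).
have prc (c : bool) (E : set (loop d -> nat)) : pr [set nu | c /\ E nu] <= c%:R * pr E.
  case: c; first by rewrite mul1r; apply: (pr_le soup uf) => // nu _ [].
  rewrite mul0r (_ : [set _ | _] = set0); last by apply/seteqP; split=> // nu [].
  have /eqP := pr_disj soup uf (E := set0) (E' := set0) (fun _ h _ => h).
  by rewrite setU0 -subr_eq0 opprD addrA subrr sub0r oppr_eq0 => /eqP ->.
have lm0 t : 0 <= lm t by rewrite mulr_ge0 // mu_ge0.
have lm1 t : lm t <= 1.
  have q0 : 0 <= (2 * d%:R : R)^-1 by rewrite invr_ge0 mulr_ge0.
  have q1 : (2 * d%:R : R)^-1 <= 1.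
    by rewrite invf_le1 -?natrM ?ler1n ?ltr0n muln_gt0.
  apply: le_trans (lam_le alpha0 t) _.
  by apply: mulr_ile1; rewrite ?alpha0 ?alpha1 ?exprn_ge0 ?exprn_ile1.
have pr0 E : 0 <= pr E by exact: (pr_ge0 soup uf _).
rewrite (bigID loc) /= natrD mulrDl; apply: lerD.
  rewrite (eq_bigr (fun t => lm t * pr (stage j))); last first.
    by move=> t lt; congr (_ * pr _); apply/funext => nu; rewrite /A lt.
  rewrite -mulr_suml ler_wpM2r //.
  apply: (@le_trans _ _ (\sum_(t <- fam | loc t) 1)); first exact: ler_sum.
  rewrite -big_filter big_const_seq count_predT iter_addr addr0 ler_nat.
  apply: leq_trans (size_words bl K); rewrite -(size_map (@rep d)).
  apply: uniq_leq_size.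
    rewrite map_inj_in_uniq ?filter_uniq // => t t' _ _ e.
    by apply: loop_eqP; exists 0%N; rewrite rot0.
  move=> w /mapP [t + ->]; rewrite mem_filter => /andP[/andP[/allP at_ vt] _].
  apply: mem_words; last by move=> x /at_; exact: blP.
  by apply: leq_trans vt; rewrite /visits (eqP (introT idP _ : count b (rep t) == size (rep t))) // -all_count; apply/allP.
pose A' t' : set (loop d -> nat) := [set nu | (0 < ex t')%N /\ stage j (addl nu t')].
pose c t t' := `[< prel t t' /\ (0 < ex t)%N >] && (visits b t <= K)%N.
apply: (@le_trans _ _ (\sum_(t <- fam) \sum_(t' <- fam | c t t') lm t * pr (A' t'))).
  rewrite big_mkcond big_seq [leRHS]big_seq ler_sum // => t tf.
  have s0 : 0 <= \sum_(t' <- fam | c t t') lm t * pr (A' t').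
    by apply: sumr_ge0 => t' _; apply: mulr_ge0.
  case: ifP => // /negPf lt.
  have hA : pr (A t) <= (nl t)%:R * pr (A' (psi t)).
    apply: le_trans (prc _ _); apply: (pr_le soup uf) => // nu _; rewrite /A /= lt => -[h1 h2].
    split=> //; split=> //; move: h1 => /and3P[e0 _ /asboolP [pt _]].
    by rewrite -(psi_exits routeP pt).
  apply: (@le_trans _ _ (lm t * ((nl t)%:R * pr (A' (psi t))))); first by rewrite ler_wpM2l.
  case nlt : (nl t); last by rewrite mul0r mulr0.
  move: nlt => /and3P[e0 vt /asboolP [pt pf]]; rewrite mul1r.
  rewrite big_mkcond (bigD1_seq (psi t)) //= /c vt andbT asboolT // lerDl.
  by apply: sumr_ge0 => t' _; case: ifP => _ //; apply: mulr_ge0.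
rewrite (exchange_big_dep xpredT) //=.
apply: (@le_trans _ _ (\sum_(t' <- fam) (fibre_const bl m K)%:R * (lm t' * pr (A' t')))).
  apply: ler_sum => t' _; rewrite -mulr_suml mulrA ler_wpM2r //.
  exact: (psi_fibre K d0 blP routeP alpha0 uf).
rewrite -mulr_sumr natrM -mulrA ler_wpM2l //.
(* Only loops leaving the box are counted, and their number is at most the total number of exits,
   hence at most K. *)
apply: (pr_mecke_ge soup alpha0 uf) => [nu t _ _ []//|nu _ [_ Xn _ _]].
apply: leq_trans Xn; rewrite /wsum big_mkcond leq_sum // => t _.
by case: ifP => // /asboolP [_ [e0 _]]; rewrite leq_pmulr.
Qed.

Definition surgery_const : nat := (\sum_(j < K.+1) stage_const ^ j)%N.

(** Occupation at most K allows at most K loops meeting pi, so finitely many stages suffice; at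
    stage 0 the set pi is free of loops of the family. *)
Lemma surgery_bound : pr [set nu | W nu /\ (occupation fam b nu <= K)%N] <=
  surgery_const%:R * pr [set nu | W nu /\ forall t, t \in fam -> (0 < nu t)%N -> ~~ hpi t].
Proof.
have pr0 E : 0 <= pr E by exact: (pr_ge0 soup uf _).
set G := [set nu | _ /\ forall t, _].
have st j : pr (stage j) <= (stage_const ^ j)%:R * pr G.
  elim: j => [|j IH].
    rewrite expn0 mul1r; apply: (pr_le soup uf) => // nu _ [Wn _ _ Nn]; split=> // t tf nt.
    apply/negP => ht; have := wsum_le (a := fun t => hpi t) (fun=> 1%N) nu tf ht.
    by rewrite Nn muln1 leqNgt nt.
  by rewrite expnS natrM -mulrA; apply: le_trans (stage_step j) _; rewrite ler_wpM2l.
apply: (@le_trans _ _ (\sum_(j <- iota 0 K.+1) pr (stage j))).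
  apply: le_trans (pr_bigU soup uf (iota 0 K.+1) stage); apply: (pr_le soup uf) => // nu _ [Wn On].
  have occ : (wsum xpredT (visits b) nu <= K)%N by [].
  have VK : (wsum (fun t => hpi t) (visits b) nu <= K)%N.
    apply: leq_trans occ; rewrite /wsum big_mkcond leq_sum // => t _.
    by case: ifP.
  exists (wsum (fun t => hpi t) (fun=> 1%N) nu).
    rewrite mem_iota /= add0n ltnS; apply: leq_trans VK; rewrite leq_sum // => t ht.
    rewrite leq_mul2l /visits -has_count; apply/orP; right.
    by apply: sub_has ht => z; exact: pib.
  split=> //; apply: leq_trans occ; rewrite leq_sum // => t _.
  by rewrite leq_mul2l exits_visits orbT.
apply: (@le_trans _ _ (\sum_(j <- iota 0 K.+1) (stage_const ^ j)%:R * pr G)).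
  by apply: ler_sum => j _; exact: st.
by rewrite -mulr_suml /surgery_const natr_sum -(big_mkord xpredT (fun j => (stage_const ^ j)%:R)) /index_iota subn0.
Qed.

End SurgeryBound.

(** * A chute through a box with connected complement *)

Section FacePath.
Variables (d h : nat).
Hypothesis hd : (3 <= d)%N.
Hypothesis h0 : (0 < h)%N.
Local Notation V := 'rV[int]_d.
Local Notation nn := (@nearest_neighbor d).
Local Notation r := (rho h).

Lemma inboxP (c z : V) : inbox h c z <-> (forall j, (`|c ord0 j - z ord0 j| <= r)%N) /\
  (forall i j, `|c ord0 i - z ord0 i|%N = r -> `|c ord0 j - z ord0 j|%N = r -> i = j).
Proof.
rewrite /inbox; split.
  move=> /andP[/linfP h1 /card_le1_eqP h2]; split=> // i j hi hj.
  by apply: h2; rewrite inE; apply/eqP.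
move=> [h1 h2]; apply/andP; split; first exact/linfP.
by apply/card_le1_eqP => i j; rewrite !inE => /eqP hi /eqP hj; apply: h2.
Qed.

(** A point at distance less than r has all its neighbours in the box, since at most one coordinate
    becomes extremal in a step. *)
Lemma entry_face (c u v : V) : nearest_neighbor u v -> ~~ inbox h c u -> inbox h c v ->
  linf_dist c v = r.
Proof.
move=> /nnP [i [hi hj]] nu /inboxP [h1 h2]; apply/eqP; rewrite eqn_leq.
apply/andP; split; first exact/linfP.
rewrite leqNgt; apply/negP => lt; move/negP: nu; apply; apply/inboxP.
have lj j : (`|c ord0 j - v ord0 j| < r)%N by apply: leq_ltn_trans (linf_coord _ _ j) lt.
have eq j : j != i -> u ord0 j = v ord0 j by exact: hj.
split.
  move=> j; have [->|ji] := eqVneq j i; last by rewrite eq // ltnW.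
  by have := lj i; move: hi; lia.
have only j : `|c ord0 j - u ord0 j|%N = r -> j = i.
  move=> e; apply/eqP; apply: contraT => /eq e'; have := lj j.
  by rewrite -e' e ltnn.
by move=> j j' /only -> /only ->.
Qed.

Section Path.
Variables (c f : V) (k : 'I_d).
Hypothesis fb : inbox h c f.
Hypothesis fk : `|c ord0 k - f ord0 k|%N = r.
Local Notation C j := (c ord0 j).

Let r2 : (2 <= r)%N. Proof. by rewrite /rho; lia. Qed.

Let f_int j : j != k -> (`|C j - f ord0 j| < r)%N.
Proof.
move=> jk; have [h1 h2] := (inboxP c f).1 fb.
rewrite ltn_neqAle h1 andbT; apply/eqP => e.
by move/eqP: jk; apply; apply: h2.
Qed.

(** Straight from the entry point f to the middle hyperplane, then the full hull of f and the centre
    in that hyperplane, then straight along the axis to the centre of the opposite face. Off the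
    hyperplane each slice contains a single chute point. *)
Definition chute : pred V := fun z =>
  [|| [forall j, (j != k) ==> (z ord0 j == f ord0 j)] && btw (f ord0 k) (z ord0 k) (C k),
      (z ord0 k == C k) && [forall j, (j != k) ==> btw (f ord0 j) (z ord0 j) (C j)]
    | [forall j, (j != k) ==> (z ord0 j == C j)] && btw (C k) (z ord0 k) (2 * C k - f ord0 k)].

Lemma chuteP z : chute z <->
  [\/ (forall j, j != k -> z ord0 j = f ord0 j) /\ btw (f ord0 k) (z ord0 k) (C k),
      z ord0 k = C k /\ (forall j, j != k -> btw (f ord0 j) (z ord0 j) (C j))
    | (forall j, j != k -> z ord0 j = C j) /\ btw (C k) (z ord0 k) (2 * C k - f ord0 k)].
Proof.
have fa (p : 'I_d -> bool) : [forall j, (j != k) ==> p j] <-> (forall j, j != k -> p j).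
  split; first by move=> /forallP q j jk; exact: (implyP (q j)).
  by move=> q; apply/forallP => j; apply/implyP; exact: q.
rewrite /chute; split.
  case/or3P => /andP[].
  - by move=> /fa q ?; apply: Or31; split=> // j /q /eqP.
  - by move=> /eqP ? /fa q; apply: Or32.
  - by move=> /fa q ?; apply: Or33; split=> // j /q /eqP.
case=> -[q1 q2]; apply/or3P.
- by apply: Or31; rewrite q2 andbT; apply/fa => j /q1 ->.
- by apply: Or32; rewrite q1 eqxx; apply/fa.
- by apply: Or33; rewrite q2 andbT; apply/fa => j /q1 ->.
Qed.

Let intr (z : V) := forall j, j != k -> (`|C j - z ord0 j| < r)%N.

Lemma intr_inbox z : intr z -> (`|C k - z ord0 k| <= r)%N -> inbox h c z.
Proof.
move=> iz hk; apply/inboxP; split.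
  by move=> j; have [->//|/iz /ltnW] := eqVneq j k.
have e j : `|C j - z ord0 j|%N = r -> j = k.
  by move=> e; apply/eqP; apply: contraT => /iz; rewrite e ltnn.
by move=> i j /e -> /e ->.
Qed.

Lemma chute_intr z : chute z -> intr z /\ (`|C k - z ord0 k| <= r)%N.
Proof.
case/chuteP => -[h1 h2].
- split; first by move=> j jk; rewrite h1 //; exact: f_int.
  by move: h2 fk; rewrite /btw; lia.
- split; last by rewrite h1 subrr.
  by move=> j jk; have := h2 j jk; have := f_int jk; rewrite /btw; lia.
- split; first by move=> j jk; rewrite h1 // subrr; lia.
  by move: h2 fk; rewrite /btw; lia.
Qed.

Lemma chute_inbox z : chute z -> inbox h c z.
Proof. by move=> /chute_intr [h1 h2]; exact: intr_inbox. Qed.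

Let Z : set V := [set z | inbox h c z /\ ~~ chute z].
Let w (a : int) : V := if btw (f ord0 k) a (C k) then f else c.

Lemma Z_off z : intr z -> (`|C k - z ord0 k| <= r)%N -> z ord0 k != C k ->
  Z z <-> exists j, j != k /\ z ord0 j != w (z ord0 k) ord0 j.
Proof.
move=> iz hk zk; have hsym : btw (f ord0 k) (z ord0 k) (C k) \/ btw (C k) (z ord0 k) (2 * C k - f ord0 k).
  by move: hk fk; rewrite /btw; lia.
split.
  move=> [_ nz]; apply: contrapT => no; move/negP: nz; apply; apply/chuteP.
  have eq j : j != k -> z ord0 j = w (z ord0 k) ord0 j.
    by move=> jk; apply/eqP; apply: contraT => ne; exfalso; apply: no; exists j.
  move: eq hsym; rewrite /w; case: ifP => bt eq [] q.
  - exact: Or31.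
  - exact: Or31.
  - by [].
  - exact: Or33.
move=> [j [jk nj]]; split; first exact: intr_inbox.
apply/negP => /chuteP; move: nj; rewrite /w; case: ifP => bt nj [] [h1 h2].
- by rewrite h1 // eqxx in nj.
- by rewrite h1 eqxx in zk.
- by move: zk bt h2 fk; rewrite /btw; lia.
- by rewrite h2 in bt.
- by rewrite h1 eqxx in zk.
- by rewrite h1 // eqxx in nj.
Qed.

Lemma slice z z' j j' : intr z -> intr z' -> z ord0 k = z' ord0 k ->
  (`|C k - z ord0 k| <= r)%N -> z ord0 k != C k ->
  j != k -> j' != k -> j != j' -> z ord0 j != w (z ord0 k) ord0 j ->
  z' ord0 j' != w (z ord0 k) ord0 j' -> rconn nn Z z z'.
Proof.
move=> iz iz' zz hk zk jk jk' jj nj nj'.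
have hull (x y : V) l : intr x -> intr y -> x ord0 k = z ord0 k -> y ord0 k = z ord0 k ->
    l != k -> x ord0 l = y ord0 l -> x ord0 l != w (z ord0 k) ord0 l -> rconn nn Z x y.
  move=> ix iy ex ey lk el nl; apply: box_conn => v hv.
  have vk : v ord0 k = z ord0 k by have := hv k; rewrite ex ey /btw; lia.
  apply/Z_off; rewrite ?vk //.
    by move=> i ik; have := ix i ik; have := iy i ik; have := hv i; rewrite /btw; lia.
  exists l; split=> //; have -> // : v ord0 l = x ord0 l.
  by have := hv l; rewrite -el /btw; lia.
pose mid := upd z' j (z ord0 j).
have im : intr mid.
  by move=> i ik; rewrite updE; case: (eqVneq i j) => [->|_]; [exact: iz|exact: iz'].
have mk : mid ord0 k = z ord0 k by rewrite updE eq_sym (negPf jk).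
apply: (rconn_trans (y := mid)).
  by apply: (hull _ _ j) => //; rewrite updE eqxx.
have jj' : j' != j by rewrite eq_sym.
by apply: (hull _ _ j') => //; rewrite updE (negPf jj').
Qed.

(** A box of dimension at least 2 minus one point is connected; when both points differ from the
    removed one only in the same coordinate, the route passes through a third point [y] differing in
    another coordinate. *)
Lemma slice_conn z z' : intr z -> intr z' -> z ord0 k = z' ord0 k ->
  (`|C k - z ord0 k| <= r)%N -> z ord0 k != C k -> Z z -> Z z' -> rconn nn Z z z'.
Proof.
move=> iz iz' zz hk zk Zz Zz'.
have [j [jk nj]] := (Z_off iz hk zk).1 Zz.
have [j' [jk' nj']] : exists j', j' != k /\ z' ord0 j' != w (z ord0 k) ord0 j'.
  by rewrite zz; apply/Z_off; rewrite -?zz.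
have [jj|jj] := eqVneq j j'; last exact: (slice iz iz' zz hk zk jk jk' jj nj nj').
subst j'.
have [l [lk lj]] : exists l : 'I_d, l != k /\ l != j.
  have : (0 < #|~: [set k; j]|)%N.
    by rewrite cardsCs finset.setCK card_ord subn_gt0 (leq_ltn_trans _ hd) // cards2 ltnS leq_b1.
  by case/card_gt0P => l; rewrite !inE negb_or => /andP[]; exists l.
pose a : int := if w (z ord0 k) ord0 l == C l then C l + 1 else C l.
pose y := upd z l a.
have iy : intr y.
  move=> i ik; rewrite updE; case: (eqVneq i l) => [->|_]; last exact: iz.
  by rewrite /a; case: ifP => _; move: r2; lia.
have yk : y ord0 k = z ord0 k by rewrite updE eq_sym (negPf lk).
have yl : y ord0 l != w (z ord0 k) ord0 l.
  by rewrite updE eqxx /a; case: ifP => [/eqP ->|/negbT]; [lia|rewrite eq_sym].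
apply: (rconn_trans (y := y)).
  by apply: (slice iz iy (esym yk) hk zk jk lk _ nj yl); rewrite eq_sym.
by apply: (slice iy iz' _ _ _ lk jk lj); rewrite ?yk.
Qed.

(** Every point is moved within its slice to a line parallel to axis k that avoids the chute; points
    of the middle hyperplane or of a side face are first pushed into a good slice. *)
Lemma chute_compl z z' : Z z -> Z z' -> rconn nn Z z z'.
Proof.
have [j0 j0k] : exists j0 : 'I_d, j0 != k.
  have : (0 < #|~: [set k]|)%N by rewrite cardsCs finset.setCK card_ord cards1; lia.
  by case/card_gt0P => l; rewrite !inE; exists l.
(* One step from the centre away from f: neither equal to f or c in coordinate [j0] nor between
   them. *)
pose s : int := if C j0 <= f ord0 j0 then C j0 - 1 else C j0 + 1.
pose q := upd c j0 s.
have qE a j : j != k -> upd q k a ord0 j = q ord0 j by move=> jk; rewrite updE (negPf jk).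
have iq a : intr (upd q k a).
  move=> j jk; rewrite qE // updE; case: (eqVneq j j0) => [->|_]; last by rewrite subrr; move: r2; lia.
  by rewrite /s; case: ifP => _; move: r2; lia.
have qk a : upd q k a ord0 k = a by rewrite updE eqxx.
have qj a : upd q k a ord0 j0 = s by rewrite qE // updE eqxx.
have Zq a : (`|C k - a| <= r)%N -> Z (upd q k a).
  move=> ha; have [->|ak] := eqVneq a (C k).
    split; first by apply: intr_inbox; rewrite ?qk // subrr.
    apply/negP => /chuteP [] [h1 h2].
    - by have := h1 _ j0k; rewrite qj /s; case: ifP; lia.
    - by have := h2 _ j0k; rewrite qj /s /btw; case: ifP; lia.
    - by have := h1 _ j0k; rewrite qj /s; case: ifP; lia.
  apply/Z_off; rewrite ?qk //; exists j0; split=> //.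
  by rewrite qj /w /s; case: ifP => ?; case: ifP => ?; lia.
pose T := upd q k (C k).
have line a : (`|C k - a| <= r)%N -> rconn nn Z (upd q k a) T.
  move=> ha; have -> : T = upd (upd q k a) k (C k) by rewrite upd_upd.
  apply: line_conn => x; rewrite qk upd_upd => hx; apply: Zq.
  by move: hx ha; rewrite /btw; lia.
suff main y : Z y -> rconn nn Z y T.
  move=> /main h1 /main h2; apply: (rconn_trans h1); apply: rconn_sym h2; exact: nn_sym.
have off v : intr v -> (`|C k - v ord0 k| <= r)%N -> v ord0 k != C k -> Z v -> rconn nn Z v T.
  move=> iy yk yC Zy; apply: (rconn_trans (y := upd q k (v ord0 k))); last exact: line.
  apply: slice_conn; rewrite ?qk //; first [exact: Zq|exact: iq].
pose sg : int := if C k <= f ord0 k then 1 else -1.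
have sg1 : `|sg|%N = 1%N by rewrite /sg; case: ifP.
move=> Zy; have [/inboxP [y1 y2] ny] := Zy.
have [iy|niy] := pselect (intr y).
  have [yk|yk] := eqVneq (y ord0 k) (C k); last exact: off.
  pose y' := upd y k (C k + sg).
  have iy' : intr y' by move=> j jk; rewrite updE (negPf jk); exact: iy.
  have ky' : y' ord0 k = C k + sg by rewrite updE eqxx.
  have Zy' : Z y'.
    apply/Z_off; rewrite ?ky' //; [by move: r2; lia|by move: sg1; lia|].
    apply: contrapT => no; move/negP: ny; apply; apply/chuteP; apply: Or32; split=> // j jk.
    have : y' ord0 j = w (C k + sg) ord0 j.
      by apply/eqP; apply: contraT => ne; exfalso; apply: no; exists j.
    rewrite updE (negPf jk) => ->; rewrite /w; case: ifP => _; rewrite /btw; lia.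
  apply: (rconn_trans (y := y')).
    apply: rconn_step => //; rewrite -{1}(upd_id y k); apply: nn_upd.
    by rewrite yk; move: sg1; lia.
  by apply: off => //; rewrite ky'; move: sg1 r2; lia.
have [j [jk jr]] : exists j, j != k /\ `|C j - y ord0 j|%N = r.
  apply: contrapT => no; apply: niy => j jk; have := y1 j.
  rewrite leq_eqVlt => /orP[/eqP e|//]; exfalso; apply: no; exists j; split=> //.
have yr i : i != j -> (`|C i - y ord0 i| < r)%N.
  move=> ij; rewrite ltn_neqAle y1 andbT; apply/eqP => e.
  by move/eqP: ij; apply; apply: y2.
have kj : k != j by rewrite eq_sym.
have Zup a : (`|C k - a| < r)%N -> Z (upd y k a).
  move=> ha; split; last first.
    apply/negP => /chute_intr [i2 _]; have := i2 j jk.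
    by rewrite updE (negPf jk) jr ltnn.
  apply/inboxP; split.
    move=> i; rewrite updE; case: (eqVneq i k) => [->|_]; [exact: ltnW|exact: y1].
  have e i : `|C i - upd y k a ord0 i|%N = r -> i = j.
    rewrite updE; case: (eqVneq i k) => [->|ik] e.
      by move: ha; rewrite e ltnn.
    by apply: y2.
  by move=> i i' /e -> /e ->.
pose a := C k - sg.
apply: (rconn_trans (y := upd y k a)).
  apply: line_conn => x hx; apply: Zup; have := yr k kj.
  by move: hx sg1 r2; rewrite /btw /a; lia.
pose y' := upd (upd y k a) j (if C j <= y ord0 j then y ord0 j - 1 else y ord0 j + 1).
have y'k : y' ord0 k = a by rewrite !updE (negPf kj) eqxx.
have y'j : y' ord0 j = (if C j <= y ord0 j then y ord0 j - 1 else y ord0 j + 1) by rewrite updE eqxx.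
have iy' : intr y'.
  move=> i ik; rewrite updE; case: (eqVneq i j) => [->|ij].
    by move: jr r2; case: ifP; lia.
  by rewrite updE (negPf ik); exact: yr.
have Zy' : Z y'.
  apply/Z_off; rewrite ?y'k //; [by rewrite /a; move: sg1 r2; lia|by rewrite /a; move: sg1; lia|].
  exists j; split=> //; rewrite y'j /w /a.
  have -> : btw (f ord0 k) (C k - sg) (C k) = false.
    by apply/negP; rewrite /sg /btw; move: fk; case: ifP; lia.
  by move: jr r2; case: ifP; lia.
apply: (rconn_trans (y := y')).
  apply: rconn_step; [by apply: Zup; rewrite /a; move: sg1 r2; lia|by []|].
  rewrite -{1}(upd_id (upd y k a) j); apply: nn_upd; rewrite updE (negPf jk).
  by case: ifP; lia.
by apply: off; rewrite ?y'k //; rewrite /a; move: sg1 r2; lia.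
Qed.

Let g : V := upd c k (2 * C k - f ord0 k).

Lemma chute_conn : rconn nn [set z | chute z] f g.
Proof.
apply: (rconn_trans (y := upd f k (C k))).
  apply: line_conn => a ha; apply/chuteP; apply: Or31; rewrite updE eqxx; split=> // j jk.
  by rewrite updE (negPf jk).
apply: (rconn_trans (y := c)).
  apply: box_conn => z hz; apply/chuteP; apply: Or32; split.
    by have := hz k; rewrite updE eqxx /btw; lia.
  by move=> j jk; have := hz j; rewrite updE (negPf jk).
apply: line_conn => a ha; apply/chuteP; apply: Or33; rewrite updE eqxx; split=> // j jk.
by rewrite updE (negPf jk).
Qed.

Lemma chute_face z : chute z -> linf_dist c z = r -> z = f \/ z = g.
Proof.
move=> cz ez; have [iz _] := chute_intr cz.
have zk : `|C k - z ord0 k|%N = r.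
  have [j hj] := @linf_gt d c z r.-1 (ltac:(by rewrite ez prednK // ltnW)).
  have jk : j = k by apply/eqP; apply: contraT => /iz; lia.
  by have := linf_coord c z k; rewrite ez; rewrite jk in hj; lia.
move/chuteP: cz => [] [h1 h2].
- left; apply: linf_eq => j; have [->|/h1 //] := eqVneq j k.
  by move: h2 zk fk r2; rewrite /btw; lia.
- by move: zk r2; rewrite h1; lia.
- right; apply: linf_eq => j; rewrite updE; case: (eqVneq j k) => [->|/h1 //].
  by move: h2 zk fk r2; rewrite /btw; lia.
Qed.

(** The exit is the centre of a face, so it has a single neighbour outside the box, and this
    neighbour lies on the shell. Vacancy of the shell thus prevents loops from crossing there. *)
Lemma chute_exit : exists a : V, [/\ nearest_neighbor g a, ~~ inbox h c a,
  forall u, nearest_neighbor u g -> ~~ inbox h c u -> u = a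
  & forall tau x, c = boxctr h tau x -> a \in gam h tau x].
Proof.
pose sg : int := if f ord0 k <= C k then 1 else -1.
have sg1 : `|sg|%N = 1%N by rewrite /sg; case: ifP.
have gk : g ord0 k = 2 * C k - f ord0 k by rewrite updE eqxx.
have gj j : j != k -> g ord0 j = C j by move=> jk; rewrite updE (negPf jk).
have far : absz (C k - (g ord0 k + sg))%R = r.+1.
  by move: fk r2; rewrite gk /sg; case: ifP; lia.
exists (upd g k (g ord0 k + sg)); split.
- by rewrite -{1}(upd_id g k); apply: nn_upd; move: sg1; lia.
- apply/negP => /inboxP [/(_ k) + _]; rewrite updE eqxx far; lia.
- move=> u /nnP [i [hi hj]] nu.
  have ik : i = k.
    apply/eqP; apply: contraT => ik; exfalso; move/negP: nu; apply; apply/inboxP.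
    have uk : u ord0 k = g ord0 k by apply: hj; rewrite eq_sym.
    have ui : `|C i - u ord0 i|%N = 1%N by move: hi; rewrite gj //; lia.
    have uj j : j != i -> j != k -> u ord0 j = C j by move=> ji jk; rewrite hj // gj.
    split=> [j|].
      have [->|ji] := eqVneq j i; first by rewrite ui ltnW.
      have [->|jk] := eqVneq j k; first by move: fk; rewrite uk gk; lia.
      by rewrite uj // subrr.
    have e j : `|C j - u ord0 j|%N = r -> j = k.
      move=> e; apply/eqP; apply: contraT => jk; move: e r2.
      have [->|ji] := eqVneq j i; first by rewrite ui; lia.
      by rewrite uj // subrr; lia.
    by move=> j j' /e -> /e ->.
  subst i; apply: linf_eq => j; rewrite [RHS]updE; case: (eqVneq j k) => [->|/hj //].
  have : u ord0 k = g ord0 k + sg \/ u ord0 k = g ord0 k - sg by move: hi sg1; lia.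
  case=> // e; exfalso; move/negP: nu; apply; apply: intr_inbox.
    by move=> j' jk'; rewrite hj // gj // subrr; move: r2; lia.
  by rewrite e; move: far sg1 r2; rewrite gk /sg; move: fk; case: ifP; lia.
- move=> tau x ec.
  have g' j : j != k -> upd g k (g ord0 k + sg) ord0 j = boxctr h tau x ord0 j.
    by move=> jk; rewrite updE (negPf jk) gj // ec.
  apply/mem_gam; split.
  + apply: (@grid_intro _ _ _ k) => j jk; exists (tau ord0 j + 4 * x ord0 j).
    by rewrite g' // mxE.
  + by apply: leq_trans (linf_coord _ _ k); rewrite -ec updE eqxx far.
  + apply/linfP => j; have [->|jk] := eqVneq j k; first by rewrite -ec updE eqxx far; move: r2; lia.
    by rewrite g' // subrr.
Qed.

Lemma chute_route u v : inbox h c u -> ~~ chute u -> inbox h c v -> ~~ chute v ->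
  exists s, [/\ exists p, s = u :: p /\ path nn u p, last u s = v,
    all (inbox h c) s, all (predC chute) s & (size s <= (2 * r).+1 ^ d)%N].
Proof.
move=> bu nu bv nv.
have [p [pp lp Zp]] := chute_compl (conj bu nu) (conj bv nv).
case/shortenP: pp lp Zp => q pq uq sq lq Zp.
have Zq z : z \in u :: q -> inbox h c z /\ ~~ chute z.
  by move=> zq; apply: Zp; move: zq; rewrite !inE => /orP[->//|/sq ->]; rewrite orbT.
exists (u :: q); split=> //.
- by exists q.
- by apply/allP => z /Zq [].
- by apply/allP => z /Zq [].
rewrite -(size_boxat c r); apply: uniq_leq_size uq _ => z /Zq [/inbox_dist hz _].
exact/mem_boxat.
Qed.

End Path.

Lemma face_path (c f : V) : inbox h c f -> linf_dist c f = r ->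
  exists (pi : pred V) (route : V -> V -> seq V) (g a : V),
  [/\ [/\ forall z, pi z -> inbox h c z,
      forall z, pi z -> linf_dist c z = r -> z = f \/ z = g,
      rconn nn [set z | pi z] f g &
      forall u v, inbox h c u -> ~~ pi u -> inbox h c v -> ~~ pi v ->
        [/\ exists p, route u v = u :: p /\ path nn u p, last u (route u v) = v,
          all (inbox h c) (route u v), all (predC pi) (route u v)
          & (size (route u v) <= (2 * r).+1 ^ d)%N]],
   nearest_neighbor g a, ~~ inbox h c a,
   forall u, nearest_neighbor u g -> ~~ inbox h c u -> u = a
  & forall tau x, c = boxctr h tau x -> a \in gam h tau x].
Proof.
move=> bf ef.
have [k fk] : exists k, `|c ord0 k - f ord0 k|%N = r.
  have r1 : (0 < r)%N by exact: rho_gt0.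
  have [j hj] := @linf_gt d c f r.-1 (ltac:(by rewrite ef prednK)).
  by exists j; have := linf_coord c f j; rewrite ef; lia.
pose route u v : seq V := if pselect (exists s, [/\ exists p, s = u :: p /\ path nn u p,
    last u s = v, all (inbox h c) s, all (predC (chute c f k)) s
    & (size s <= (2 * r).+1 ^ d)%N]) is left e then sval (cid e) else [::].
have [a [a1 a2 a3 a4]] := chute_exit bf fk.
exists (chute c f k), route, (upd c k (2 * c ord0 k - f ord0 k)), a; split=> //; split.
- exact: (chute_inbox bf fk).
- exact: (chute_face bf fk).
- exact: (chute_conn bf fk).
- move=> u v bu nu bv nv; have e := chute_route bf fk bu nu bv nv.
  by rewrite /route; case: pselect => // e'; case: (cid e').
Qed.

End FacePath.

(** * Exploring a vacant cluster box by box *)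

Section Exploration.
Context {R : realType} {disp : measure_display} {Omega : measurableType disp}.
Variables (P : probability Omega R) (d : nat) (alpha : R) (L : Omega -> loop d -> nat).
Hypothesis soup : loop_soup P alpha L.
Hypothesis alpha0 : 0 <= alpha.
Hypothesis alpha1 : alpha <= 1.
Hypothesis hd : (3 <= d)%N.
Variable h : nat.
Hypothesis h0 : (0 < h)%N.
Variable fam : seq (loop d).
Hypothesis uf : uniq fam.
Local Notation V := 'rV[int]_d.
Local Notation nn := (@nearest_neighbor d).
Local Notation pr := (Pr P L fam).
Local Notation r := (rho h).
Local Notation m := ((2 * r).+1 ^ d)%N.
Local Notation cfg := (loop d -> nat).
Variables (tau : V) (K : nat).
Local Notation bx x := (inbox h (boxctr h tau x)).
Local Notation bl x := (boxat (boxctr h tau x) r).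

Definition ebit (nu : cfg) (e : V * V) : Prop := exists2 t, (0 < nu t)%N & e \in edges_of t.
(** Equality of all the information outside box x used by the exploration; surgery in box x and
    removal of loops contained in it preserve it. *)
Definition agree (x : V) (nu nu' : cfg) : Prop :=
  [/\ forall z, ~~ bx x z -> hit nu z <-> hit nu' z,
    forall e, ~~ both_in (bx x) e -> ebit nu e <-> ebit nu' e
  & forall y, y != x -> occupation fam (bx y) nu = occupation fam (bx y) nu'].

Lemma agree_sym x nu nu' : agree x nu nu' -> agree x nu' nu.
Proof.
move=> [h1 h2 h3]; split; first by move=> z /h1 [].
  by move=> e /h2 [].
by move=> y /h3.
Qed.

Lemma hit_addl (nu : cfg) t z : hit (addl nu t) z <-> hit nu z \/ z \in rep t.
Proof.
split.
  move=> [s]; rewrite /addl; have [->|st] := eqVneq s t; first by right.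
  by rewrite addn0 => ns zs; left; exists s.
case=> [[s ns zs]|zt]; first by exists s => //; rewrite /addl ltn_addr.
by exists t => //; rewrite /addl eqxx addn1.
Qed.

Lemma ebit_addl (nu : cfg) t e : ebit (addl nu t) e <-> ebit nu e \/ e \in edges_of t.
Proof.
split.
  move=> [s]; rewrite /addl; have [->|st] := eqVneq s t; first by right.
  by rewrite addn0 => ns zs; left; exists s.
case=> [[s ns zs]|zt]; first by exists s => //; rewrite /addl ltn_addr.
by exists t => //; rewrite /addl eqxx addn1.
Qed.

Lemma occ_addl (b : pred V) nu t : t \in fam ->
  occupation fam b (addl nu t) = (occupation fam b nu + visits b t)%N.
Proof. by move=> tf; have := wsum_addl uf xpredT (visits b) nu tf; rewrite mul1n. Qed.

Lemma bx_disj x y z : bx x z -> bx y z -> x = y.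
Proof. by move=> /inbox_dist h1 /inbox_dist h2; apply: (box_disjoint hd h0 h1 h2). Qed.

Lemma agree_surg x pi route nu t t' :
  (forall u v, bx x u -> ~~ pi u -> bx x v -> ~~ pi v ->
    [/\ exists p, route u v = u :: p /\ path nn u p, last u (route u v) = v,
      all (bx x) (route u v), all (predC pi) (route u v) & (size (route u v) <= m)%N]) ->
  t \in fam -> t' \in fam -> psi_rel (bx x) pi route t t' ->
  agree x (addl nu t) (addl nu t').
Proof.
move=> rP tf tf' pt; split.
- move=> z bz; rewrite !hit_addl.
  have := psi_count rP (a := pred1 z) pt (fun y (e : pred1 z y) => ltac:(by rewrite (eqP e))).
  by rewrite -!has_pred1 !has_count => ->.
- by move=> e be; rewrite !ebit_addl (psi_mem_edges rP pt be).
- move=> y yx; rewrite !occ_addl //; congr (_ + _)%N; apply: (psi_count rP) => // z by_.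
  by apply/negP => bz; move/eqP: yx; apply; apply: bx_disj by_ bz.
Qed.

Lemma edgeP t (e : V * V) : e \in edges_of t -> [/\ e.1 \in rep t, e.2 \in rep t & nn e.1 e.2].
Proof.
have /andP[_] := rep_ok t; rewrite /edges_of /cyc_edges (cycle_path 0).
have l : last 0 (rep t) \in rep t.
  by have := rep_neq0 t; case: (rep t) => // y s _ /=; exact: mem_last.
suff H (s : seq V) (x : V) : path nn x s -> e \in pairmap pair x s ->
    [/\ e.1 \in x :: s, e.2 \in s & nn e.1 e.2].
  by move=> /H h1 /h1 []; rewrite inE => /orP[/eqP ->|].
elim: s x => [|y s IH] x //= /andP[xy ps]; rewrite inE => /orP[/eqP ->|/(IH y ps) []].
  by rewrite /= !mem_head.
by move=> h1 h2 ->; rewrite !inE [e.2 == y]eq_sym -in_cons inE h2 !orbT; split=> //; move: h1; rewrite !inE => ->; rewrite orbT.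
Qed.

Lemma agree_local x nu t : t \in fam -> all (bx x) (rep t) -> agree x (addl nu t) nu.
Proof.
move=> tf /allP at_; split.
- move=> z bz; rewrite hit_addl; split; [case=> // /at_|by left].
  by rewrite (negPf bz).
- move=> e be; rewrite ebit_addl; split; [case=> // et|by left].
  exfalso; move/negP: be; apply; rewrite /both_in.
  by have [e1 e2 _] := edgeP et; rewrite !at_.
- move=> y yx; rewrite occ_addl // /visits (_ : count _ _ = 0%N) ?addn0 //.
  apply/eqP; rewrite -leqn0 leqNgt -has_count; apply/hasPn => z /at_ bz.
  by apply/negP => by_; move/eqP: yx; apply; apply: bx_disj by_ bz.
Qed.

Variables (D : set V) (x0 : V) (sites : seq V) (allowed : cfg -> V -> Prop).
Hypothesis allowed_sites : forall nu x, allowed nu x -> x \in sites.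
Hypothesis allowed_agree : forall x y nu nu', agree x nu nu' -> allowed nu y -> allowed nu' y.
Hypothesis allowed_gam : forall nu x z, allowed nu x -> z \in gam h tau x -> D z /\ ~ hit nu z.
Hypothesis allowed_box : forall nu x z, allowed nu x -> bx x z -> D z.
Hypothesis fam_closed : forall x pi route t t', x \in sites ->
  (forall u v, bx x u -> ~~ pi u -> bx x v -> ~~ pi v ->
    [/\ exists p, route u v = u :: p /\ path nn u p, last u (route u v) = v,
      all (bx x) (route u v), all (predC pi) (route u v) & (size (route u v) <= m)%N]) ->
  t \in fam -> psi_rel (bx x) pi route t t' -> t' \in fam.

(** Vacant points that may be used once the boxes in S are opened; the inside of other allowed boxes
    stays unrevealed. *)
Definition free_set (nu : cfg) (S : seq V) : set V :=
  [set z | [/\ D z, ~ hit nu z & forall x, allowed nu x -> bx x z -> x \in S]].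
Definition explored nu S : set V := [set z | rconn nn (free_set nu S) x0 z].
Definition no_entry (nu : cfg) x f : Prop :=
  forall u, nearest_neighbor u f -> ~~ bx x u -> ~ ebit nu (u, f) /\ ~ ebit nu (f, u).
(** Whether f itself is vacant is not asked, only that no loop crosses the box boundary at f: this
    is visible from outside the box. *)
Definition touch nu S x f : Prop :=
  [/\ allowed nu x, x \notin S, bx x f, no_entry nu x f
    & exists z, [/\ explored nu S z, nearest_neighbor z f & ~~ bx x z]].
Definition next_site nu S : option V :=
  ohead [seq x <- sites | `[< exists f, touch nu S x f >]].
Definition first_face nu S x : option V := ohead [seq f <- bl x | `[< touch nu S x f >]].
Definition success nu S : Prop := exists z y, [/\ explored nu S z, allowed nu y & z \in gam h tau y].
Fixpoint opened nu i : seq V :=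
  if i is i'.+1 then (if next_site nu (opened nu i') is Some x then x :: opened nu i' else opened nu i')
  else [::].
Definition gains (nu : cfg) (S : seq V) : nat := count (fun x => (occupation fam (bx x) nu <= K)%N) S.

Lemma next_touch nu S x : next_site nu S = Some x -> exists f, touch nu S x f.
Proof.
rewrite /next_site; case E: [seq _ <- _ | _] => [//|a q] [<-].
have : a \in [seq x <- sites | `[< exists f, touch nu S x f >]] by rewrite E mem_head.
by rewrite mem_filter => /andP[/asboolP].
Qed.

Lemma next_none nu S x f : next_site nu S = None -> ~ touch nu S x f.
Proof.
rewrite /next_site; case E: [seq _ <- _ | _] => [|//] _ tf.
have : x \in [seq x <- sites | `[< exists f, touch nu S x f >]].
  rewrite mem_filter; apply/andP; split; first by apply/asboolP; exists f.
  by case: tf => /allowed_sites.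
by rewrite E.
Qed.

Lemma first_face_touch nu S x f : first_face nu S x = Some f -> touch nu S x f.
Proof.
rewrite /first_face; case E: [seq _ <- _ | _] => [//|a q] [<-].
have : a \in [seq f <- bl x | `[< touch nu S x f >]] by rewrite E mem_head.
by rewrite mem_filter => /andP[/asboolP].
Qed.

Lemma first_face_exists nu S x f : touch nu S x f ->
  exists2 f', f' \in bl x & first_face nu S x = Some f'.
Proof.
move=> tf; rewrite /first_face; case E: [seq _ <- _ | _] => [|a q].
  have : f \in [seq f <- bl x | `[< touch nu S x f >]].
    rewrite mem_filter; apply/andP; split; first exact/asboolP.
    by case: tf => _ _ /inbox_dist hz _ _; apply/mem_boxat.
  by rewrite E.
exists a => //; have : a \in [seq f <- bl x | `[< touch nu S x f >]] by rewrite E mem_head.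
by rewrite mem_filter => /andP[].
Qed.

Lemma opened_uniq nu i : uniq (opened nu i) /\ {subset opened nu i <= sites}.
Proof.
elim: i => //= i [IH1 IH2]; case E: next_site => [x|] //.
have [f [ax xS _ _ _]] := next_touch E; split=> /=; first by rewrite xS.
by move=> y; rewrite inE => /orP[/eqP ->|/IH2 //]; exact: allowed_sites ax.
Qed.

Lemma opened_mono nu i j : (i <= j)%N -> exists q, opened nu j = q ++ opened nu i.
Proof.
elim: j => [|j IH]; first by rewrite leqn0 => /eqP ->; exists [::].
rewrite leq_eqVlt => /orP[/eqP ->|]; first by exists [::].
rewrite ltnS => /IH [q e] /=; case: next_site => [x|]; last by exists q.
by exists (x :: q); rewrite e.
Qed.

Lemma opened_done nu : next_site nu (opened nu (size sites)) = None.
Proof.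
have step i : next_site nu (opened nu i) = None \/ (i < size (opened nu i.+1))%N.
  elim: i => [|i IH].
    by rewrite /=; case: next_site => [x|]; [right|left].
  case: IH => [e|IH]; first by left; rewrite /= e.
  rewrite [opened nu i.+2]/= ; case: next_site => [x|]; [right|by left].
  exact: IH.
case: (step (size sites)) => // hs.
have [u1 s1] := opened_uniq nu (size sites).+1.
by have := uniq_leq_size u1 s1; rewrite leqNgt hs.
Qed.

Lemma explored_sub nu S S' : {subset S <= S'} -> explored nu S `<=` explored nu S'.
Proof.
by move=> sS z; apply: rconn_sub => y [h1 h2 h3]; split=> // x ax bxy; apply: sS; exact: h3 bxy.
Qed.

Lemma success_mono nu i j : (i <= j)%N -> success nu (opened nu i) -> success nu (opened nu j).
Proof.
move=> /(opened_mono nu) [q ->] [z [y [h1 h2 h3]]]; exists z, y; split=> //.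
by apply: explored_sub h1 => a aq; rewrite mem_cat aq orbT.
Qed.

Lemma gains_mono nu i j : (i <= j)%N -> (gains nu (opened nu i) <= gains nu (opened nu j))%N.
Proof. by move=> /(opened_mono nu) [q ->]; rewrite /gains count_cat leq_addl. Qed.

Section Agree.
Variables (x : V) (nu nu' : cfg).
Hypothesis ag : agree x nu nu'.
Hypothesis ax : allowed nu x.

Let alE y : allowed nu y <-> allowed nu' y.
Proof. by split; [exact: (allowed_agree ag)|exact: (allowed_agree (agree_sym ag))]. Qed.

Lemma free_agree S : x \notin S -> free_set nu S = free_set nu' S.
Proof.
have [h1 _ _] := ag => xS; apply/seteqP; split=> z [Dz Hz Bz].
  split=> //; last by move=> y /alE; exact: Bz.
  by rewrite -h1 //; apply: contra xS; exact: Bz.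
split=> //; last by move=> y /alE; exact: Bz.
by rewrite h1 //; apply: contra xS; apply: Bz; exact/alE.
Qed.

Lemma touch_agree S y f : x \notin S -> touch nu S y f <-> touch nu' S y f.
Proof.
move=> xS; have [_ h2 _] := ag; rewrite /touch /explored (free_agree xS).
have ne : bx y f -> no_entry nu y f <-> no_entry nu' y f.
  move=> bf; suff E u : ~~ bx y u -> (ebit nu (u, f) <-> ebit nu' (u, f)) /\
      (ebit nu (f, u) <-> ebit nu' (f, u)).
    split=> H u nu_ bu; have [q1 q2] := H u nu_ bu; have [e1 e2] := E u bu.
      by rewrite -e1 -e2.
    by rewrite e1 e2.
  move=> bu; have nb : ~~ (bx x u && bx x f).
    apply/negP => /andP[b1 b2]; move/negP: bu; apply.
    by rewrite -(bx_disj b2 bf).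
  by split; apply: h2; rewrite /both_in /= // andbC.
by split=> -[q1 q2 q3 q4 q5]; (split; [exact/alE|by []|by []|exact/ne|by []]).
Qed.

Lemma next_agree S : x \notin S -> next_site nu S = next_site nu' S.
Proof.
move=> xS; rewrite /next_site; congr ohead; apply: eq_filter => y.
by apply/asboolP/asboolP => -[f tf]; exists f; apply/(touch_agree y f xS).
Qed.

Lemma first_face_agree S y : x \notin S -> first_face nu S y = first_face nu' S y.
Proof.
move=> xS; rewrite /first_face; congr ohead; apply: eq_filter => f.
by apply/asboolP/asboolP => tf; apply/(touch_agree y f xS).
Qed.

Lemma success_agree S : x \notin S -> success nu S <-> success nu' S.
Proof.
move=> xS; rewrite /success /explored (free_agree xS).
by split=> -[z [y [q1 q2 q3]]]; exists z, y; split=> //; apply/alE.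
Qed.

Lemma gains_agree S : x \notin S -> gains nu S = gains nu' S.
Proof.
have [_ _ h3] := ag => xS; apply: eq_in_count => y yS; rewrite h3 //.
by apply: contraNneq xS => <-.
Qed.

Lemma opened_agree i : x \notin opened nu i -> opened nu i = opened nu' i.
Proof.
elim: i => //= i IH; case E: next_site => [y|] /=.
  rewrite inE negb_or => /andP[_ xS]; rewrite -IH // -next_agree // E.
  by [].
by move=> xS; rewrite -IH // -next_agree // E.
Qed.

End Agree.

(** The whole past of the exploration when it is about to open box x at f. As x is not in S, the
    event is invariant under [agree]. *)
Definition Wf i S x f k : set cfg := [set nu | [/\ opened nu i = S, next_site nu S = Some x,
  first_face nu S x = Some f, ~ success nu S & gains nu S = k]].

Lemma free_vacant nu S z : free_set nu S z -> D z /\ ~ hit nu z.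
Proof. by case. Qed.

(** Surgery applied to the chute from f: entries at f are excluded by [no_entry], entries at the
    other end by vacancy of the shell. Once the chute is free of loops, opening the box joins the
    cluster to the shell. *)
Lemma entry_bound i S x f k : pr [set nu | Wf i S x f k nu /\ (occupation fam (bx x) nu <= K)%N] <=
  (surgery_const (bl x) m K)%:R * pr [set nu | Wf i S x f k nu /\ success nu (x :: S)].
Proof.
have [[nu0 [_ _ /first_face_touch [ax0 _ bf _ [z0 [_ nzf bz0]]] _ _]]|no] := pselect (exists nu, Wf i S x f k nu); last first.
  apply: (@le_trans _ _ 0); last by rewrite mulr_ge0 // (pr_ge0 soup uf).
  rewrite (_ : [set _ | _] = set0); last first.
    by apply/seteqP; split=> // nu [w _]; apply: no; exists nu.
  have /eqP := pr_disj soup uf (E := set0) (E' := set0) (fun _ h _ => h).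
  by rewrite setU0 -subr_eq0 opprD addrA subrr sub0r oppr_eq0 => /eqP ->.
have xs : x \in sites := allowed_sites ax0.
have fr := entry_face hd h0 nzf bz0 bf.
have [pi [route [g [a [[pb pf pc rP] nga ba au ag]]]]] := face_path hd h0 bf fr.
have aga : a \in gam h tau x by exact: ag.
have d0 : (0 < d)%N by lia.
have blP z : bx x z -> z \in bl x by move=> /inbox_dist hz; apply/mem_boxat.
have W_agree nu nu' : agree x nu nu' -> Wf i S x f k nu -> Wf i S x f k nu'.
  move=> an [w1 w2 w3 w4 w5]; have [ax xS _ _ _] := first_face_touch w3.
  split; first by rewrite -(opened_agree an ax) w1.
  - by rewrite -(next_agree an ax).
  - by rewrite -(first_face_agree an ax).
  - by move=> s'; apply: w4; apply/(success_agree an ax).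
  - by rewrite -(gains_agree an).
apply: le_trans (@surgery_bound _ _ _ P d alpha L soup alpha0 alpha1 d0 fam uf (bx x) pi (bl x)
  route m K blP pb rP (Wf i S x f k) _ _ _ _) _.
- move=> nu t tf nt [_ _ /first_face_touch [ax _ _ ne _] _ _].
  have gu : ~ hit nu a by have [] := allowed_gam ax aga.
  apply/allP => -[u v] et; have /= [ut vt nuv] := edgeP et.
  have eb : ebit nu (u, v) by exists t.
  rewrite /pi_free /=; apply/andP; split; apply/implyP => /andP[b1 b2]; apply/negP => pv.
    have [e|e] := pf _ pv (entry_face hd h0 nuv b1 b2).
      by subst v; case: (ne u nuv b1).
    subst v; have e := au _ nuv b1; subst u.
    by apply: gu; exists t.
  have nvu : nearest_neighbor v u by rewrite nn_sym.
  have [e|e] := pf _ pv (entry_face hd h0 nvu b2 b1).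
    by subst u; case: (ne v nvu b2).
  subst u; have e := au _ nvu b2; subst v.
  by apply: gu; exists t.
- by move=> nu t t' tf tf' pt; apply: W_agree; apply: agree_surg pt.
- by move=> nu t tf at_; apply: W_agree; exact: agree_local.
- by move=> t t' tf pt; apply: (fam_closed xs rP tf pt).
rewrite ler_wpM2l //; apply: (pr_le soup uf) => nu sn [w nohit]; split=> //.
case: w => _ _ /first_face_touch [ax xS _ _ [z [cz nzf' bz]]] _ _.
have vac y : pi y -> ~ hit nu y.
  move=> py [t nt yt]; have [tf|tf] := boolP (t \in fam); last by rewrite sn in nt.
  by move/negP: (nohit t tf nt); apply; apply/hasP; exists y.
have cS : explored nu (x :: S) z by apply: explored_sub cz => y yS; rewrite inE yS orbT.
have pfree y : pi y -> free_set nu (x :: S) y.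
  move=> py; split; [exact: (allowed_box ax (pb y py))|exact: vac|].
  by move=> x' _ bx'; rewrite (bx_disj bx' (pb y py)) mem_head.
have afree : free_set nu (x :: S) a.
  have [Da ha] := allowed_gam ax aga; split=> // x' _ bx'.
  by case: (gam_box hd h0 aga bx').
exists a, x; split=> //.
apply: (rconn_rcons (y := g)) => //; apply: (rconn_trans (y := f)).
  by apply: (rconn_rcons cS nzf'); apply: pfree; exact: (rconn_l pc).
by apply: rconn_sub pc => y; exact: pfree.
Qed.

(** The exploration has opened k boxes of occupation at most K and still has not reached the
    network. *)
Definition stuck k : set cfg := [set nu | exists2 i, (i <= size sites)%N &
  (k <= gains nu (opened nu i))%N /\ ~ success nu (opened nu i)].

Variable C : nat.
Hypothesis C_bound : forall x, (surgery_const (bl x) m K <= C)%N.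

(** Decompose at the opening that makes the count of light boxes k + 1. By [entry_bound] its
    probability is at most C times that of the same past followed by success; these successes are
    disjoint and lie in stuck k minus stuck (k+1). *)
Lemma stuck_step k : pr (stuck k.+1) * (C.+1)%:R <= C%:R * pr (stuck k).
Proof.
pose M := size sites.
pose faces := flatten [seq bl x | x <- sites].
pose idx := undup [seq (p, q) | p <- [seq (i, U) | i <- iota 0 M, U <- words sites M],
                         q <- [seq (x, f) | x <- sites, f <- faces]].
pose E1 (e : (nat * seq V) * (V * V)) : set cfg := [set nu |
  Wf e.1.1 e.1.2 e.2.1 e.2.2 k nu /\ (occupation fam (bx e.2.1) nu <= K)%N].
pose E2 (e : (nat * seq V) * (V * V)) : set cfg := [set nu |
  Wf e.1.1 e.1.2 e.2.1 e.2.2 k nu /\ success nu (e.2.1 :: e.1.2)].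
pose T := stuck k `\` stuck k.+1.
have up : pr (stuck k.+1) <= \sum_(e <- idx) pr (E1 e).
  apply: le_trans (pr_bigU soup uf idx E1); apply: (pr_le soup uf) => nu _ [i iM [gi si]].
  pose pk j := (k.+1 <= gains nu (opened nu j))%N.
  (* The first time the count exceeds k; the box opened at that moment is the light one. *)
  have : exists j, pk j by exists i.
  move=> /ex_minnP [j0 gj jmin].
  have j0i : (j0 <= i)%N by exact: jmin.
  case: j0 gj jmin j0i => [//|j] gj jmin ji.
  have gjk : (gains nu (opened nu j) <= k)%N.
    by rewrite leqNgt; apply/negP => /jmin; rewrite ltnn.
  have sj : ~ success nu (opened nu j).
    by move=> q; apply: si; apply: success_mono q; exact: ltnW.
  move: gj; rewrite /pk /=; case nx : (next_site nu (opened nu j)) => [x|]; last by rewrite ltnNge gjk.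
  rewrite /gains /= -/(gains nu (opened nu j)) => gj.
  have [f0 tf0] := next_touch nx; have [f fb ff] := first_face_exists tf0.
  have xs : x \in sites by case: tf0 => /allowed_sites.
  have [uo so] := opened_uniq nu j.
  exists ((j, opened nu j), (x, f)).
    rewrite mem_undup; apply/allpairsP; exists ((j, opened nu j), (x, f)); split=> //=.
      apply/allpairsP; exists (j, opened nu j); split=> //=.
        by rewrite mem_iota /= add0n; exact: leq_trans ji iM.
      apply: mem_words => //; exact: uniq_leq_size.
    apply/allpairsP; exists (x, f); split=> //=.
    by apply/flattenP; exists (bl x) => //; apply: (map_f (fun y => bl y)).
  have gk : gains nu (opened nu j) = k /\ (occupation fam (bx x) nu <= K)%N.
    by move: gj; case: (_ <= K)%N => /=; lia.
  by case: gk => gk ok; split=> //; split.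
have mid : \sum_(e <- idx) pr (E1 e) <= C%:R * \sum_(e <- idx) pr (E2 e).
  rewrite mulr_sumr; apply: ler_sum => e _; apply: le_trans (entry_bound _ _ _ _ _) _.
  by rewrite ler_wpM2r ?(pr_ge0 soup uf) // ler_nat C_bound.
have step nu i x : next_site nu (opened nu i) = Some x -> opened nu i.+1 = x :: opened nu i.
  by rewrite /= => ->.
have low : \sum_(e <- idx) pr (E2 e) <= pr T.
  apply: (pr_sum_disj soup uf); first exact: undup_uniq.
    move=> [[i U] [x f]]; rewrite mem_undup => /allpairsP [[p q] /= [hp _ [-> _]]] nu.
    move: hp => /allpairsP [[i' U'] /= [hi _ ->]]; rewrite mem_iota /= add0n in hi.
    move=> [] /= [w1 w2 w3 w4 w5] sc; split.
      by exists i'; [exact: ltnW|rewrite w1 w5].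
    move=> [j jM [gj sj]]; have [ji|ij] := leqP j i'.
      by have := gains_mono nu ji; rewrite w1 w5 leqNgt gj.
    apply: sj; apply: (success_mono ij); rewrite (step nu i' x) ?w1 //.
  have lt i i' U U' x x' f f' nu : E2 ((i, U), (x, f)) nu -> E2 ((i', U'), (x', f')) nu ->
      (i < i')%N -> False.
    move=> [] /= [w1 w2 w3 w4 w5] sc [] /= [v1 v2 v3 v4 v5] _ ii'.
    by apply: v4; rewrite -v1; apply: (success_mono ii'); rewrite (step nu i x) ?w1.
  move=> [[i U] [x f]] [[i' U'] [x' f']] nu _ _ h1 h2.
  have ii' : i = i'.
    by case: (ltngtP i i') => // q; [case: (lt _ _ _ _ _ _ _ _ _ h1 h2 q)|case: (lt _ _ _ _ _ _ _ _ _ h2 h1 q)].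
  move: h1 h2 => [] /= [w1 w2 w3 w4 w5] _ [] /= [v1 v2 v3 v4 v5] _.
  have UU : U = U' by rewrite -w1 -v1 ii'.
  have xx : x = x' by rewrite UU v2 in w2; case: w2.
  have -> : f = f' by rewrite UU xx v3 in w3; case: w3.
  by rewrite ii' UU xx.
have sum : pr T + pr (stuck k.+1) <= pr (stuck k).
  rewrite -(pr_disj soup uf); last by move=> nu [].
  apply: (pr_le soup uf) => nu _ [[]//|[i iM [gi si]]].
  by exists i => //; split=> //; exact: ltnW.
have main : pr (stuck k.+1) <= C%:R * pr T.
  by apply: le_trans up _; apply: le_trans mid _; rewrite ler_wpM2l.
have C0 : 0 <= (C%:R : R) by [].
rewrite -natr1 mulrDr mulr1; move: main sum C0.
move: (pr (stuck k.+1)) (pr T) (pr (stuck k)) (C%:R : R) => a t b c h1 h2 h3; nra.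
Qed.

Lemma stuck_bound k : pr (stuck k) <= (C%:R / C.+1%:R) ^+ k.
Proof.
elim: k => [|k IH]; first exact: (pr_le1 soup uf).
have c0 : 0 < (C.+1%:R : R) by rewrite ltr0n.
rewrite exprS mulrAC ler_pdivlMr //; apply: le_trans (stuck_step k) _.
by rewrite ler_wpM2l.
Qed.

End Exploration.

(** * Bad sites and the Peierls estimate *)

Lemma linf_sub d (x z : 'rV[int]_d) : linf_dist 0 (x - z) = linf_dist x z.
Proof. by apply: eq_bigr => i _; rewrite !mxE sub0r abszN. Qed.

Section Sparse.
Variables (R : realType) (d : nat).
Local Notation V := 'rV[int]_d.

Definition sparse (J : seq V) : Prop :=
  [/\ uniq J, forall i j, i \in J -> j \in J -> i != j -> (8 <= linf_dist i j)%N
    & forall i, i \in J -> \sum_(j <- J | j != i) (linf_dist i j)%:R^-1 <= 7^-1 :> R].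

Lemma sparse_filter (a : pred V) J : sparse J -> sparse [seq x <- J | a x].
Proof.
move=> [uJ dJ sJ]; split; first by rewrite filter_uniq.
  by move=> i j; rewrite !mem_filter => /andP[_ iJ] /andP[_ jJ]; exact: dJ.
move=> i; rewrite mem_filter => /andP[_ iJ]; apply: le_trans (sJ _ iJ).
rewrite big_filter_cond /= big_mkcond [leRHS]big_mkcond ler_sum // => j _.
by case: (a j) => //=; case: ifP.
Qed.

Lemma trees_sparse k x I : I \in trees k x -> sparse I.
Proof.
move=> /(trees_separated R) [uI dI sI]; split=> // i /sI hi; apply: le_trans hi _.
by rewrite ler_piMr ?invr_ge0 // gerBl exprn_ge0.
Qed.

Lemma harmonic_ge k : (k%:R / 2 : R) <= \sum_(t < 2 ^ k) (t.+1)%:R^-1.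
Proof.
elim: k => [|k IH]; first by rewrite mul0r sumr_ge0.
have -> : (2 ^ k.+1 = 2 ^ k + 2 ^ k)%N by rewrite expnS mul2n addnn.
rewrite big_split_ord /= -natr1 mulrDl; apply: lerD => //.
apply: (@le_trans _ _ (\sum_(i < 2 ^ k) (2 ^ k.+1)%:R^-1)).
  rewrite big_const_ord iter_addr addr0 -[_ *+ (2 ^ k)]mulr_natl expnS natrM invfM mulrCA.
  by rewrite divff ?mulr1 ?mul1r // pnatr_eq0 expn_eq0.
apply: ler_sum => i _; rewrite lef_pV2 ?posrE ?ltr0n ?expn_gt0 // ler_nat expnS.
by have := ltn_ord i; lia.
Qed.

End Sparse.

Section BadSites.
Context {R : realType} {disp : measure_display} {Omega : measurableType disp}.
Variables (P : probability Omega R) (d : nat) (alpha : R) (L : Omega -> loop d -> nat).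
Hypothesis soup : loop_soup P alpha L.
Hypothesis alpha0 : 0 <= alpha.
Hypothesis hd : (3 <= d)%N.
Variable h : nat.
Hypothesis h0 : (0 < h)%N.
Variable fam : seq (loop d).
Hypothesis uf : uniq fam.
Local Notation V := 'rV[int]_d.
Local Notation pr := (Pr P L fam).
Local Notation r := (rho h).
Local Notation c0 := (plum R (0 : V) ^+ 5).
Implicit Types (J : seq V) (x z : V).

(** A lower bound for the potential created by a segment of r + 1 points at its end; it grows like
    log r. *)
Definition line_mass : R := \sum_(t < r.+1) ((d + 100) * t.+1)%:R^-1.

Lemma line_mass_gt0 : 0 < line_mass.
Proof.
rewrite /line_mass big_ord_recl ltr_wpDr ?sumr_ge0 ?invr_gt0 ?ltr0n ?muln_gt0 ?addn_gt0 ?orbT //.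
Qed.

Lemma line_massE : line_mass = (d + 100)%:R^-1 * \sum_(t < r.+1) (t.+1)%:R^-1.
Proof. by rewrite mulr_sumr; apply: eq_bigr => t _; rewrite natrM invfM. Qed.

Definition gam_pot (j x : V) : R := line_mass^-1 * \sum_(z <- gamAll h j) plum R (x - z).

Lemma gam_pot_ge1 j x : x \in gamAll h j -> 1 <= gam_pot j x.
Proof.
move=> xj; rewrite /gam_pot mulrC ler_pdivlMr ?line_mass_gt0 // mul1r.
have [k [s [s1 ln]]] := gamAll_line hd h0 xj.
pose y (t : 'I_r.+1) : V := upd x k (x ord0 k + s * (t : nat)%:Z).
have yg t : y t \in gamAll h j by apply: ln; rewrite -ltnS.
have yi : injective y.
  move=> t t' /(congr1 (fun w : V => w ord0 k)); rewrite !updE eqxx => e.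
  apply: val_inj => /=; move: e; move: (x ord0 k) (nat_of_ord t) (nat_of_ord t') => a b c.
  have: s = 1 \/ s = -1 by lia.
  by case=> ->; lia.
have ug : uniq (gamAll h j).
  by rewrite filter_uniq // /boxat map_inj_uniq ?uniq_boxseq //; exact: addrI.
apply: (@le_trans _ _ (\sum_(z <- [seq y t | t <- enum 'I_r.+1]) plum R (x - z))).
  rewrite big_map big_enum /=; apply: ler_sum => t _; apply: (plum_lo R).
  rewrite linf_sub; apply/linfP => i; rewrite updE; case: eqP => [->|_]; last by rewrite subrr.
  by move: s1; move: (val t) => b; nia.
rewrite [leRHS](bigID (fun z => z \in [seq y t | t <- enum 'I_r.+1])) /= ler_wpDr //.
  by apply: sumr_ge0 => z _; exact: ltW (plum_gt0 _ _).
rewrite -[leRHS]big_filter le_eqVlt; apply/orP; left; apply/eqP.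
have uy : uniq [seq y t | t <- enum 'I_r.+1] by rewrite map_inj_uniq // enum_uniq.
apply: perm_big; apply: uniq_perm => //; first by rewrite filter_uniq.
move=> z; rewrite mem_filter; case e: (z \in _) => //=; symmetry.
by move/mapP: e => [t _ ->]; exact: yg.
Qed.

Lemma gam_far i j x z : (5 <= linf_dist i j)%N -> x \in gamAll h i -> z \in gamAll h j ->
  (2 * r * linf_dist i j <= linf_dist x z)%N.
Proof.
move=> D5 /mem_gamAll [_ hx] /mem_gamAll [_ hz].
have := boxctr_dist hd h0 0 i j.
have := linf_triangle x (boxctr h 0 i) (boxctr h 0 j).
have := linf_triangle z x (boxctr h 0 j); rewrite (linf_distC z) => t1 t2 e.
by move: t2; rewrite e; nia.
Qed.

(** The potential of a whole grid seen from distance D in site units is at most a constant over D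
    times [line_mass]. Summed over a sparse family it is of order 1/log r, which gives the
    separation required by [Pr_hits]. *)
Lemma hits_bound J (eps : R) : sparse R J -> 0 < eps -> eps <= 1 ->
  (2 * (d * 11 ^ d * 11))%:R <= eps * line_mass ->
  alpha * ((d * 11 ^ d * (11 * r))%:R * (2 / c0)) <= eps ->
  pr [set nu | forall i, i \in J -> hits nu (gamAll h i)] <= eps ^+ size J.
Proof.
move=> [uJ dJ sJ] e0 e1 lge asm.
have lg0 := line_mass_gt0; have c00 : 0 < c0 by rewrite exprn_gt0 // plum_gt0.
have r0 : (0 < r)%N by exact: rho_gt0.
apply: (Pr_hits soup alpha0 hd uf e0 e1 (h := gam_pot)).
- move=> j x; rewrite /gam_pot mulr_ge0 ?invr_ge0 ?(ltW lg0) // sumr_ge0 // => z _.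
  exact: ltW (plum_gt0 _ _).
- move=> j x; rewrite /gam_pot avgZ ler_wpM2l ?invr_ge0 ?(ltW lg0) // avg_sum ler_sum // => z _.
  rewrite avg_shift; apply: le_trans (plum_super R hd _) _.
  by rewrite gerBl exprn_ge0 // ltW // plum_gt0.
- exact: gam_pot_ge1.
- move=> j; apply: le_trans asm; rewrite ler_wpM2l // ler_wpM2r ?ler_nat ?(size_gamAll hd h0) //.
  by rewrite divr_ge0 // ltW.
- split=> //.
    move=> i j x iJ jJ xi xj; apply/eqP; apply: contraT => ij.
    have D8 := dJ i j iJ jJ ij.
    have := gam_far (ltac:(by apply: leq_trans D8) : (5 <= _)%N) xi xj.
    by rewrite linfxx leqNgt muln_gt0 (muln_gt0 2) r0 /= (leq_trans _ D8).
  move=> i x iJ xi.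
  have hj j : j \in J -> j != i -> gam_pot j x <=
      line_mass^-1 * (d * 11 ^ d * 11)%:R * (linf_dist i j)%:R^-1.
    move=> jJ ji; have D8 : (8 <= linf_dist i j)%N by apply: dJ; rewrite // eq_sym.
    rewrite /gam_pot -mulrA ler_wpM2l ?invr_ge0 ?(ltW lg0) //.
    apply: (@le_trans _ _ (\sum_(z <- gamAll h j) (r * linf_dist i j)%:R^-1)).
      rewrite big_seq [leRHS]big_seq ler_sum // => z zj; apply: (plum_up R).
        by rewrite muln_gt0 r0 /= (leq_trans _ D8).
      rewrite linf_sub; apply: leq_trans (gam_far _ xi zj); last by apply: leq_trans D8.
      by rewrite -mulnA leq_pmull.
    rewrite big_const_seq count_predT iter_addr addr0 -[_ *+ size _]mulr_natl natrM invfM mulrA.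
    rewrite ler_wpM2r ?invr_ge0 // ler_pdivrMr ?ltr0n // -natrM ler_nat -mulnA.
    exact: size_gamAll.
  apply: (@le_trans _ _ (\sum_(j <- J | j != i) line_mass^-1 * (d * 11 ^ d * 11)%:R * (linf_dist i j)%:R^-1)).
    rewrite big_seq_cond [leRHS]big_seq_cond ler_sum // => j /andP[jJ ji]; exact: hj.
  rewrite -mulr_sumr; apply: le_trans (ler_wpM2l _ (sJ i iJ)) _.
    by rewrite mulr_ge0 // invr_ge0 ltW.
  rewrite -mulrA mulrC ler_pdivrMr //; move: lge; rewrite natrM.
  move: ((d * 11 ^ d * 11)%:R : R) (ler0n R (d * 11 ^ d * 11)) => q q0 lge.
  by lra.
Qed.

Definition kappa : R := ((d + 100) * r.+1)%:R^-1 ^+ 5.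

(** The potentials of the centres sum to at most 1 + 1/7 everywhere: compare distances with those
    from the centre nearest to the point. Hence the choice C = 2 and eta = kappa/3 in
    [Pr_visits]. *)
Lemma visits_bound J tau (K : nat) : sparse R J ->
  alpha * (((2 * r).+1 ^ d)%:R * (3 / c0)) <= 1 ->
  pr [set nu | forall i, i \in J -> (K < occupation fam (inbox h (boxctr h tau i)) nu)%N] <=
  (((1 + kappa / 3)^-1) ^+ K.+1) ^+ size J.
Proof.
move=> [uJ dJ sJ] asm.
have r0 : (0 < r)%N by exact: rho_gt0.
have k0 : 0 < kappa by rewrite exprn_gt0 // invr_gt0 ltr0n muln_gt0 addn_gt0 orbT.
have -> : (((1 + kappa / 3)^-1) ^+ K.+1) ^+ size J = \prod_(i <- J) (1 + kappa / 3)^-1 ^+ K.+1.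
  by rewrite big_const_seq count_predT iter_mulr mulr1.
apply: (Pr_visits soup alpha0 hd uf (b := fun i => inbox h (boxctr h tau i))
  (bl := fun i => boxat (boxctr h tau i) r) (o := fun i => boxctr h tau i) (kappa := kappa) (C := 2)).
- by move=> i z /inbox_dist hz; apply/mem_boxat.
- move=> i x /inbox_dist hx; rewrite /kappa lerXn2r ?nnegrE ?invr_ge0 ?(ltW (plum_gt0 _ _)) //.
  by apply: (plum_lo R); rewrite linf_sub linf_distC.
- move=> x; case: (J) uJ dJ sJ => [|j0 J'] uJ' dJ' sJ'; first by rewrite big_nil.
  set J1 := j0 :: J' in uJ' dJ' sJ' *.
  have [i0 i0J imin] : exists2 i0, i0 \in J1 &
      forall j, j \in J1 -> (linf_dist x (boxctr h tau i0) <= linf_dist x (boxctr h tau j))%N.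
    rewrite /J1; elim: (J') (j0) => [|a q IH] b.
      by exists b; [rewrite mem_head|move=> j; rewrite inE => /eqP ->].
    have [i i1 i2] := IH a.
    have [le|lt] := leqP (linf_dist x (boxctr h tau b)) (linf_dist x (boxctr h tau i)).
      exists b; first exact: mem_head.
      move=> j; rewrite inE => /orP[/eqP ->//|/i2]; exact: leq_trans.
    exists i; first by rewrite inE i1 orbT.
    by move=> j; rewrite inE => /orP[/eqP ->|/i2 //]; exact: ltnW.
  rewrite (bigD1_seq i0) //=; apply: (@le_trans _ _ (1 + 7^-1)); last by lra.
  apply: lerD; first exact: plum_le1.
  apply: le_trans (sJ' i0 i0J); rewrite big_seq_cond [leRHS]big_seq_cond ler_sum // => j /andP[jJ ji].
  have D8 : (8 <= linf_dist i0 j)%N by apply: dJ' => //; rewrite eq_sym.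
  apply: (plum_up R); first by rewrite (leq_trans _ D8).
  rewrite linf_sub; have := imin j jJ; have := boxctr_dist hd h0 tau i0 j.
  have := linf_triangle x (boxctr h tau i0) (boxctr h tau j).
  by rewrite (linf_distC _ x) => t1 e; move: t1; rewrite e; nia.
- by rewrite divr_gt0.
- by rewrite -mulrA; have -> : (3^-1 : R) * (1 + 2) = 1; [lra|rewrite mulr1].
- move=> x; rewrite -size_filter; case E: [seq i <- J | inbox h (boxctr h tau i) x] => [|i [|j q]] //.
  have m i' : i' \in [:: i, j & q] -> i' \in J /\ inbox h (boxctr h tau i') x.
    by rewrite -E mem_filter => /andP[].
  have [_ /inbox_dist bi] := m i (mem_head _ _).
  have [_ /inbox_dist bj] : j \in J /\ inbox h (boxctr h tau j) x by apply: m; rewrite !inE eqxx orbT.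
  have : uniq [:: i, j & q] by rewrite -E filter_uniq.
  by rewrite (box_disjoint hd h0 bi bj) /= inE eqxx.
- move=> i; rewrite size_boxat; apply: le_trans asm; rewrite ler_wpM2l // ler_wpM2l //.
Qed.

Variable K : nat.
Definition heavy (nu : loop d -> nat) (tau x : V) : Prop :=
  (K < occupation fam (inbox h (boxctr h tau x)) nu)%N.
Definition bad (nu : loop d -> nat) : set V :=
  [set x | hits nu (gamAll h x) \/ exists2 tau, tau \in taus d & heavy nu tau x].

(** There are 4^d + 1 reasons for being bad, so one of them applies to a fraction 1/(4^d+1) of I.
    The union bound is over the reason and the subset, encoded by at most 3^|I| Boolean words. *)
Lemma bad_bound I (eta : R) : sparse R I -> 0 < eta -> eta <= 1 ->
  (forall J, sparse R J -> pr [set nu | forall i, i \in J -> hits nu (gamAll h i)] <= 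
     (eta ^+ (4 ^ d).+1) ^+ size J) ->
  (forall J tau, sparse R J -> pr [set nu | forall i, i \in J -> heavy nu tau i] <= 
     (eta ^+ (4 ^ d).+1) ^+ size J) ->
  pr [set nu | forall i, i \in I -> bad nu i] <= ((4 ^ d).+1 * 3 ^ size I)%:R * eta ^+ size I.
Proof.
move=> sI e0 e1 H1 H2; pose Q : seq (option V) := None :: map Some (taus d).
pose ty nu (a : option V) i : bool :=
  if a is Some tau then `[< heavy nu tau i >] else `[< hits nu (gamAll h i) >].
pose Jm (mk : seq bool) := [seq x <- I | x \in mask mk I].
pose idx := [seq (a, mk) | a <- Q, mk <- [seq mk <- words [:: true; false] (size I) |
   size I <= size (Jm mk) * (4 ^ d).+1]]%N.
have sQ : size Q = (4 ^ d).+1 by rewrite /= size_map size_taus.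
have tyP nu a i : ty nu a i <-> (if a is Some tau then heavy nu tau i else hits nu (gamAll h i)).
  by case: a => [tau|]; split=> /asboolP.
pose E (p : option V * seq bool) : set (loop d -> nat) :=
  [set nu | forall i, i \in Jm p.2 -> ty nu p.1 i].
have HE p : p \in idx -> pr (E p) <= eta ^+ size I.
  case: p => a mk /allpairsP [[a' mk'] /= [_ + [-> ->]]]; rewrite mem_filter => /andP[hs _].
  have sJ : sparse R (Jm mk') by exact: sparse_filter.
  apply: (@le_trans _ _ ((eta ^+ (4 ^ d).+1) ^+ size (Jm mk'))); last first.
    by rewrite -exprM ler_wiXn2l ?(ltW e0) // mulnC.
  case: (a') => [tau|]; [apply: le_trans (H2 _ tau sJ)|apply: le_trans (H1 _ sJ)];
    by apply: (pr_le soup uf) => nu _ q0 i /q0 /tyP.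
have cov : pr [set nu | forall i, i \in I -> bad nu i] <= \sum_(p <- idx) pr (E p).
  apply: le_trans (pr_bigU soup uf idx E); apply: (pr_le soup uf) => nu _ hb.
  have tot : (size I <= \sum_(a <- Q) count (ty nu a) I)%N.
    elim: (I) hb => [|i I' IH] hb //=.
    rewrite big_split /=; rewrite -add1n; apply: leq_add; last first.
      by apply: IH => j jI; apply: hb; rewrite inE jI orbT.
    have [a aQ ta] : exists2 a, a \in Q & ty nu a i.
      case: (hb i (mem_head _ _)) => [hh|[tau tt ht]].
        by exists None; [rewrite mem_head|apply/tyP].
      by exists (Some tau); [rewrite inE /= (map_f Some tt)|apply/tyP].
    by rewrite (big_rem a) //= ta.
  have [a aQ ha] : exists2 a, a \in Q & (size I <= count (ty nu a) I * (4 ^ d).+1)%N.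
    apply: contrapT => no.
    have lt a : a \in Q -> (count (ty nu a) I * (4 ^ d).+1 < size I)%N.
      by move=> aQ; rewrite ltnNge; apply/negP => q0; apply: no; exists a.
    have : (\sum_(a <- Q) (count (ty nu a) I * (4 ^ d).+1).+1 <= \sum_(a <- Q) size I)%N.
      by rewrite big_seq [X in (_ <= X)%N]big_seq leq_sum.
    have -> : (\sum_(a <- Q) (count (ty nu a) I * (4 ^ d).+1).+1 =
        (\sum_(a <- Q) count (ty nu a) I) * (4 ^ d).+1 + size Q)%N.
      under eq_bigr => a _ do rewrite -addn1.
      by rewrite big_split /= big_distrl /= sum1_size.
    rewrite big_const_seq count_predT iter_addn addn0 sQ leqNgt => /negP; apply.
    by have : (0 < (4 ^ d).+1)%N by []; move: tot; move: (\sum_(a <- Q) _)%N (4 ^ d).+1 => u v; nia.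
  pose mk := map (ty nu a) I.
  have Jmk : Jm mk = [seq x <- I | ty nu a x].
    by apply: eq_in_filter => x xI; rewrite -filter_mask mem_filter xI andbT.
  exists (a, mk).
    apply/allpairsP; exists (a, mk); split=> //=; rewrite mem_filter Jmk size_filter ha /=.
    apply: mem_words; first by rewrite size_map.
    by move=> x _; case: x; rewrite !inE.
  by move=> i /=; rewrite Jmk mem_filter => /andP[].
apply: le_trans cov _; apply: (@le_trans _ _ (\sum_(p <- idx) eta ^+ size I)).
  by rewrite big_seq [leRHS]big_seq ler_sum.
rewrite big_const_seq count_predT iter_addr addr0 -[_ *+ size idx]mulr_natl.
rewrite ler_wpM2r ?exprn_ge0 ?(ltW e0) // ler_nat size_allpairs sQ leq_mul2l; apply/orP; right.
rewrite size_filter; apply: leq_trans (count_size _ _) _.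
exact: leq_trans (size_words _ _) _.
Qed.

(* Peierls: a large star-connected bad set contains the leaves of a separated dyadic tree. *)
Definition no_bad_path (B : set V) (N m : nat) : Prop :=
  forall u v, rconn (@star d) (B `&` lball 0 N) u v -> (linf_dist u v < m)%N.

Lemma peierls (N k : nat) (p : R) : 0 <= p -> (forall I, sparse R I -> size I = (2 ^ k)%N ->
    pr [set nu | forall i, i \in I -> bad nu i] <= p) ->
  pr [set nu | ~ no_bad_path (bad nu) N (2 * 16 ^ k).+1] <=
    ((2 * N).+1 ^ d * tree_const d ^ (2 ^ k))%:R * p.
Proof.
move=> p0 hp; pose idx := flatten [seq trees k x | x <- boxseq d N].
apply: (@le_trans _ _ (\sum_(I <- idx) pr [set nu | forall i, i \in I -> bad nu i])).
  apply: le_trans (pr_bigU soup uf idx _); apply: (pr_le soup uf) => nu _ nb.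
  have [u [v [c far]]] : exists u v, rconn (@star d) (bad nu `&` lball 0 N) u v /\
      (2 * 16 ^ k < linf_dist u v)%N.
    apply: contrapT => no; apply: nb => u v c; rewrite ltnS leqNgt; apply/negP => q.
    by apply: no; exists u, v.
  have [I It hI] := tree_crossing c (ltac:(by rewrite linfxx) : (linf_dist u u <= 16 ^ k)%N) far.
  exists I; last by move=> i /hI [].
  apply/flattenP; exists (trees k u) => //; apply: map_f; apply/mem_boxseq.
  by have [_] := rconn_l c.
apply: (@le_trans _ _ (\sum_(I <- idx) p)).
  rewrite big_seq [leRHS]big_seq ler_sum // => I /flattenP [_ /mapP [x _ ->] It].
  by apply: hp; [exact: trees_sparse It|exact: trees_size It].
rewrite big_const_seq count_predT iter_addr addr0 -[_ *+ size idx]mulr_natl.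
rewrite ler_wpM2r // ler_nat size_flatten /shape -map_comp sumnE big_map.
apply: (@leq_trans (\sum_(x <- boxseq d N) tree_const d ^ (2 ^ k))%N).
  by apply: leq_sum => x _; exact: trees_count.
by rewrite big_const_seq count_predT iter_addn addn0 size_boxseq mulnC.
Qed.

End BadSites.

(** * Deterministic step: large vacant sets are joined to the network *)

Section Levels.
Variable d : nat.
Local Notation V := 'rV[int]_d.
Local Notation nn := (@nearest_neighbor d).

(** Take the first arrival at level q and go back from there to the nearest visit at level p. *)
Lemma crossing_levels (A : set V) (f : V -> nat) a b p q :
  (forall x y, A x -> A y -> nn x y -> (f y <= f x + 1)%N) ->
  rconn nn A a b -> (f a <= p)%N -> (p < q)%N -> (q <= f b)%N ->
  exists u v, [/\ f u = p, f v = q & rconn nn (A `&` [set z | (p <= f z <= q)%N]) u v].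
Proof.
move=> lip c fa pq fb.
have Aa := rconn_l c.
have [z [z' [cz nzz Az' nfz _]]] := vconn_exit (A := [set z : V | (f z < q)%N]) c
  (leq_ltn_trans fa pq) (ltac:(by rewrite /= ltnNge fb)).
have fz' : (q <= f z')%N by rewrite leqNgt; apply/negP.
have [Az fz] := rconn_r cz; rewrite /= in fz.
have ez' : f z' = q by have := lip _ _ Az Az' nzz; lia.
have c2 : rconn nn (A `&` [set z | (f z <= q)%N]) z' a.
  apply: rconn_sym; first exact: nn_sym.
  apply: rconn_rcons (nzz) _; last by split=> //=; rewrite ez'.
  by apply: rconn_sub cz => y [Ay fy]; split=> //=; exact: ltnW.
have [y [y' [cy nyy [Ay' fy'] nfy _]]] := vconn_exit (A := [set z : V | (p < f z)%N]) c2
  (ltac:(by rewrite /= ez')) (ltac:(by rewrite /= ltnNge fa)).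
have {nfy} fy : (f y' <= p)%N by rewrite leqNgt; apply/negP.
have [[Ay fyq] /= fyp] := rconn_r cy; rewrite /= in fyq fy'.
have ey' : f y' = p.
  have nyy' : nn y' y by rewrite nn_sym.
  by have := lip _ _ Ay' Ay nyy'; lia.
exists y', z'; split=> //; apply: rconn_sym; first exact: nn_sym.
apply: rconn_rcons (nyy) _; last by split=> //=; rewrite ey' leqnn ltnW.
by apply: rconn_sub cy => x [[Ax /= fx] fx']; split=> //=; rewrite fx (ltnW fx').
Qed.

End Levels.

Section Deterministic.
Variables (d h : nat).
Hypothesis hd : (3 <= d)%N.
Hypothesis h0 : (0 < h)%N.
Local Notation V := 'rV[int]_d.
Local Notation nn := (@nearest_neighbor d).
Local Notation r := (rho h).
Let hd1 : (1 < d)%N. Proof. exact: ltnW. Qed.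

Let tausP (tau : V) : tau \in taus d <-> is_tau tau.
Proof. exact: (mem_taus hd h0). Qed.

Lemma boxctr_norm (tau x : V) q : is_tau tau -> (linf_dist 0 x <= q)%N ->
  (linf_dist 0 (boxctr h tau x) <= r * (4 * q + 3))%N.
Proof.
move=> ht /linfP hx; apply/linfP => j; rewrite !mxE sub0r abszN.
have := hx j; have := ht j; rewrite mxE sub0r abszN.
move: (x ord0 j) (tau ord0 j) => a t h1 h2.
by rewrite abszM absz_nat leq_mul2l; apply/orP; right; lia.
Qed.

Lemma gam_norm (tau x z : V) q : is_tau tau -> (linf_dist 0 x <= q)%N ->
  z \in gam h tau x -> (linf_dist 0 z <= r * (4 * q + 5))%N.
Proof.
move=> ht hx /mem_gam [_ _ hz]; have := boxctr_norm ht hx.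
move=> h1; apply: leq_trans (linf_triangle (boxctr h tau x) 0 z) _.
apply: leq_trans (leq_add h1 hz) _; rewrite [(2 * _)%N]mulnC -mulnDr leq_mul2l; apply/orP; right; lia.
Qed.

Lemma gamAll_norm (x z : V) q : (linf_dist 0 x <= q)%N ->
  z \in gamAll h x -> (linf_dist 0 z <= r * (4 * q + 8))%N.
Proof.
move=> hx /mem_gamAll [_ hz].
have ht : is_tau (0 : V) by move=> j; rewrite mxE.
have := boxctr_norm ht hx.
move=> h1; apply: leq_trans (linf_triangle (boxctr h 0 x) 0 z) _.
apply: leq_trans (leq_add h1 hz) _; rewrite [(5 * _)%N]mulnC -mulnDr leq_mul2l; apply/orP; right; lia.
Qed.

Lemma gam_chain (tau : V) (Z W : set V) x y z z' :
  (forall u, Z u -> forall v, v \in gam h tau u -> W v) -> rconn nn Z x y ->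
  z \in gam h tau x -> z' \in gam h tau y -> rconn nn W z z'.
Proof.
move=> ZW c zx z'y.
have net u v v' : Z u -> v \in gam h tau u -> v' \in gam h tau u -> rconn nn W v v'.
  by move=> Zu hv hv'; apply: rconn_sub (gam_conn hd h0 hv hv') => w; exact: ZW.
have H : [set u : V | forall v, v \in gam h tau u -> rconn nn W z v] y.
  apply: (vconn_inv c).
    by move=> v vx; apply: (net x) => //; exact: rconn_l c.
  move=> u u' Zu Zu' nu hu v vu'.
  have [g gu gu'] := gam_adj hd h0 tau nu.
  by apply: (rconn_trans (hu g gu)); exact: (net u').
exact: H.
Qed.

Lemma gam_neq0 (tau x : V) : exists z, z \in gam h tau x.
Proof.
pose i : 'I_d := Ordinal (ltac:(lia) : (0 < d)%N).
have nx : nn x (upd x i (x ord0 i + 1)).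
  by rewrite -{1}(upd_id x i); apply: nn_upd; lia.
by have [z hz _] := gam_adj hd h0 tau nx; exists z.
Qed.

Lemma site_norm (z : V) n n1 : (linf_dist 0 z <= n)%N -> (n + h <= 8 * h * n1)%N ->
  (linf_dist 0 (site_of h z) <= n1)%N.
Proof.
move=> /linfP hz hn; apply/linfP => j; rewrite !mxE sub0r abszN.
have := hz j; rewrite mxE sub0r abszN.
set a := z ord0 j + h%:Z => hj.
have hn0 : (8 * h)%:Z != 0 by lia.
have := divz_eq a (8 * h)%:Z; have := modz_ge0 a hn0.
have : modz a (8 * h)%:Z < (8 * h)%:Z by rewrite ltz_pmod //; lia.
have : (absz (z ord0 j) <= n)%N by [].
have : a = z ord0 j + h%:Z by [].
clear hj; move: a (z ord0 j) (divz a _) (modz a _) => a w q s ea hw h1 h2 h3; nia.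
Qed.

Lemma site_dist (z z' : V) D : (linf_dist (site_of h z) (site_of h z') <= D)%N ->
  (linf_dist z z' <= 8 * h * D.+1)%N.
Proof.
move=> /linfP hz; apply/linfP => j; have := hz j; rewrite !mxE.
set a := z ord0 j + h%:Z; set b := z' ord0 j + h%:Z.
have hn0 : (8 * h)%:Z != 0 by lia.
have := divz_eq a (8 * h)%:Z; have := modz_ge0 a hn0.
have : modz a (8 * h)%:Z < (8 * h)%:Z by rewrite ltz_pmod //; lia.
have := divz_eq b (8 * h)%:Z; have := modz_ge0 b hn0.
have : modz b (8 * h)%:Z < (8 * h)%:Z by rewrite ltz_pmod //; lia.
have -> : absz (z ord0 j - z' ord0 j)%R = absz (a - b)%R by rewrite /a /b; congr absz; ring.
move: a b => a b; move: (divz a _) (modz a _) (divz b _) (modz b _) => q s q' s' h1 h2 h3 h4 h5 h6 h7.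
rewrite h3 h6; have : (absz ((q - q') * (8 * h)%:Z)%R <= 8 * h * D)%N.
  by rewrite abszM absz_nat mulnC leq_mul2l h7 orbT.
have -> : q * (8 * h)%:Z + s - (q' * (8 * h)%:Z + s') = (q - q') * (8 * h)%:Z + (s - s') by ring.
rewrite mulnS; move: ((q - q') * _) (8 * h * D)%N => w e; lia.
Qed.

Definition tau_bad (tau : V) (nu : loop d -> nat) : set V := [set x | hits nu (gam h tau x)].
(** Defined by hits of the shells of the shift tau only, not by [bad], so that it is determined
    outside the boxes of that shift, as the exploration requires. *)
Definition tau_allowed N n1 (tau : V) (nu : loop d -> nat) (x : V) : Prop :=
  outer_comp N.+1 (tau_bad tau nu) x /\ (linf_dist 0 x <= n1)%N.

Section Main.
Variables (R : realType) (N m n1 n J k K : nat) (U B : set V).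
Variables (nu : V -> loop d -> nat) (fam : V -> seq (loop d)).
Local Notation D := (lball (0 : V) (2 * n)).
Hypothesis m0 : (0 < m)%N.
Hypothesis k0 : (0 < k)%N.
Hypothesis n1N : (n1 + m <= N)%N.
Hypothesis ND : (r * (4 * N + 12) <= 2 * n)%N.
Hypothesis n_n1 : (n + h <= 8 * h * n1)%N.
Hypothesis Jn : (160 * h * (J * m.+1).+2 <= n)%N.
Hypothesis Jk : (k * 4 ^ d <= J)%N.
Hypothesis hitU : forall tau z, tau \in taus d -> D z -> hit (nu tau) z <-> ~ U z.
Hypothesis good_gam : forall x z, lball 0 N.+1 x -> ~ B x -> z \in gamAll h x -> U z.
Hypothesis good_occ : forall x tau, lball 0 N.+1 x -> ~ B x -> tau \in taus d ->
  (occupation (fam tau) (inbox h (boxctr h tau x)) (nu tau) <= K)%N.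
Hypothesis NB : no_bad_path B N.+1 m.
Hypothesis nstuck : forall tau x0, tau \in taus d -> lball 0 n x0 ->
  ~ stuck h (fam tau) tau K D x0 (boxseq d n1) (tau_allowed N n1 tau) k (nu tau).

Let Dgam tau x z : tau \in taus d -> (linf_dist 0 x <= N.+1)%N -> z \in gam h tau x -> D z.
Proof.
move=> /tausP ht hx hz; change (linf_dist 0 z <= 2 * n)%N.
apply: leq_trans (gam_norm ht hx hz) _.
by apply: leq_trans ND; rewrite leq_mul2l; apply/orP; right; lia.
Qed.

Let tau_badB tau x : tau \in taus d -> lball 0 N.+1 x -> tau_bad tau (nu tau) x -> B x.
Proof.
move=> ht hx [z zg hz]; apply: contrapT => nB.
have Dz := Dgam ht hx zg; apply: (proj1 (hitU ht Dz) hz).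
by apply: (good_gam hx nB); apply: gam_sub zg => //; exact/tausP.
Qed.

Let tau_outer tau x : tau \in taus d -> outer_comp N.+1 B x ->
  outer_comp N.+1 (tau_bad tau (nu tau)) x.
Proof.
move=> ht [y ny c]; exists y => //; apply: rconn_sub c => z [hz h1]; split=> //.
by case: h1 => [nB|->]; [left => /(tau_badB ht hz)|right].
Qed.

Lemma tau_network tau y y' z z' : tau \in taus d ->
  outer_comp N.+1 (tau_bad tau (nu tau)) y -> outer_comp N.+1 (tau_bad tau (nu tau)) y' ->
  (linf_dist 0 y <= n1)%N -> (linf_dist 0 y' <= n1)%N ->
  z \in gam h tau y -> z' \in gam h tau y' -> rconn nn (U `&` D) z z'.
Proof.
move=> ht oy oy' ny ny' zy zy'.
have NBt u v : rconn (@star d) (tau_bad tau (nu tau) `&` lball 0 N.+1) u v -> (linf_dist u v < m)%N.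
  by move=> c; apply: NB; apply: rconn_sub c => x [h1 h2]; split=> //; exact: (tau_badB ht).
have c := outer_comp_connected hd1 NBt n1N oy oy' ny ny'.
apply: (gam_chain _ c zy zy') => x [xN nb] v vx.
have Dv : D v by apply: (Dgam ht _ vx); exact: leqW.
split=> //; apply: contrapT => nU; apply: nb; exists v => //.
exact/(hitU ht Dv).
Qed.

(** The networks of two shifts both contain their shell at the good site s0, and the connected
    vacant grid [gamAll] of s0 contains both shells. *)
Lemma networks_joined tau tau' s0 y y' z z' : tau \in taus d -> tau' \in taus d ->
  outer_comp N.+1 B s0 -> (linf_dist 0 s0 <= n1)%N ->
  tau_allowed N n1 tau (nu tau) y -> tau_allowed N n1 tau' (nu tau') y' ->
  z \in gam h tau y -> z' \in gam h tau' y' -> rconn nn (U `&` D) z z'.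
Proof.
move=> ht ht' os ns [oy ny] [oy' ny'] zy zy'.
have [g gs] := gam_neq0 tau s0; have [g' gs'] := gam_neq0 tau' s0.
apply: (rconn_trans (tau_network ht oy (tau_outer ht os) ny ns zy gs)).
apply: (rconn_trans (y := g')); last first.
  exact: (tau_network ht' (tau_outer ht' os) oy' ns ny' gs' zy').
have sN : (linf_dist 0 s0 < N.+1)%N by lia.
have nB : ~ B s0 by apply: (outer_comp_good os).
have ga t w : t \in taus d -> w \in gam h t s0 -> w \in gamAll h s0.
  by move=> /tausP htt; exact: gam_sub.
apply: rconn_sub (gamAll_conn hd h0 (ga _ _ ht gs) (ga _ _ ht' gs')) => w wg; split.
  by apply: good_gam wg => //; exact: ltnW.
rewrite /lball /=; apply: leq_trans (gamAll_norm ns wg) _.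
by apply: leq_trans ND; rewrite leq_mul2l; apply/orP; right; lia.
Qed.

Section Reach.
Variables (A : set V) (a b : V).
Hypothesis AU : A `<=` U `&` lball 0 n.
Hypothesis A_conn : nn_connected A.
Hypothesis Aa : A a.
Hypothesis Ab : A b.
Hypothesis ab : (n <= 20 * linf_dist a b)%N.

Let site_n1 z : A z -> (linf_dist 0 (site_of h z) <= n1)%N.
Proof. by move=> /AU [_ zn]; exact: site_norm n_n1. Qed.

Let f z := linf_dist (site_of h a) (site_of h z).

(** The sites of A cross the j-th annulus of width m by a star path, which is too long to stay in a
    hole. *)
Lemma level_site j : (j < J)%N -> exists z, [/\ A z, outer_comp N.+1 B (site_of h z)
  & (j * m.+1 <= f z <= j * m.+1 + m)%N].
Proof.
move=> jJ; have c : rconn nn A a b by exact: A_conn.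
have lip (x y : V) : A x -> A y -> nn x y -> (f y <= f x + 1)%N.
  move=> _ _ /(site_of_star hd h0) sxy.
  have {}sxy : (linf_dist (site_of h x) (site_of h y) <= 1)%N := sxy.
  by have := linf_triangle (site_of h x) (site_of h a) (site_of h y); rewrite /f; lia.
have fb : (J * m.+1 <= f b)%N.
  rewrite leqNgt; apply/negP => lt.
  have := site_dist (ltnW lt); rewrite leqNgt => /negP; apply.
  have : (8 * h * (J * m.+1).+2 <= linf_dist a b)%N.
    rewrite -(@leq_pmul2l 20) //; apply: leq_trans ab; apply: leq_trans Jn.
    by rewrite !mulnA.
  by apply: leq_trans; rewrite ltn_mul2l muln_gt0 h0 /=.
have [|||u [v [fu fv cuv]]] := crossing_levels (p := (j * m.+1)%N) (q := (j * m.+1 + m)%N) lip c.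
- by rewrite /f linfxx.
- by lia.
- by apply: leq_trans fb; have := leq_mul jJ (leqnn m.+1); rewrite mulSn; lia.
apply: contrapT => no.
have : rconn (@star d) (lball 0 N.+1 `\` outer_comp N.+1 B) (site_of h u) (site_of h v).
  have Zs z : (A `&` [set z | (j * m.+1 <= f z <= j * m.+1 + m)%N]) z ->
      (lball 0 N.+1 `\` outer_comp N.+1 B) (site_of h z).
    move=> [Az fz]; split; first by rewrite /lball /=; have := site_n1 Az; lia.
    by move=> oz; apply: no; exists z.
  apply: (vconn_inv (A := [set z : V | rconn (@star d) (lball 0 N.+1 `\` outer_comp N.+1 B)
      (site_of h u) (site_of h z)]) cuv).
    by apply: rconn_refl; apply: Zs; exact: rconn_l cuv.
  move=> z z' Zz Zz' nz cz; apply: (rconn_rcons cz); first exact: site_of_star.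
  exact: Zs.
move=> /(holes_small hd1 NB m0).
have := linf_triangle (site_of h u) (site_of h a) (site_of h v).
by move: fu fv; rewrite /f; lia.
Qed.

Lemma outer_site : exists2 s0, outer_comp N.+1 B s0 & (linf_dist 0 s0 <= n1)%N.
Proof.
have J0 : (0 < J)%N by apply: leq_trans Jk; rewrite muln_gt0 k0 expn_gt0.
by have [z [Az oz _]] := level_site J0; exists (site_of h z) => //; exact: site_n1.
Qed.

(** Pigeonhole over the 4^d shifts; disjoint annuli give distinct sites. *)
Lemma frequent_tau : exists2 tau, tau \in taus d & exists zs : seq V,
  [/\ size zs = k, uniq [seq site_of h z | z <- zs]
    & forall z, z \in zs -> [/\ A z, outer_comp N.+1 B (site_of h z) & tau_of h z = tau]].
Proof.
pose zf j := if pselect (exists z, [/\ A z, outer_comp N.+1 B (site_of h z)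
  & (j * m.+1 <= f z <= j * m.+1 + m)%N]) is left e then sval (cid e) else 0.
have zfP j : (j < J)%N -> [/\ A (zf j), outer_comp N.+1 B (site_of h (zf j))
  & (j * m.+1 <= f (zf j) <= j * m.+1 + m)%N].
  move=> /level_site e; rewrite /zf; case: pselect => // e'; by case: (cid e').
pose js tau := [seq j <- iota 0 J | tau_of h (zf j) == tau].
have [tau ht hs] : exists2 tau, tau \in taus d & (k <= size (js tau))%N.
  apply: contrapT => no.
  have : (size (iota 0 J) <= \sum_(t <- taus d) size (js t))%N.
    rewrite /js; elim: (iota 0 J) => [|j q IH] //=; rewrite -add1n.
    apply: (@leq_trans (\sum_(t <- taus d) ((tau_of h (zf j) == t) + size [seq j <- q | tau_of h (zf j) == t]))%N).
      rewrite big_split /=; apply: leq_add IH.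
      have tt : tau_of h (zf j) \in taus d by apply/tausP; have [] := site_tau hd h0 (zf j).
      by rewrite (big_rem _ tt) /= eqxx.
    by apply: leq_sum => t _; case: eqP.
  have : (\sum_(t <- taus d) (size (js t)).+1 <= \sum_(t <- taus d) k)%N.
    rewrite big_seq [X in (_ <= X)%N]big_seq leq_sum // => t tt.
    by rewrite ltnNge; apply/negP => q; apply: no; exists t.
  have -> : (\sum_(t <- taus d) (size (js t)).+1 = (\sum_(t <- taus d) size (js t)) + 4 ^ d)%N.
    under eq_bigr => t _ do rewrite -addn1.
    by rewrite big_split /= sum1_size size_taus.
  rewrite big_const_seq count_predT iter_addn addn0 size_taus size_iota => h1 h2.
  have : (0 < 4 ^ d)%N by rewrite expn_gt0.
  by move: (leq_trans h2 (leqnn _)) h1 Jk; move: (\sum_(t <- _) _)%N (4 ^ d)%N (k * _)%N => s e w; lia.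
exists tau => //; exists [seq zf j | j <- take k (js tau)].
have sub j : j \in take k (js tau) -> (j < J)%N /\ tau_of h (zf j) = tau.
  by move=> /mem_take; rewrite mem_filter mem_iota /= add0n => /andP[/eqP ? ?].
split; first by rewrite size_map size_takel.
- rewrite -map_comp map_inj_in_uniq ?take_uniq ?filter_uniq ?iota_uniq //.
  move=> j j' /sub [jJ _] /sub [jJ' _] /= e.
  have [_ _ h1] := zfP j jJ; have [_ _ h2] := zfP j' jJ'.
  move: h1 h2; rewrite /f e; move: (linf_dist _ _) => w h1 h2.
  have : (j * m.+1 < j'.+1 * m.+1)%N by rewrite mulSn; lia.
  have : (j' * m.+1 < j.+1 * m.+1)%N by rewrite mulSn; lia.
  by rewrite !ltn_mul2r /=; lia.
- move=> z /mapP [j /sub [jJ et] ->]; have [h1 h2 _] := zfP j jJ; by split.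
Qed.

(** Explore from a point of A for the frequent shift. When no box remains to be opened the explored
    set contains A, hence k light boxes have been opened, and since the exploration is not stuck it
    has reached the network. *)
Lemma reaches_network : exists tau y z x0, [/\ tau \in taus d, tau_allowed N n1 tau (nu tau) y,
  z \in gam h tau y, A x0 & rconn nn (U `&` D) x0 z].
Proof.
have [tau ht [zs [sz uz zP]]] := frequent_tau.
have r0 := rho_gt0 h0.
pose bx x := inbox h (boxctr h tau x).
(* A box is too small to contain both a and b; a path leaving a box steps into the gap, since
   distinct boxes of one shift are more than one step apart. *)
have [x0 [Ax0 nx0]] : exists x0 : V, A x0 /\ forall x, ~~ bx x x0.
  have [[x bxa]|no] := pselect (exists x, bx x a); last first.
    by exists a; split=> // x; apply/negP => q; apply: no; exists x.
  have nb : ~ [set z | bx x z] b.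
    move=> /inbox_dist hb; have ha := inbox_dist bxa.
    have := linf_triangle (boxctr h tau x) a b; rewrite (linf_distC a (boxctr _ _ _)).
    have h160 : (160 * h <= n)%N by apply: leq_trans Jn; rewrite leq_pmulr.
    have rh : r = (2 * h)%N by [].
    move: ha hb ab h0; rewrite rh; clear -h160; lia.
  have [y [z [cy nyz Az nz _]]] := vconn_exit (A_conn Aa Ab) (bxa : [set z | bx x z] a) nb.
  have [Ay by_] := rconn_r cy.
  exists z; split=> // x'; apply/negP => bz; rewrite /= in by_ nz.
  have xx : x = x'.
    have h1 := inbox_dist by_; have h2 := inbox_dist bz.
    have := linf_triangle y (boxctr h tau x) (boxctr h tau x').
    have := linf_triangle z y (boxctr h tau x'); rewrite boxctr_dist // (linf_distC z (boxctr _ _ _)).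
    have h3 := nn_linf nyz => t1 t2.
    have : (linf_dist x x' = 0)%N by have := leq_mul (leqnn (4 * r)) (leqnn (linf_dist x x')); case: (linf_dist x x') t2 t1 => // e t2 t1; rewrite mulnS in t2 t1 *; lia.
    by move=> e; apply: linf_eq => j; have := linf_coord x x' j; rewrite e; lia.
  by apply: nz; rewrite xx.
pose al := tau_allowed N n1 tau.
have als nu' x : al nu' x -> x \in boxseq d n1 by case=> _ hx; apply/mem_boxseq.
pose S := opened h tau D x0 (boxseq d n1) al (nu tau) (size (boxseq d n1)).
have done_ := opened_done h tau D x0 als (nu tau).
have AD z : A z -> D z /\ U z.
  by move=> /AU [Uz zn]; split=> //; rewrite /lball /=; apply: leq_trans zn _; lia.
have nhit z : A z -> ~ hit (nu tau) z by move=> /AD [Dz Uz] /(hitU ht Dz).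
(* Following A, a step into an allowed unopened box would be a touch, because a vacant point is on
   no loop edge; this contradicts that no touch is left. *)
have clA z : A z -> explored h tau D x0 al (nu tau) S z.
  move=> Az; apply: (vconn_inv (A := explored h tau D x0 al (nu tau) S) (A_conn Ax0 Az)).
    apply: rconn_refl; split; [by case: (AD _ Ax0)|exact: nhit|].
    by move=> x _ bxx; have := nx0 x; rewrite /bx bxx.
  move=> y y' Ay Ay' nyy cy; apply: (rconn_rcons cy nyy).
  split; [by case: (AD _ Ay')|exact: nhit|] => x ax bxy'.
  apply: contraT => xS; exfalso.
  have byy : ~~ bx x y.
    by apply/negP => byx; have [_ _ /(_ x ax byx)] := rconn_r cy; apply/negP.
  apply: (next_none als done_ (x := x) (f := y')); split=> //; last by exists y.
  by move=> u _ _; split=> -[t nt /edgeP [/= h1 h2 _]]; apply: (nhit _ Ay'); exists t.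
have suc : success h tau D x0 al (nu tau) S.
  apply: contrapT => ns; apply: (nstuck ht (x0 := x0)); first by case: (AU Ax0).
  exists (size (boxseq d n1)) => //; split=> //; rewrite /gains -size_filter -sz -(size_map (site_of h)).
  apply: uniq_leq_size uz _ => x /mapP [z /zP [Az oz tz] ->].
  have sN := site_n1 Az.
  have nB : ~ B (site_of h z) by apply: (outer_comp_good oz); lia.
  rewrite mem_filter; apply/andP; split.
    by apply: good_occ => //; rewrite /lball /=; lia.
  have [_ _ Sz] := rconn_r (clA z Az).
  apply: Sz; first by split=> //; exact: tau_outer.
  have [_ hz] := site_tau hd h0 z; rewrite tz in hz.
  apply/inboxP => //; have lt j : (`|boxctr h tau (site_of h z) ord0 j - z ord0 j| < r)%N.
    by apply: leq_ltn_trans (leq_trans (linf_coord _ _ j) hz) _; rewrite /rho; lia.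
  by split=> [j|i j e]; [exact: ltnW|have := lt i; rewrite e ltnn].
have [z [y [cz ay zg]]] := suc.
exists tau, y, z, x0; split=> //; apply: rconn_sub cz => w [Dw hw _]; split=> //.
by apply: contrapT => nU; apply: hw; apply/(hitU ht Dw).
Qed.

End Reach.

(** The diameter is a supremum; halving the bound provides an actual pair of points. *)
Lemma large_diam (A : set V) : (0 < n)%N -> ((n%:R / 10)%:E <= linf_diam R A)%E ->
  exists a b, [/\ A a, A b & (n <= 20 * linf_dist a b)%N].
Proof.
move=> n0 hA; have : ((n%:R / 20)%:E < linf_diam R A)%E.
  apply: lt_le_trans hA; rewrite lte_fin.
  have : 0 < (n%:R : R) by rewrite ltr0n.
  by lra.
move=> /ereal_sup_gt [_ [a Aa [b Ab <-]]]; rewrite lte_fin => lt.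
exists a, b; split=> //; rewrite -(ler_nat R) natrM; lra.
Qed.

Lemma local_uniqueness : (0 < n)%N -> large_sets_connected R U n.
Proof.
move=> n0 A A' AU AU' cA cA' /(large_diam n0) [a [b [Aa Ab ab]]]
  /(large_diam n0) [a' [b' [Aa' Ab' ab']]].
have [s0 os ns] := outer_site AU cA Aa Ab ab.
have [tau [y [z [x0 [ht ay zy Ax0 c]]]]] := reaches_network AU cA Aa Ab ab.
have [tau' [y' [z' [x0' [ht' ay' zy' Ax0' c']]]]] := reaches_network AU' cA' Aa' Ab' ab'.
exists x0, x0'; split=> //; apply: (rconn_trans c).
apply: (rconn_trans (networks_joined ht ht' os ns ay ay' zy zy')).
by apply: rconn_sym c'; exact: nn_sym.
Qed.

End Main.
End Deterministic.

(** * Finite loop families stable under surgery *)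

Section Families.
Variables (d h : nat).
Hypothesis hd : (3 <= d)%N.
Hypothesis h0 : (0 < h)%N.
Local Notation V := 'rV[int]_d.
Local Notation nn := (@nearest_neighbor d).
Local Notation r := (rho h).
Local Notation m := ((2 * r).+1 ^ d)%N.
Variable tau : V.
Local Notation bx x := (inbox h (boxctr h tau x)).
Implicit Types (t : loop d).

Definition in_gap : pred V := fun z => `[< forall y, ~~ bx y z >].
(** A plain length bound would not survive surgery. Visits to the gap are unchanged by it, and after
    rerouting a box is visited at most m times per exit, each exit leading into the gap; hence the
    bound N * m. *)
Definition tame N t : Prop := [/\ forall z, z \in rep t -> (linf_dist 0 z <= N)%N,
  (visits in_gap t <= N)%N & forall y, (visits (bx y) t <= N * m)%N].
Definition loop_of_seq (s : seq V) : option (loop d) :=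
  if pselect (is_loop s) is left e then Some (loop_of e) else None.
Definition loop_family N : seq (loop d) :=
  undup [seq t <- pmap loop_of_seq (words (boxseq d N) (((2 * N).+1 ^ d) * (N * m))%N) | `[< tame N t >]].

Lemma loop_family_uniq N : uniq (loop_family N). Proof. exact: undup_uniq. Qed.

Let m_gt0 : (0 < m)%N. Proof. by rewrite expn_gt0. Qed.

Lemma size_le_count (s A : seq V) c : {subset s <= A} ->
  (forall z, (count (pred1 z) s <= c)%N) -> (size s <= size A * c)%N.
Proof.
move=> sA hc; apply: (@leq_trans (\sum_(z <- A) count (pred1 z) s)%N); last first.
  apply: (@leq_trans (\sum_(z <- A) c)%N); first by apply: leq_sum => z _; exact: hc.
  by rewrite big_const_seq count_predT iter_addn addn0 mulnC.
elim: s sA {hc} => //= x s IH sA.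
rewrite big_split /= -add1n; apply: leq_add; last first.
  by apply: IH => z zs; apply: sA; rewrite inE zs orbT.
have xA : x \in A by apply: sA; rewrite mem_head.
by rewrite (big_rem x) //= eqxx.
Qed.

Lemma mem_loop_family N t : t \in loop_family N <-> tame N t.
Proof.
rewrite mem_undup mem_filter; split; first by move=> /andP[/asboolP].
move=> tt; apply/andP; split; first exact/asboolP.
have [h1 h2 h3] := tt.
rewrite mem_pmap; apply/mapP; exists (rep t).
  apply: mem_words; last by move=> z /h1 hz; apply/mem_boxseq.
  rewrite -size_boxseq; apply: size_le_count; first by move=> z /h1 hz; apply/mem_boxseq.
  move=> z; have [[y byz]|no] := pselect (exists y, bx y z).
    apply: leq_trans (h3 y); apply: sub_count => w /= /eqP -> //.
  apply: (@leq_trans N); last by rewrite leq_pmulr.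
  apply: leq_trans h2; apply: sub_count => w /= /eqP ->.
  by apply/asboolP => y; apply/negP => byz; apply: no; exists y.
rewrite /loop_of_seq; case: pselect => [e|]; last by have := rep_ok t.
by congr Some; symmetry; apply/loop_ofP; exists 0%N; rewrite rot0.
Qed.

Lemma loop_family_eventually t : exists N0, forall N, (N0 <= N)%N -> t \in loop_family N.
Proof.
exists (lsize t + \sum_(z <- rep t) linf_dist (0 : V) z)%N => N hN; apply/mem_loop_family; split.
- move=> z zt; apply: leq_trans hN; rewrite (big_rem z) //=; lia.
- by apply: leq_trans (leq_trans (leq_addr _ _) hN); exact: count_size.
- move=> y; apply: (@leq_trans N); last by rewrite leq_pmulr.
  by apply: leq_trans (leq_trans (leq_addr _ _) hN); exact: count_size.
Qed.

Lemma surg_exits (b pi : pred V) route s s' C x : surg b pi route s s' C -> b x ->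
  count (exit_edge b) (pairmap pair x s) = size C.
Proof.
move=> hs; elim: s s' C / hs x => [//|o i s s' C x0 no ho ni hi h1 h2 _ IH] x bx'.
rewrite !pairmap_cat !count_cat.
have ins y p : all b p -> count (exit_edge b) (pairmap pair y p) = 0%N.
  by elim: p y => //= z p IHp y /andP[bz bp]; rewrite IHp // /exit_edge /= bz andbF.
have out y p : ~~ b y -> all (predC b) p -> count (exit_edge b) (pairmap pair y p) = 0%N.
  by elim: p y => //= z p IHp y by_ /andP[bz bp]; rewrite IHp // /exit_edge /= (negPf by_).
have -> : count (exit_edge b) (pairmap pair x o) = 1%N.
  case: o no ho => //= y o _ /andP[by_ ho]; rewrite (out y) //.
  by rewrite /exit_edge /= bx' by_.
rewrite ins // IH; first by rewrite add0n add1n.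
case: i ni hi {h1 h2} => // y i _ hi /=; apply: (allP hi); exact: mem_last.
Qed.

Lemma psi_visits (b pi : pred V) (route : V -> V -> seq V) (bl : seq V) t t' :
  (forall z, b z -> z \in bl) ->
  (forall u v, b u -> ~~ pi u -> b v -> ~~ pi v ->
  [/\ exists p, route u v = u :: p /\ path nn u p, last u (route u v) = v,
    all b (route u v), all (predC pi) (route u v) & (size (route u v) <= m)%N]) ->
  psi_rel b pi route t t' -> (visits b t' <= m * exits b t)%N.
Proof.
move=> blP rP [k [k' [C hs]]].
have [_ _ h3 _ _] := surg_size blP rP hs.
have hp : count b (rot k' (rep t')) = visits b t'.
  by have /permP -> : perm_eq (rot k' (rep t')) (rep t') by rewrite perm_rot.
rewrite hp in h3; apply: leq_trans h3 _; rewrite leq_mul2l; apply/orP; right.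
have s0 : rot k (rep t) != [::] by rewrite -size_eq0 size_rot size_eq0 rep_neq0.
have /andP[_ bl0] := surg_marked hs s0.
rewrite -(surg_exits hs bl0); apply: eq_leq.
exact: (permP (cyc_edges_rot 0 k (rep t))).
Qed.

(** Only the visits to box x change. By [psi_visits] they are at most m times the exits, and
    distinct exits are distinct visits to the gap, since no edge joins two boxes of the same
    shift. *)
Lemma loop_family_closed N q x pi route t t' : (linf_dist 0 x <= q)%N -> (forall j, 0 <= tau ord0 j <= 3) ->
  (r * (4 * q + 4) <= N)%N ->
  (forall u v, bx x u -> ~~ pi u -> bx x v -> ~~ pi v ->
    [/\ exists p, route u v = u :: p /\ path nn u p, last u (route u v) = v,
      all (bx x) (route u v), all (predC pi) (route u v) & (size (route u v) <= m)%N]) ->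
  t \in loop_family N -> psi_rel (bx x) pi route t t' -> t' \in loop_family N.
Proof.
move=> hx ht qN rP /mem_loop_family [h1 h2 h3] pt; apply/mem_loop_family.
have blP z : bx x z -> z \in boxat (boxctr h tau x) r.
  by move=> /inbox_dist hz; apply/mem_boxat.
have cnt (a : pred V) : (forall z, a z -> ~~ bx x z) -> visits a t' = visits a t.
  by move=> ha; rewrite /visits (psi_count rP pt ha).
have gap (z : V) : in_gap z -> ~~ bx x z by move=> /asboolP.
have dis (y : V) : y != x -> forall z, bx y z -> ~~ bx x z.
  move=> yx z by_; apply/negP => bz; move/eqP: yx; apply.
  exact: (box_disjoint hd h0 (inbox_dist by_) (inbox_dist bz)).
split.
- move=> z zt'; have [bz|bz] := boolP (bx x z).
    apply: leq_trans qN; apply: leq_trans (linf_triangle (boxctr h tau x) 0 z) _.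
    have hb : (linf_dist 0 (boxctr h tau x) <= r * (4 * q + 3))%N.
      apply/linfP => j; rewrite !mxE sub0r abszN; move/linfP: hx => /(_ j).
      rewrite mxE sub0r abszN; have := ht j.
      move: (x ord0 j) (tau ord0 j) => a b e1 e2.
      by rewrite abszM absz_nat leq_mul2l; apply/orP; right; lia.
    apply: leq_trans (leq_add hb (inbox_dist bz)) _.
    by rewrite -[X in (_ + X <= _)%N]muln1 -mulnDr leq_mul2l; apply/orP; right; lia.
  apply: h1; move: zt'; rewrite -!has_pred1 !has_count.
  have e := cnt (pred1 z) (fun w e => ltac:(by rewrite (eqP e))).
  by rewrite -/(visits (pred1 z) t') e.
- by rewrite cnt.
- move=> y; have [->|yx] := eqVneq y x; last by rewrite cnt //; exact: dis.
  apply: leq_trans (psi_visits blP rP pt) _; rewrite mulnC leq_mul2r; apply/orP; right.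
  apply: leq_trans h2; rewrite /exits /visits.
  have es : [seq e.2 | e <- edges_of t] = rep t.
    rewrite /edges_of /cyc_edges.
    by elim: (rep t) (last 0 (rep t)) => //= z s IH w; rewrite IH.
  rewrite -[X in (_ <= count _ X)%N]es count_map.
  apply: sub_in_count => -[u v] et; rewrite /exit_edge /= => /andP[bu bv].
  have nuv : nn u v.
    have /andP[_] := rep_ok t; rewrite (cycle_path 0); move: et; rewrite /edges_of /cyc_edges.
    elim: (rep t) (last 0 (rep t)) => //= z s IH w; rewrite inE => /orP[/eqP [-> ->] /andP[]//|et].
    by move=> /andP[_]; exact: IH.
  apply/asboolP => y'; apply/negP => bv'.
  have [e|ne] := eqVneq y' x; first by rewrite -e bv' in bv.
  have d1 := inbox_dist bu; have d2 := inbox_dist bv'; have d3 := nn_linf nuv.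
  have := linf_triangle u (boxctr h tau x) (boxctr h tau y').
  have := linf_triangle v u (boxctr h tau y'); rewrite boxctr_dist // (linf_distC v (boxctr _ _ _)).
  have r0 := rho_gt0 h0; have r2 : (2 <= r)%N by rewrite /rho; lia.
  have : (0 < linf_dist x y')%N.
    rewrite lt0n; apply: contra ne => /eqP e0; apply/eqP; apply: linf_eq => j.
    by have := linf_coord x y' j; rewrite e0; lia.
  case: (linf_dist x y') => // e _; rewrite mulnS => t1 t2.
  by move: (4 * r * e)%N t2 => w t2; lia.
Qed.

End Families.

(** * From all dyadic scales to the infinite component *)

Section InfiniteComponent.
Variables (R : realType) (d : nat).
Local Notation V := 'rV[int]_d.
Local Notation nn := (@nearest_neighbor d).
Variable U : set V.

(** Diameter n/5 rather than n/10, so that the same set still counts as large at scale 2n and can be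
    glued to the next one. *)
Definition spans (n : nat) : Prop := exists z z', [/\ rconn nn (U `&` lball 0 n) z z'
  & (n <= 5 * linf_dist z z')%N].

Let rsym (Z : set V) x y : rconn nn Z x y -> rconn nn Z y x.
Proof. by apply: rconn_sym; exact: nn_sym. Qed.

Lemma rconn_comp_connected (Z : set V) z : nn_connected [set y : V | rconn nn Z z y].
Proof.
move=> x y cx cy; apply: (rconn_trans (y := z)).
  apply: rsym; exact: rconn_self cx.
exact: rconn_self cy.
Qed.

Lemma linf_diam_ge (A : set V) a b (q : R) : A a -> A b -> q <= (linf_dist a b)%:R ->
  (q%:E <= linf_diam R A)%E.
Proof.
move=> Aa Ab hq; apply: (@le_trans _ _ ((linf_dist a b)%:R)%:E); first by rewrite lee_fin.
by apply: ereal_sup_ubound; exists a => //; exists b.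
Qed.

Variable n : nat.
Hypothesis n0 : (0 < n)%N.
Local Notation sc j := (2 ^ j * n)%N.
Hypothesis luniq : forall j, large_sets_connected R U (sc j).
Hypothesis lspan : forall j, spans (sc j).

(** Spanning sets of consecutive scales are joined by local uniqueness and form one unbounded
    cluster starting in the ball of radius n. Any other infinite component contains a large set at
    some scale and is glued to the same cluster. *)
Lemma infinite_comp : the_infinite_component_meets U (lball 0 n).
Proof.
have sc_gt j : (j < sc j)%N by apply: leq_trans (ltn_expl j (ltac:(by []) : (1 < 2)%N)) _; rewrite leq_pmulr.
have /choice [z hz] : forall j, exists z : V, exists z' : V,
   rconn nn (U `&` lball 0 (sc j)) z z' /\ (sc j <= 5 * linf_dist z z')%N.
  by move=> j; have [z [z' [h1 h2]]] := lspan j; exists z, z'.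
have /choice [z' hz'] := hz.
pose C j : set V := [set y | rconn nn (U `&` lball 0 (sc j)) (z j) y].
have Cz j : C j (z j) by apply: rconn_refl; exact: rconn_l (hz' j).1.
have CU j y : C j y -> U y /\ lball 0 (sc j) y by move=> /rconn_r [].
have bigC j : (((sc j)%:R / 5 : R)%:E <= linf_diam R (C j))%E.
  apply: (linf_diam_ge (a := z j) (b := z' j)) => //; first exact: (hz' j).1.
  by have := (hz' j).2; rewrite -(ler_nat R) natrM => h; lra.
have sub_n A q j : (q <= j)%N -> A `<=` U `&` lball 0 (sc q) -> A `<=` U `&` lball 0 (sc j).
  move=> qj hA y /hA [Uy yn]; split=> //; rewrite /lball /=; apply: leq_trans yn _.
  by rewrite leq_mul2r leq_exp2l // qj orbT.
have glue A j : A `<=` U `&` lball 0 (sc j) -> nn_connected A ->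
    (((sc j)%:R / 10 : R)%:E <= linf_diam R A)%E -> exists2 a, A a & rconn nn U a (z j).
  move=> AU cA dA; have [|||||x [y [Ax Cy c]]] := luniq AU (B := C j) (j := j).
  - by move=> y /CU [].
  - by [].
  - exact: rconn_comp_connected.
  - by [].
  - apply: le_trans (bigC j); rewrite lee_fin.
    by have : 0 <= ((sc j)%:R : R) by []; lra.
  exists x => //; apply: (rconn_trans (y := y)); first by apply: rconn_sub c => w [].
  by apply: rsym; apply: rconn_sub Cy => w [].
have chain j : rconn nn U (z 0) (z j).
  elim: j => [|j IH]; first by apply: rconn_refl; case: (CU 0 _ (Cz 0)).
  apply: (rconn_trans IH).
  have [|||a Ca c] := glue (C j) j.+1.
  - by apply: (sub_n _ j) => // y /CU [].
  - exact: rconn_comp_connected.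
  - apply: le_trans (bigC j); rewrite lee_fin expnS -mulnA natrM.
    by have : 0 <= ((sc j)%:R : R) by []; lra.
  by apply: (rconn_trans (y := a)) => //; apply: rconn_sub Ca => w [].
have far (A : set V) M : infinite_set A -> exists2 y : V, A y & (M < linf_dist 0 y)%N.
  move=> iA; apply: contrapT => no; apply: iA.
  apply: (sub_finite_set (B := [set` boxseq d M])); last exact: finite_seq.
  move=> y Ay; apply/mem_boxseq; rewrite leqNgt; apply/negP => q; apply: no.
  by exists y.
pose A := [set y : V | path_in U (z 0) y].
have Az : infinite_set A.
  move=> /finite_seqP [s As].
  pose M := (\sum_(y <- s) linf_dist (0 : V) y)%N.
  have hM y : A y -> (linf_dist 0 y <= M)%N.
    by rewrite As /= => ys; rewrite /M (big_rem y) //= leq_addr.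
  pose j := (10 * M)%N.
  have A1 : A (z j) by exact: chain.
  have A2 : A (z' j).
    by apply: (rconn_trans (chain j)); apply: rconn_sub (hz' j).1 => w [].
  have := linf_triangle 0 (z j) (z' j); rewrite (linf_distC (z j) 0).
  have := hM _ A1; have := hM _ A2; have := (hz' j).2; have := sc_gt j.
  by rewrite /j; move: (sc _) => w; lia.
exists A; split.
- by split=> //; exists (z 0) => //; case: (CU 0 _ (Cz 0)).
- move=> A' [[x' Ux' A'E] iA'].
  (* At this scale x' is well inside the ball, so its path to the boundary of the ball has large
     diameter. *)
  pose M := (4 * linf_dist 0 x')%N.
  have [y A'y yM] := far A' (sc M) iA'.
  have cy : rconn nn U x' y by rewrite A'E in A'y.
  have xs : lball 0 (sc M) x'.
    by rewrite /lball /=; apply: leq_trans (ltnW (sc_gt M)); rewrite /M; lia.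
  have nys : ~ lball 0 (sc M) y by rewrite /lball /=; apply/negP; rewrite -ltnNge.
  have [u [v [cu nuv Uv nv _]]] := vconn_exit cy xs nys.
  have [Uu us] := rconn_r cu.
  have un : (sc M <= linf_dist 0 u)%N.
    rewrite leqNgt; apply/negP => lt; apply: nv; rewrite /lball /=.
    by have := linf_triangle u 0 v; have := nn_linf nuv; lia.
  have [|||a Ca c] := glue [set w : V | rconn nn (U `&` lball 0 (sc M)) x' w] M.
  - by move=> w /rconn_r.
  - exact: rconn_comp_connected.
  - apply: (linf_diam_ge (a := x') (b := u)) => //; first by apply: rconn_refl.
    have : (sc M <= 10 * linf_dist x' u)%N.
      by have := linf_triangle x' 0 u; have := sc_gt M; move: un; rewrite {2}/M; lia.
    by rewrite -(ler_nat R) natrM => h; lra.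
  have xz : rconn nn U x' (z 0).
    apply: (rconn_trans (y := a)); first by apply: rconn_sub Ca => w [].
    by apply: (rconn_trans c); apply: rsym.
  rewrite A'E; apply/seteqP; split=> w cw.
    by apply: (rconn_trans (y := x')) => //; exact: rsym.
  exact: rconn_trans xz cw.
- exists (z 0); split; first by apply: rconn_refl; case: (CU 0 _ (Cz 0)).
  by have [_] := CU 0 _ (Cz 0); rewrite expn0 mul1n.
Qed.

End InfiniteComponent.

(** * The network spans a ball *)

Section Span.
Variables (d h : nat).
Hypothesis hd : (3 <= d)%N.
Hypothesis h0 : (0 < h)%N.
Local Notation V := 'rV[int]_d.
Local Notation nn := (@nearest_neighbor d).
Local Notation r := (rho h).
Variables (N m n1 n : nat) (U B : set V).
Hypothesis m0 : (0 < m)%N.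
Hypothesis mn1 : (m <= n1)%N.
Hypothesis n1N : (n1 + m <= N)%N.
Hypothesis ND : (r * (4 * N + 12) <= n)%N.
Hypothesis n_n1 : (n + 20 * r * (2 * m + 1) <= 40 * r * n1)%N.
Hypothesis good_gam : forall x z, lball 0 N.+1 x -> ~ B x -> z \in gamAll h x -> U z.
Hypothesis NB : no_bad_path B N.+1 m.
Let hd1 : (1 < d)%N. Proof. exact: ltnW. Qed.

Lemma vacant_spans : spans U n.
Proof.
have r0 := rho_gt0 h0.
pose i : 'I_d := Ordinal (ltac:(lia) : (0 < d)%N).
pose p (a : int) : V := upd 0 i a.
have pn a : linf_dist 0 (p a) = `|a|%N.
  apply/eqP; rewrite eqn_leq; apply/andP; split.
    by apply/linfP => j; rewrite updE !mxE; case: eqP => _; lia.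
  by have := linf_coord 0 (p a) i; rewrite updE eqxx mxE; lia.
(* A segment of length m on a coordinate axis does not fit in a hole, so it meets the outer cluster;
   one such segment is used at each end of the axis. *)
have seg (a b : int) : (absz (a - b)%R = m) -> (`|a| <= n1)%N -> (`|b| <= n1)%N ->
    exists2 c, btw a c b & outer_comp N.+1 B (p c).
  move=> ab an bn; apply: contrapT => no.
  have : rconn (@star d) (lball 0 N.+1 `\` outer_comp N.+1 B) (p a) (p b).
    have c : rconn nn (lball 0 N.+1 `\` outer_comp N.+1 B) (p a) (p b).
      have -> : p b = upd (p a) i b by rewrite /p upd_upd.
      apply: line_conn => c; rewrite updE eqxx /p upd_upd => hc; split.
        by rewrite /lball /= -/(p c) pn; move: hc; rewrite /btw; lia.
      by move=> oc; apply: no; exists c.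
    apply: (vconn_inv (A := [set z : V | rconn (@star d) (lball 0 N.+1 `\` outer_comp N.+1 B) (p a) z]) c).
      by apply: rconn_refl; exact: rconn_l c.
    by move=> u v Zu Zv nuv cu; apply: (rconn_rcons cu) => //; exact: nn_star.
  move=> /(holes_small hd1 NB m0); have := linf_coord (p a) (p b) i.
  by rewrite !updE eqxx; lia.
have [c1 b1 o1] := seg (n1 - m)%N%:Z n1%:Z (ltac:(lia)) (ltac:(lia)) (ltac:(lia)).
have [c2 b2 o2] := seg (- (n1 - m)%N%:Z) (- n1%:Z) (ltac:(lia)) (ltac:(lia)) (ltac:(lia)).
have q1 : (linf_dist 0 (p c1) <= n1)%N by rewrite pn; move: b1; rewrite /btw; lia.
have q2 : (linf_dist 0 (p c2) <= n1)%N by rewrite pn; move: b2; rewrite /btw; lia.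
have c := outer_comp_connected hd1 NB n1N o1 o2 q1 q2.
have t0 : is_tau (0 : V) by move=> j; rewrite mxE.
have [z zg] := gam_neq0 hd h0 0 (p c1); have [z' zg'] := gam_neq0 hd h0 0 (p c2).
exists z, z'; split.
  apply: (gam_chain hd h0 _ c zg zg') => x [xN nb] v vx; split.
    by apply: (good_gam (x := x)) => //; [rewrite /lball /=; exact: leqW|exact: (gam_sub hd h0 t0 vx)].
  change (linf_dist 0 v <= n)%N; apply: leq_trans (gam_norm hd h0 t0 xN vx) _.
  by apply: leq_trans ND; rewrite leq_mul2l; apply/orP; right; lia.
have [_ _ hz] := (mem_gam h 0 (p c1) z).1 zg; have [_ _ hz'] := (mem_gam h 0 (p c2) z').1 zg'.
have dd := boxctr_dist hd h0 0 (p c1) (p c2).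
have far : (2 * (n1 - m) <= linf_dist (p c1) (p c2))%N.
  have := linf_coord (p c1) (p c2) i; rewrite !updE eqxx; move: b1 b2; rewrite /btw; lia.
have := linf_triangle z (boxctr h 0 (p c1)) (boxctr h 0 (p c2)).
have := linf_triangle z' z (boxctr h 0 (p c2)).
rewrite (linf_distC z' (boxctr _ _ _)) => t1 t2.
have t3 : (4 * r * (2 * (n1 - m)) <= linf_dist z z' + 4 * r)%N.
  apply: leq_trans (leq_mul (leqnn (4 * r)) far) _; rewrite -dd; lia.
have e1 : (40 * r * n1 = 40 * (r * m) + 40 * (r * (n1 - m)))%N.
  by rewrite -[in LHS](subnKC mn1); ring.
have e2 : (20 * r * (2 * m + 1) = 40 * (r * m) + 20 * r)%N by ring.
have e3 : (4 * r * (2 * (n1 - m)) = 8 * (r * (n1 - m)))%N by ring.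
move: n_n1 t3; rewrite e1 e2 e3; move: (r * m)%N (r * (n1 - m))%N => u w; lia.
Qed.

End Span.

(** * Limits of events and measurability *)

Section ProbabilityTools.
Context {R : realType} {disp : measure_display} {Omega : measurableType disp}.
Variable P : probability Omega R.

Lemma P_bigU (I : eqType) (s : seq I) (E : I -> set Omega) :
  (forall i, measurable (E i)) ->
  measurable [set w | exists2 i, i \in s & E i w] /\
  (P [set w | exists2 i, i \in s & E i w] <= \sum_(i <- s) P (E i))%E.
Proof.
move=> mE; elim: s => [|i s [IHm IH]].
  rewrite (_ : [set _ | _] = set0); last by apply/seteqP; split=> // w [].
  by split=> //; rewrite measure0 big_nil.
have -> : [set w | exists2 j, j \in i :: s & E j w] = E i `|` [set w | exists2 j, j \in s & E j w].
  apply/seteqP; split=> w /=.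
    by move=> [j]; rewrite inE => /orP[/eqP ->|js] Ew; [left|right; exists j].
  by case=> [Ew|[j js Ew]]; [exists i; rewrite ?mem_head|exists j; rewrite // inE js orbT].
split; first exact: measurableU.
rewrite big_cons; apply: le_trans (measureU2 _ (mE i) IHm) _.
exact: leeD2l.
Qed.

(** X is the increasing union of the events that all A i hold from index k on. It transfers bounds
    for finite loop families to the soup. *)
Lemma liminf_bound (X : set Omega) (A : nat -> set Omega) (q : \bar R) i1 :
  measurable X -> (forall i, measurable (A i)) ->
  (forall i, (i1 <= i)%N -> (P (A i) <= q)%E) ->
  (forall w, X w -> exists i0, forall i, (i0 <= i)%N -> A i w) -> (P X <= q)%E.
Proof.
move=> mX mA hq hX.
pose B k := X `&` \bigcap_i A (k + i)%N.
have mB k : measurable (B k).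
  by apply: measurableI => //; apply: bigcapT_measurable => i; exact: mA.
have ndB : nondecreasing_seq B.
  apply/nondecreasing_seqP => k; apply/subsetPset => w [Xw hw]; split=> // i _.
  by rewrite addSnnS; exact: hw.
have BX : \bigcup_k B k = X.
  apply/seteqP; split=> w; first by case=> k _ [].
  move=> Xw; have [i0 hi] := hX w Xw; exists i0 => //; split=> // i _.
  by apply: hi; exact: leq_addr.
have := nondecreasing_cvg_mu mB (bigcupT_measurable _ mB) ndB.
move=> /(_ _ P); rewrite BX => cv.
rewrite -(cvg_lim _ cv) //; apply: lime_le; first by apply/cvg_ex; exists (P X).
apply: nearW => k /=; apply: (@le_trans _ _ (P (A (k + i1)%N))).
  by apply: le_measure; rewrite ?inE //; move=> w [_]; exact.
by apply: hq; exact: leq_addl.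
Qed.

Lemma measurable_countU (T : countType) (E : T -> set Omega) :
  (forall t, measurable (E t)) -> measurable [set w | exists t, E t w].
Proof.
move=> mE; have -> : [set w | exists t, E t w] =
    \bigcup_k (if unpickle k is Some t then E t else set0).
  apply/seteqP; split=> w /=.
    by move=> [t Ew]; exists (pickle t) => //; rewrite pickleK.
  by move=> [k _]; case: (unpickle k) => [t|//] Ew; exists t.
by apply: bigcupT_measurable => k; case: (unpickle k).
Qed.

Lemma measurable_countI (T : countType) (E : T -> set Omega) :
  (forall t, measurable (E t)) -> measurable [set w | forall t, E t w].
Proof.
move=> mE; have -> : [set w | forall t, E t w] = ~` [set w | exists t, (~` E t) w].
  apply/seteqP; split=> w /=; first by move=> h [t]; apply; exact: h.
  by move=> h t; apply: contrapT => n; apply: h; exists t.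
by apply: measurableC; apply: measurable_countU => t; exact: measurableC.
Qed.

Lemma measurable_prop (Q : Prop) : measurable [set w : Omega | Q].
Proof.
have [q|nq] := pselect Q.
  by rewrite (_ : [set _ | _] = setT) //; apply/seteqP; split.
by rewrite (_ : [set _ | _] = set0) //; apply/seteqP; split.
Qed.

Lemma measurable_and (E F : Omega -> Prop) : measurable [set w | E w] -> measurable [set w | F w] ->
  measurable [set w | E w /\ F w].
Proof. exact: measurableI. Qed.

Lemma measurable_imp (E F : Omega -> Prop) : measurable [set w | E w] -> measurable [set w | F w] ->
  measurable [set w | E w -> F w].
Proof.
move=> mE mF; have -> : [set w | E w -> F w] = ~` [set w | E w] `|` [set w | F w].
  apply/seteqP; split=> w /=.
    by move=> h; have [e|e] := pselect (E w); [right; exact: h|left].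
  by case=> [n /n|].
by apply: measurableU => //; exact: measurableC.
Qed.

Variables (d : nat) (U : Omega -> set 'rV[int]_d).
Local Notation V := 'rV[int]_d.
Local Notation nn := (@nearest_neighbor d).
Hypothesis mU : forall z, measurable [set w | U w z].

Lemma measurable_path x y : measurable [set w | path_in (U w) x y].
Proof.
apply: (@measurable_countU (seq V) (fun p => [set w | [/\ path nn x p, last x p = y
  & forall z, z \in x :: p -> U w z]])) => p.
have -> : [set w | [/\ path nn x p, last x p = y & forall z, z \in x :: p -> U w z]] =
   [set w | (path nn x p /\ last x p = y) /\ (forall z : V, z \in x :: p -> U w z)].
  by apply/seteqP; split=> w /=; [case|case=> -[]].
apply: measurable_and; first exact: measurable_prop.
apply: (@measurable_countI V (fun z => [set w | z \in x :: p -> U w z])) => z.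
by apply: measurable_imp; [exact: measurable_prop|exact: mU].
Qed.

(** The trace on a ball takes countably many values, so even a property quantifying over subsets of
    Z^d is a countable union of measurable events. *)
Lemma measurable_local (G : set V -> Prop) q :
  (forall A, G A <-> G (A `&` lball 0 q)) -> measurable [set w | G (U w)].
Proof.
move=> loc; pose E (s : seq V) := [set w | G [set` s] /\ (forall z : V, (z \in s) <-> (U w z /\ lball 0 q z))].
have -> : [set w | G (U w)] = [set w | exists s, E s w].
  apply/seteqP; split=> w /=.
    move=> /loc Gw; exists [seq z <- boxseq d q | `[< U w z >]].
    have m (z : V) : (z \in [seq z <- boxseq d q | `[< U w z >]]) <-> (U w z /\ lball 0 q z).
      rewrite mem_filter; split; first by move=> /andP[/asboolP ? /mem_boxseq].
      by move=> [h1 h2]; apply/andP; split; [exact/asboolP|exact/mem_boxseq].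
    split=> //; move: Gw; congr G; apply/seteqP; split=> z /=; first by move/m.
    by move=> h; apply/m.
  move=> [s [Gs h]]; apply/loc; move: Gs; congr G.
  by apply/seteqP; split=> z /=; [move/h|move=> hz; apply/h].
apply: measurable_countU => s; apply: measurable_and; first exact: measurable_prop.
apply: (@measurable_countI V (fun z => [set w | (z \in s) <-> (U w z /\ lball 0 q z)])) => z.
have m1 : measurable [set w | U w z /\ lball 0 q z].
  by apply: measurable_and => //; exact: measurable_prop.
apply: measurable_and; apply: measurable_imp => //; exact: measurable_prop.
Qed.

Lemma measurable_spans n : measurable [set w | spans (U w) n].
Proof.
apply: (@measurable_local (fun A => spans A n) n) => A.
by rewrite /spans -setIA setIid.
Qed.

Lemma measurable_large n : measurable [set w | large_sets_connected R (U w) n].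
Proof.
apply: (@measurable_local (fun A => large_sets_connected R A n) (2 * n)) => A.
have s1 : (lball (0 : V) n) `<=` lball 0 (2 * n).
  by move=> z; rewrite /lball /= => h; apply: leq_trans h _; rewrite leq_pmull.
rewrite /large_sets_connected -!setIA !setIid (setIidr s1).
by [].
Qed.

Definition unbounded (A : set V) (x : V) : Prop :=
  forall M : nat, exists y, (M < linf_dist 0 y)%N /\ path_in A x y.

Lemma infinite_unbounded (A : set V) x : infinite_set [set y | path_in A x y] <-> unbounded A x.
Proof.
split.
  move=> iA M; apply: contrapT => no; apply: iA.
  apply: (sub_finite_set (B := [set` boxseq d M])); last exact: finite_seq.
  move=> y Ay; apply/mem_boxseq; rewrite leqNgt; apply/negP => q; apply: no.
  by exists y.
move=> ub /finite_seqP [s As].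
pose M := (\sum_(y <- s) linf_dist (0 : V) y)%N.
have [y [yM cy]] := ub M.
have ys : y \in s by have : [set y | path_in A x y] y by []; rewrite As.
by move: yM; rewrite /M (big_rem y) //= ltnNge leq_addr.
Qed.

(** Existence and uniqueness of the infinite component restated with quantifiers over vertices only,
    which makes the event measurable. *)
Lemma meets_iff (A B : set V) : the_infinite_component_meets A B <->
  (exists x, (B x /\ A x) /\ unbounded A x) /\
  (forall xy : V * V, A xy.1 -> A xy.2 -> unbounded A xy.1 -> unbounded A xy.2 -> path_in A xy.1 xy.2).
Proof.
have sym (Z : set V) x y : path_in Z x y -> path_in Z y x by apply: rconn_sym; exact: nn_sym.
have tr (Z : set V) x y z : path_in Z x y -> path_in Z y z -> path_in Z x z.
  exact: (@rconn_trans _ nn Z x y z).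
have comp_eq (Z : set V) x y : path_in Z x y -> [set z | path_in Z x z] = [set z | path_in Z y z].
  by move=> c; apply/seteqP; split=> z cz; [exact: (tr _ _ _ _ (sym _ _ _ c) cz)|exact: (tr _ _ _ _ c cz)].
split.
  move=> [C [[[x Ax Cx] iC] uC [b [Cb Bb]]]]; split.
    have cb : path_in A x b by rewrite Cx in Cb.
    exists b; split; first by split=> //; exact: rconn_r cb.
    by apply/infinite_unbounded; rewrite -(comp_eq _ _ _ cb) -Cx.
  move=> [y z] /= Ay Az /infinite_unbounded iy /infinite_unbounded iz.
  have e1 : [set u | path_in A y u] = C by apply: uC; split=> //; exists y.
  have e2 : [set u | path_in A z u] = C by apply: uC; split=> //; exists z.
  have : [set u | path_in A y u] z by rewrite e1 -e2; exact: rconn_refl.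
  by [].
move=> [[x [[Bx Ax] ux]] uq]; exists [set y | path_in A x y]; split.
- by split; [exists x|apply/infinite_unbounded].
- move=> C' [[y Ay ->] /infinite_unbounded uy]; apply: comp_eq.
  exact: (uq (y, x)).
- by exists x; split=> //; exact: rconn_refl.
Qed.

Lemma measurable_meets B : measurable [set w | the_infinite_component_meets (U w) B].
Proof.
have mub x : measurable [set w | unbounded (U w) x].
  apply: (@measurable_countI nat (fun M => [set w | exists y, (M < linf_dist 0 y)%N /\ path_in (U w) x y])) => M.
  apply: (@measurable_countU V (fun y => [set w | (M < linf_dist 0 y)%N /\ path_in (U w) x y])) => y.
  by apply: measurable_and; [exact: measurable_prop|exact: measurable_path].
rewrite (_ : [set w | _] = [set w | (exists x, (B x /\ U w x) /\ unbounded (U w) x) /\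
  (forall xy : V * V, U w xy.1 -> U w xy.2 -> unbounded (U w) xy.1 -> unbounded (U w) xy.2 ->
     path_in (U w) xy.1 xy.2)]); last by apply/seteqP; split=> w /= /meets_iff.
apply: measurable_and.
  apply: (@measurable_countU V (fun x => [set w | (B x /\ U w x) /\ unbounded (U w) x])) => x.
  by apply: measurable_and => //; apply: measurable_and => //; exact: measurable_prop.
apply: (@measurable_countI (V * V)%type (fun xy => [set w | U w xy.1 -> U w xy.2 ->
  unbounded (U w) xy.1 -> unbounded (U w) xy.2 -> path_in (U w) xy.1 xy.2])) => xy.
do 4!(apply: measurable_imp; first by []).
exact: measurable_path.
Qed.

End ProbabilityTools.

(** * Choice of the block scale, the occupation threshold and alpha *)

Section Constants.
Variables (R : realType) (d : nat).
Hypothesis hd : (3 <= d)%N.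

Lemma large_line_mass (M : R) : exists2 h, (0 < h)%N & M <= line_mass d h.
Proof.
have [k hk] : exists k : nat, M * (d + 100)%:R * 2 <= k%:R.
  exists (Num.truncn `|M * (d + 100)%:R * 2|).+1.
  by apply: ltW; apply: le_lt_trans (ler_norm _) (truncnS_gt _).
exists (2 ^ k)%N; first by rewrite expn_gt0.
rewrite line_massE mulrC ler_pdivlMr ?ltr0n ?addn_gt0 ?orbT //.
apply: (@le_trans _ _ (k%:R / 2)); first by rewrite ler_pdivlMr.
apply: le_trans (harmonic_ge R k) _.
have le2 : (2 ^ k <= (rho (2 ^ k)).+1)%N by rewrite /rho; lia.
rewrite (big_ord_widen _ (fun t => (t.+1)%:R^-1) le2) [leRHS](bigID (fun t : 'I__ => (t < 2 ^ k)%N)) /=.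
by rewrite ler_wpDr // sumr_ge0.
Qed.

Lemma small_power (a e : R) : 0 < a -> 0 < e -> exists K, (1 + a)^-1 ^+ K.+1 <= e.
Proof.
move=> a0 e0.
have [K hK] : exists K : nat, e^-1 / a <= K%:R.
  exists (Num.truncn `|e^-1 / a|).+1.
  by apply: ltW; apply: le_lt_trans (ler_norm _) (truncnS_gt _).
exists K; rewrite exprVn -[e]invrK lef_pV2 ?posrE ?invr_gt0 ?exprn_gt0 ?addr_gt0 //.
apply: (@le_trans _ _ (1 + K.+1%:R * a)).
  rewrite ler_pdivrMr // in hK; apply: le_trans hK _.
  by rewrite -natr1 mulrDl mul1r; lra.
elim: K.+1 => [|n IH]; first by rewrite mul0r addr0 expr0.
rewrite exprS; apply: (@le_trans _ _ ((1 + a) * (1 + n%:R * a))); last by rewrite ler_wpM2l // addr_ge0 // ltW.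
have : 0 <= n%:R * a * a by rewrite !mulr_ge0 // ltW.
by rewrite -natr1; move: (n%:R : R) => u; nra.
Qed.

(** With the factors 3 from subsets and [tree_const] from trees, each leaf contributes 3 *
    tree_const * tree_eta = 1/2. *)
Definition tree_eta : R := (6 * tree_const d)%:R^-1.
Definition type_eps : R := tree_eta ^+ (4 ^ d).+1.
Local Notation c0 := (plum R (0 : 'rV[int]_d) ^+ 5).
Local Notation r h := (rho h).

Lemma tree_const_gt0 : (0 < tree_const d)%N.
Proof. by rewrite /tree_const muln_gt0 !expn_gt0. Qed.

Lemma tree_eta_bounds : 0 < tree_eta <= 1.
Proof.
have t0 := tree_const_gt0.
by rewrite invr_gt0 ltr0n muln_gt0 t0 /= invf_le1 ?ltr0n ?ler1n muln_gt0 t0.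
Qed.

Lemma type_eps_bounds : 0 < type_eps <= 1.
Proof.
have /andP[e0 e1] := tree_eta_bounds.
by rewrite exprn_gt0 //= exprn_ile1 // ltW.
Qed.

Definition small_alpha h (alpha : R) : Prop := [/\ 0 <= alpha, alpha <= 1,
  alpha * ((d * 11 ^ d * (11 * r h))%:R * (2 / c0)) <= type_eps
  & alpha * (((2 * r h).+1 ^ d)%:R * (3 / c0)) <= 1].

(** The order matters: h by divergence of the harmonic series, then K depending on h, then the range
    of alpha depending on h. *)
Lemma constants_exist : exists h K : nat, [/\ (0 < h)%N,
  (2 * (d * 11 ^ d * 11))%:R <= type_eps * line_mass d h,
  (1 + kappa d h / 3)^-1 ^+ K.+1 <= type_eps
  & exists2 a1, 0 < a1 & forall alpha, 0 <= alpha <= a1 -> small_alpha h alpha].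
Proof.
have /andP[e0 e1] := type_eps_bounds.
have [h h0 hl] := large_line_mass ((2 * (d * 11 ^ d * 11))%:R / type_eps).
have k0 : 0 < kappa d h / 3 :> R.
  by rewrite divr_gt0 // exprn_gt0 // invr_gt0 ltr0n muln_gt0 addn_gt0 orbT.
have [K hK] := small_power k0 e0.
have c00 : 0 < c0 by rewrite exprn_gt0 // plum_gt0.
exists h, K; split=> //; first by move: hl; rewrite ler_pdivrMr // mulrC.
set A1 := (d * 11 ^ d * (11 * r h))%:R * (2 / c0); set A2 := ((2 * r h).+1 ^ d)%:R * (3 / c0).
have a1 : 0 <= A1 by rewrite mulr_ge0 // divr_ge0 // ltW.
have a2 : 0 <= A2 by rewrite mulr_ge0 // divr_ge0 // ltW.
have den : 0 < 1 + A1 + A2 by lra.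
exists (type_eps / (1 + A1 + A2)); first by rewrite divr_gt0.
move=> alpha /andP[al0]; rewrite ler_pdivlMr // => al1.
have b1 : 0 <= alpha * A1 by rewrite mulr_ge0.
have b2 : 0 <= alpha * A2 by rewrite mulr_ge0.
by split=> //; rewrite -?/A1 -?/A2; move: al1; rewrite !mulrDr mulr1; lra.
Qed.

End Constants.

(** * Failure probabilities at one scale *)

Lemma eventually_all (T : eqType) (s : seq T) (Q : T -> nat -> Prop) :
  (forall x, x \in s -> exists i0, forall i, (i0 <= i)%N -> Q x i) ->
  exists i0, forall i, (i0 <= i)%N -> forall x, x \in s -> Q x i.
Proof.
elim: s => [|x s IH] hs; first by exists 0%N.
have [i1 h1] := hs x (mem_head _ _).
have [i2 h2] : exists i0, forall i, (i0 <= i)%N -> forall y, y \in s -> Q y i.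
  by apply: IH => y ys; apply: hs; rewrite inE ys orbT.
exists (i1 + i2)%N => i hi y; rewrite inE => /orP[/eqP ->|ys].
  by apply: h1; apply: leq_trans hi; exact: leq_addr.
by apply: h2 => //; apply: leq_trans hi; exact: leq_addl.
Qed.

Section Scale.
Context {R : realType} {disp : measure_display} {Omega : measurableType disp}.
Variables (P : probability Omega R) (d : nat) (alpha : R) (L : Omega -> loop d -> nat).
Hypothesis soup : loop_soup P alpha L.
Hypothesis hd : (3 <= d)%N.
Variables (h K : nat).
Hypothesis h0 : (0 < h)%N.
Hypothesis line_large : (2 * (d * 11 ^ d * 11))%:R <= type_eps R d * line_mass d h.
Hypothesis K_large : (1 + kappa d h / 3)^-1 ^+ K.+1 <= type_eps R d.
Hypothesis alpha_small : small_alpha d h alpha.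
Local Notation V := 'rV[int]_d.
Local Notation r := (rho h).
Let alpha0 : 0 <= alpha. Proof. by case: alpha_small. Qed.
Let alpha1 : alpha <= 1. Proof. by case: alpha_small. Qed.

Lemma no_bad_path_bound fam N k : uniq fam ->
  Pr P L fam [set nu | ~ no_bad_path (bad h fam K nu) N (2 * 16 ^ k).+1] <=
    ((2 * N).+1 ^ d * (4 ^ d).+1)%:R * 2^-1 ^+ (2 ^ k).
Proof.
move=> uf; have [_ _ s1 s2] := alpha_small.
have /andP[e0 e1] := tree_eta_bounds R d; have /andP[t0 t1] := type_eps_bounds R d.
have tree I : sparse R I -> size I = (2 ^ k)%N ->
    Pr P L fam [set nu | forall i, i \in I -> bad h fam K nu i] <=
      ((4 ^ d).+1 * 3 ^ (2 ^ k))%:R * tree_eta R d ^+ (2 ^ k).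
  move=> sI <-; apply: (bad_bound soup alpha0 hd h0 uf sI e0 e1) => [J sJ|J tau sJ].
    exact: (hits_bound soup alpha0 hd h0 uf sJ t0 t1 line_large s1).
  apply: le_trans (visits_bound soup alpha0 hd h0 uf tau K sJ s2) _.
  rewrite lerXn2r ?nnegrE ?(ltW t0) // exprn_ge0 // invr_ge0 addr_ge0 // divr_ge0 //.
  by rewrite exprn_ge0 // invr_ge0.
apply: le_trans (peierls soup uf N _ tree) _.
  by rewrite mulr_ge0 // exprn_ge0 // ltW.
have T0 : (tree_const d)%:R != 0 :> R by rewrite pnatr_eq0 -lt0n tree_const_gt0.
rewrite /tree_eta; move: (tree_const d) T0 => T T0.
rewrite !natrM !natrX exprVn -!exprVn -!mulrA ler_wpM2l ?exprn_ge0 //.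
rewrite mulrCA ler_wpM2l // mulrA -exprMn -exprMn le_eqVlt; apply/orP; left; apply/eqP.
congr (_ ^+ _); by field.
Qed.

(** Badness involves all shifts, so it is evaluated on the union of the families, whereas each
    exploration uses the family stable under surgery in the boxes of its own shift. *)
Definition every_fam i : seq (loop d) := undup (flatten [seq loop_family h tau i | tau <- taus d]).

Lemma sub_every_fam tau i t : tau \in taus d -> t \in loop_family h tau i -> t \in every_fam i.
Proof.
move=> tt tf; rewrite mem_undup; apply/flattenP; exists (loop_family h tau i) => //.
exact: (map_f (fun y => loop_family h y i)).
Qed.

Lemma hit_eventually w M tau : exists i0, forall i, (i0 <= i)%N -> forall z : V, z \in boxseq d M ->
  hit (restr (loop_family h tau i) (L w)) z <-> ~ vacant_set (L w) z.
Proof.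
apply: eventually_all => z _.
have down i : hit (restr (loop_family h tau i) (L w)) z -> ~ vacant_set (L w) z.
  move=> [t]; rewrite /restr; case: ifP => // _ Lt zt vz; apply: (vz t Lt).
  exact/loop_verticesP.
have [vz|nvz] := pselect (vacant_set (L w) z).
  by exists 0%N => i _; split; [exact: down|].
have [t [Lt zt]] : exists t, (0 < L w t)%N /\ z \in rep t.
  apply: contrapT => no; apply: nvz => t Lt /loop_verticesP zt; apply: no.
  by exists t.
have [i0 hi] := loop_family_eventually hd h0 tau t.
exists i0 => i /hi tf; split; first exact: down.
by move=> _; exists t => //; rewrite /restr tf.
Qed.

Lemma measurable_vacant z : measurable [set w | vacant_set (L w) z].
Proof.
apply: (@measurable_countI _ _ (loop d) (fun l => [set w | (0 < L w l)%N -> ~ loop_vertices l z])) => l.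
apply: measurable_imp; last exact: measurable_prop.
rewrite (_ : [set w | _] = ~` [set w | L w l = 0%N]); last first.
  by apply/seteqP; split=> w /=; rewrite lt0n => /eqP.
by apply: measurableC; exact: (soup_meas soup).
Qed.

Lemma good_gam_of N M i w : (r * (4 * N + 12) <= M)%N ->
  (forall z : V, z \in boxseq d M -> hit (restr (loop_family h 0 i) (L w)) z <-> ~ vacant_set (L w) z) ->
  forall x z, lball 0 N.+1 x -> ~ bad h (every_fam i) K (restr (every_fam i) (L w)) x ->
    z \in gamAll h x -> vacant_set (L w) z.
Proof.
move=> NM hv x z xN nb zx; apply: contrapT => nv.
have zM : z \in boxseq d M.
  apply/mem_boxseq; apply: leq_trans (gamAll_norm hd h0 xN zx) _.
  by apply: leq_trans NM; rewrite leq_mul2l; apply/orP; right; lia.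
have [t] := (hv z zM).2 nv; rewrite {1}/restr; case: ifP => // tf Lt zt.
apply: nb; left; exists z => //; exists t => //; rewrite /restr (sub_every_fam _ tf) //.
by apply/(mem_taus hd h0) => j; rewrite mxE.
Qed.

Lemma span_bound k N n1 n : (2 * 16 ^ k < n1)%N -> (n1 + (2 * 16 ^ k).+1 <= N)%N ->
  (r * (4 * N + 12) <= n)%N ->
  (n + 20 * r * (2 * (2 * 16 ^ k).+1 + 1) <= 40 * r * n1)%N ->
  (P [set w | ~ spans (vacant_set (L w)) n] <=
    (((2 * N.+1).+1 ^ d * (4 ^ d).+1)%:R * 2^-1 ^+ (2 ^ k))%:E)%E.
Proof.
move=> h1 h2 h3 h4.
pose A i := [set w | [set nu | ~ no_bad_path (bad h (every_fam i) K nu) N.+1 (2 * 16 ^ k).+1]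
   (restr (every_fam i) (L w))].
have uf i : uniq (every_fam i) by exact: undup_uniq.
apply: (liminf_bound (A := A) (i1 := 0%N)).
- by apply: measurableC; apply: measurable_spans; exact: measurable_vacant.
- by move=> i; exact: (Pr_meas (soup_meas soup) (uf i)).
- move=> i _; rewrite -(PrK P (soup_meas soup) (uf i)) lee_fin.
  exact: no_bad_path_bound.
- move=> w ns; have [i0 hi] := hit_eventually w n 0.
  exists i0 => i /hi hv nb; apply: ns.
  apply: (vacant_spans hd h0 _ _ h2 h3 h4 _ nb) => //.
  exact: (good_gam_of h3 hv).
Qed.

Definition open_const : nat := surgery_const (boxat (0 : V) r) ((2 * r).+1 ^ d) K.

Lemma open_constE x : surgery_const (boxat (x : V) r) ((2 * r).+1 ^ d) K = open_const.
Proof. by rewrite /open_const /surgery_const /stage_const /fibre_const !size_boxat. Qed.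

(** The shells avoid all boxes of the shift, so [agree] preserves the allowed sites and
    [stuck_bound] applies. *)
Lemma stuck_family_bound tau x0 N n1 n k i : tau \in taus d -> (n1 < N)%N ->
  (r * (4 * N + 12) <= 2 * n)%N -> (2 * n <= i)%N ->
  Pr P L (loop_family h tau i) (stuck h (loop_family h tau i) tau K (lball 0 (2 * n)) x0 (boxseq d n1)
     (tau_allowed h N n1 tau) k) <= (open_const%:R / open_const.+1%:R) ^+ k.
Proof.
move=> tt nN ND Di; have ht := (mem_taus hd h0 tau).1 tt.
have uf := loop_family_uniq h tau i.
apply: (stuck_bound soup alpha0 alpha1 hd h0 uf) => [nu x []|x y nu nu' ag [oy ny]|nu x z [ox nx] zx|nu x z [ox nx] bz|x pi route t t' xs rP tf pt|x].
- by move=> _ hx; apply/mem_boxseq.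
- split=> //; have [hh _ _] := ag.
  have e : tau_bad h tau nu = tau_bad h tau nu'.
    apply/seteqP; split=> v [z zv hz]; exists z => //; apply/hh => //;
      by apply/negP => bz; case: (gam_box hd h0 zv bz).
  by rewrite -e.
- split.
    change (linf_dist 0 z <= 2 * n)%N; apply: leq_trans (gam_norm hd h0 ht nx zx) _.
    by apply: leq_trans ND; rewrite leq_mul2l; apply/orP; right; lia.
  move=> hz; apply: (outer_comp_good ox); first by lia.
  by exists z.
- change (linf_dist 0 z <= 2 * n)%N; apply: leq_trans (linf_triangle (boxctr h tau x) 0 z) _.
  apply: leq_trans (leq_add (boxctr_norm hd h0 ht nx) (inbox_dist bz)) _.
  apply: leq_trans ND; rewrite -[X in (_ + X <= _)%N]muln1 -mulnDr leq_mul2l; apply/orP; right; lia.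
- have nx : (linf_dist 0 x <= n1)%N by apply/mem_boxseq.
  apply: (loop_family_closed hd h0 nx ht _ rP tf pt); apply: leq_trans Di; apply: leq_trans ND.
  by rewrite leq_mul2l; apply/orP; right; lia.
- by rewrite open_constE.
Qed.

Lemma occupation_sub fam fam' (b : pred V) nu : uniq fam -> uniq fam' -> {subset fam <= fam'} ->
  (occupation fam b (restr fam nu) <= occupation fam' b (restr fam' nu))%N.
Proof.
move=> uf uf' sf.
have E s : occupation s b (restr s nu) = (\sum_(t <- s) nu t * visits b t)%N.
  by rewrite /occupation big_seq [RHS]big_seq; apply: eq_bigr => t ts; rewrite /restr ts.
rewrite !E [X in (_ <= X)%N](bigID (fun t => t \in fam)) /=.
apply: (@leq_trans (\sum_(t <- fam' | t \in fam) nu t * visits b t)%N); last exact: leq_addr.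
rewrite -[X in (_ <= X)%N]big_filter; apply: eq_leq; apply: perm_big; apply: uniq_perm => //.
  by rewrite filter_uniq.
by move=> t; rewrite mem_filter; case e: (t \in fam) => //=; rewrite sf.
Qed.

(** Failure of local uniqueness forces, on all sufficiently large families, a long bad path or a
    stuck exploration for some shift and starting point. *)
Lemma large_bound k s N n1 n : (0 < s)%N -> (0 < n)%N -> (n1 + (2 * 16 ^ k).+1 <= N)%N ->
  (r * (4 * N + 12) <= 2 * n)%N -> (n + h <= 8 * h * n1)%N ->
  (160 * h * (s * 4 ^ d * (2 * 16 ^ k).+2).+2 <= n)%N ->
  (P [set w | ~ large_sets_connected R (vacant_set (L w)) n] <=
    (((2 * N.+1).+1 ^ d * (4 ^ d).+1)%:R * 2^-1 ^+ (2 ^ k) +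
     (4 ^ d * (2 * n).+1 ^ d)%:R * (open_const%:R / open_const.+1%:R) ^+ s)%:E)%E.
Proof.
move=> s0 n0 h2 h3 h4 h5.
set q2 := (_ / _) ^+ s.
have uf i : uniq (every_fam i) by exact: undup_uniq.
pose A1 i := [set w | [set nu | ~ no_bad_path (bad h (every_fam i) K nu) N.+1 (2 * 16 ^ k).+1]
   (restr (every_fam i) (L w))].
pose A2 i (e : V * V) := [set w | stuck h (loop_family h e.1 i) e.1 K (lball 0 (2 * n)) e.2 (boxseq d n1)
     (tau_allowed h N n1 e.1) s (restr (loop_family h e.1 i) (L w))].
pose idx := [seq (tau, x0) | tau <- taus d, x0 <- boxseq d n].
have mA1 i : measurable (A1 i) by exact: (Pr_meas (soup_meas soup) (uf i)).
have mA2 i e : measurable (A2 i e) by exact: (Pr_meas (soup_meas soup) (loop_family_uniq h e.1 i)).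
have [mU _] : (forall i, measurable [set w | exists2 e, e \in idx & A2 i e w]) /\ True.
  by split=> // i; exact: (P_bigU P idx (mA2 i)).1.
apply: (liminf_bound (A := fun i => A1 i `|` [set w | exists2 e, e \in idx & A2 i e w]) (i1 := (2 * n)%N)).
- by apply: measurableC; apply: measurable_large; exact: measurable_vacant.
- by move=> i; exact: measurableU.
- move=> i Di; apply: le_trans (measureU2 _ (mA1 i) (mU i)) _.
  have b1 : (P (A1 i) <= (((2 * N.+1).+1 ^ d * (4 ^ d).+1)%:R * 2^-1 ^+ (2 ^ k))%:E)%E.
    by rewrite /A1 -(PrK P (soup_meas soup) (uf i)) lee_fin; exact: no_bad_path_bound.
  rewrite EFinD; apply: leeD; first exact: b1.
  apply: le_trans (P_bigU P idx (mA2 i)).2 _.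
  apply: (@le_trans _ _ (\sum_(e <- idx) q2%:E)%E).
    rewrite big_seq [leRHS]big_seq; apply: lee_sum => -[tau x0] /allpairsP [[tau' x0'] /= [tt _ [-> _]]].
    rewrite /A2 /= -(PrK P (soup_meas soup) (loop_family_uniq h tau' i)) lee_fin.
    by apply: stuck_family_bound => //; lia.
  rewrite sumEFin lee_fin big_const_seq count_predT iter_addr addr0 -[_ *+ size idx]mulr_natl.
  by rewrite size_allpairs size_taus size_boxseq.
- move=> w ng.
  have [i0 hi] : exists i0, forall i, (i0 <= i)%N -> forall tau, tau \in taus d ->
      forall z : V, z \in boxseq d (2 * n) -> hit (restr (loop_family h tau i) (L w)) z <-> ~ vacant_set (L w) z.
    apply: eventually_all => tau _; have [i0 hi] := hit_eventually w (2 * n) tau.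
    by exists i0.
  exists i0 => i /hi hv; apply: contrapT => nA; apply: ng.
  have t0 : (0 : V) \in taus d by apply/(mem_taus hd h0) => j; rewrite mxE.
  apply: (local_uniqueness hd h0 (m := (2 * 16 ^ k).+1) (J := (s * 4 ^ d)%N) (k := s) (K := K)
    (B := bad h (every_fam i) K (restr (every_fam i) (L w)))
    (nu := fun tau => restr (loop_family h tau i) (L w)) (fam := fun tau => loop_family h tau i)
    _ s0 h2 h3 h4 h5) => //.
  + by move=> tau z tt Dz; apply: (hv tau tt); apply/mem_boxseq.
  + exact: (good_gam_of h3 (hv 0 t0)).
  + move=> x tau xN nb tt; rewrite leqNgt; apply/negP => hK; apply: nb; right.
    exists tau => //; apply: leq_trans hK _; apply: occupation_sub => //.
      exact: loop_family_uniq.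
    by move=> t; exact: sub_every_fam.
  + by apply: contrapT => nb; apply: nA; left.
  + move=> tau x0 tt x0n st; apply: nA; right; exists (tau, x0) => //.
    by apply/allpairsP; exists (tau, x0); split=> //=; apply/mem_boxseq.
Qed.

End Scale.

(** * Stretched exponential decay uniformly over scales *)

Section Decay.
Variable R : realType.

Definition root10 (n : nat) : R := n%:R `^ 10^-1.

Lemma root10X n : root10 n ^+ 10 = n%:R.
Proof.
rewrite /root10 -powR_mulrn ?powR_ge0 // -powRrM mulVf ?powRr1 //. 
Qed.

Lemma root10_ge0 n : 0 <= root10 n. Proof. exact: powR_ge0. Qed.

Lemma root10_le a b : (a <= b)%N -> root10 a <= root10 b.
Proof. by move=> ab; apply: ge0_ler_powR; rewrite ?nnegrE ?invr_ge0 ?ler_nat. Qed.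

Lemma expr_le_expR (y : R) k : 0 <= y -> y ^+ k <= k%:R ^+ k * expR y.
Proof.
move=> y0; case: k => [|k]; first by rewrite !expr0 mul1r -expR0 ler_expR.
have k0 : 0 < (k.+1%:R : R) by [].
have -> : expR y = expR (y / k.+1%:R) ^+ k.+1.
  by rewrite -expRM_natl mulrCA divff ?mulr1 // gt_eqF.
rewrite -exprMn lerXn2r ?nnegrE ?mulr_ge0 ?expR_ge0 //.
rewrite mulrC -ler_pdivrMr //; apply: le_trans (expR_ge1Dx _).
by rewrite lerDr.
Qed.

(** With y = n^(1/10) the hypothesis gives s of order at least y^2, so th^s <= exp(-b y^2). The
    polynomial factor is at most a constant times e^y, and 3y <= b y^2 + 9/(4b). *)
Lemma stretched_decay (th : R) (M D d : nat) : 0 < th -> th < 1 -> (0 < M)%N ->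
  exists2 C1 : R, 0 <= C1 & forall n s : nat, (0 < n)%N -> (n <= M * s ^ 5)%N ->
    ((2 * n).+1 ^ d * D)%:R * th ^+ s <= C1 * expR (- (2 * root10 n)).
Proof.
move=> th0 th1 M0; pose l : R := - ln th.
have l0 : 0 < l by rewrite oppr_gt0 ln_lt0 // th0 th1.
have MR : 0 < (M%:R : R) by rewrite ltr0n.
pose b : R := l / M%:R; have b0 : 0 < b by rewrite divr_gt0.
pose A : R := (3 ^ d * D * (10 * d) ^ (10 * d))%:R.
exists (A * expR (9 / (4 * b))); first by rewrite mulr_ge0 // expR_ge0.
move=> n s n0 ns; set y := root10 n; have y0 : 0 <= y by exact: root10_ge0.
have sy : y ^+ 2 <= s%:R * M%:R.
  rewrite leNgt; apply/negP => lt.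
  have h1 : (s%:R * M%:R : R) ^+ 5 < y ^+ 2 ^+ 5 by rewrite ltrXn2r // ?nnegrE ?exprn_ge0.
  move: h1; rewrite -exprM root10X -natrM -natrX ltr_nat ltnNge => /negP; apply.
  apply: leq_trans ns _; rewrite expnMn mulnC leq_mul2l; apply/orP; right.
  by rewrite -[X in (X <= _)%N]expn1 leq_pexp2l.
have e1 : th ^+ s <= expR (- (b * y ^+ 2)).
  rewrite -[th]lnK ?posrE // -expRM_natl ler_expR -lerN2 opprK -mulrN -/l /b mulrAC ler_pdivrMr //.
  by have := ler_wpM2l (ltW l0) sy; lra.
have e2 : ((2 * n).+1 ^ d * D)%:R <= A * expR y.
  apply: (@le_trans _ _ (((3 * n) ^ d * D)%:R)).
    rewrite ler_nat leq_mul2r; apply/orP; right; case: (d) => // d'.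
    by rewrite leq_exp2r //; lia.
  rewrite /A -mulnA [(D * _)%N]mulnC mulnA natrM [X in _ <= X * _]natrM mulrAC ler_wpM2r //.
  rewrite expnMn natrM [X in _ <= X * _]natrM -mulrA ler_wpM2l //.
  have -> : ((n ^ d)%:R : R) = y ^+ (10 * d) by rewrite natrX -(root10X n) -exprM.
  by rewrite natrX; exact: expr_le_expR.
apply: (@le_trans _ _ (A * expR y * expR (- (b * y ^+ 2)))).
  by apply: ler_pM => //; rewrite exprn_ge0 // ltW.
rewrite -!(mulrA A) -!expRD ler_wpM2l // ler_expR.
have : 0 <= (2 * b * y - 3) ^+ 2 / (4 * b) by rewrite mulr_ge0 ?sqr_ge0 // invr_ge0 mulr_ge0 // ltW.
have -> : (2 * b * y - 3) ^+ 2 / (4 * b) = b * y ^+ 2 - 3 * y + 9 / (4 * b).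
  by field; rewrite gt_eqF.
by move: (b * y ^+ 2) (9 / (4 * b)) => u v; lra.
Qed.

End Decay.

Section AllScales.
Variables (R : realType) (d : nat).
Hypothesis hd : (3 <= d)%N.
Variables (h K : nat).
Hypothesis h0 : (0 < h)%N.
Hypothesis line_large : (2 * (d * 11 ^ d * 11))%:R <= type_eps R d * line_mass d h.
Hypothesis K_large : (1 + kappa d h / 3)^-1 ^+ K.+1 <= type_eps R d.

Definition scale_const : nat := (160 * h * (4 ^ d.+1 + 2))%N.
Local Notation oc := (open_const d h K).
(** A common rate dominating 1/2, from the bad paths, and oc/(oc+1), from the stuck explorations. *)
Definition scale_rate : R := (oc.+1)%:R / (oc.+2)%:R.

Lemma scale_rate_bounds : [/\ 0 < scale_rate, scale_rate < 1, 2^-1 <= scale_rate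
  & oc%:R / oc.+1%:R <= scale_rate].
Proof.
have c0 : 0 <= (oc%:R : R) by [].
have e1 : (oc.+1%:R : R) = oc%:R + 1 by rewrite natr1.
have e2 : (oc.+2%:R : R) = oc%:R + 2 by rewrite -natr1 -natr1 -addrA.
rewrite /scale_rate e1 e2; move: (oc%:R : R) c0 => x x0 {e1 e2}.
split.
- by rewrite divr_gt0 //; lra.
- by rewrite ltr_pdivrMr; lra.
- by rewrite ler_pdivlMr; lra.
- rewrite ler_pdivrMr; last lra.
  rewrite mulrAC ler_pdivlMr; [nra|lra].
Qed.

Lemma scale_bound (disp : measure_display) (Omega : measurableType disp)
    (P : probability Omega R) (alpha : R) (L : Omega -> loop d -> nat) n :
  loop_soup P alpha L -> small_alpha d h alpha -> (scale_const <= n)%N ->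
  exists2 s, (n <= 32 * scale_const * s ^ 5)%N &
   (P [set w | ~ spans (vacant_set (L w)) n] <=
      (((2 * n).+1 ^ d * (2 * (4 ^ d).+1))%:R * scale_rate ^+ s)%:E)%E /\
   (P [set w | ~ large_sets_connected R (vacant_set (L w)) n] <=
      (((2 * n).+1 ^ d * (2 * (4 ^ d).+1))%:R * scale_rate ^+ s)%:E)%E.
Proof.
move=> soup sa hn.
have [r0 r1 r2 r3] := scale_rate_bounds.
have M0 : (0 < scale_const)%N by rewrite /scale_const !muln_gt0 h0 addn_gt0 orbT.
have q0 : (0 < n %/ scale_const)%N by rewrite divn_gt0.
have /andP[k1 k2] := trunc_log_bounds (ltac:(by []) : (1 < 32)%N) q0.
set k := trunc_log 32 (n %/ scale_const) in k1 k2.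
rewrite leq_divRL // in k1; rewrite ltn_divLR // in k2.
(* Holes have size of order 16^k = s^4, and of order s annuli of that width are needed; since s^5 =
   32^k, they fit into length n for this k. *)
pose s := (2 ^ k)%N; have s0 : (0 < s)%N by rewrite expn_gt0.
have s5 : (32 ^ k = s ^ 5)%N by rewrite /s -expnM mulnC (expnM 2 5).
have s4 : (16 ^ k = s ^ 4)%N by rewrite /s -expnM mulnC (expnM 2 4).
exists s; first by apply: ltnW; rewrite -s5 mulnAC -expnS.
rewrite s5 in k1.
pose m := (2 * 16 ^ k).+1.
have mb : (m.+1 <= 4 * s ^ 4)%N.
  have : (0 < s ^ 4)%N by rewrite expn_gt0 s0.
  by rewrite /m s4; lia.
have hJ : (160 * h * (s * 4 ^ d * m.+1).+2 <= n)%N.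
  apply: leq_trans k1; rewrite [X in (_ <= X)%N]mulnC /scale_const -(mulnA (160 * h)%N (4 ^ _ + 2)%N) leq_mul2l.
  apply/orP; right.
  rewrite [(4 ^ _ + 2)%N]addnC mulnDl -addn2 addnC leq_add //.
    by rewrite leq_pmulr // expn_gt0 s0.
  have -> : (4 ^ d.+1 * s ^ 5 = s * 4 ^ d * (4 * s ^ 4))%N by rewrite (expnS 4) (expnS s 4); ring.
  by rewrite leq_mul2l mb orbT.
have hm : (160 * h * m.+1 <= n)%N.
  apply: leq_trans hJ; rewrite leq_mul2l; apply/orP; right.
  apply: (@leq_trans (s * 4 ^ d * m.+1)%N); last by lia.
  by rewrite leq_pmull // muln_gt0 s0 expn_gt0.
(* The number of site periods 8h in length n, from which the site radii [n1] below are obtained. *)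
pose q := (n %/ (8 * h))%N.
have h8 : (0 < 8 * h)%N by rewrite muln_gt0.
have nq1 : (8 * (h * q) <= n)%N by rewrite mulnA mulnC; exact: leq_trunc_div.
have nq2 : (n < 8 * (h * q) + 8 * h)%N.
  by rewrite mulnA -[X in (_ + X)%N]muln1 -mulnDr addn1 mulnC -ltn_divLR.
have hm' : (160 * (h * m) + 160 * h <= n)%N.
  by apply: leq_trans hm; apply: eq_leq; ring.
have qm : (2 * m + 3 <= q)%N.
  rewrite leq_divRL //; apply: leq_trans hm'.
  have -> : ((2 * m + 3) * (8 * h) = 16 * (h * m) + 24 * h)%N by ring.
  by lia.
have n0 : (0 < n)%N by apply: leq_trans hn.
have pow X : (X <= n)%N -> ((2 * X).+1 ^ d <= (2 * n).+1 ^ d)%N.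
  by move=> Xn; rewrite leq_exp2r ?ltnS ?leq_mul2l //; lia.
have half : 2^-1 ^+ s <= scale_rate ^+ s.
  by rewrite lerXn2r // ?nnegrE ?invr_ge0 // ltW.
have rate : (oc%:R / oc.+1%:R) ^+ s <= scale_rate ^+ s.
  by rewrite lerXn2r // ?nnegrE ?divr_ge0 // ltW.
split.
  pose n1 := (q - m - 3)%N.
  have n1q : (n1 + m = q - 3)%N by rewrite /n1; lia.
  have NN : (rho h * (4 * (n1 + m) + 12) <= n)%N.
    rewrite n1q; have -> : (4 * (q - 3) + 12 = 4 * q)%N by lia.
    by rewrite /rho; apply: leq_trans nq1; apply: eq_leq; ring.
  have big : (n + 20 * rho h * (2 * m + 1) <= 40 * rho h * n1)%N.
    have e : (n1 + (m + 3) = q)%N by rewrite /n1; lia.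
    have e2 : (40 * rho h * n1 + 80 * (h * m) + 240 * h = 80 * (h * q))%N.
      by rewrite -e /rho; ring.
    have e3 : (20 * rho h * (2 * m + 1) = 80 * (h * m) + 40 * h)%N by rewrite /rho; ring.
    by rewrite e3; move: (40 * rho h * n1)%N e2 => w; move: (h * m)%N (h * q)%N hm' nq1 nq2 => u v; lia.
  apply: le_trans (span_bound soup hd h0 line_large K_large sa (k := k) (n1 := n1) (N := (n1 + m)%N) _ _ NN big) _.
  - by rewrite /n1; move: qm; rewrite /m; lia.
  - by [].
  rewrite lee_fin; apply: ler_pM => //; try by rewrite exprn_ge0 // invr_ge0.
  rewrite ler_nat leq_mul ?leq_pmull //; apply: pow.
  by apply: leq_trans (leq_trans _ NN) _ => //; rewrite /rho; move: h0; nia.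
pose n1 := (q + 2)%N.
have NN : (rho h * (4 * (n1 + m) + 12) <= 2 * n)%N.
  have -> : (rho h * (4 * (n1 + m) + 12) = 8 * (h * q) + 8 * (h * m) + 40 * h)%N.
    by rewrite /rho /n1; ring.
  by move: (h * m)%N (h * q)%N hm' nq1 nq2 => u v; lia.
have b1 : (n + h <= 8 * h * n1)%N.
  have -> : (8 * h * n1 = 8 * (h * q) + 16 * h)%N by rewrite /n1; ring.
  by move: (h * q)%N nq2 => v; lia.
apply: le_trans (large_bound soup hd h0 line_large K_large sa (k := k) (s := s) (n1 := n1) (N := (n1 + m)%N) s0 n0 _ NN b1 hJ) _.
  by [].
rewrite lee_fin (mul2n (4 ^ d).+1) -addnn mulnDr natrD mulrDl; apply: lerD.
  apply: ler_pM => //; try by rewrite exprn_ge0 // invr_ge0.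
  rewrite ler_nat leq_mul //; apply: pow.
  have hh : (2 * (4 * (n1 + m) + 12) <= 2 * n)%N.
    by apply: leq_trans NN; rewrite leq_mul2r /rho; apply/orP; right; lia.
  by move: hh; lia.
apply: ler_pM => //; try by rewrite exprn_ge0 // divr_ge0.
by rewrite ler_nat mulnC leq_mul.
Qed.

Lemma uniform_bound : exists2 C1 : R, 0 <= C1 &
  forall (disp : measure_display) (Omega : measurableType disp)
    (P : probability Omega R) (alpha : R) (L : Omega -> loop d -> nat) n,
  loop_soup P alpha L -> small_alpha d h alpha -> (0 < n)%N ->
   (P [set w | ~ spans (vacant_set (L w)) n] <= (C1 * expR (- (2 * root10 R n)))%:E)%E /\
   (P [set w | ~ large_sets_connected R (vacant_set (L w)) n] <= (C1 * expR (- (2 * root10 R n)))%:E)%E.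
Proof.
have [r0 r1 _ _] := scale_rate_bounds.
have M0 : (0 < 32 * scale_const)%N by rewrite /scale_const !muln_gt0 h0 addn_gt0 orbT.
have [C1 c0 hC] := stretched_decay (2 * (4 ^ d).+1) d r0 r1 M0.
(* Makes the bound at least 1, hence trivial, for n below [scale_const]. *)
pose C2 : R := expR (2 * scale_const%:R).
exists (C1 + C2); first by rewrite addr_ge0 // expR_ge0.
move=> disp Omega P alpha L n soup sa n0.
have e0 : 0 <= expR (- (2 * root10 R n)) by exact: expR_ge0.
have [ge|lt] := leqP scale_const n.
  have [s ns [b1 b2]] := scale_bound soup sa ge.
  have hb : ((2 * n).+1 ^ d * (2 * (4 ^ d).+1))%:R * scale_rate ^+ s <=
      (C1 + C2) * expR (- (2 * root10 R n)).
    apply: le_trans (hC n s n0 ns) _; rewrite ler_wpM2r // lerDl; exact: expR_ge0.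
  by split; [apply: le_trans b1 _|apply: le_trans b2 _]; rewrite lee_fin.
have one : 1 <= (C1 + C2) * expR (- (2 * root10 R n)).
  apply: (@le_trans _ _ (C2 * expR (- (2 * root10 R n)))); last first.
    by rewrite ler_wpM2r // lerDr.
  rewrite -expRD; apply: le_trans (expR_ge1Dx _); rewrite lerDl subr_ge0 ler_wpM2l //.
  have y1 : 1 <= root10 R n.
    rewrite -[1](_ : root10 R 1 = 1); last by rewrite /root10 powR1.
    exact: root10_le.
  apply: (@le_trans _ _ n%:R); last by rewrite ler_nat ltnW.
  by rewrite -root10X ler_eXnr.
have mV z : measurable [set w | (fun w => vacant_set (L w)) w z] by exact: (measurable_vacant soup).
have le1 (E : set Omega) : measurable E -> (P E <= ((C1 + C2) * expR (- (2 * root10 R n)))%:E)%E.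
  by move=> mE; apply: le_trans (probability_le1 P mE) _; rewrite lee_fin.
split; apply: le1; apply: measurableC; [exact: (measurable_spans mV)|exact: (measurable_large mV)].
Qed.

End AllScales.

(** * Summation over dyadic scales *)

Unset Implicit Arguments.

Theorem theorem1p3 (R : realType) (d : nat) (hd : (3 <= d)%N) :
  exists alpha1 c C : R, [/\ 0 < alpha1, 0 < c &
    forall alpha : R, 0 <= alpha <= alpha1 ->
    forall (disp : measure_display) (Omega : measurableType disp)
      (P : probability Omega R) (L : Omega -> loop d -> nat),
      loop_soup P alpha L ->
    forall n : nat, (1 <= n)%N ->
      ((1 - C * expR (- (n%:R `^ c)))%:E
         <= P [set w | the_infinite_component_meets
                         (vacant_set (L w)) (lball 0 n)])%E
      /\
      ((1 - C * expR (- (n%:R `^ c)))%:E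
         <= P [set w | large_sets_connected R (vacant_set (L w)) n])%E].
Proof.
have [h [K [h0 line_large K_large [alpha1 a1 ha]]]] := constants_exist R hd.
have [C1 c0 hC] := uniform_bound hd h0 line_large K_large.
(* Used at x = (2^j)^(1/10), where it yields e^-x <= T 2^-j and makes the errors summable in j. *)
have [T T0 hT] : exists2 T : R, 1 <= T & forall x, 0 <= x -> x ^+ 10 <= T * expR x.
  exists (10%:R ^+ 10); first by rewrite exprn_ege1 // ler1n.
  by move=> x; exact: expr_le_expR.
pose C : R := 4 * T * C1.
exists alpha1, 10^-1, C; split=> //.
move=> alpha /ha sa disp Omega P L soup n n1.
have mV z : measurable [set w | (fun w => vacant_set (L w)) w z] by exact: (measurable_vacant soup).
have compl (E : Omega -> Prop) (q : R) : measurable [set w | E w] -> (P [set w | ~ E w] <= q%:E)%E ->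
    ((1 - q)%:E <= P [set w | E w])%E.
  move=> mE hq; have -> : [set w | E w] = ~` [set w | ~ E w].
    by apply/seteqP; split=> w /=; [move=> e n'|move/contrapT].
  rewrite probability_setC; last exact: measurableC.
  by rewrite EFinB leeB.
have y0 := root10_ge0 R n.
have e0 : 0 <= expR (- root10 R n) by exact: expR_ge0.
rewrite -/(root10 R n); split; apply: compl; last first.
- have [_ b] := hC _ _ P alpha L n soup sa n1; apply: le_trans b _; rewrite lee_fin.
  apply: (@le_trans _ _ (C1 * expR (- root10 R n))); first by rewrite ler_wpM2l // ler_expR; lra.
  by rewrite ler_wpM2r // /C ler_peMl //; lra.
- exact: (measurable_large mV).
(* If no F j occurs, [infinite_comp] applies; the case is thus a union bound over j. *)
- pose F j := [set w | ~ spans (vacant_set (L w)) (2 ^ j * n)] `|`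
              [set w | ~ large_sets_connected R (vacant_set (L w)) (2 ^ j * n)].
  have mF j : measurable (F j).
    by apply: measurableU; apply: measurableC; [exact: (measurable_spans mV)|exact: (measurable_large mV)].
  have PF j : (P (F j) <= (2 * C1 * T * expR (- root10 R n) * 2^-1 ^+ j)%:E)%E.
    have jn : (0 < 2 ^ j * n)%N by rewrite muln_gt0 expn_gt0.
    have [b1 b2] := hC _ _ P alpha L _ soup sa jn.
    apply: le_trans (measureU2 _ _ _) _.
      by apply: measurableC; exact: (measurable_spans mV).
      by apply: measurableC; exact: (measurable_large mV).
    apply: le_trans (leeD b1 b2) _; rewrite -EFinD lee_fin.
    (* One half of the exponent keeps the decay in n, the other half pays for the sum over j. *)
    have core : expR (- (2 * root10 R (2 ^ j * n))) <= T * (expR (- root10 R n) * 2^-1 ^+ j).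
      set x := root10 R (2 ^ j).
      have x0 : 0 <= x by exact: root10_ge0.
      have r1 : root10 R n + x <= 2 * root10 R (2 ^ j * n).
        have h1 : root10 R n <= root10 R (2 ^ j * n) by apply: root10_le; rewrite leq_pmull // expn_gt0.
        have h2 : x <= root10 R (2 ^ j * n) by apply: root10_le; rewrite leq_pmulr.
        by lra.
      apply: (@le_trans _ _ (expR (- root10 R n) * expR (- x))).
        by rewrite -expRD ler_expR; lra.
      rewrite [leRHS]mulrCA ler_wpM2l // expRN -div1r ler_pdivrMr ?expR_gt0 //.
      have := hT x x0; rewrite root10X natrX => hx.
      rewrite exprVn mulrAC ler_pdivlMr ?exprn_gt0 // mul1r.
      exact: hx.
    have := ler_wpM2l c0 core; move: (expR _) (expR _) (2^-1 ^+ j) => E2 E p.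
    by lra.
  apply: (liminf_bound (A := fun i => [set w | exists2 j, j \in iota 0 i & F j w]) (i1 := 0%N)).
  + by apply: measurableC; exact: (measurable_meets mV).
  + by move=> i; exact: (P_bigU P (iota 0 i) mF).1.
  + move=> i _; apply: le_trans (P_bigU P (iota 0 i) mF).2 _.
    apply: le_trans (lee_sum _ (fun j _ => PF j)) _.
    rewrite sumEFin lee_fin -mulr_sumr.
    have gs : \sum_(j <- iota 0 i) 2^-1 ^+ j = 2 - 2 * 2^-1 ^+ i :> R.
      elim: i => [|i IH]; first by rewrite big_nil expr0 mulr1 subrr.
      by rewrite -addn1 iotaD big_cat IH /= big_seq1 add0n addn1 exprS; lra.
    rewrite gs /C; have p0 : 0 <= (2^-1 : R) ^+ i by rewrite exprn_ge0 // invr_ge0.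
    have q0 : 0 <= C1 * T * expR (- root10 R n) by rewrite !mulr_ge0 // (le_trans _ T0).
    have := mulr_ge0 q0 p0; move: q0; move: (expR _) ((2^-1 : R) ^+ i) => E p q0 qp.
    have -> : 4 * T * C1 * E = 4 * (C1 * T * E) by ring.
    have -> : 2 * C1 * T * E * (2 - 2 * p) = 4 * (C1 * T * E) - 4 * (C1 * T * E * p) by ring.
    by lra.
  + move=> w nm; have [j Fj] : exists j, F j w.
      apply: contrapT => no; apply: nm; apply: (@infinite_comp R) => // j.
        by apply: contrapT => nl; apply: no; exists j; right.
      by apply: contrapT => nl; apply: no; exists j; left.
    exists j.+1 => i ji; exists j => //; rewrite mem_iota /= add0n; exact: ji.
- exact: (measurable_meets mV).
Qed.
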